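(* Let $(r,v)$ be any minimizer of $I_\varepsilon^\tau$ over $\mathcal{U}_{\rm rad}$. Assume that $\hat\Phi(v_1,v_2,v_3,v_4)=\sum_{i=1}^3\psi(v_i)+h(v_1v_2v_3-v_4)$, where $h\in C^2(0,\infty)$ is convex with $h(\delta)\to\infty$ as $\delta\to0^+$ and $h(\delta)/\delta\to\infty$ as $\delta\to\infty$, and $\psi$ is a non-negative convex $C^3$ function on $(0,\infty)$ such that $|v\,\psi'(cv)|\le K\psi(v)$ for all $v>0$ and all $c$ with $|c-1|\le\gamma_0$, for some positive constants $K,\gamma_0$. Then $(r,v)\in C^1(0,1]\times C^1(0,1]$, $r'(R)>0$ for all $R\in(0,1]$, $R^2\hat\Phi_{,1}(r(R),v(R))$ is $C^1(0,1]$, and $$\frac{d}{dR}\left[R^2\hat\Phi_{,1}(r(R),v(R))\right]=2R\,\hat\Phi_{,2}(r(R),v(R)),\quad 0<R<1,$$ $$v^{\frac12}(R)\left(\varepsilon^\alpha\frac{d}{dR}\left[R^2|v'(R)|^{\alpha-1}\mathrm{sgn}(v'(R))\right]-R^2\left[\hat\Phi_{,4}(r(R),v(R))+\frac1{q\varepsilon^q}\phi_\tau'(v(R))\right]\right)=0,\quad0<R<1,$$ with boundary conditions $$r(0)=0,\quad r(1)=\lambda,\quad\lim_{R\to0^+}R^2|v'(R)|^{\alpha-1}\mathrm{sgn}(v'(R))\,v^{\frac12}(R)=0,\quad v(1)=0.$$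
   Context: Let $\lambda,\varepsilon,\tau>0$, $\alpha>1$, $\frac1\alpha+\frac1q=1$. The function $\phi_\tau:\mathbb{R}\to[0,\infty)$ is continuous with $\mathrm{supp}(\phi_\tau)\subset(0,\tau)$, and $\phi_\tau'$ denotes its derivative. It is also a standing assumption that $h$ is strictly convex, with a unique minimum at $d_0$, and that $h(d)\sim Cd^{\gamma}$ as $d\to\infty$ for some $\gamma>1$, $C>0$. The subscript $_{,i}$ denotes the partial derivative with respect to the $i$-th argument, and one writes $$\hat\Phi(r(R),v(R))=\hat\Phi\left(r'(R),\frac{r(R)}R,\frac{r(R)}R,v(R)\right),$$ and similarly for $\hat\Phi_{,i}(r(R),v(R))$. The functional is $$I_\varepsilon^\tau(r,v)=\int_0^1R^2\hat\Phi(r(R),v(R))\,dR+\int_0^1R^2\left[\frac{\varepsilon^\alpha}{\alpha}|v'(R)|^\alpha+\frac1{q\varepsilon^q}\phi_\tau(v(R))\right]dR,$$ minimized over $$\mathcal{U}_{\rm rad}=\{(r,v)\in W^{1,1}(0,1)\times W^{1,\alpha}(0,1):r(0)=0,\ r(1)=\lambda,\ r'(R)(r(R)/R)^2>v(R)\ge0\text{ a.e.},\ v(1)=0\}.$$ *)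

(* Defs.v *)
From mathcomp Require Export all_boot all_order all_algebra.
From mathcomp Require Export all_classical all_reals all_analysis.

Set Implicit Arguments.
Unset Strict Implicit.
Unset Printing Implicit Defensive.

Import Order.TTheory GRing.Theory Num.Theory.
Import numFieldNormedType.Exports.

Local Open Scope classical_set_scope.
Local Open Scope ring_scope.

Section Calculus.
Context {R : realType}.
Implicit Types (f g : R -> R) (A : set R).

(* [A] is meant to be open. *)
Definition Ck_on_open (k : nat) A f : Prop :=
  forall x : R, A x ->
    (forall j, (j < k)%N -> derivable (derive1n j f) x 1) /\
    (forall j, (j <= k)%N -> {for x, continuous (derive1n j f)}).

(* The increment is restricted to [A], so for [A = `]0, 1]] this is the
   usual derivative at [x < 1] and the left derivative at [x = 1]; values
   of [f] outside [A] play no role. *)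
Definition derivable_on A f (x : R) : Prop :=
  cvg ((f y - f x) / (y - x) @[y --> within A x^']).

Definition deriv_on A f (x : R) : R :=
  lim ((f y - f x) / (y - x) @[y --> within A x^']).

Definition C1_on A f : Prop :=
  (forall x : R, A x -> derivable_on A f x) /\
  {within A, continuous (deriv_on A f)}.

Definition supp f : set R := closure [set x | f x != 0].

Definition strictly_convex_on A f : Prop :=
  forall x y t : R, A x -> A y -> x != y -> 0 < t < 1 ->
    f (t * x + (1 - t) * y) < t * f x + (1 - t) * f y.

End Calculus.

Section Sobolev.
Context {R : realType}.
Local Notation mu := (@lebesgue_measure R).
Local Notation I01 := (`]0%R, 1%R[%classic : set R).
Implicit Types (f g : R -> R).

Definition Lp01 (p : R) f : Prop :=
  measurable_fun I01 f /\
  (\int[mu]_(x in I01) (`|f x| `^ p)%:E < +oo)%E.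

Definition test_function (eta : R -> R) : Prop :=
  [/\ forall x : R, derivable eta x 1, continuous (derive1 eta) &
      supp eta `<=` I01].

Definition weak_derivative f g : Prop :=
  forall eta, test_function eta ->
    \int[mu]_(x in I01) (f x * derive1 eta x) =
    - \int[mu]_(x in I01) (g x * eta x).

(* [f] is the representative, continuous on [0, 1], of an element of
   W^{1,p}(0,1) with weak derivative [g]; boundary values refer to it. *)
Definition sobolev (p : R) f g : Prop :=
  [/\ {within `[0, 1], continuous f}, Lp01 p f, Lp01 p g &
      weak_derivative f g].

End Sobolev.

Section Model.
Context {R : realType}.
Local Notation mu := (@lebesgue_measure R).
Local Notation I01 := (`]0%R, 1%R[%classic : set R).

Definition Phi_hat (psi h : R -> R) (v1 v2 v3 v4 : R) : R :=
  psi v1 + psi v2 + psi v3 + h (v1 * v2 * v3 - v4).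

Definition partial1 (F : R -> R -> R -> R -> R) (a b c d : R) : R :=
  derive1 (fun x => F x b c d) a.
Definition partial2 (F : R -> R -> R -> R -> R) (a b c d : R) : R :=
  derive1 (fun x => F a x c d) b.
Definition partial4 (F : R -> R -> R -> R -> R) (a b c d : R) : R :=
  derive1 (fun x => F a b c x) d.

Definition radial (F : R -> R -> R -> R -> R) (r dr v : R -> R) (x : R) : R :=
  F (dr x) (r x / x) (r x / x) (v x).

(* |s|^{alpha-1} sgn s *)
Definition signed_pow (alpha s : R) : R := `|s| `^ (alpha - 1) * Num.sg s.

(* [dr] and [dv] stand for the weak derivatives of [r] and [v]. *)
Definition U_rad (lambda alpha : R) (r dr v dv : R -> R) : Prop :=
  [/\ sobolev 1 r dr, sobolev alpha v dv,
      r 0 = 0 /\ r 1 = lambda,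
      {ae mu, forall x : R, 0 < x < 1 ->
         dr x * (r x / x) ^+ 2 > v x /\ v x >= 0} &
      v 1 = 0].

Definition energy (psi h phi : R -> R) (eps alpha q : R)
    (r dr v dv : R -> R) : \bar R :=
  (\int[mu]_(x in I01) (x ^+ 2 * radial (Phi_hat psi h) r dr v x)%:E +
   \int[mu]_(x in I01)
     (x ^+ 2 * (eps `^ alpha / alpha * `|dv x| `^ alpha +
                (q * eps `^ q)^-1 * phi (v x)))%:E)%E.

Definition minimizer (psi h phi : R -> R) (lambda eps alpha q : R)
    (r v : R -> R) : Prop :=
  exists dr dv, U_rad lambda alpha r dr v dv /\
    forall s ds w dw, U_rad lambda alpha s ds w dw ->
      (energy psi h phi eps alpha q r dr v dv <=
       energy psi h phi eps alpha q s ds w dw)%E.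

End Model.

(* Main.v *)
Require Import Defs.
From mathcomp Require Import measurable_realfun ring lra.
Import Order.TTheory GRing.Theory Num.Theory.
Import numFieldNormedType.Exports.

Set Implicit Arguments.
Unset Strict Implicit.
Unset Printing Implicit Defensive.

Local Open Scope classical_set_scope.
Local Open Scope ring_scope.

(* Near the origin nothing is known at first, so all variations live on [a, 1] with a > 0, and only the
   energy difference on [a, 1] matters.

   Radius. Varying u = r^3 / 3 on the set where d = r' (r / x)^2 - v stays in a compact part of (0, oo)
   shows that x^2 psi'(r') / r^2 + h'(d) is, almost everywhere, a constant minus an absolutely continuous
   function. The left-hand side is strictly increasing in r', hence r' has a continuous representative,
   and then the stress is C^1.

   Damage. The obstacle v >= 0 and the mere differentiability of phi rule out outer variations, so v is
   reparametrised instead. With e = eps^alpha / alpha, c = (q eps^q)^-1 and K = e |v'|^alpha this yields a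
   conservation law which makes |v'| continuous; comparing v with its chords then excludes corners, and
   everywhere on (0, 1)
     ((alpha - 1) K - c phi(v))' = - 2 alpha K / x - h'(d) v'.
   Where v' <> 0 this gives the derivative of the flux x^2 |v'|^(alpha-1) sgn v'. At a zero x0 of v' with
   v(x0) > 0, subtract from the flux its expected tangent and test minimality on [x0 - d, x0 + d] with the
   primitive of the deviation of the result from its mean: the deviation is o(d).

   Origin. Z = (alpha - 1) e |flux|^q satisfies: x^(2q) ((alpha - 1) K - c phi(v)) = Z + O(x), and its
   derivative is bounded on one side, depending on the sign of v', by O(1) + x^2 h'(d)^+ |flux|^(q-1), with
   x^2 h'(d)^+ integrable because of the growth of h. Since |v'|^alpha is integrable, the flux is small
   somewhere in each [x, 2x], hence it tends to 0. *)

(** * Integrals over compact intervals *)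

Section IntervalIntegrals.
Context {R : realType}.
Local Notation mu := (@lebesgue_measure R).
Implicit Types (a b c x y : R) (f g : R -> R).

(** With u = r^3 / 3 the determinant is u' / x^2 - v, so h does not see u itself: h' multiplies only
    the derivative of a test function, which can be cut off wherever d is near 0 or oo, while the
    test function itself, spread over all of [a, 1], meets only psi', which |v psi'(cv)| <= K psi(v)
    dominates by the energy. A reparametrisation of v leaves the determinant D = r' (r / x)^2 in
    place, and D is merely continuous, so the term h(D - v) is not carried along. It is replaced by
    its linearisation with a constant slope b0, at the price of a remainder M int |v'|. With b0 = 0
    and M bounded this yields continuity of |v'|; with b0 = - h'(D - v) frozen at a point, M is as
    small as desired nearby and the law becomes a derivative at that point. At a zero x0 of v' the
    law gives |v'| = O(d^(1 / (alpha - 1))) at distance d. This makes the flux O(d), exactly the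
    order at which a derivative is read off; all estimates there are made after rescaling v' by this
    power. *)

Definition itg a b f : R := \int[mu]_(x in `[a, b]) f x.
Definition intg a b f : Prop := mu.-integrable `[a, b] (EFin \o f).

Lemma intgS a b a' b' f : a <= a' -> b' <= b -> intg a b f -> intg a' b' f.
Proof.
move=> aa bb; apply: integrableS => //; apply: subset_itv; rewrite bnd_simp //.
Qed.

Lemma intgD a b f g : intg a b f -> intg a b g -> intg a b (fun x => f x + g x).
Proof. by move=> intf intgg; exact: (integrableD _ intf intgg). Qed.

Lemma intgB a b f g : intg a b f -> intg a b g -> intg a b (fun x => f x - g x).
Proof. by move=> intf intgg; exact: (integrableB _ intf intgg). Qed.

Lemma intgZ a b (k : R) f : intg a b f -> intg a b (fun x => k * f x).
Proof. by move=> intf; exact: (integrableZl _ k intf). Qed.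

Lemma intgN a b f : intg a b f -> intg a b (fun x => - f x).
Proof. by move=> intf; exact: (integrableN intf). Qed.

Lemma intg_norm a b f : intg a b f -> intg a b (fun x => `|f x|).
Proof. by move=> intf; exact: (integrable_abse intf). Qed.

Lemma intg_cont a b f : {within `[a, b], continuous f} -> intg a b f.
Proof.
by move=> cf; apply: continuous_compact_integrable => //; exact: segment_compact.
Qed.

Lemma intg_cst a b (k : R) : intg a b (fun=> k).
Proof. by apply: intg_cont => x; exact: cvg_cst. Qed.

Lemma eq_intg a b f g : {in `[a, b], f =1 g} -> intg a b f -> intg a b g.
Proof.
by move=> fg; apply: eq_integrable => // x; rewrite inE/= => xab /=; rewrite fg.
Qed.

Lemma intg_meas a b f : intg a b f -> measurable_fun `[a, b] f.
Proof. by move=> /measurable_int/measurable_EFinP. Qed.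

Lemma intg_bound a b (M : R) f g : measurable_fun `[a, b] f -> intg a b g ->
  (forall x, a <= x <= b -> `|f x| <= M * g x) -> intg a b f.
Proof.
move=> mf intgg fM; apply: (@le_integrable _ _ _ mu _ _ _ (EFin \o (fun x => M * g x))) => //.
- exact/measurable_EFinP.
- by move=> x/=; rewrite in_itv/= => xab; rewrite lee_fin (le_trans (fM _ xab))// ler_norm.
- exact: intgZ.
Qed.

Lemma eq_itg a b f g : {in `[a, b], f =1 g} -> itg a b f = itg a b g.
Proof. by move=> fg; apply: eq_Rintegral => x; rewrite inE/= => xab; rewrite fg. Qed.

Lemma itgD a b f g : intg a b f -> intg a b g ->
  itg a b (fun x => f x + g x) = itg a b f + itg a b g.
Proof. by move=> intf intgg; rewrite /itg RintegralD. Qed.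

Lemma itgB a b f g : intg a b f -> intg a b g ->
  itg a b (fun x => f x - g x) = itg a b f - itg a b g.
Proof. by move=> intf intgg; rewrite /itg RintegralB. Qed.

Lemma itgZ a b (k : R) f : intg a b f ->
  itg a b (fun x => k * f x) = k * itg a b f.
Proof. by move=> intf; rewrite /itg RintegralZl. Qed.

Lemma itgN a b f : intg a b f -> itg a b (fun x => - f x) = - itg a b f.
Proof.
move=> intf; rewrite -mulN1r -itgZ//; apply: eq_itg => x _; by rewrite mulN1r.
Qed.

Lemma itg_cst a b (k : R) : a <= b -> itg a b (fun=> k) = k * (b - a).
Proof.
move=> ab; rewrite /itg Rintegral_cst//= lebesgue_measure_itv/= lte_fin.
by move: ab; rewrite le_eqVlt => /predU1P[->|->//]; rewrite ltxx subrr.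
Qed.

Lemma le_itg a b f g : intg a b f -> intg a b g ->
  (forall x, a <= x <= b -> f x <= g x) -> itg a b f <= itg a b g.
Proof.
by move=> intf intgg fg; apply: le_Rintegral => // x /=; rewrite in_itv/=; exact: fg.
Qed.

Lemma itg_ge0 a b f : (forall x, a <= x <= b -> 0 <= f x) -> 0 <= itg a b f.
Proof. by move=> f0; apply: Rintegral_ge0 => x/=; rewrite in_itv/=; exact: f0. Qed.

Lemma norm_itg a b f : intg a b f -> `|itg a b f| <= itg a b (fun x => `|f x|).
Proof. by move=> intf; exact: le_normr_Rintegral. Qed.

Lemma itg1 a f : itg a a f = 0.
Proof. by rewrite /itg set_itv1 Rintegral_set1. Qed.

Lemma itg_cat a b c f : a <= b -> b <= c -> intg a c f ->
  itg a c f = itg a b f + itg b c f.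
Proof.
move=> ab bc intf; have := @Rintegral_itvB R f (BLeft a) (BRight c) b intf.
rewrite !bnd_simp => /(_ ab bc); rewrite Rintegral_itv_obnd_cbnd; last first.
  by apply: integrableS intf => //; apply: subset_itv; rewrite bnd_simp.
by rewrite /itg => <-; rewrite addrC subrK.
Qed.

Lemma intg_cat a b c f : a <= b -> b <= c -> intg a b f -> intg b c f -> intg a c f.
Proof.
move=> ab bc i1 i2; rewrite /intg (@itv_bndbnd_setU _ _ _ (BRight b)) ?bnd_simp//.
have {}i2 : mu.-integrable `]b, c] (EFin \o f).
  by apply: integrableS i2 => //; apply: subset_itvr; rewrite bnd_simp.
have mf : measurable_fun (`[a, b] `|` `]b, c]) (EFin \o f).
  by apply/measurable_funU => //; split; apply: (measurable_int mu).
apply/integrableP; split => //.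
rewrite ge0_integral_setU//=.
- by apply: lte_add_pinfty; [case/integrableP: i1|case/integrableP: i2].
- by apply/measurable_EFinP/measurableT_comp => //; exact/measurable_EFinP.
- apply/disj_setPS => y [/=]; rewrite 2!in_itv/= => /andP[_ yx] /andP[].
  by rewrite ltNge yx.
Qed.

Lemma ge0_le_itg a b a' b' f : a <= a' -> a' <= b' -> b' <= b -> intg a b f ->
  (forall x, a <= x <= b -> 0 <= f x) -> itg a' b' f <= itg a b f.
Proof.
move=> aa ab bb intf f0.
rewrite (@itg_cat a a' b)//; last exact: le_trans bb.
rewrite (@itg_cat a' b' b)//; last exact: intgS intf.
rewrite -[leLHS]add0r lerD// ?lerDl; apply: itg_ge0 => x /andP[h1 h2]; apply: f0.
  by rewrite h1 (le_trans h2)// (le_trans ab).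
by rewrite h2 (le_trans _ h1)// (le_trans aa).
Qed.

Lemma itg_bound a b (M : R) f : a <= b -> intg a b f ->
  (forall x, a <= x <= b -> `|f x| <= M) -> `|itg a b f| <= M * (b - a).
Proof.
move=> ab intf fM; rewrite (le_trans (norm_itg intf))// -itg_cst//.
by apply: le_itg => //; [exact: intg_norm|exact: intg_cst].
Qed.

Lemma mu_itvcc a b : a <= b -> mu `[a, b] = (b - a)%:E.
Proof.
move=> ab; rewrite lebesgue_measure_itv/= lte_fin; move: ab.
by rewrite le_eqVlt => /predU1P[->|->//]; rewrite ltxx subrr.
Qed.

(** Absolute continuity of the Lebesgue integral, applied to [f] extended by zero. *)
Lemma itg_norm_unif a b f (e : R) : a <= b -> intg a b f -> 0 < e ->
  exists2 d : R, 0 < d & forall x y, a <= x -> x <= y -> y <= b -> y - x < d ->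
    itg x y (fun z => `|f z|) < e.
Proof.
move=> ab intf e0.
have intT : mu.-integrable setT (EFin \o f \_ `[a, b]).
  by rewrite -restrict_EFin; apply/integrable_restrict => //=; rewrite setTI.
have [d [d0 H]] := integral_normr_continuous intT e0; exists d => // x y ax xy yb yxd.
have muxy : (mu `[x, y] < d%:E)%E by rewrite mu_itvcc// lte_fin.
have := H `[x, y]%classic (measurable_itv _) muxy.
apply: le_lt_trans; rewrite le_eqVlt; apply/orP; left; apply/eqP.
apply: eq_Rintegral => z; rewrite inE/= in_itv/= => /andP[xz zy].
by rewrite patchE ifT// inE/= in_itv/= (le_trans ax xz) (le_trans zy).
Qed.

Lemma itg_sub a b x y f : a <= x -> x <= y -> y <= b -> intg a b f ->
  itg a y f - itg a x f = itg x y f.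
Proof.
move=> ax xy yb intf; rewrite (@itg_cat a x y)//; last exact: intgS intf.
by rewrite addrC addKr.
Qed.

End IntervalIntegrals.

(** * Epsilon-delta forms of limits, continuity and derivatives *)

Section EpsDelta.
Context {R : realType}.
Implicit Types (A : set R) (f F : R -> R) (x l : R).

Lemma cvg_withinP A f x l :
  (f y @[y --> within A (nbhs x)] --> l) <->
  (forall e : R, 0 < e -> exists2 d : R, 0 < d & forall y, A y -> `|y - x| < d -> `|f y - l| <= e).
Proof.
split=> [/cvgrPdist_le H e e0|H].
  have := H e e0; rewrite nearE /within/= nearE => /nbhs_ballP[d /= d0 Hd].
  exists d => // y Ay yx; rewrite distrC; apply: Hd => //.
  by rewrite /ball/= distrC.
apply/cvgrPdist_le => e e0; have [d d0 Hd] := H e e0.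
rewrite nearE /within/= nearE; apply/nbhs_ballP; exists d => //= y.
by rewrite /ball/= distrC => yx Ay; rewrite distrC; apply: Hd.
Qed.

Lemma continuous_withinP A f : {within A, continuous f} <->
  (forall x, A x -> forall e : R, 0 < e ->
    exists2 d : R, 0 < d & forall y, A y -> `|y - x| < d -> `|f y - f x| <= e).
Proof.
by split=> [/subspace_continuousP H x Ax|H]; [apply/cvg_withinP/H|
  apply/subspace_continuousP => x Ax; apply/cvg_withinP/H].
Qed.

Lemma continuous_forP f x : {for x, continuous f} <->
  (forall e : R, 0 < e ->
     exists2 d : R, 0 < d & forall y, `|y - x| < d -> `|f y - f x| <= e).
Proof.
split=> [/cvgrPdist_le H e e0|H].
  have := H e e0; rewrite nearE => /nbhs_ballP[d /= d0 Hd].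
  exists d => // y yx; rewrite distrC; apply: Hd => //.
  by rewrite /ball/= distrC.
apply/cvgrPdist_le => e e0; have [d d0 Hd] := H e e0.
rewrite nearE; apply/nbhs_ballP; exists d => //= y.
by rewrite /ball/= distrC => yx; rewrite distrC; apply: Hd.
Qed.

Lemma is_deriveP F x l : is_derive x 1 F l <->
  (forall e : R, 0 < e -> exists2 d : R, 0 < d &
     forall y, `|y - x| < d -> `|F y - F x - l * (y - x)| <= e * `|y - x|).
Proof.
split=> [[dF <-] e e0|H].
  have /cvgrPdist_le/(_ e e0) : h^-1 *: (F (h *: 1 + x) - F x) @[h --> 0^'] --> 'D_1 F x.
    exact: dF.
  rewrite nearE/= /dnbhs /within/= nearE => /nbhs_ballP[d /= d0 Hd].
  exists d => // y yx; have [->|yx0] := eqVneq y x.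
    by rewrite !subrr mulr0 subrr normr0 mulr0.
  have yx0' : y - x != 0 by rewrite subr_eq0.
  have := Hd (y - x); rewrite /ball/= sub0r normrN => /(_ yx yx0').
  rewrite /GRing.scale/= mulr1 subrK => h1.
  rewrite (_ : F y - F x - _ = - ((y - x) * ('D_1 F x - (y - x)^-1 * (F y - F x)))); last first.
    by field.
  by rewrite normrN normrM mulrC ler_wpM2r.
have E : h^-1 *: (F (h *: 1 + x) - F x) @[h --> 0^'] --> l.
  apply/cvgrPdist_le => e e0; have [d d0 Hd] := H e e0.
  rewrite nearE/= /dnbhs /within/= nearE; apply/nbhs_ballP; exists d => //= h.
  rewrite /ball/= sub0r normrN => hd h0; rewrite /GRing.scale/= mulr1.
  have := Hd (h + x); rewrite addrK => /(_ hd).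
  rewrite (_ : F (h + x) - F x - l * h = - (h * (l - h^-1 * (F (h + x) - F x)))); last first.
    by field.
  by rewrite normrN normrM mulrC ler_pM2r// normr_gt0.
apply: DeriveDef; first by apply/cvg_ex; exists l.
exact/cvg_lim.
Qed.

Lemma is_derive_cont F x l : is_derive x 1 F l -> {for x, continuous F}.
Proof.
by move=> [dF _]; apply: differentiable_continuous; apply/derivable1_diffP.
Qed.

Lemma within_bounded (a b : R) f : a <= b -> {within `[a, b], continuous f} ->
  exists M : R, forall x, a <= x <= b -> `|f x| <= M.
Proof.
move=> ab cf; have cnf : {within `[a, b], continuous (fun x => `|f x|)}.
  by apply/subspace_continuousP => x xab; apply: cvg_norm; move/subspace_continuousP : cf; apply.
have [c cab Hc] := EVT_max ab cnf.
by exists `|f c| => x xab; apply: Hc; rewrite in_itv.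
Qed.

Lemma within_at A f x (e0 : R) : 0 < e0 -> (forall y, `|y - x| < e0 -> A y) ->
  {within A, continuous f} -> {for x, continuous f}.
Proof.
move=> e00 HA /continuous_withinP cf; apply/continuous_forP => e e_gt0.
have Ax : A x by apply: HA; rewrite subrr normr0.
have [d d0 Hd] := cf x Ax e e_gt0.
exists (Num.min d e0) => [|y]; first by rewrite lt_min d0.
by rewrite lt_min => /andP[yd ye]; apply: Hd => //; exact: HA.
Qed.

Lemma within_at_itv (a b : R) f x : a < x < b ->
  {within `[a, b], continuous f} -> {for x, continuous f}.
Proof.
move=> /andP[ax xb]; apply: (@within_at _ _ _ (Num.min (x - a) (b - x))).
  by rewrite lt_min !subr_gt0 ax.
move=> y; rewrite lt_min !ltr_norml /= in_itv/= => /andP[/andP[h1 _] /andP[_ h2]].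
by apply/andP; split; lra.
Qed.

(* Cousin's covering argument *)
Lemma local_to_global (a b : R) (P : R -> R -> Prop) : a <= b ->
  (forall x, a <= x <= b -> exists2 d : R, 0 < d & forall y z, a <= y -> y <= x ->
     x <= z -> z <= b -> x - d < y -> z < x + d -> P y z) ->
  (forall x y z, a <= x -> x <= y -> y <= z -> z <= b -> P x y -> P y z -> P x z) ->
  P a b.
Proof.
move=> ab loc tr.
pose S := [set x | a <= x <= b /\ P a x].
have Sa : S a.
  split; first by rewrite lexx.
  have [|d d0 H] := loc a; first by rewrite lexx.
  by apply: H; rewrite ?lexx// ?ltrDl// ltrBlDr ltrDl.
have hS : has_sup S by split; [exists a | exists b => x [/andP[]]].
set s := sup S.
have as_ : a <= s by apply: ub_le_sup => //; case: hS.
have sb : s <= b by apply: ge_sup; [case: hS | move=> x [/andP[]]].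
have [|d d0 H] := loc s; first by rewrite as_ sb.
have [x [/andP[ax xb] Pax] sx] := sup_adherent d0 hS.
have xs : x <= s by apply: ub_le_sup; [case: hS | split => //; rewrite ax].
have key z : s <= z -> z <= b -> z < s + d -> P a z.
  move=> sz zb zsd; apply: (tr a x z) => //; first exact: le_trans sz.
  exact: H.
have [sbE|sbN] := eqVneq s b; first by apply: key; rewrite ?sbE// ltrDl.
have sltb : s < b by rewrite lt_neqAle sbN.
exfalso; pose z := Num.min b (s + d / 2).
have sz : s < z by rewrite lt_min sltb ltrDl divr_gt0.
have zb : z <= b by rewrite ge_min lexx.
have zsd : z < s + d by rewrite gt_min; apply/orP; right; rewrite ltrD2l; lra.
have : z <= s.
  apply: ub_le_sup; first by case: hS.
  by split; [rewrite zb (le_trans as_ (ltW sz))|apply: key => //; exact: ltW].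
by rewrite leNgt sz.
Qed.

End EpsDelta.

(** * Absolutely continuous functions and their densities *)

Section AbsolutelyContinuous.
Context {R : realType}.
Local Notation mu := (@lebesgue_measure R).
Implicit Types (a b x y : R) (f g U : R -> R).

(** Absolute continuity with the density carried as data, so that calculus can be done on integrals
    and no derivative almost everywhere has to be named. *)
Definition primitive_on a b U g : Prop :=
  intg a b g /\ forall x, a <= x <= b -> U x = U a + itg a x g.

Lemma primitive_sub a b U g x y : primitive_on a b U g ->
  a <= x -> x <= y -> y <= b -> U y - U x = itg x y g.
Proof.
move=> [intf HU] ax xy yb; rewrite (HU y) ?(le_trans ax)// (HU x) ?ax ?(le_trans xy)//.
by rewrite -(itg_sub ax xy yb intf); ring.
Qed.

Lemma primitiveS a b a' b' U g : a <= a' -> b' <= b ->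
  primitive_on a b U g -> primitive_on a' b' U g.
Proof.
move=> aa bb pU; split; first by apply: intgS pU.1.
move=> x /andP[ax xb]; rewrite -(primitive_sub pU aa ax); first by rewrite addrC subrK.
exact: le_trans bb.
Qed.

Lemma primitive_of_itg a b (k : R) g : intg a b g ->
  primitive_on a b (fun x => k + itg a x g) g.
Proof. by move=> intgg; split=> // x xab; rewrite itg1 addr0. Qed.

Lemma eq_primitive a b U V g h : {in `[a, b], U =1 V} -> {in `[a, b], g =1 h} ->
  primitive_on a b U g -> primitive_on a b V h.
Proof.
move=> UV gh [intgg HU]; split; first exact: eq_intg gh intgg.
move=> x /andP[ax xb]; have axb : a <= x <= b by rewrite ax.
rewrite -UV ?in_itv/= ?ax// -UV ?in_itv/= ?lexx ?(le_trans ax)// HU//.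
congr (_ + _); apply: eq_itg => z; rewrite in_itv/= => /andP[az zx].
by apply: gh; rewrite in_itv/= az (le_trans zx).
Qed.

Lemma primitive_unif a b U g (e : R) : a <= b -> primitive_on a b U g -> 0 < e ->
  exists2 d : R, 0 < d & forall x y, a <= x <= b -> a <= y <= b -> `|y - x| < d ->
    `|U y - U x| <= e.
Proof.
move=> ab pU e0; have [d d0 H] := itg_norm_unif ab pU.1 e0.
exists d => // x y; wlog xy : x y / x <= y.
  move=> h xab yab yx; have [xy|/ltW yx'] := leP x y; first exact: h.
  by rewrite distrC; apply: h => //; rewrite distrC.
move=> /andP[ax xb] /andP[ay yb]; rewrite ger0_norm ?subr_ge0// => yx.
rewrite (primitive_sub pU ax xy yb) (le_trans (norm_itg _)) ?ltW ?H//.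
exact: intgS pU.1.
Qed.

Lemma primitive_continuous a b U g : a <= b -> primitive_on a b U g ->
  {within `[a, b], continuous U}.
Proof.
move=> ab pU; apply/continuous_withinP => x; rewrite /= in_itv/= => xab e e0.
have [d d0 H] := primitive_unif ab pU e0.
by exists d => // y; rewrite /= in_itv/= => yab; exact: H.
Qed.

(** The increment of F o U differs from the integral of the formal derivative by at most
    [e * int |g|] on short intervals. Both sides of this bound are additive over adjacent intervals,
    so it passes to the whole interval by the covering argument; then [e] tends to 0. *)
Lemma primitive_chain a b U g (F dF : R -> R) : a <= b -> primitive_on a b U g ->
  (forall x, a <= x <= b -> is_derive (U x) 1 F (dF (U x))) ->
  (forall x, a <= x <= b -> {for U x, continuous dF}) ->
  primitive_on a b (F \o U) (fun x => dF (U x) * g x).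
Proof.
move=> ab pU dFU cF.
have cU := primitive_continuous ab pU.
have cdFU : {within `[a, b], continuous (fun x => dF (U x))}.
  apply/subspace_continuousP => x /= xab.
  apply: (@cvg_comp _ _ _ U dF (within `[a, b] (nbhs x)) (nbhs (U x))).
    by move/subspace_continuousP : cU; apply.
  by apply: cF; move: xab; rewrite in_itv.
have int1 : intg a b (fun x => dF (U x) * g x).
  have [M HM] := within_bounded ab cdFU.
  apply: (@intg_bound _ _ _ M _ (fun x => `|g x|)).
  - apply: measurable_funM; last exact: intg_meas pU.1.
    by apply: intg_meas; exact: intg_cont.
  - exact: intg_norm pU.1.
  - by move=> x xab; rewrite normrM ler_wpM2r// HM.
split=> // x /andP[ax xb]; apply/eqP; rewrite -subr_eq0 -normr_le0 /=.
rewrite opprD addrA.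
set D := (X in `|X| <= _).
suff key (e : R) : 0 < e -> `|D| <= e * itg a x (fun z => `|g z|).
  apply/ler_addgt0Pl => e e0; rewrite addr0.
  have G0 : 0 <= itg a x (fun z => `|g z|) by apply: itg_ge0.
  have e1 : 0 < e / (1 + itg a x (fun z => `|g z|)) by rewrite divr_gt0// ltr_wpDr.
  rewrite (le_trans (key _ e1))// -mulrA ger_pMr// mulrC ler_pdivrMr ?ltr_wpDr//.
  by rewrite mul1r lerDr.
move=> e0; rewrite /D.
pose P y z : Prop := `|F (U z) - F (U y) - itg y z (fun w => dF (U w) * g w)| <=
  e * itg y z (fun w => `|g w|).
suff : P a x by [].
have intx := intgS (lexx a) xb int1; have igx := intgS (lexx a) xb pU.1.
apply: (@local_to_global _ a x P) => // [w /andP[aw wx]|u w z au uw wz zx]; rewrite /P; last first.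
  move=> h1 h2.
  have -> : itg u z (fun w => `|g w|) = itg u w (fun w => `|g w|) + itg w z (fun w => `|g w|).
    by rewrite (@itg_cat _ u w)//; apply/intg_norm/(intgS _ _ igx).
  have -> : itg u z (fun w => dF (U w) * g w) = itg u w (fun w => dF (U w) * g w) +
      itg w z (fun w => dF (U w) * g w).
    by rewrite (@itg_cat _ u w)//; apply/(intgS _ _ intx).
  rewrite mulrDr (le_trans _ (lerD h1 h2))// (le_trans _ (ler_normD _ _))//.
  by rewrite le_eqVlt; apply/orP; left; apply/eqP; congr `|_|; ring.
have awb : a <= w <= b by rewrite aw (le_trans wx).
have e2 : 0 < e / 2 by rewrite divr_gt0.
have [d1 d10 H1] := (is_deriveP _ _ _).1 (dFU w awb) _ e2.
have d12 : 0 < d1 / 2 by rewrite divr_gt0.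
have [d2 d20 H2] := primitive_unif ab pU d12.
have waS : `[a, b]%classic w by rewrite /= in_itv.
have [d3 d30 H3] := (continuous_withinP _ _).1 cdFU w waS _ e2.
exists (Num.min d2 d3); first by rewrite lt_min d20.
move=> y z ay yw wz zx ydw zdw.
have yb : y <= b by rewrite (le_trans yw)//; case/andP: awb.
have zb : z <= b by exact: le_trans xb.
have loc u : y <= u -> u <= z -> [/\ a <= u <= b, `|u - w| < d2 & `|u - w| < d3].
  move=> yu uz; rewrite (le_trans ay yu) (le_trans uz zb).
  suff : `|u - w| < Num.min d2 d3 by rewrite lt_min => /andP[].
  rewrite ltr_norml ltrBrDr addrC (lt_le_trans ydw yu)/= ltrBlDr addrC.
  exact: le_lt_trans zdw.
have yz := le_trans yw wz.
have near u : y <= u -> u <= z ->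
    `|F (U u) - F (U w) - dF (U w) * (U u - U w)| <= e / 2 * `|U u - U w|.
  move=> yu uz; have [h1 h2 _] := loc u yu uz; apply: H1.
  by rewrite (le_lt_trans (H2 _ _ awb h1 h2))// ltr_pdivrMr// ltr_pMr// ltr1n.
have ig y1 z1 : y <= y1 -> z1 <= z -> intg y1 z1 g.
  by move=> yy zz; apply: intgS igx; [exact: le_trans yy|exact: le_trans zx].
have ign y1 z1 : y <= y1 -> z1 <= z -> intg y1 z1 (fun w => `|g w|).
  by move=> *; apply/intg_norm/ig.
have idg y1 z1 : y <= y1 -> z1 <= z -> intg y1 z1 (fun w => dF (U w) * g w).
  by move=> yy zz; apply: intgS intx; [exact: le_trans yy|exact: le_trans zx].
have n1 : `|F (U z) - F (U w) - dF (U w) * (U z - U w)| <= e / 2 * itg w z (fun w => `|g w|).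
  rewrite (le_trans (near z yz (lexx z)))// ler_wpM2l ?(ltW e2)//.
  by rewrite (primitive_sub pU)//; apply: norm_itg; apply: ig.
have n2 : `|F (U y) - F (U w) - dF (U w) * (U y - U w)| <= e / 2 * itg y w (fun w => `|g w|).
  rewrite (le_trans (near y (lexx y) yz))// ler_wpM2l ?(ltW e2)//.
  rewrite distrC (primitive_sub pU)//; first by apply: norm_itg; apply: ig.
  by case/andP: awb.
have n3 : `|itg y z (fun u => dF (U u) * g u) - dF (U w) * (U z - U y)| <=
    e / 2 * itg y z (fun w => `|g w|).
  have iC : intg y z (fun u => dF (U w) * g u) by apply: intgZ; exact: ig.
  rewrite (primitive_sub pU)// -(itgZ _ (ig y z _ _))// -itgB//; last exact: idg.
  rewrite (le_trans (norm_itg _))//; first by apply: intgB => //; exact: idg.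
  rewrite -itgZ; last exact: ign.
  apply: le_itg.
  - by apply/intg_norm/intgB => //; exact: idg.
  - by apply: intgZ; exact: ign.
  - move=> u /andP[yu uz]; rewrite -mulrBl normrM ler_wpM2r//.
    by have [h1 h2 h3] := loc u yu uz; apply: H3.
(* Three errors: the two increments from the tangency point [w], which together cost e/2 of the
   integral of |g| over [y, z], and the oscillation of [dF] under the integral, which costs the
   other e/2. *)
rewrite (_ : F (U z) - F (U y) - _ = (F (U z) - F (U w) - dF (U w) * (U z - U w))
   - (F (U y) - F (U w) - dF (U w) * (U y - U w))
   - (itg y z (fun u => dF (U u) * g u) - dF (U w) * (U z - U y))); last by ring.
rewrite (le_trans (ler_normB _ _))// (le_trans (lerD (ler_normB _ _) n3))//.
rewrite (le_trans (lerD (lerD n1 n2) (lexx _)))//.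
rewrite (@itg_cat _ y w z)//; last exact: ign.
by rewrite le_eqVlt; apply/orP; left; apply/eqP; field.
Qed.

Lemma primitiveD a b U g V h : primitive_on a b U g -> primitive_on a b V h ->
  primitive_on a b (fun x => U x + V x) (fun x => g x + h x).
Proof.
move=> pU pV; split; first exact: intgD pU.1 pV.1.
move=> x /andP[ax xb]; rewrite itgD; last 2 first.
- exact: intgS pU.1.
- exact: intgS pV.1.
by rewrite pU.2 ?ax// pV.2 ?ax//; ring.
Qed.

Lemma primitiveZ a b (k : R) U g : primitive_on a b U g ->
  primitive_on a b (fun x => k * U x) (fun x => k * g x).
Proof.
move=> pU; split; first exact: intgZ pU.1.
move=> x /andP[ax xb]; rewrite itgZ; last exact: intgS pU.1.
by rewrite pU.2 ?ax//; ring.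
Qed.

Lemma is_derive_sqr (x : R) : is_derive x 1 (fun y : R => y ^+ 2) (2 * x).
Proof.
apply/is_deriveP => e e0; exists e => // y yx.
rewrite (_ : y ^+ 2 - x ^+ 2 - 2 * x * (y - x) = (y - x) * (y - x)); last by ring.
by rewrite normrM ler_wpM2r// ltW.
Qed.

(** Polarisation: UV is half of (U + V)^2 - U^2 - V^2, and squares are covered by the chain rule. *)
Lemma primitive_mul a b U g V h : a <= b ->
  primitive_on a b U g -> primitive_on a b V h ->
  primitive_on a b (fun x => U x * V x) (fun x => g x * V x + U x * h x).
Proof.
move=> ab pU pV.
have sq W w : primitive_on a b W w ->
    primitive_on a b (fun x => W x ^+ 2) (fun x => 2 * W x * w x).
  move=> pW; apply: (@primitive_chain _ _ _ _ (fun y => y ^+ 2) (fun y => 2 * y)) => //.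
    by move=> x _; exact: is_derive_sqr.
  by move=> x _; apply: cvgMr; exact: cvg_id.
have pS := sq _ _ (primitiveD pU pV).
have := primitiveZ 2^-1 (primitiveD pS (primitiveZ (-1) (primitiveD (sq _ _ pU) (sq _ _ pV)))).
by apply: eq_primitive => x _; field.
Qed.

Lemma primitive_id a b : primitive_on a b id (fun=> 1).
Proof.
split; first exact: intg_cst.
by move=> x /andP[ax _]; rewrite itg_cst//; ring.
Qed.

Lemma primitive_cst a b (k : R) : primitive_on a b (fun=> k) (fun=> 0).
Proof.
split; first exact: intg_cst.
by move=> x /andP[ax _]; rewrite itg_cst//; ring.
Qed.

Lemma primitive_C1 a b (F dF : R -> R) : a <= b ->
  (forall x, a <= x <= b -> is_derive x 1 F (dF x)) ->
  (forall x, a <= x <= b -> {for x, continuous dF}) ->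
  primitive_on a b F dF.
Proof.
move=> ab dFx cF; have := primitive_chain ab (primitive_id a b) dFx cF.
by apply: eq_primitive => x _ //=; rewrite mulr1.
Qed.

Lemma itg_by_parts a b U g V h : a <= b ->
  primitive_on a b U g -> primitive_on a b V h ->
  itg a b (fun x => U x * h x) = U b * V b - U a * V a - itg a b (fun x => g x * V x).
Proof.
move=> ab pU pV; have pUV := primitive_mul ab pU pV.
have bd A k B : primitive_on a b A k -> {within `[a, b], continuous B} ->
    intg a b (fun x => k x * B x).
  move=> pA cB; have [M HM] := within_bounded ab cB.
  apply: (@intg_bound _ _ _ M _ (fun x => `|k x|)).
  - apply: measurable_funM; first exact: intg_meas pA.1.
    by apply: intg_meas; exact: intg_cont.
  - exact: intg_norm pA.1.
  - by move=> x xab; rewrite normrM mulrC ler_wpM2r// HM.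
have i1 := bd _ _ _ pU (primitive_continuous ab pV).
have i2 := bd _ _ _ pV (primitive_continuous ab pU).
have {}i2 : intg a b (fun x => U x * h x).
  by apply: eq_intg i2 => x _; rewrite mulrC.
have := pUV.2 b; rewrite ab lexx itgD// => /(_ isT) ->; ring.
Qed.

Lemma is_derive_itg a x f (u : R) : a < x -> x < u -> intg a u f -> {for x, continuous f} ->
  is_derive x 1 (fun y => itg a y f) (f x).
Proof.
move=> ax xu intf cf; have [dF Fx] := continuous_FTC1_closed xu intf ax cf.
exact: (DeriveDef dF (etrans (esym (derive1E _ _)) Fx)).
Qed.

End AbsolutelyContinuous.

(** * Weak derivatives and absolute continuity *)

Section WeakDerivative.
Context {R : realType}.
Local Notation mu := (@lebesgue_measure R).
Local Notation I01 := (`]0%R, 1%R[%classic : set R).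
Implicit Types (f g U eta : R -> R).

Lemma integrable_oo (a b : R) f : mu.-integrable `]a, b[ (EFin \o f) <-> intg a b f.
Proof.
split=> [i|]; last by apply: integrableS => //; exact: subset_itv_oo_cc.
have mf := measurable_int _ i.
have mf' : measurable_fun `]a, b] (EFin \o f) by apply/emeasurable_fun_itv_bndo_bndcP.
have mf'' : measurable_fun `[a, b] (EFin \o f) by apply/emeasurable_fun_itv_obnd_cbndP.
have m1 : measurable_fun `]a, b[ (fun x => `|(EFin \o f) x|%E) by apply: measurableT_comp.
have m2 : measurable_fun `]a, b] (fun x => `|(EFin \o f) x|%E) by apply: measurableT_comp.
apply/integrableP; split => //.
by case/integrableP: i => _; rewrite integral_itv_bndo_bndc// integral_itv_obnd_cbnd.
Qed.

Lemma integrable_I01 f : mu.-integrable I01 (EFin \o f) <-> intg 0 1 f.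
Proof. exact: integrable_oo. Qed.

Lemma Rintegral_I01 f : intg 0 1 f -> \int[mu]_(x in I01) f x = itg 0 1 f.
Proof.
move=> i; rewrite Rintegral_itv_bndo_bndc; last by apply/integrable_I01.
rewrite Rintegral_itv_obnd_cbnd//; apply: integrableS i => //.
by apply: subset_itvr; rewrite bnd_simp.
Qed.

Lemma test_function_primitive eta : test_function eta ->
  [/\ primitive_on 0 1 eta (derive1 eta), eta 0 = 0 & eta 1 = 0].
Proof.
move=> [deta ceta seta]; split.
- apply: primitive_C1 => // [x _|x _]; last exact: ceta.
  by apply: DeriveDef => //; rewrite derive1E.
- apply/eqP/negP => /negP e0.
  have /seta : supp eta 0 by apply: subset_closure; exact: e0.
  by rewrite /= in_itv/= ltxx.
- apply/eqP/negP => /negP e0.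
  have /seta : supp eta 1 by apply: subset_closure; exact: e0.
  by rewrite /= in_itv/= ltxx andbF.
Qed.

Lemma intg_mul_cont a b f (w : R -> R) : a <= b -> intg a b f ->
  {within `[a, b], continuous w} -> intg a b (fun x => f x * w x).
Proof.
move=> ab intf cw; have [M HM] := within_bounded ab cw.
apply: (@intg_bound _ _ _ M _ (fun x => `|f x|)).
- apply: measurable_funM; first exact: intg_meas intf.
  by apply: intg_meas; exact: intg_cont.
- exact: intg_norm.
- by move=> x xab; rewrite normrM mulrC ler_wpM2r// HM.
Qed.

Lemma weak_of_primitive U g : primitive_on 0 1 U g -> weak_derivative U g.
Proof.
move=> pU eta teta; have [peta e0 e1] := test_function_primitive teta.
have cU := primitive_continuous ler01 pU.
have ce := primitive_continuous ler01 peta.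
rewrite Rintegral_I01; last first.
  apply: (@eq_intg _ _ _ (fun x => derive1 eta x * U x)); first by move=> x _; rewrite mulrC.
  exact: intg_mul_cont peta.1 cU.
rewrite Rintegral_I01; last exact: intg_mul_cont pU.1 ce.
by rewrite (itg_by_parts ler01 pU peta) e0 e1 !mulr0 subrr sub0r.
Qed.

(** The positive part of d - |x - p|, a continuous averaging weight around [p]. *)
Let hat (p d x : R) : R := (d - `|x - p| + `|d - `|x - p| |) / 2.

Let hat_cont (p d : R) : continuous (hat p d).
Proof.
move=> x.
have h : d - `|y - p| @[y --> x] --> d - `|x - p|.
  apply: cvgB; first exact: cvg_cst.
  by apply: cvg_norm; apply: cvgB; [exact: cvg_id|exact: cvg_cst].
by apply: cvgMl; apply: cvgD => //; exact: cvg_norm.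
Qed.

Let hat_out (p d x : R) : d <= `|x - p| -> hat p d x = 0.
Proof.
by move=> dx; rewrite /hat [X in _ + X]ler0_norm ?subr_le0// addrN mul0r.
Qed.

Let hat_ge0 (p d x : R) : 0 <= hat p d x.
Proof.
rewrite divr_ge0//; have := ler_norm (- (d - `|x - p|)); rewrite normrN; lra.
Qed.

Let hat_int (p d : R) : 0 < d -> 0 <= p - d -> p + d <= 1 -> 0 < itg 0 1 (hat p d).
Proof.
move=> d0 pd0 pd1; have ih a b : intg a b (hat p d).
  by apply: intg_cont; apply: continuous_subspaceT => x; exact: hat_cont.
apply: (@lt_le_trans _ _ (d / 2 * d)); first by rewrite mulr_gt0// divr_gt0.
have -> : d / 2 * d = itg (p - d / 2) (p + d / 2) (fun=> d / 2).
  by rewrite itg_cst; [field|lra].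
apply: (@le_trans _ _ (itg (p - d / 2) (p + d / 2) (hat p d))).
  apply: le_itg => // [|x /andP[x1 x2]]; first exact: intg_cst.
  have xp : `|x - p| <= d / 2 by rewrite ler_norml; apply/andP; split; lra.
  by rewrite /hat [X in _ + X]ger0_norm; lra.
by apply: ge0_le_itg => // *; try lra; exact: hat_ge0.
Qed.

(** The du Bois-Reymond lemma for continuous functions: weighted means of [W] around any two points
    coincide, and the weights can be concentrated. *)
Lemma continuous_weak_const (W : R -> R) : {within `[0, 1], continuous W} ->
  (forall eta, test_function eta -> itg 0 1 (fun x => W x * derive1 eta x) = 0) ->
  forall x y : R, 0 < x < 1 -> 0 < y < 1 -> W x = W y.
Proof.
move=> cW HW x1 x2 x101 x201; apply/eqP; rewrite -subr_eq0 -normr_le0.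
apply/ler_addgt0Pl => e e0; rewrite addr0.
have near (p : R) : 0 < p < 1 -> exists2 d : R, 0 < d & [/\ 0 < p - d, p + d < 1 &
    forall x : R, 0 <= x <= 1 -> `|x - p| < d -> `|W x - W p| <= e / 2].
  move=> p01; have pI : `[0%R, 1%R]%classic p.
    by rewrite /= in_itv/=; apply/andP; split; lra.
  have [d d0 Hd] := (continuous_withinP _ _).1 cW p pI (e / 2) (divr_gt0 e0 (ltr0n _ 2)).
  exists (Num.min d (Num.min (p / 2) ((1 - p) / 2))).
    by rewrite !lt_min d0; lra.
  have m1 : Num.min d (Num.min (p / 2) ((1 - p) / 2)) <= d by rewrite ge_min lexx.
  have m2 : Num.min d (Num.min (p / 2) ((1 - p) / 2)) <= p / 2 by rewrite !ge_min lexx orbT.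
  have m3 : Num.min d (Num.min (p / 2) ((1 - p) / 2)) <= (1 - p) / 2.
    by rewrite !ge_min lexx !orbT.
  split; [lra|lra|move=> x x01 xp; apply: Hd; last exact: lt_le_trans xp m1].
  by rewrite /= in_itv.
have [d1 d10 [p1 q1 H1]] := near x1 x101.
have [d2 d20 [p2 q2 H2]] := near x2 x201.
set c1 := itg 0 1 (hat x1 d1); set c2 := itg 0 1 (hat x2 d2).
have c10 : 0 < c1 by apply: hat_int => //; lra.
have c20 : 0 < c2 by apply: hat_int => //; lra.
(* The coefficients give [k] mean zero, so its primitive has compact support in (0, 1) and is a test
   function. *)
pose k x := c2 * hat x1 d1 x - c1 * hat x2 d2 x.
have kc : continuous k.
  by move=> x; apply: cvgB; apply: cvgMr; exact: hat_cont.
have kint a b : intg a b k by apply: intg_cont; exact: continuous_subspaceT.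
have hint p d a b : intg a b (hat p d).
  by apply: intg_cont; apply: continuous_subspaceT => x; exact: hat_cont.
pose lo : R := Num.min (x1 - d1) (x2 - d2); pose hi : R := Num.max (x1 + d1) (x2 + d2).
have lo0 : 0 < lo by rewrite lt_min p1.
have hi1 : hi < 1 by rewrite gt_max q1.
have klo (x : R) : x <= lo -> k x = 0.
  rewrite le_min => /andP[l1 l2]; rewrite /k !hat_out ?mulr0 ?subrr//.
    by rewrite ler0_norm; lra.
  by rewrite ler0_norm; lra.
have khi (x : R) : hi <= x -> k x = 0.
  rewrite ge_max => /andP[l1 l2]; rewrite /k !hat_out ?mulr0 ?subrr//.
    by rewrite ger0_norm; lra.
  by rewrite ger0_norm; lra.
have k01 : itg 0 1 k = 0.
  by rewrite itgB ?itgZ//; [rewrite mulrC subrr|exact: intgZ|exact: intgZ].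
(* The base point lies to the left of 0, so that the fundamental theorem also covers a neighbourhood
   of 0; for x < -1 the interval is empty and the integral is 0, as it should be. *)
pose eta x := itg (-1) x k.
have eta_lo (x : R) : x <= lo -> eta x = 0.
  move=> xlo; rewrite /eta (@eq_itg _ _ _ _ (fun=> 0)).
    have [x1'|x1'] := leP (-1) x; first by rewrite itg_cst// mul0r.
    by rewrite /itg set_itv_ge ?Rintegral_set0// bnd_simp -ltNge.
  by move=> z; rewrite in_itv/= => /andP[_ zx]; apply: klo; exact: le_trans zx xlo.
have eta_hi (x : R) : hi <= x -> eta x = 0.
  move=> xhi; have hilo : lo <= hi by rewrite /lo /hi ge_min le_max; apply/orP; left; apply/orP; left; lra.
  have x0 : 0 <= x by lra.
  have m10 : -1 <= 0 :> R by lra.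
  rewrite /eta (@itg_cat _ _ 0)//.
  rewrite -/(eta 0) eta_lo ?(ltW lo0)// add0r.
  have E : itg hi 1 k = 0.
    rewrite (@eq_itg _ _ _ _ (fun=> 0)); first by rewrite itg_cst ?mul0r// ltW.
    by move=> z; rewrite in_itv/= => /andP[zx _]; exact: khi.
  have E' : itg hi x k = 0.
    rewrite (@eq_itg _ _ _ _ (fun=> 0)); first by rewrite itg_cst ?mul0r.
    by move=> z; rewrite in_itv/= => /andP[zx _]; exact: khi.
  have hi0 : 0 <= hi by lra.
  have := k01; rewrite (@itg_cat _ 0 hi 1)// ?(ltW hi1)// E addr0.
  by rewrite (@itg_cat _ 0 hi x)// E' addr0.
have deta (x : R) : is_derive x 1 eta (k x).
  have [x1'|x1'] := leP x (- 1 / 2).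
    rewrite klo; last lra.
    apply/is_deriveP => e' e'0; exists (1 / 2); first lra.
    move=> y yx; have {}yx : y < 0.
      by move: yx; rewrite ltr_norml => /andP[_]; lra.
    have [y1 y2] : y <= lo /\ x <= lo by split; lra.
    by rewrite !eta_lo// subrr mul0r subrr normr0 mulr_ge0// ltW.
  by apply: (@is_derive_itg _ _ _ _ (x + 1)) => //; [lra|lra|exact: kc].
have deta1 (x : R) : derive1 eta x = k x by rewrite derive1E; apply: derive_val.
have teta : test_function eta.
  split.
  - by move=> x; have [] := deta x.
  - by rewrite (_ : derive1 eta = k)//; apply/funext.
  - move=> x sx; suff : lo <= x <= hi.
      by move=> /andP[l1 l2]; rewrite /= in_itv/= (lt_le_trans lo0 l1) (le_lt_trans l2 hi1).
    have cl : closed `[lo, hi]%classic by exact: itv_closed.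
    have : closure `[lo, hi]%classic x.
      apply: closureS sx => y /= ey; rewrite in_itv/=.
      by apply/andP; split; rewrite leNgt; apply/negP => h; move/negP: ey; apply;
        apply/eqP; [exact: eta_lo (ltW h)|exact: eta_hi (ltW h)].
    by move/cl; rewrite /= in_itv.
have := HW _ teta.
have cWk p d : intg 0 1 (fun x => hat p d x * W x).
  by apply: intg_mul_cont.
have est (p d : R) : (forall x : R, 0 <= x <= 1 -> `|x - p| < d -> `|W x - W p| <= e / 2) ->
    `|itg 0 1 (fun x => hat p d x * W x) - W p * itg 0 1 (hat p d)| <= e / 2 * itg 0 1 (hat p d).
  move=> Hp; rewrite -!itgZ// -itgB//; last exact: intgZ.
  rewrite (le_trans (norm_itg _))//; first by apply: intgB => //; exact: intgZ.
  apply: le_itg; [by apply/intg_norm/intgB => //; exact: intgZ|exact: intgZ|].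
  move=> x x01; have [xp|xp] := ltP `|x - p| d; last first.
    by rewrite hat_out// mul0r !mulr0 subrr normr0.
  rewrite (mulrC (W p)) -mulrBr normrM (ger0_norm (hat_ge0 _ _ _)) mulrC.
  by rewrite ler_wpM2r// Hp.
have e1 := est _ _ H1; have e2 := est _ _ H2.
set I1 := itg 0 1 (fun x => hat x1 d1 x * W x) in e1 *.
set I2 := itg 0 1 (fun x => hat x2 d2 x * W x) in e2 *.
rewrite (@eq_itg _ _ _ _ (fun x => c2 * (hat x1 d1 x * W x) - c1 * (hat x2 d2 x * W x))); last first.
  by move=> x _; rewrite deta1 /k; ring.
rewrite itgB ?itgZ//; [|exact: intgZ|exact: intgZ].
rewrite -/I1 -/I2 => E.
rewrite -/c1 -/c2 in e1 e2.
have cc : 0 < c1 * c2 by rewrite mulr_gt0.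
rewrite -(ler_pM2l cc) -[X in X * `|_|](gtr0_norm cc) -normrM.
rewrite (_ : c1 * c2 * (W x1 - W x2) = - (c2 * (I1 - W x1 * c1)) + c1 * (I2 - W x2 * c2)); last first.
  by apply/eqP; rewrite -subr_eq0; apply/eqP; rewrite -[RHS]E; ring.
rewrite (le_trans (ler_normD _ _))// normrN !normrM (gtr0_norm c10) (gtr0_norm c20).
have f1 : c2 * `|I1 - W x1 * c1| <= c2 * (e / 2 * c1) by rewrite ler_pM2l.
have f2 : c1 * `|I2 - W x2 * c2| <= c1 * (e / 2 * c2) by rewrite ler_pM2l.
apply: (le_trans (lerD f1 f2)).
by rewrite le_eqVlt; apply/orP; left; apply/eqP; field.
Qed.

(** U minus the integral of [g] has weak derivative 0, hence is constant inside the interval, and by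
    continuity up to its ends. *)
Lemma primitive_of_weak U g : {within `[0, 1], continuous U} -> intg 0 1 g ->
  weak_derivative U g -> primitive_on 0 1 U g.
Proof.
move=> cU ig wU; split => // x x01.
pose W x := U x - itg 0 x g.
have pG : primitive_on 0 1 (fun x => itg 0 x g) g.
  by have := primitive_of_itg 0 ig; apply: eq_primitive => // y _; rewrite add0r.
have cG := primitive_continuous ler01 pG.
have cW : {within `[0, 1], continuous W}.
  by apply: within_continuousB.
have HW eta : test_function eta -> itg 0 1 (fun x => W x * derive1 eta x) = 0.
  move=> teta; have [peta e0 e1] := test_function_primitive teta.
  have ce := primitive_continuous ler01 peta.
  have iA : intg 0 1 (fun x => U x * derive1 eta x).
    apply: (@eq_intg _ _ _ (fun x => derive1 eta x * U x)); first by move=> y _; rewrite mulrC.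
    exact: intg_mul_cont peta.1 cU.
  have iB : intg 0 1 (fun x => itg 0 x g * derive1 eta x).
    apply: (@eq_intg _ _ _ (fun x => derive1 eta x * itg 0 x g)); first by move=> y _; rewrite mulrC.
    exact: intg_mul_cont peta.1 cG.
  rewrite (@eq_itg _ _ _ _ (fun x => U x * derive1 eta x - itg 0 x g * derive1 eta x)); last first.
    by move=> y _; rewrite /W mulrBl.
  rewrite itgB//; have := wU _ teta; have := weak_of_primitive pG teta.
  rewrite !Rintegral_I01//; last exact: intg_mul_cont.
  by move=> -> ->; rewrite subrr.
have C := continuous_weak_const cW HW.
suff E (y : R) : 0 <= y <= 1 -> W y = W (1 / 2).
  have := E x x01; rewrite -(E 0) ?lexx ?ler01// /W itg1 subr0 => <-.
  by rewrite subrK.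
move=> y01; apply/eqP; rewrite -subr_eq0 -normr_le0.
apply/ler_addgt0Pl => e e0; rewrite addr0.
have yI : `[0%R, 1%R]%classic y by rewrite /= in_itv.
have [d d0 Hd] := (continuous_withinP _ _).1 cW y yI e e0.
have [z [z01 zy]] : exists z, 0 < z < 1 /\ `|z - y| < d.
  pose m := Num.min (d / 2) (1 / 4).
  have m0 : 0 < m by rewrite lt_min; lra.
  have m1 : m <= d / 2 by rewrite ge_min lexx.
  have m2 : m <= 1 / 4 by rewrite ge_min lexx orbT.
  have [y2|y2] := leP y (1 / 2).
    by exists (y + m); split; [lra|rewrite addrC addKr gtr0_norm//; lra].
  by exists (y - m); split; [lra|rewrite addrC addKr normrN gtr0_norm//; lra].
rewrite -(C z (1 / 2)); last 2 first.
- exact: z01.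
- by lra.
rewrite distrC; apply: Hd => //; rewrite /= in_itv/=; lra.
Qed.

End WeakDerivative.

(** * Null sets, affine substitutions and first variations *)

Section MeasureTools.
Context {R : realType}.
Local Notation mu := (@lebesgue_measure R).
Import HBNNSimple.

Lemma ae_imp (P Q : R -> Prop) : (forall x, P x -> Q x) ->
  {ae mu, forall x, P x} -> {ae mu, forall x, Q x}.
Proof.
by move=> PQ [N [mN N0 PN]]; exists N; split => // x /= nQ; apply: PN => /PQ.
Qed.

Lemma ae_and (P Q : R -> Prop) : {ae mu, forall x, P x} -> {ae mu, forall x, Q x} ->
  {ae mu, forall x, P x /\ Q x}.
Proof.
move=> [N [mN N0 PN]] [M [mM M0 QM]]; exists (N `|` M); split => //.
- exact: measurableU.
- by apply/negligibleP; [exact: measurableU|apply: negligibleU; exact/negligibleP].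
- move=> x /= nPQ; have [Px|nPx] := pselect (P x); last by left; apply: PN.
  by right; apply: QM => Qx; apply: nPQ.
Qed.

Lemma ae_forall (P : nat -> R -> Prop) : (forall n, {ae mu, forall x, P n x}) ->
  {ae mu, forall x, forall n, P n x}.
Proof.
move=> H; have /choice[N HN] n : exists N, [/\ measurable N, mu N = 0%E &
    ~` [set x | P n x] `<=` N] by have [N HN] := H n; exists N.
exists (\bigcup_n N n); split.
- by apply: bigcup_measurable => n _; case: (HN n).
- apply/negligibleP; first by apply: bigcup_measurable => n _; case: (HN n).
  by apply: negligible_bigcup => n; case: (HN n) => mN N0 _; apply/negligibleP.
- move=> x /= /existsNP[n nP]; exists n => //.
  by case: (HN n) => _ _; apply.
Qed.

(** The push-forward of Lebesgue measure under x |-> k x + m, scaled by [k], agrees with Lebesgue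
    measure on half-open intervals, hence everywhere by uniqueness. *)
Lemma ge0_integral_affine (k m a b : R) (f : R -> \bar R) : 0 < k ->
  measurable_fun `[k * a + m, k * b + m] f ->
  (forall x, k * a + m <= x <= k * b + m -> (0 <= f x)%E) ->
  (k%:E * \int[mu]_(x in `[a, b]) f (k * x + m)%R =
   \int[mu]_(x in `[(k * a + m)%R, (k * b + m)%R]) f x)%E.
Proof.
move=> k0 mf f0; pose p : measurableTypeR R -> measurableTypeR R := fun x => k * x + m.
have mp : measurable_fun setT p by apply: measurable_funD => //; apply: measurable_funM.
pose nu : {measure set (measurableTypeR R) -> \bar R} :=
  measure_function_pushforward__canonical__measure_function_Measure mu mp.
have Ep (i : bool * R) (j : bool * R) : p @^-1` [set` Interval (BSide i.1 (k * i.2 + m)) (BSide j.1 (k * j.2 + m))] =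
    [set` Interval (BSide i.1 i.2) (BSide j.1 j.2)].
  apply/seteqP; split => x /=; rewrite !itv_boundlr /p;
    by case: i j => [[] i] [[] j] /=; rewrite !bnd_simp ?(lerD2r, ltrD2r) ?(ler_pM2l k0) ?(ltr_pM2l k0).
have nuE A : measurable A -> mscale (NngNum (ltW k0)) nu A = mu A.
  move=> mA; apply/esym/(lebesgue_measure_unique (mu := mscale (NngNum (ltW k0)) nu)) => // _ [[c d] _ <-].
  have := Ep (false, (c - m) / k) (false, (d - m) / k); rewrite /= => E.
  rewrite /mscale /nu /= /pushforward.
  have -> : c = k * ((c - m) / k) + m by field; rewrite gt_eqF.
  have -> : d = k * ((d - m) / k) + m by field; rewrite gt_eqF.
  rewrite E !lebesgue_measure_itv/= !lte_fin ltrD2r ltr_pM2l//.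
  by case: ifP => _; rewrite ?mule0// -!EFinB -EFinM; congr EFin; field; rewrite gt_eqF.
transitivity (\int[mscale (NngNum (ltW k0)) nu]_(x in `[(k * a + m)%R, (k * b + m)%R]) f x)%E; last first.
  by apply: eq_measure_integral => A mA _; exact: nuE.
rewrite ge0_integral_mscale//; congr (_ * _)%E; rewrite /nu ge0_integral_pushforward//; last first.
  by move=> x; rewrite inE/= in_itv/=; exact: f0.
by rewrite (Ep (true, a) (false, b)).
Qed.

Lemma measurable_affine (k m a b : R) (f : R -> R) : 0 < k ->
  measurable_fun `[k * a + m, k * b + m] f ->
  measurable_fun `[a, b] (fun x => f (k * x + m)).
Proof.
move=> k0 mf; apply: (@measurable_comp _ _ _ _ _ _ `[k * a + m, k * b + m]) => //.
  move=> _ [x /=] /[swap] <-; rewrite !in_itv/= => /andP[ax xb].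
  by rewrite !lerD2r !ler_pM2l// ax.
by apply: measurable_funD => //; apply: measurable_funM.
Qed.

Lemma intg_affine (k m a b : R) (f : R -> R) : 0 < k ->
  intg (k * a + m) (k * b + m) f -> intg a b (fun x => f (k * x + m)).
Proof.
move=> k0 intf; have mf := intg_meas intf.
have mfa := measurable_affine k0 mf.
apply/integrableP; split; first exact/measurable_EFinP.
have /integrableP[_ fin] := intf.
have E := ge0_integral_affine k0 (f := fun x => `|f x|%:E) (a := a) (b := b).
move: E => /(_ m); rewrite -[X in (_ < X)%E](@gt0_muley R k^-1%:E) ?lte_fin ?invr_gt0//.
rewrite -lte_pdivrMl ?invr_gt0// invrK => ->//.
by apply/measurable_EFinP/measurableT_comp.
Qed.

Lemma itg_affine (k m a b : R) (f : R -> R) : 0 < k ->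
  intg (k * a + m) (k * b + m) f ->
  k * itg a b (fun x => f (k * x + m)) = itg (k * a + m) (k * b + m) f.
Proof.
move=> k0 intf.
have posI (g : R -> R) : intg (k * a + m) (k * b + m) g -> (forall x, 0 <= g x) ->
    k * itg a b (fun x => g (k * x + m)) = itg (k * a + m) (k * b + m) g.
  move=> intgg g0; rewrite /itg /Rintegral.
  have E := @ge0_integral_affine k m a b (EFin \o g) k0 (measurable_int _ intgg) (fun x _ => g0 x).
  by rewrite -E fineM//; apply: integrable_fin_num => //; exact: intg_affine.
have ia := intg_norm intf.
(* [f] is the difference of the nonnegative functions |f| + f and |f|. *)
have ip : intg (k * a + m) (k * b + m) (fun x => `|f x| + f x) by exact: intgD.
have ip0 x : 0 <= `|f x| + f x by have := ler_norm (- f x); rewrite normrN; lra.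
have := posI _ ip ip0.
have := posI _ ia (fun x => normr_ge0 _).
rewrite !itgD//; [|exact: (intg_affine k0 ia)|exact: intg_affine].
by rewrite mulrDr => -> /addrI.
Qed.

Lemma ae_ex (P : R -> Prop) (a b : R) : a < b ->
  {ae mu, forall x, P x} -> exists2 x, a < x < b & P x.
Proof.
move=> ab [N [mN N0 PN]]; apply: contrapT => noP.
suff : (mu `]a, b[ <= 0)%E.
  by rewrite lebesgue_measure_itv/= lte_fin ab -EFinB lee_fin leNgt subr_gt0 ab.
rewrite -N0 le_measure ?inE// => x; rewrite /= in_itv/= => xab; apply: PN => Px.
by apply: noP; exists x.
Qed.

Lemma ae_itg (a b : R) (f g : R -> R) : intg a b f -> measurable_fun `[a, b] g ->
  {ae mu, forall x, a <= x <= b -> f x = g x} -> intg a b g /\ itg a b f = itg a b g.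
Proof.
move=> intf mg fg.
have fg' : ae_eq mu [set` `[a, b]] (EFin \o f) (EFin \o g).
  by apply: ae_imp fg => x h /=; rewrite in_itv/= => xab; rewrite h.
split; last first.
  rewrite /itg /Rintegral; congr fine; apply: ae_eq_integral => //.
  - exact: measurable_int intf.
  - exact/measurable_EFinP.
apply/integrableP; split; first exact/measurable_EFinP.
have /integrableP[_] := intf.
suff -> : (\int[mu]_(x in `[a, b]) `|(EFin \o f) x| = \int[mu]_(x in `[a, b]) `|(EFin \o g) x|)%E by [].
apply: ge0_ae_eq_integral => //.
- by apply/measurable_EFinP/measurableT_comp => //; exact: intg_meas intf.
- by apply/measurable_EFinP/measurableT_comp.
- by apply: ae_imp fg' => x h xab; congr (abse _); exact: h.
Qed.

Lemma itg_ge0_eq0 (a b : R) (f : R -> R) : intg a b f ->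
  (forall x, a <= x <= b -> 0 <= f x) -> itg a b f = 0 ->
  {ae mu, forall x, a <= x <= b -> f x = 0}.
Proof.
move=> intf f0 If.
have : (\int[mu]_(x in `[a, b]) `|(EFin \o f) x| = 0)%E.
  transitivity (\int[mu]_(x in `[a, b]) (EFin \o f) x)%E.
    apply: eq_integral => x; rewrite inE/= in_itv/= => xab.
    by rewrite ger0_norm ?f0.
  rewrite -[LHS]fineK; last exact: integrable_fin_num.
  by rewrite -[fine _]/(itg a b f) If.
move/ae_eq_integral_abs => /(_ (measurable_itv _) (measurable_int _ intf)).
by apply: ae_imp => x h xab; have [] := h ltac:(by rewrite /= in_itv).
Qed.

(* The densities of the competitors are only controlled off a null set, so [f] and [g] need not be measurable. *)
Lemma ge0_le_integral_off_null d (T : measurableType d) (nu : {measure set T -> \bar R})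
    (D N : set T) (f g : T -> \bar R) :
  measurable N -> nu N = 0%E ->
  (forall x, D x -> (0 <= f x)%E) -> (forall x, D x -> (0 <= g x)%E) ->
  (forall x, D x -> ~ N x -> (f x <= g x)%E) ->
  (\int[nu]_(x in D) f x <= \int[nu]_(x in D) g x)%E.
Proof.
move=> mN N0 f0 g0 fg; rewrite !ge0_integralE//.
apply: ge_ereal_sup => _ [h /= hf <-].
(* Cutting the simple function off on the null set brings it below [g] everywhere without changing
   its integral. *)
pose h' := mul_nnsfun h (indic_nnsfun R (measurableC mN)).
have -> : sintegral nu h = sintegral nu h'.
  have := integral_nnsfun nu measurableT h; have := integral_nnsfun nu measurableT h'.
  rewrite !patch_setT => <- <-; apply: ge0_ae_eq_integral => //.
  - exact/measurable_EFinP.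
  - exact/measurable_EFinP.
  - by move=> x _; rewrite lee_fin.
  - by move=> x _; rewrite lee_fin.
  - exists N; split=> // x /= nx; apply: contrapT => Nx; apply: nx => _.
    by rewrite /= /mindic indicE mem_set// mulr1.
apply: ereal_sup_ubound; exists h' => // x /=.
have [Nx|Nx] := pselect (N x).
  rewrite /mindic indicE memNset ?mulr0/=; last by apply.
  by rewrite patchE; case: ifPn => // /set_mem; exact: g0.
rewrite /mindic indicE mem_set// mulr1; apply: (le_trans (hf x)).
by rewrite !patchE; case: ifPn => // /set_mem Dx; exact: fg.
Qed.

Lemma eq_integral_off_null d (T : measurableType d) (nu : {measure set T -> \bar R})
    (D N : set T) (f g : T -> \bar R) :
  measurable N -> nu N = 0%E -> (forall x, D x -> ~ N x -> f x = g x) ->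
  (\int[nu]_(x in D) f x = \int[nu]_(x in D) g x)%E.
Proof.
move=> mN N0 fg; rewrite integralE [RHS]integralE.
have E (p q : T -> \bar R) : (forall x, 0 <= p x)%E -> (forall x, 0 <= q x)%E ->
    (forall x, D x -> ~ N x -> p x = q x) ->
    (\int[nu]_(x in D) p x = \int[nu]_(x in D) q x)%E.
  move=> p0 q0 pq; apply/eqP; rewrite eq_le; apply/andP; split;
    by apply: (ge0_le_integral_off_null mN N0) => // x Dx Nx; rewrite pq.
by congr (_ - _)%E; apply: E => // x Dx Nx; rewrite ?funeposE ?funenegE fg.
Qed.

(** The integral is differentiable at t = 0 by dominated differentiation, and t = 0 is a minimum up
    to the error m |t|; difference quotients from both sides then bound the derivative by [m]. The
    choice m = 0 serves exact stationarity of the radius, m > 0 the reparametrisations of the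
    damage, where the elastic term is only estimated. *)
Lemma first_variation (a b t0 m : R) (f : R -> R -> R) (df G : R -> R) :
  0 < t0 -> (forall t, `|t| < t0 -> intg a b (f t)) -> intg a b G ->
  (forall t x : R, `|t| < t0 -> a <= x <= b ->
     exists2 l : R, is_derive t 1 (f^~ x) l & `|l| <= G x) ->
  (forall x : R, a <= x <= b -> is_derive (0 : R) 1 (f^~ x) (df x)) ->
  (forall t, `|t| < t0 -> itg a b (f 0) <= itg a b (f t) + m * `|t|) ->
  `|itg a b df| <= m.
Proof.
move=> t00 intf intG dfG df0 fmin.
pose F t := itg a b (f t).
have mem t : `]- t0, t0[%classic t <-> `|t| < t0 by rewrite /= in_itv/= ltr_norml.
have I0 : `]- t0, t0[%classic (0 : R) by apply/mem; rewrite normr0.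
have dF : is_derive (0 : R) 1 F (itg a b df).
  have h1 x : `]- t0, t0[%classic x -> mu.-integrable `[a, b] (EFin \o f x).
    by move=> /mem; exact: intf.
  have h2 x y : `]- t0, t0[%classic x -> `[a, b]%classic y -> derivable (f ^~ y) x 1.
    move=> /mem xt; rewrite /= in_itv/= => yab.
    by have [l [dl _] _] := dfG x y xt yab.
  have h3 (y : R) : 0 <= `|G y| by [].
  have h4 x y : `]- t0, t0[%classic x -> `[a, b]%classic y -> `|partial1of2 f x y| <= `|G y|.
    move=> /mem xt; rewrite /= in_itv/= => yab.
    have [l [_ dl] lG] := dfG x y xt yab.
    by rewrite partial1of2E dl (le_trans lG)// ler_norm.
  have A := @derivable_under_integral R _ _ mu f _ (measurable_itv _) 0 _ _ I0 h1 h2 _ h3 (intg_norm intG) h4.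
  have B := @differentiation_under_integral R _ _ mu f _ (measurable_itv _) 0 _ _ I0 h1 h2 _ h3 (intg_norm intG) h4.
  apply: DeriveDef => //; rewrite -derive1E B; apply: eq_Rintegral => y.
  rewrite inE/= in_itv/= => yab; rewrite partial1of2E.
  by have := df0 y yab => -[_ ->].
move/is_deriveP : dF => dF.
apply/ler_addgt0Pl => e e0; have [d d0 Hd] := dF e e0.
pose s := Num.min (d / 2) (t0 / 2).
have s0 : 0 < s by rewrite lt_min !divr_gt0.
have sd : s < d by apply: (@le_lt_trans _ _ (d / 2)); [rewrite ge_min lexx|lra].
have st : s < t0 by apply: (@le_lt_trans _ _ (t0 / 2)); [rewrite ge_min lexx orbT|lra].
have P (t : R) : `|t| = s -> t * itg a b df >= - (e + m) * s.
  move=> ts; have := Hd t; rewrite subr0 ts => /(_ sd).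
  have := fmin t; rewrite ts => /(_ st); rewrite -!/(F _).
  by rewrite ler_norml => h1 /andP[h2 h3]; rewrite mulNr mulrDl; lra.
have := P s (gtr0_norm s0); rewrite [X in _ <= X]mulrC ler_pM2r// => h1.
have := P (- s); rewrite normrN (gtr0_norm s0) => /(_ erefl).
rewrite [X in _ <= X]mulNr -mulrN [X in _ <= X]mulrC ler_pM2r// => h2.
by rewrite ler_norml; apply/andP; split; lra.
Qed.

End MeasureTools.

(** * Convex functions on the half-line *)

Section ConvexCalculus.
Context {R : realType}.
Implicit Types (f df : R -> R) (x y d l : R).

Definition convex_pos f := forall x y t : R, 0 < x -> 0 < y -> 0 < t < 1 ->
  f (t * x + (1 - t) * y) <= t * f x + (1 - t) * f y.

Lemma convex_functionW f : convex_function (`]0, +oo[%classic : set R) f -> convex_pos f.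
Proof.
move=> cf x y t x0 y0 /andP[t0 t1].
have := cf (Itv01 (ltW t0) (ltW t1)) x y.
by rewrite !inE /= !in_itv/= !andbT => /(_ x0 y0); rewrite !convRE.
Qed.

Lemma Ck_derive (k : nat) f x : (0 < k)%N -> Ck_on_open k `]0, +oo[ f -> 0 < x ->
  is_derive x 1 f (derive1 f x) /\ {for x, continuous (derive1 f)}.
Proof.
move=> k0 cf x0; have xI : `]0, +oo[%classic x by rewrite /= in_itv/= x0.
have [dF cF] := cf x xI; split; last exact: (cF 1%N k0).
by apply: DeriveDef; [exact: (dF 0%N k0)|rewrite derive1E].
Qed.

Lemma strictly_convex_onW f : strictly_convex_on (`]0, +oo[%classic : set R) f -> convex_pos f.
Proof.
move=> sf x y t x0 y0 t01; have [->|xy] := eqVneq x y.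
  by rewrite -mulrDl -mulrDl addrC subrK !mul1r.
by apply/ltW/sf; rewrite //= in_itv/= ?x0 ?y0.
Qed.

(** If the tangent lay above [f] at [y] by [g], then at x + s (y - x) convexity would put [f] below
    the tangent by s g, while differentiability allows only s g / 2 for small s. *)
Lemma tangent_le f x l y : convex_pos f -> 0 < x -> is_derive x 1 f l -> 0 < y ->
  f x + l * (y - x) <= f y.
Proof.
move=> cf x0 /is_deriveP df y0; rewrite leNgt; apply/negP => gap.
have [E|yx] := eqVneq y x; first by move: gap; rewrite E; lra.
have n0 : 0 < `|y - x| by rewrite normr_gt0 subr_eq0.
set g := f x + l * (y - x) - f y.
have g0 : 0 < g by rewrite subr_gt0.
have [e e0 He] := df (g / (2 * `|y - x|)) ltac:(by rewrite divr_gt0// mulr_gt0).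
pose s := Num.min (1 / 2) (e / (2 * `|y - x|)).
have s0 : 0 < s by rewrite lt_min !divr_gt0// mulr_gt0.
have s1 : s <= 1 / 2 by rewrite ge_min lexx.
have s2 : s * `|y - x| < e.
  have : s <= e / (2 * `|y - x|) by rewrite ge_min lexx orbT.
  rewrite ler_pdivlMr ?mulr_gt0//; lra.
have := He (x + s * (y - x)); rewrite addrC addKr normrM (gtr0_norm s0) => /(_ s2).
have := cf y x s y0 x0 ltac:(by rewrite s0/=; lra).
rewrite (_ : s * y + (1 - s) * x = s * (y - x) + x); last by ring.
move=> h1; rewrite ler_norml => /andP[h2 _].
have h3 : g / (2 * `|y - x|) * (s * `|y - x|) = s * (g / 2) by field; rewrite gt_eqF.
rewrite h3 in h2.
rewrite (addrC x) in h2.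
have : s * g <= s * (g / 2) by rewrite /g in h2 *; lra.
by rewrite ler_pM2l//; lra.
Qed.

Lemma convex_derive_le f df : convex_pos f ->
  (forall x, 0 < x -> is_derive x 1 f (df x)) ->
  forall x y, 0 < x -> x <= y -> df x <= df y.
Proof.
move=> cf dfx x y x0 xy; have y0 : 0 < y by exact: lt_le_trans xy.
have [->//|xny] := eqVneq x y.
have ltxy : x < y by rewrite lt_neqAle xny.
have h1 := tangent_le cf x0 (dfx x x0) y0.
have h2 := tangent_le cf y0 (dfx y y0) x0.
have : df x * (y - x) <= df y * (y - x) by lra.
by rewrite ler_pM2r// subr_gt0.
Qed.

Lemma strictly_convex_derive_lt f df : strictly_convex_on (`]0, +oo[%classic : set R) f ->
  (forall x, 0 < x -> is_derive x 1 f (df x)) ->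
  forall x y, 0 < x -> x < y -> df x < df y.
Proof.
move=> sf dfx x y x0 xy; have y0 : 0 < y by exact: lt_trans xy.
have cf := strictly_convex_onW sf.
have m0 : 0 < 2^-1 * x + (1 - 2^-1) * y by rewrite addr_gt0// mulr_gt0//; lra.
have h1 := tangent_le cf x0 (dfx x x0) m0.
have h2 := tangent_le cf y0 (dfx y y0) m0.
have := sf x y 2^-1; rewrite /= !in_itv/= !andbT => /(_ x0 y0 (negbT (lt_eqF xy))).
move=> /(_ ltac:(lra)) h3.
have : df x * (y - x) < df y * (y - x) by nra.
by rewrite ltr_pM2r// subr_gt0.
Qed.

(** The tangent at [d], evaluated at 1, gives f'(d) (1 - d) <= f(1) - f(d), and the right-hand side
    tends to -oo. *)
Lemma derive_to_Ny f df : convex_pos f -> (forall x, 0 < x -> is_derive x 1 f (df x)) ->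
  f d @[d --> 0^'+] --> +oo ->
  forall M : R, exists2 e : R, 0 < e & forall d, 0 < d -> d < e -> df d <= M.
Proof.
move=> cf dfx /cvgryPge f0 M.
have := f0 (f 1 + `|M|); rewrite nearE/= => -[e /= e0 He].
exists (Num.min e 1); first by rewrite lt_min e0 ltr01.
move=> d d0; rewrite lt_min => /andP[de d1].
have := He d; rewrite /ball/= sub0r normrN gtr0_norm// => /(_ de d0) h1.
have := tangent_le cf d0 (dfx d d0) ltr01 => h2.
have h3 : df d * (1 - d) <= - `|M| by lra.
have h4 : - `|M| <= M by rewrite lerNl -normrN ler_norm.
apply: le_trans h4; rewrite leNgt; apply/negP => h5.
have : 0 < (df d + `|M|) * (1 - d) by rewrite mulr_gt0//; lra.
have := normr_ge0 M; nra.
Qed.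

(** The same tangent now reads f(d) - f(1) <= f'(d) (d - 1), and the left-hand side grows faster
    than d. *)
Lemma derive_to_y f df : convex_pos f -> (forall x, 0 < x -> is_derive x 1 f (df x)) ->
  f d / d @[d --> +oo] --> +oo ->
  forall M : R, exists2 D : R, 0 < D & forall d, D <= d -> M <= df d.
Proof.
move=> cf dfx /cvgryPge foo M.
have := foo (`|M| + `|f 1|); rewrite nearE/= => -[D [_ HD]].
exists (Num.max (D + 1) 2); first by rewrite lt_max ltr0n orbT.
move=> d; rewrite ge_max => /andP[Dd d2].
have d0 : 0 < d by lra.
have := HD d ltac:(lra); rewrite ler_pdivlMr// => h1.
have := tangent_le cf d0 (dfx d d0) ltr01 => h2.
have h4 : M <= `|M| by rewrite ler_norm.
apply: le_trans h4 _; rewrite leNgt; apply/negP => h5.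
have h6 : f 1 <= `|f 1| by rewrite ler_norm.
have : (df d - `|M|) * (d - 1) < 0 by rewrite nmulr_rlt0; lra.
have := normr_ge0 M; have := normr_ge0 (f 1); nra.
Qed.

(** The tangent at [d], evaluated at 2d, bounds d f'(d) by f(2d) - f(d), and the power growth bounds
    f(2d) by a multiple of f(d). Only an upper bound is sought: for the [h] of the theorem the
    derivative tends to -oo at 0. It makes x^2 h'(d)^+ integrable. *)
Lemma growth_derive_bound f df d0 (gamma C : R) : convex_pos f ->
  (forall x, 0 < x -> is_derive x 1 f (df x)) -> 0 < C -> 0 <= gamma ->
  (forall d, 0 < d -> f d0 <= f d) ->
  f d / (C * d `^ gamma) @[d --> +oo] --> (1 : R) ->
  exists2 B : R, 0 <= B & forall d, 0 < d -> df d <= B * (1 + (f d - f d0)).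
Proof.
move=> cf dfx C0 g0 fmin /cvgrPdist_le/(_ (1 / 2) ltac:(lra)).
rewrite nearE => -[D0 [_ HD]].
pose D := Num.max 1 (D0 + 1).
have D1 : 1 <= D by rewrite le_max lexx.
have DD : D0 < D by rewrite lt_max ltrDl ltr01 orbT.
have lo d : D <= d -> C * d `^ gamma <= 2 * f d /\ f d <= 2 * (C * d `^ gamma).
  move=> Dd; have dp : 0 < C * d `^ gamma by rewrite mulr_gt0// powR_gt0//; lra.
  have := HD d ltac:(lra); rewrite ler_norml => /andP[h1 h2].
  have h3 : f d = f d / (C * d `^ gamma) * (C * d `^ gamma) by rewrite divfK// gt_eqF.
  by split; nra.
pose G : R := 2 `^ gamma.
have G1 : 1 <= G by rewrite -(powRr0 2) ler_powR//; lra.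
exists (`|df D| + 4 * G * (1 + `|f d0|)).
  by rewrite addr_ge0// mulr_ge0// ?addr_ge0//; lra.
move=> d dp; have fd := fmin d dp; have n1 := normr_ge0 (df D); have n2 := normr_ge0 (f d0).
have nD := ler_norm (df D); have nf := ler_norm (f d0).
have nf' := ler_norm (- f d0); rewrite normrN in nf'.
have [dD|Dd] := leP d D.
  have := convex_derive_le cf dfx dp dD => h.
  apply: (le_trans h); apply: (le_trans nD).
  by rewrite mulrDl -[leLHS]addr0 lerD//; [rewrite ler_peMr//; lra|rewrite !mulr_ge0//; lra].
have d2 : 0 < 2 * d by lra.
have := tangent_le cf dp (dfx d dp) d2 => h1.
have [h2 _] := lo d (ltW Dd); have [_ h3] := lo (2 * d) ltac:(lra).
rewrite powRM in h3; [|lra|lra].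
rewrite -/G in h3.
have h5 : f (2 * d) <= 4 * G * f d by nra.
have f0 : 0 <= f d by have := powR_ge0 d gamma; nra.
have h6 : df d * d <= 4 * G * f d by nra.
have h7 : df d <= 4 * G * f d.
  have [df0|df0] := leP (df d) 0; first by apply: (le_trans df0); rewrite !mulr_ge0//; lra.
  by apply: le_trans h6; rewrite ler_peMr//; lra.
apply: (le_trans h7); rewrite mulrDl.
have p0 : 0 <= 1 + (f d - f d0) by lra.
have p1 : 0 <= `|df D| * (1 + (f d - f d0)) by rewrite mulr_ge0.
have p2 : 0 <= `|f d0| * (f d - f d0) by rewrite mulr_ge0//; lra.
suff : 4 * G * f d <= 4 * G * ((1 + `|f d0|) * (1 + (f d - f d0))) by rewrite mulrA; lra.
by rewrite ler_pM2l; lra.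
Qed.

End ConvexCalculus.

(** * The minimisation problem on (0, 1) *)

Section OpenIntervals.
Context {R : realType}.
Local Notation mu := (@lebesgue_measure R).
Local Notation I01 := (`]0%R, 1%R[%classic : set R).
Implicit Types (a b : R) (f g U V : R -> R).

Lemma Rintegral_oo a b f : intg a b f -> \int[mu]_(x in `]a, b[) f x = itg a b f.
Proof.
move=> i; rewrite Rintegral_itv_bndo_bndc; last by apply/integrable_oo.
rewrite Rintegral_itv_obnd_cbnd//; apply: integrableS i => //.
by apply: subset_itvr; rewrite bnd_simp.
Qed.

Lemma eq_intg_oo a b f g : {in `]a, b[, f =1 g} -> intg a b f -> intg a b g.
Proof.
move=> fg /integrable_oo i; apply/integrable_oo; apply: eq_integrable i => // x.
by rewrite inE/= => xab; rewrite fg.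
Qed.

Lemma eq_itg_oo a b f g : {in `]a, b[, f =1 g} -> intg a b f -> itg a b f = itg a b g.
Proof.
move=> fg i; rewrite -!Rintegral_oo//; last exact: eq_intg_oo fg i.
by apply: eq_Rintegral => x; rewrite inE/= => xab; rewrite fg.
Qed.

Lemma intg_bound_oo a b (M : R) f g : measurable_fun `]a, b[ f -> intg a b g ->
  (forall x, a < x < b -> `|f x| <= M * g x) -> intg a b f.
Proof.
move=> mf intgg fM; apply/integrable_oo.
apply: (@le_integrable _ _ _ mu _ _ _ (EFin \o (fun x => M * g x))) => //.
- exact/measurable_EFinP.
- by move=> x/=; rewrite in_itv/= => xab; rewrite lee_fin (le_trans (fM _ xab))// ler_norm.
- by apply/integrable_oo; exact: intgZ.
Qed.

Lemma le_itg_oo a b f g : intg a b f -> intg a b g ->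
  (forall x, a < x < b -> f x <= g x) -> itg a b f <= itg a b g.
Proof.
move=> i j fg; rewrite -!Rintegral_oo//; apply: le_Rintegral => //.
- exact/integrable_oo.
- exact/integrable_oo.
Qed.

Lemma intg_meas_oo a b f : intg a b f -> measurable_fun `]a, b[ f.
Proof. by move=> /intg_meas; apply: measurable_funS => //; exact: subset_itv_oo_cc. Qed.

Lemma measurable_pos_comp (D : set R) f g : measurable D ->
  (forall x : R, 0 < x -> {for x, continuous f}) -> measurable_fun D g ->
  (forall x, D x -> 0 < g x) -> measurable_fun D (fun x => f (g x)).
Proof.
move=> mD cf mg g0.
apply: (measurable_comp (F := (`]0%R, +oo[%classic : set R)) (f := f) (g := g)) => //.
- by move=> _ [x Dx <-] /=; rewrite in_itv/= g0.
- apply: open_continuous_measurable_fun => // x.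
  by rewrite inE/= in_itv/= andbT => x0; exact: cf.
Qed.

Lemma within_measurable_oo a b f : {within `[a, b], continuous f} ->
  measurable_fun `]a, b[ f.
Proof. by move=> cf; exact: (intg_meas_oo (intg_cont cf)). Qed.

Lemma ae_neq a : {ae mu, forall x : R, x != a}.
Proof.
exists [set a]; split => //; first exact: lebesgue_measure_set1.
by move=> x /= /negP; rewrite negbK => /eqP.
Qed.

Lemma primitive_ae a b U g h : primitive_on a b U g -> measurable_fun `]a, b[ h ->
  {ae mu, forall x : R, a < x < b -> g x = h x} -> primitive_on a b U h.
Proof.
move=> pU mh gh.
have mh' : measurable_fun `[a, b] h.
  by apply/measurable_fun_itv_obnd_cbndP/measurable_fun_itv_bndo_bndcP.
have gh' : {ae mu, forall x : R, a <= x <= b -> g x = h x}.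
  apply: ae_imp (ae_and gh (ae_and (ae_neq a) (ae_neq b))) => x [H [xa xb]] /andP[ax bx].
  by apply: H; rewrite !lt_neqAle eq_sym xa xb ax.
have [ih _] := ae_itg pU.1 mh' gh'.
split=> // x /andP[ax xb]; rewrite pU.2 ?ax//; congr (_ + _).
have i1 := intgS (lexx a) xb pU.1.
have m1 := intg_meas (intgS (lexx a) xb ih).
have gh1 : {ae mu, forall z : R, a <= z <= x -> g z = h z}.
  by apply: ae_imp gh' => z H /andP[az zx]; apply: H; rewrite az (le_trans zx).
by have [_ ->] := ae_itg i1 m1 gh1.
Qed.

Lemma primitive_glue a b c U V g h : a <= b -> b <= c ->
  primitive_on a b U g -> primitive_on b c V h -> U b = V b ->
  primitive_on a c (fun x => if x <= b then U x else V x)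
                   (fun x => if x <= b then g x else h x).
Proof.
move=> ab bc pU pV UV.
have i1 : intg a b (fun x => if x <= b then g x else h x).
  by apply: eq_intg pU.1 => x; rewrite in_itv/= => /andP[_ ->].
have i2 : intg b c (fun x => if x <= b then g x else h x).
  apply: eq_intg_oo pV.1 => x; rewrite in_itv/= => /andP[bx _].
  by rewrite leNgt bx.
split; first exact: intg_cat i1 i2.
move=> x /andP[ax xc]; rewrite ab; have [xb|bx] := leP x b.
  rewrite pU.2 ?ax//; congr (_ + _); apply: eq_itg => z; rewrite in_itv/= => /andP[_ zx].
  by rewrite (le_trans zx xb).
rewrite (@itg_cat _ a b x) ?(ltW bx)//; last first.
  by apply: (@intgS _ a c) => //; exact: intg_cat i1 i2.
rewrite pV.2 ?(ltW bx)// -UV pU.2 ?ab ?lexx// addrA; congr (_ + _ + _).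
  by apply: eq_itg => z; rewrite in_itv/= => /andP[_ ->].
apply: eq_itg_oo; last by apply: intgS pV.1.
by move=> z; rewrite in_itv/= => /andP[bz _]; rewrite leNgt bz.
Qed.

Lemma measurable_norm_powR (D : set R) (p : R) f : measurable_fun D f ->
  measurable_fun D (fun x => `|f x| `^ p).
Proof.
move=> mf; apply: (measurableT_comp (measurable_powR p)).
exact: measurableT_comp.
Qed.

Lemma Lp01P (p : R) f : Lp01 p f <->
  measurable_fun I01 f /\ intg 0 1 (fun x => `|f x| `^ p).
Proof.
have E : (\int[mu]_(x in I01) `|(`|f x| `^ p)%:E| =
    \int[mu]_(x in I01) (`|f x| `^ p)%:E)%E.
  by apply: eq_integral => x _; rewrite gee0_abs// lee_fin powR_ge0.
split=> [[mf fin]|[mf /integrable_oo/integrableP[_]]]; last by rewrite E.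
split => //; apply/integrable_oo/integrableP; split; last by rewrite E.
apply/measurable_EFinP.
exact: measurable_norm_powR.
Qed.

Lemma Lp01_intg (p : R) f : 1 <= p -> Lp01 p f -> intg 0 1 f.
Proof.
move=> p1 /Lp01P[mf fp].
apply: (@intg_bound_oo _ _ 1 _ (fun x => 1 + `|f x| `^ p)) => //.
  by apply: intgD => //; exact: intg_cst.
move=> x _; rewrite mul1r; have [f1|f1] := leP 1 `|f x|.
  by apply: (le_trans (le1r_powR f1 p1)); rewrite lerDr.
by apply: (le_trans (ltW f1)); rewrite lerDl powR_ge0.
Qed.

Lemma sobolev_primitive (p : R) U g : 1 <= p -> sobolev p U g -> primitive_on 0 1 U g.
Proof.
move=> p1 [cU _ Lg wU]; apply: primitive_of_weak => //; exact: Lp01_intg Lg.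
Qed.

Lemma primitive_sobolev (p : R) U g : 1 <= p -> primitive_on 0 1 U g ->
  intg 0 1 (fun x => `|g x| `^ p) -> sobolev p U g.
Proof.
move=> p1 pU ig; have cU := primitive_continuous ler01 pU.
split => //; last exact: weak_of_primitive.
- apply/Lp01P; split; first exact: within_measurable_oo.
  have [M HM] := within_bounded ler01 cU.
  apply: (@intg_bound_oo _ _ (M `^ p) _ (fun=> 1)); last 2 first.
  + exact: intg_cst.
  + move=> x /andP[x0 x1]; rewrite mulr1 ger0_norm ?powR_ge0//.
    apply: ge0_ler_powR; rewrite ?nnegrE//; first lra.
      by apply: le_trans (HM 0 _); rewrite ?lexx ?ler01.
    by apply: HM; rewrite !ltW.
  + by apply: measurable_norm_powR; exact: within_measurable_oo.
- by apply/Lp01P; split => //; exact: intg_meas_oo pU.1.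
Qed.

Lemma integral_I01 f : intg 0 1 f ->
  (\int[mu]_(x in I01) (f x)%:E)%E = (itg 0 1 f)%:E.
Proof.
move=> i; rewrite -(Rintegral_oo i) /Rintegral fineK//.
by apply: integrable_fin_num => //; exact/integrable_oo.
Qed.

(** A bounded negative part has finite integral, so an infinite positive part could not be
    compensated. *)
Lemma intg_of_integral_lty (k : R) f : measurable_fun I01 f ->
  (forall x, 0 < x < 1 -> - k <= f x) ->
  (\int[mu]_(x in I01) (f x)%:E < +oo)%E -> intg 0 1 f.
Proof.
move=> mf fk; rewrite integralE => fin.
have mE : measurable_fun I01 (EFin \o f) by exact/measurable_EFinP.
have neg : mu.-integrable I01 ((EFin \o f)^\-)%E.
  apply: (@le_integrable _ _ _ mu _ _ _ (EFin \o cst `|k|)) => //.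
  - exact: measurable_funeneg.
  - move=> x /=; rewrite in_itv/= => x01; rewrite gee0_abs// funenegE ge_max.
    by rewrite -EFinN !lee_fin normr_id normr_ge0 andbT; have := fk x x01; have := ler_norm k; lra.
  - by apply/integrable_oo; exact: intg_cst.
apply/integrable_oo/integrableP; split => //.
rewrite (_ : (fun _ => _) = (EFin \o f)^\+ \+ (EFin \o f)^\-)%E; last first.
  by rewrite -fune_abse.
rewrite ge0_integralD//; [|exact: measurable_funepos|exact: measurable_funeneg].
have /integrableP[_ negfin] := neg.
have negfin' : (\int[mu]_(x in I01) (EFin \o f)^\- x < +oo)%E.
  apply: le_lt_trans negfin; apply: ge0_le_integral => //.
  - exact: measurable_funeneg.
  - by apply: measurableT_comp => //; exact: measurable_funeneg.
  - by move=> x _; rewrite gee0_abs.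
apply: lte_add_pinfty => //; rewrite ltey; apply/eqP => E.
move: fin; rewrite [X in (X - _)%E]E.
have : ((\int[mu]_(x in I01) (EFin \o f)^\- x) \is a fin_num)%E.
  by rewrite ge0_fin_numE// integral_ge0.
by move/fineK => <-; rewrite -EFinN addye.
Qed.

End OpenIntervals.

(** * The energy of a pair, and localisation of minimality away from the origin *)

Section Setup.
Context {R : realType}.
Local Notation mu := (@lebesgue_measure R).
Local Notation I01 := (`]0%R, 1%R[%classic : set R).
Variables (psi h phi : R -> R).

Definition elastic (s ds w : R -> R) (x : R) : R :=
  x ^+ 2 * (psi (ds x) + 2 * psi (s x / x) + h (ds x * (s x / x) ^+ 2 - w x)).

Definition damage (e c alpha : R) (w dw : R -> R) (x : R) : R :=
  x ^+ 2 * (e * `|dw x| `^ alpha + c * phi (w x)).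

Lemma radialE (s ds w : R -> R) (x : R) :
  x ^+ 2 * radial (Phi_hat psi h) s ds w x = elastic s ds w x.
Proof.
rewrite /radial /Phi_hat /elastic.
by rewrite (_ : ds x * (s x / x) ^+ 2 = ds x * (s x / x) * (s x / x)); ring.
Qed.

Variables (lambda eps alpha q d0 : R) (r v : R -> R).
Hypotheses (lambda_gt0 : 0 < lambda) (eps_gt0 : 0 < eps) (alpha_gt1 : 1 < alpha)
  (q_gt0 : 0 < q)
  (phi_ge0 : forall x, 0 <= phi x) (phi_cont : continuous phi)
  (h_cont : forall x : R, 0 < x -> {for x, continuous h})
  (psi_cont : forall x : R, 0 < x -> {for x, continuous psi})
  (psi_ge0 : forall x : R, 0 < x -> 0 <= psi x)
  (h_min : forall x : R, 0 < x -> h d0 <= h x)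
  (rv_min : minimizer psi h phi lambda eps alpha q r v).

Let e := eps `^ alpha / alpha.
Let c := (q * eps `^ q)^-1.

Lemma coef_gt0 : 0 < e /\ 0 < c.
Proof.
have alpha_gt0 := lt_trans ltr01 alpha_gt1.
by split; rewrite ?invr_gt0 ?divr_gt0 ?mulr_gt0 ?powR_gt0.
Qed.

Definition admissible (s ds w : R -> R) (x : R) : Prop :=
  0 <= w x < ds x * (s x / x) ^+ 2.

Lemma admissible_stretch (s ds w : R -> R) (x : R) : 0 < x -> admissible s ds w x -> 0 < ds x.
Proof.
move=> x0 /andP[w0 wd]; have : 0 < ds x * (s x / x) ^+ 2 by exact: le_lt_trans wd.
by apply: contraTT; rewrite -!leNgt => d; rewrite mulr_le0_ge0// sqr_ge0.
Qed.

Lemma measurable_elastic (a b : R) (s ds w : R -> R) : 0 <= a ->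
  {within `[a, b], continuous s} ->
  {within `[a, b], continuous w} -> measurable_fun `]a, b[ ds ->
  (forall x : R, a < x < b -> 0 < s x) ->
  (forall x : R, a < x < b -> admissible s ds w x) ->
  measurable_fun `]a, b[ (elastic s ds w).
Proof.
move=> a0 cs cw mds s0 adm.
have ms := within_measurable_oo cs; have mw := within_measurable_oo cw.
have mid : measurable_fun `]a, b[ (fun x : R => x) by [].
have mV : measurable_fun `]a, b[ (fun x : R => x^-1).
  apply: open_continuous_measurable_fun => // x; rewrite inE/= in_itv/= => /andP[x0 _].
  by apply: inv_continuous; rewrite gt_eqF// (le_lt_trans a0).
have msx : measurable_fun `]a, b[ (fun x : R => s x / x) by exact: measurable_funM.
have msx2 : measurable_fun `]a, b[ (fun x : R => (s x / x) ^+ 2) by exact: measurable_funX.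
apply: measurable_funM; first exact: measurable_funX.
apply: measurable_funD; first apply: measurable_funD.
- apply: measurable_pos_comp => // x /=; rewrite in_itv/= => x01.
  by apply: admissible_stretch (adm x x01); apply: (le_lt_trans a0); case/andP: x01.
- apply: measurable_funM => //; apply: measurable_pos_comp => // x /=; rewrite in_itv/= => x01.
  by rewrite divr_gt0 ?s0//; apply: (le_lt_trans a0); case/andP: x01.
- apply: measurable_pos_comp => //.
    by apply: measurable_funB => //; apply: measurable_funM.
  by move=> x /=; rewrite in_itv/= => /adm/andP[_]; rewrite subr_gt0.
Qed.

Lemma elastic_ge (s ds w : R -> R) (x : R) : 0 < x < 1 -> 0 < s x -> admissible s ds w x ->
  - `|h d0| <= elastic s ds w x.
Proof.
move=> /andP[x0 x1] s0 adm; have d0' := admissible_stretch x0 adm.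
have h1 := psi_ge0 d0'; have h2 : 0 <= psi (s x / x) by apply: psi_ge0; rewrite divr_gt0.
case/andP: adm => _; rewrite -subr_gt0 => /h_min h3.
have h4 := ler_norm (- h d0); rewrite normrN in h4.
have x2 : 0 <= x ^+ 2 <= 1 by rewrite sqr_ge0 expr_le1// ltW.
have n0 := normr_ge0 (h d0).
have : - `|h d0| <= psi (ds x) + 2 * psi (s x / x) + h (ds x * (s x / x) ^+ 2 - w x) by lra.
rewrite /elastic; set y := (_ + _); case/andP: x2 => x20 x21 hy.
have [y0|y0] := leP 0 y.
  by apply: (@le_trans _ _ 0); [lra|rewrite mulr_ge0].
by apply: (le_trans hy); nra.
Qed.

Lemma intg_damage (w dw : R -> R) : {within `[0, 1], continuous w} ->
  intg 0 1 (fun x => `|dw x| `^ alpha) -> intg 0 1 (damage e c alpha w dw).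
Proof.
move=> cw idw.
have i1 : intg 0 1 (fun x => e * `|dw x| `^ alpha + c * phi (w x)).
  apply: intgD; first exact: intgZ.
  apply: intgZ; apply: intg_cont; apply/subspace_continuousP => x xI.
  apply: (@cvg_comp _ _ _ w phi (within `[0, 1] (nbhs x)) (nbhs (w x))).
    by move/subspace_continuousP : cw; apply.
  exact: phi_cont.
have := @intg_mul_cont R 0 1 _ (fun x => x ^+ 2) ler01 i1.
move=> /(_ ltac:(apply: continuous_subspaceT => x; exact: exprn_continuous)).
by apply: eq_intg => x _; rewrite /damage mulrC.
Qed.

Lemma energyE (s ds w dw : R -> R) :
  intg 0 1 (elastic s ds w) -> intg 0 1 (damage e c alpha w dw) ->
  energy psi h phi eps alpha q s ds w dw =
  (itg 0 1 (elastic s ds w) + itg 0 1 (damage e c alpha w dw))%:E.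
Proof.
move=> iA iB; rewrite /energy EFinD -!integral_I01//; congr (_ + _)%E.
by apply: eq_integral => x _; rewrite radialE.
Qed.

Lemma U_rad_primitive (s ds w dw : R -> R) : U_rad lambda alpha s ds w dw ->
  primitive_on 0 1 s ds /\ primitive_on 0 1 w dw.
Proof.
move=> [S1 S2 _ _ _]; split; first exact: sobolev_primitive S1.
by apply: sobolev_primitive S2; rewrite ltW.
Qed.

Lemma primitive_U_rad (s ds w dw : R -> R) : primitive_on 0 1 s ds -> primitive_on 0 1 w dw ->
  s 0 = 0 -> s 1 = lambda -> w 1 = 0 -> intg 0 1 (fun x => `|dw x| `^ alpha) ->
  (forall x : R, 0 < x < 1 -> admissible s ds w x) ->
  U_rad lambda alpha s ds w dw.
Proof.
move=> ps pw s0 s1 w1 idw adm; split => //.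
- apply: primitive_sobolev => //.
  apply: eq_intg (intg_norm ps.1) => x _; rewrite powRr1//.
- by apply: primitive_sobolev => //; rewrite ltW.
- by apply: aeW => x /adm/andP[].
Qed.

(** The uniform dilation x |-> lambda x without damage. It forces the energy of the minimizer to be
    finite. *)
Lemma energy_finite : exists s ds w dw, U_rad lambda alpha s ds w dw /\
  (energy psi h phi eps alpha q s ds w dw < +oo)%E.
Proof.
exists (fun x => lambda * x), (fun=> lambda), (fun=> 0), (fun=> 0).
have pi : primitive_on 0 1 (fun x => lambda * x) (fun=> lambda).
  by have := primitiveZ lambda (primitive_id 0 1); apply: eq_primitive => // x _; rewrite mulr1.
have i0 : intg 0 1 (fun=> `|0 : R| `^ alpha).
  by exact: intg_cst.
split.
  apply: primitive_U_rad => //; [exact: primitive_cst|by rewrite mulr0|by rewrite mulr1|].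
  move=> x /andP[x0 x1]; rewrite /admissible lexx/= mulfK ?gt_eqF//.
  by rewrite mulr_gt0// exprn_gt0.
rewrite energyE ?ltry//; last first.
  by apply: intg_damage => //; apply: continuous_subspaceT => x; exact: cvg_cst.
apply: (@eq_intg_oo _ _ _ (fun x => (psi lambda + 2 * psi lambda + h (lambda * lambda ^+ 2)) * x ^+ 2)).
  move=> x; rewrite in_itv/= => /andP[x0 _].
  by rewrite /elastic mulfK ?gt_eqF// subr0 mulrC.
apply: intgZ; apply: intg_cont; apply: continuous_subspaceT => x; exact: exprn_continuous.
Qed.

(** The constraints hold only almost everywhere and for some weak derivative. Here that derivative
    is changed on a null set so that they hold at every point of (0, 1], where [psi] and [h] can
    then be evaluated without exception, and the two parts of the energy are separated as finite
    integrals. *)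
Lemma minimizer_clean : exists dr dv,
  [/\ primitive_on 0 1 r dr, primitive_on 0 1 v dv & forall x : R, 0 < x <= 1 -> 0 < r x] /\
  [/\ forall x : R, 0 < x <= 1 -> admissible r dr v x,
      intg 0 1 (fun x => `|dv x| `^ alpha),
      intg 0 1 (elastic r dr v) &
      forall s ds w dw, U_rad lambda alpha s ds w dw ->
        (energy psi h phi eps alpha q r dr v dv <=
         energy psi h phi eps alpha q s ds w dw)%E].
Proof.
have [dr0 [dv0 [U Emin]]] := rv_min.
have [pr pv] := U_rad_primitive U.
have [[_ _ Ldr _] [_ _ Ldv _] [r0 r1] aeU v1] := U.
have cr := primitive_continuous ler01 pr; have cv := primitive_continuous ler01 pv.
have idv : intg 0 1 (fun x => `|dv0 x| `^ alpha) by have /Lp01P[] := Ldv.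
have dr_pos : {ae mu, forall x : R, 0 < x < 1 -> 0 < dr0 x}.
  apply: ae_imp aeU => x H x01; have [h1 h2] := H x01.
  by apply: (@admissible_stretch r dr0 v x); [case/andP: x01|rewrite /admissible h2 h1].
(* Since [dr0] is positive almost everywhere, |dr0| is a density of [r] as well; r(x) = 0 would
   force it to vanish almost everywhere on (0, x). *)
have pr_abs : primitive_on 0 1 r (fun x => `|dr0 x|).
  apply: (primitive_ae pr); first exact: (intg_meas_oo (intg_norm pr.1)).
  by apply: ae_imp dr_pos => x H x01; rewrite gtr0_norm// H.
have rpos (x : R) : 0 < x <= 1 -> 0 < r x.
  move=> /andP[x0 x1]; have := pr_abs.2 x; rewrite (ltW x0) x1 r0 add0r => /(_ isT) rx.
  have r_ge0 : 0 <= r x by rewrite rx; apply: itg_ge0.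
  rewrite lt_neqAle r_ge0 andbT; apply/eqP => /esym E; move: rx; rewrite E => /esym I0.
  have A := itg_ge0_eq0 (intgS (lexx 0) x1 pr_abs.1) (fun _ _ => normr_ge0 _) I0.
  have [y /andP[y0 yx] [B C]] := ae_ex x0 (ae_and A dr_pos).
  have := B ltac:(by rewrite (ltW y0) (ltW yx)).
  have := C ltac:(by rewrite y0 (lt_le_trans yx)).
  by move=> /[swap] /eqP; rewrite normr_eq0 => /eqP ->; rewrite ltxx.
have vpos (x : R) : 0 <= x <= 1 -> 0 <= v x.
  move=> x01; rewrite leNgt; apply/negP => vx.
  have xI : `[0%R, 1%R]%classic x by rewrite /= in_itv.
  have vx2 : 0 < - v x / 2 by rewrite divr_gt0// oppr_gt0.
  have [d d0' Hd] := (continuous_withinP _ _).1 cv x xI _ vx2.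
  have [a [b [ab Hab]]] : exists a b, a < b /\ forall y, a < y < b -> 0 < y < 1 /\ `|y - x| < d.
    have [x2|x2] := leP x (1 / 2).
      exists x, (x + Num.min d (1 / 2)); split; first by rewrite ltrDl lt_min d0'; lra.
      move=> y /andP[y1]; rewrite -ltrBlDl lt_min => /andP[y2 y3].
      split; first lra.
      by rewrite gtr0_norm; lra.
    exists (x - Num.min d (1 / 2)), x; split; first by rewrite gtrBl lt_min d0'; lra.
    move=> y /andP[]; rewrite ltrBlDl -ltrBlDr lt_min => /andP[y2 y3] y1.
    split; first lra.
    by rewrite ltr0_norm; lra.
  have [y /Hab[y01 yx] H] := ae_ex ab aeU.
  have [_ vy] := H y01.
  have := Hd y ltac:(by rewrite /= in_itv/= !ltW; case/andP: y01) yx.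
  by rewrite ler_norml => /andP[_]; lra.
have [N [mN N0 HN]] := aeU.
pose g (x : R) := (v x + 1) * (x / r x) ^+ 2.
pose dr x := dr0 x + (g x - dr0 x) * (\1_(N `|` [set 1]) x).
have drN x : ~ N x -> x != 1 -> dr x = dr0 x.
  move=> nN x1; rewrite /dr indicE memNset ?mulr0 ?addr0//.
  by move=> [//|/= E]; move/eqP: x1.
have drN' x : N x \/ x = 1 -> dr x = g x.
  by move=> Nx; rewrite /dr indicE mem_set// mulr1 addrC subrK.
have adm (x : R) : 0 < x <= 1 -> admissible r dr v x.
  move=> /andP[x0 x1]; have rx := rpos x ltac:(by rewrite x0).
  have vx := vpos x ltac:(by rewrite ltW).
  have [Nx|Nx] := pselect (N x \/ x = 1).
    rewrite /admissible drN'// vx/= /g -mulrA -exprMn.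
    rewrite (_ : x / r x * (r x / x) = 1) ?expr1n ?mulr1 ?ltrDl//.
    by field; rewrite !gt_eqF.
  rewrite /admissible drN; last 2 first.
  - by move=> Nx'; apply: Nx; left.
  - by apply/eqP => E; apply: Nx; right.
  have xlt1 : x < 1 by rewrite lt_neqAle x1 andbT; apply/eqP => E; apply: Nx; right.
  have good := contrapT (fun nP => Nx (or_introl (HN x nP))).
  have [h1 h2] := good ltac:(by rewrite x0).
  by rewrite h2 h1.
have mg : measurable_fun I01 g.
  apply: open_continuous_measurable_fun => // x; rewrite inE/= in_itv/= => /andP[x0 x1].
  have cx (f : R -> R) : {within `[0, 1], continuous f} -> {for x, continuous f}.
    by apply: within_at_itv; rewrite x0.
  have crx := cx _ cr; have cvx := cx _ cv.
  apply: cvgM; first by apply: cvgD => //; exact: cvg_cst.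
  have E : y / r y @[y --> x] --> x / r x.
    apply: cvgM; first exact: cvg_id.
    by apply: cvgV => //; rewrite gt_eqF// rpos// x0 ltW.
  by apply: (cvgM E E).
have mdr : measurable_fun I01 dr.
  have mdr0 := intg_meas_oo pr.1.
  apply: measurable_funD => //; apply: measurable_funM; first exact: measurable_funB.
  by apply: measurable_indic; apply: measurableU => //; exact: measurable_set1.
have pr' : primitive_on 0 1 r dr.
  apply: (primitive_ae pr mdr); exists N; split => // x /= H.
  apply: contrapT => nN; apply: H => /andP[_ x1]; rewrite drN//.
  by rewrite lt_eqF.
have mA : measurable_fun I01 (elastic r dr v).
  apply: measurable_elastic => // x /andP[x0 x1]; first by apply: rpos; rewrite x0 ltW.
  by apply: adm; rewrite x0 ltW.
(* With [dr0] the density may evaluate [psi] and [h] outside (0, oo) on the null set, so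
   measurability is not at hand there. *)
have EE : energy psi h phi eps alpha q r dr0 v dv0 = energy psi h phi eps alpha q r dr v dv0.
  rewrite /energy; congr (_ + _)%E; apply: (eq_integral_off_null (nu := mu) mN N0) => x.
  rewrite /= in_itv/= => /andP[x0 x1] nNx; rewrite /radial drN//.
  by rewrite lt_eqF.
have iB := intg_damage cv idv.
exists dr, dv0; do 2 split => //; last by move=> s ds w dw /Emin; rewrite EE.
have [s [ds [w [dw [/Emin le fin]]]]] := energy_finite.
have := le_lt_trans le fin; rewrite EE /energy.
have -> : (\int[mu]_(x in I01) (x ^+ 2 * (eps `^ alpha / alpha * `|dv0 x| `^ alpha +
                (q * eps `^ q)^-1 * phi (v x)))%:E)%E = (itg 0 1 (damage e c alpha v dv0))%:E.
  by rewrite -integral_I01.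
move=> fin'; apply: (intg_of_integral_lty (k := `|h d0|)) => //.
  move=> x x01; apply: elastic_ge => //; [apply: rpos|apply: adm]; case/andP: x01 => -> /ltW//.
have -> : (\int[mu]_(x in I01) (elastic r dr v x)%:E)%E =
    (\int[mu]_(x in I01) (x ^+ 2 * radial (Phi_hat psi h) r dr v x)%:E)%E.
  by apply: eq_integral => x _; rewrite radialE.
(* An infinite elastic part would make the whole energy infinite, because the damage part is
   finite. *)
rewrite ltey; apply/eqP => E; move: fin'; rewrite E.
by rewrite addye.
Qed.

(** A competitor on [a, 1] with the right value at [a] is glued to the minimizer on [0, a]; the
    energy on [0, a] is finite and cancels. *)
Lemma local_minimality : exists dr dv,
  [/\ primitive_on 0 1 r dr, primitive_on 0 1 v dv & forall x : R, 0 < x <= 1 -> 0 < r x] /\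
  [/\ forall x : R, 0 < x <= 1 -> admissible r dr v x,
      intg 0 1 (fun x => `|dv x| `^ alpha),
      intg 0 1 (elastic r dr v) &
      forall (a : R) (s ds w dw : R -> R), 0 < a < 1 -> primitive_on a 1 s ds -> primitive_on a 1 w dw ->
        s a = r a -> s 1 = lambda -> w a = v a -> w 1 = 0 ->
        intg a 1 (fun x => `|dw x| `^ alpha) -> intg a 1 (elastic s ds w) ->
        (forall x : R, a <= x <= 1 -> admissible s ds w x) ->
        itg a 1 (elastic r dr v) + itg a 1 (damage e c alpha v dv) <=
        itg a 1 (elastic s ds w) + itg a 1 (damage e c alpha w dw)].
Proof.
have [dr [dv [[pr pv rpos] [adm idv iA Emin]]]] := minimizer_clean.
have cv := primitive_continuous ler01 pv.
exists dr, dv; do 2 split => //.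
move=> a s ds w dw /andP[a0 a1] ps pw sa s1 wa w1 idw iAs adms.
have ale := ltW a0; have a1' := ltW a1.
have prs := primitive_glue ale a1' (primitiveS (lexx 0) a1' pr) ps (esym sa).
have pvw := primitive_glue ale a1' (primitiveS (lexx 0) a1' pv) pw (esym wa).
set S := (fun x => if x <= a then r x else s x) in prs.
set dS := (fun x => if x <= a then dr x else ds x) in prs.
set W := (fun x => if x <= a then v x else w x) in pvw.
set dW := (fun x => if x <= a then dv x else dw x) in pvw.
have [_ _ [r0 r1] _ v1] : U_rad lambda alpha r (projT1 (cid rv_min)) v (projT1 (cid (projT2 (cid rv_min)))).
  by case: (cid (projT2 (cid rv_min))) => ? [].
have lo (x : R) : x <= a -> [/\ S x = r x, dS x = dr x, W x = v x & dW x = dv x].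
  by move=> xa; rewrite /S /dS /W /dW xa.
have hi (x : R) : a < x -> [/\ S x = s x, dS x = ds x, W x = w x & dW x = dw x].
  by move=> xa; rewrite /S /dS /W /dW leNgt xa.
have glue (F : (R -> R) -> (R -> R) -> (R -> R) -> (R -> R) -> R -> R) :
    (forall s1 ds1 w1 dw1 s2 ds2 w2 dw2 x, s1 x = s2 x -> ds1 x = ds2 x -> w1 x = w2 x ->
       dw1 x = dw2 x -> F s1 ds1 w1 dw1 x = F s2 ds2 w2 dw2 x) ->
    intg 0 1 (F r dr v dv) -> intg a 1 (F s ds w dw) ->
    intg 0 1 (F S dS W dW) /\ itg 0 1 (F S dS W dW) = itg 0 a (F r dr v dv) + itg a 1 (F s ds w dw).
  move=> ext i1 i2.
  have E1 : {in `[0, a], F r dr v dv =1 F S dS W dW}.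
    by move=> x; rewrite in_itv/= => /andP[_ /lo[h1 h2 h3 h4]]; apply: ext.
  have E2 : {in `]a, 1[, F s ds w dw =1 F S dS W dW}.
    by move=> x; rewrite in_itv/= => /andP[/hi[h1 h2 h3 h4] _]; apply: ext.
  have i1' := intgS (lexx 0) a1' i1.
  have I : intg 0 1 (F S dS W dW).
    exact: intg_cat ale a1' (eq_intg E1 i1') (eq_intg_oo E2 i2).
  split => //; rewrite (itg_cat ale a1' I); congr (_ + _).
    by apply/esym/eq_itg.
  by apply/esym/eq_itg_oo.
have [_ idW] : intg 0 1 (fun x => `|dW x| `^ alpha) /\ intg 0 1 (fun x => `|dW x| `^ alpha).
  have [] := glue (fun _ _ _ dw x => `|dw x| `^ alpha) => //.
  by move=> > _ _ _ ->.
have [iAS EA] := glue (fun s ds w _ => elastic s ds w)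
  ltac:(by move=> > h1 h2 h3 _; rewrite /elastic h1 h2 h3) iA iAs.
have iB := intg_damage cv idv.
have iBw : intg a 1 (damage e c alpha w dw).
  have := intg_damage (primitive_continuous ler01 pvw) idW => iBW.
  apply: (@eq_intg_oo _ _ _ (damage e c alpha W dW)); last by apply: intgS iBW.
  by move=> x; rewrite in_itv/= => /andP[/hi[_ _ h3 h4] _]; rewrite /damage h3 h4.
have [iBS EB] := glue (fun _ _ w dw => damage e c alpha w dw)
  ltac:(by move=> > _ _ h3 h4; rewrite /damage h3 h4) iB iBw.
have [S0 _ _ _] := lo 0 ale; have [S1 _ W1 _] := hi 1 a1.
have U : U_rad lambda alpha S dS W dW.
  apply: primitive_U_rad => //; rewrite ?S0 ?S1 ?W1//.
  move=> x /andP[x0 x1]; have [xa|ax] := leP x a.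
    have [h1 h2 h3 _] := lo x xa; rewrite /admissible h1 h2 h3.
    by apply: adm; rewrite x0 ltW.
  have [h1 h2 h3 _] := hi x ax; rewrite /admissible h1 h2 h3.
  by apply: adms; rewrite !ltW.
have := Emin _ _ _ _ U; rewrite !energyE// lee_fin EA EB.
rewrite (itg_cat ale a1' iA) (itg_cat ale a1' iB); lra.
Qed.

End Setup.

(** * Variation of the radius *)

Section RealCalculus.
Context {R : realType}.
Implicit Types (x y t : R).

Lemma is_derive_affine (k m t : R) : is_derive t 1 (fun s : R => k + m * s) m.
Proof.
apply/is_deriveP => e e0; exists 1 => // y _.
have -> : k + m * y - (k + m * t) - m * (y - t) = 0 by ring.
by rewrite normr0 mulr_ge0// ltW.
Qed.

Lemma is_derive_mul (f g : R -> R) (x a b : R) : is_derive x 1 f a -> is_derive x 1 g b ->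
  is_derive x 1 (fun y => f y * g y) (a * g x + f x * b).
Proof.
move=> df dg; apply: is_derive_eq (is_deriveM df dg) _.
by rewrite /GRing.scale/= addrC (mulrC a).
Qed.

Lemma is_derive_add (f g : R -> R) (x a b : R) : is_derive x 1 f a -> is_derive x 1 g b ->
  is_derive x 1 (fun y => f y + g y) (a + b).
Proof. by move=> df dg; exact: is_deriveD. Qed.

Lemma is_derive_scale (f : R -> R) (k x a : R) : is_derive x 1 f a ->
  is_derive x 1 (fun y => k * f y) (k * a).
Proof.
move=> df; have := is_derive_mul (is_derive_cst k x 1) df.
by rewrite mul0r add0r.
Qed.

Lemma is_derive_inv (f : R -> R) (x a : R) : f x != 0 -> is_derive x 1 f a ->
  is_derive x 1 (fun y => (f y)^-1) (- a / f x ^+ 2).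
Proof.
move=> fx df; apply: is_derive_eq (is_deriveV fx df) _.
by rewrite /GRing.scale/= !mulNr mulrC.
Qed.

Lemma is_derive_div (f g : R -> R) (x a b : R) : g x != 0 ->
  is_derive x 1 f a -> is_derive x 1 g b ->
  is_derive x 1 (fun y => f y / g y) ((a * g x - f x * b) / g x ^+ 2).
Proof.
move=> gx df dg; apply: is_derive_eq (is_derive_mul df (is_derive_inv gx dg)) _.
by field.
Qed.

Lemma is_derive_compose (f g : R -> R) (x a b : R) : is_derive x 1 g b ->
  is_derive (g x) 1 f a -> is_derive x 1 (fun y => f (g y)) (a * b).
Proof. by move=> dg df; exact: is_derive1_comp. Qed.

(** Variations are made in r^3, and this root returns to the radius. *)
Definition cbrt x : R := x `^ 3^-1.

Lemma cbrt_gt0 x : 0 < x -> 0 < cbrt x. Proof. exact: powR_gt0. Qed.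

Lemma cbrtK x : 0 <= x -> cbrt x ^+ 3 = x.
Proof.
by move=> x0; rewrite /cbrt -powR_mulrn ?powR_ge0// -powRrM mulVf ?powRr1// pnatr_eq0.
Qed.

Lemma exprK_cbrt x : 0 <= x -> cbrt (x ^+ 3) = x.
Proof.
by move=> x0; rewrite /cbrt -powR_mulrn// -powRrM mulfV ?powRr1// pnatr_eq0.
Qed.

Lemma is_derive_cbrt x : 0 < x -> is_derive x 1 cbrt (3 * cbrt x ^+ 2)^-1.
Proof.
move=> x0; have xI : x \in `]0, +oo[ by rewrite in_itv/= x0.
apply: DeriveDef; first exact: derivable_powR.
rewrite -derive1E powR_derive1// invfM; congr (_ * _).
rewrite -powR_invn ?powR_ge0//.
by rewrite /cbrt -powRrM; congr (_ `^ _); field.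
Qed.

Lemma cbrt_der_cont x : 0 < x -> {for x, continuous (fun y => (3 * cbrt y ^+ 2)^-1)}.
Proof.
move=> x0; have c := is_derive_cont (is_derive_cbrt x0).
apply: cvgV; first by rewrite mulf_neq0 ?pnatr_eq0// expf_neq0// gt_eqF// cbrt_gt0.
by apply: cvgMr; exact: (cvgM c c).
Qed.

Lemma derive_increment (F : R -> R) (t0 G t : R) :
  (forall s : R, `|s| < t0 -> exists2 l : R, is_derive s 1 F l & `|l| <= G) ->
  `|t| < t0 -> `|F t - F 0| <= G * `|t|.
Proof.
move=> H tt0.
have seg (a b : R) : - t0 < a -> a <= b -> b < t0 -> `|F b - F a| <= G * (b - a).
  move=> ta ab bt.
  have dF (s : R) : s \in `]a, b[ -> is_derive s 1 F ('D_1 F s).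
    rewrite in_itv/= => /andP[as_ sb].
    have [|l dl _] := H s; first by rewrite ltr_norml; lra.
    by apply: DeriveDef => //; case: dl.
  have cF : {within `[a, b], continuous F}.
    apply/subspace_continuousP => s /=; rewrite in_itv/= => /andP[as_ sb].
    have [|l dl _] := H s; first by rewrite ltr_norml; lra.
    apply: cvg_within_filter; exact: (is_derive_cont dl).
  have [s sab ->] := MVT_segment ab dF cF.
  move: sab; rewrite in_itv/= => /andP[as_ sb].
  have [|l [_ dl] lG] := H s; first by rewrite ltr_norml; lra.
  by rewrite normrM dl [X in _ * X]ger0_norm ?subr_ge0// ler_wpM2r// subr_ge0.
move: tt0; rewrite ltr_norml => /andP[t1 t2].
have [t3|t3] := leP 0 t.
  have h0 : - t0 < 0 by lra.
  by have := seg 0 t h0 t3 t2; rewrite subr0 [`|t|]ger0_norm.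
have h0 : 0 < t0 by lra.
by have := seg t 0 t1 (ltW t3) h0; rewrite distrC sub0r [`|t|]ltr0_norm.
Qed.

(** Continuity of an implicitly defined root without differentiability in the unknown: by strict
    monotonicity G - p has strict signs on both sides of the root, and these signs persist at nearby
    points. *)
Lemma implicit_monotone (A : set R) (G : R -> R -> R) (p : R -> R) :
  (forall x, A x -> forall d1 d2, 0 < d1 -> d1 < d2 -> G x d1 < G x d2) ->
  (forall x, A x -> exists2 d, 0 < d & G x d = p x) ->
  (forall d, 0 < d -> {within A, continuous (fun x => G x d - p x)}) ->
  exists s : R -> R, (forall x, A x -> 0 < s x /\ G x (s x) = p x) /\
    {within A, continuous s}.
Proof.
move=> mono ex cG.
have /choice[s Hs] x : exists d, A x -> 0 < d /\ G x d = p x.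
  have [Ax|nAx] := pselect (A x); last by exists 0.
  by have [d d0 E] := ex x Ax; exists d.
exists s; split => //; apply/continuous_withinP => x Ax e e0.
have [sx0 Gx] := Hs x Ax.
(* The half of [s x] keeps the lower comparison point positive when [e] is large. *)
pose d1 := Num.max (s x / 2) (s x - e); pose d2 := s x + e.
have d10 : 0 < d1 by rewrite lt_max divr_gt0.
have d1s : d1 < s x by rewrite gt_max; apply/andP; split; lra.
have d2s : s x < d2 by rewrite ltrDl.
have d20 : 0 < d2 by exact: lt_trans d2s.
have g1 : 0 < p x - G x d1 by rewrite subr_gt0 -Gx; exact: mono.
have g2 : 0 < G x d2 - p x by rewrite subr_gt0 -Gx; exact: mono.
have [a1 a10 H1] := (continuous_withinP _ _).1 (cG d1 d10) x Ax _ (divr_gt0 g1 (ltr0n _ 2)).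
have [a2 a20 H2] := (continuous_withinP _ _).1 (cG d2 d20) x Ax _ (divr_gt0 g2 (ltr0n _ 2)).
exists (Num.min a1 a2) => [|y Ay]; first by rewrite lt_min a10.
rewrite lt_min => /andP[/(H1 y Ay) h1 /(H2 y Ay) h2].
move: h1 h2; rewrite !ler_norml => /andP[_ h1] /andP[h2 _].
have [sy0 Gy] := Hs y Ay.
have l1 : d1 < s y.
  rewrite ltNge; apply/negP => sd; have : G y (s y) <= G y d1.
    move: sd; rewrite le_eqVlt => /predU1P[->//|/(mono y Ay _ _ sy0)/ltW//].
  by rewrite Gy; lra.
have l2 : s y < d2.
  rewrite ltNge; apply/negP => sd; have : G y d2 <= G y (s y).
    move: sd; rewrite le_eqVlt => /predU1P[->//|/(mono y Ay _ _ d20)/ltW//].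
  by rewrite Gy; lra.
have l3 : s x - e <= d1 by rewrite le_max lexx orbT.
by apply/andP; split; move: l2; rewrite /d2; lra.
Qed.

End RealCalculus.

(** * Weak Euler-Lagrange identity in the variable r^3 / 3 *)

Section StretchVariation.
Context {R : realType}.
Local Notation mu := (@lebesgue_measure R).
Variables (psi dpsi h dh : R -> R) (d0 K gamma0 : R) (r dr v dv : R -> R).
Hypotheses (psi_der : forall x : R, 0 < x -> is_derive x 1 psi (dpsi x))
  (dpsi_cont : forall x : R, 0 < x -> {for x, continuous dpsi})
  (dpsi_mono : forall x y : R, 0 < x -> x <= y -> dpsi x <= dpsi y)
  (psi_ge0 : forall x : R, 0 < x -> 0 <= psi x)
  (h_der : forall x : R, 0 < x -> is_derive x 1 h (dh x))
  (dh_cont : forall x : R, 0 < x -> {for x, continuous dh})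
  (dh_mono : forall x y : R, 0 < x -> x < y -> dh x < dh y)
  (dh_0 : forall M : R, exists2 e : R, 0 < e & forall d, 0 < d -> d < e -> dh d <= M)
  (dh_oo : forall M : R, exists2 D : R, 0 < D & forall d, D <= d -> M <= dh d)
  (h_min : forall x : R, 0 < x -> h d0 <= h x)
  (K_gt0 : 0 < K) (gamma0_gt0 : 0 < gamma0)
  (psi_bound : forall s k : R, 0 < s -> `|k - 1| <= gamma0 -> `|s * dpsi (k * s)| <= K * psi s)
  (pr : primitive_on 0 1 r dr) (pv : primitive_on 0 1 v dv)
  (r_gt0 : forall x : R, 0 < x <= 1 -> 0 < r x)
  (adm : forall x : R, 0 < x <= 1 -> admissible r dr v x)
  (iA : intg 0 1 (elastic psi h r dr v))
  (r_min : forall (a : R) (s ds : R -> R), 0 < a < 1 -> primitive_on a 1 s ds ->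
     s a = r a -> s 1 = r 1 -> intg a 1 (elastic psi h s ds v) ->
     (forall x : R, a <= x <= 1 -> admissible s ds v x) ->
     itg a 1 (elastic psi h r dr v) <= itg a 1 (elastic psi h s ds v)).

Let dd x := dr x * (r x / x) ^+ 2 - v x.
(** [P] and [Q] are the partial derivatives of the elastic density with respect to u' and u, for u =
    r^3 / 3, u' = r^2 r'. As the determinant is u' / x^2 - v, the derivative of [h] occurs in [P]
    alone. *)
Let P x := x ^+ 2 * dpsi (dr x) / r x ^+ 2 + dh (dd x).
Let Q x := - 2 * x ^+ 2 * dr x * dpsi (dr x) / r x ^+ 3 + 2 * x * dpsi (r x / x) / r x ^+ 2.

Lemma dr_gt0 x : 0 < x <= 1 -> 0 < dr x.
Proof. by move=> x01; apply: (admissible_stretch _ (adm x01)); case/andP: x01. Qed.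

Lemma dd_gt0 x : 0 < x <= 1 -> 0 < dd x.
Proof. by move=> /adm/andP[_]; rewrite subr_gt0. Qed.

Lemma v_ge0 x : 0 < x <= 1 -> 0 <= v x. Proof. by move=> /adm/andP[]. Qed.

Lemma r_mono x y : 0 < x -> x <= y -> y <= 1 -> r x <= r y.
Proof.
move=> x0 xy y1; rewrite -subr_ge0 (primitive_sub pr (ltW x0) xy y1).
apply: itg_ge0 => z /andP[xz zy]; apply/ltW/dr_gt0.
by rewrite (lt_le_trans x0 xz) (le_trans zy).
Qed.

Lemma drE x : 0 < x <= 1 -> dr x = (dd x + v x) * x ^+ 2 / r x ^+ 2.
Proof.
move=> x01; have rx := r_gt0 x01; case/andP: x01 => x0 _.
by rewrite /dd; field; rewrite !gt_eqF.
Qed.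

Let cr : {within `[0, 1], continuous r} := primitive_continuous ler01 pr.
Let cv : {within `[0, 1], continuous v} := primitive_continuous ler01 pv.

(** All terms of the elastic density are bounded below, hence each [psi] term is dominated by the
    density plus a constant; these are the integrable majorants used for [psi']. *)
Lemma energy_part x : 0 < x <= 1 ->
  0 <= x ^+ 2 * psi (dr x) <= elastic psi h r dr v x + `|h d0| /\
  0 <= x ^+ 2 * psi (r x / x) <= elastic psi h r dr v x + `|h d0|.
Proof.
move=> x01; have h1 := psi_ge0 (dr_gt0 x01).
have h3 := h_min (dd_gt0 x01); have rx := r_gt0 x01; case/andP: x01 => x0 x1.
have h2 : 0 <= psi (r x / x) by apply: psi_ge0; rewrite divr_gt0.
have n1 := ler_norm (- h d0); rewrite normrN in n1; have n0 := normr_ge0 (h d0).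
have x2 : 0 <= x ^+ 2 by rewrite sqr_ge0.
have x21 : x ^+ 2 <= 1 by rewrite expr_le1// ltW.
have p1 := mulr_ge0 x2 h1; have p2 := mulr_ge0 x2 h2.
have p3 : - `|h d0| <= x ^+ 2 * h (dd x).
  apply: (@le_trans _ _ (x ^+ 2 * (- `|h d0|))); first nra.
  by rewrite ler_wpM2l//; lra.
have -> : elastic psi h r dr v x = x ^+ 2 * psi (dr x) + 2 * (x ^+ 2 * psi (r x / x)) +
    x ^+ 2 * h (dd x) by rewrite /elastic /dd; ring.
by split; apply/andP; split; lra.
Qed.

Section Variation.
Variables (a delta G0 : R) (g : R -> R).
Hypotheses (a01 : 0 < a < 1) (delta_gt0 : 0 < delta) (G0_gt0 : 0 < G0)
  (mg : measurable_fun `[a, 1] g) (gG0 : forall x : R, a <= x <= 1 -> `|g x| <= G0)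
  (g_out : forall x : R, a <= x <= 1 -> ~~ (delta <= dd x <= delta^-1) -> g x = 0)
  (g_mean : itg a 1 g = 0).

Let a0 : 0 < a. Proof. by case/andP: a01. Qed.
Let a1 : a < 1. Proof. by case/andP: a01. Qed.
Let rho x := itg a x g.
Let ra := r a.
Let ra0 : 0 < ra. Proof. by apply: r_gt0; rewrite a0 ltW. Qed.

Let ig : intg a 1 g.
Proof.
apply: (@intg_bound _ _ _ G0 _ (fun=> 1)) => //; first exact: intg_cst.
by move=> x /gG0; rewrite mulr1.
Qed.

Let prho : primitive_on a 1 rho g.
Proof. by split => // x _; rewrite /rho itg1 add0r. Qed.

Let rho_le x : a <= x <= 1 -> `|rho x| <= G0.
Proof.
move=> /andP[ax x1]; rewrite /rho.
have := @itg_bound _ a x G0 g ax (intgS (lexx a) x1 ig).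
have H (z : R) : a <= z <= x -> `|g z| <= G0.
  by move=> /andP[az zx]; apply: gG0; rewrite az (le_trans zx).
move=> /(_ H) /le_trans; apply.
have h1 : x - a <= 1 by have := a0; lra.
by rewrite -[leRHS]mulr1 ler_wpM2l// ltW.
Qed.

(** [th] bounds the relative change of r^3 and of the determinant. The stretch then changes by a
    factor within [8 * th] of 1, which explains the two eighths: the factor has to stay within
    gamma0 of 1 and between 1/2 and 2. The two entries of [t0] secure these relative bounds for 3 t
    rho and t g. *)
Let th := Num.min 8^-1 (gamma0 / 8).
Let t0 := Num.min (th * ra ^+ 3 / (3 * G0)) (th * (a ^+ 2 * delta) / G0).

Let th_gt0 : 0 < th. Proof. by rewrite lt_min invr_gt0 ltr0n divr_gt0. Qed.
Let th_le8 : th <= 8^-1. Proof. by rewrite ge_min lexx. Qed.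
Let th_gamma : 8 * th <= gamma0.
Proof. by rewrite mulrC -ler_pdivlMr// ge_min lexx orbT. Qed.

Let t0_gt0 : 0 < t0.
Proof.
rewrite lt_min; apply/andP; split; first by rewrite divr_gt0 ?mulr_gt0 ?exprn_gt0.
by rewrite divr_gt0 ?mulr_gt0 ?exprn_gt0.
Qed.

Let inI x : a <= x <= 1 -> 0 < x <= 1.
Proof. by move=> /andP[ax ->]; rewrite (lt_le_trans a0). Qed.

Let small1 t x : `|t| < t0 -> a <= x <= 1 -> `|3 * t * rho x| <= th * r x ^+ 3.
Proof.
move=> tt xI; rewrite !normrM gtr0_norm//.
apply: (@le_trans _ _ (th * ra ^+ 3)); last first.
  have rar : ra <= r x by case/andP: xI => ax x1; exact: r_mono.
  by rewrite ler_pM2l// ler_pXn2r// nnegrE ?(ltW ra0)// (le_trans (ltW ra0)).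
have h1 : `|t| <= th * ra ^+ 3 / (3 * G0).
  by apply/ltW/(lt_le_trans tt); rewrite ge_min lexx.
rewrite ler_pdivlMr ?mulr_gt0// in h1.
apply: le_trans h1; rewrite (_ : 3 * `|t| * `|rho x| = `|t| * (3 * `|rho x|)); last by ring.
by rewrite ler_wpM2l// ler_pM2l// rho_le.
Qed.

Let small2 t x : `|t| < t0 -> a <= x <= 1 -> `|t * g x| <= th * (x ^+ 2 * dd x).
Proof.
move=> tt xI; have x0 := inI xI; have ddx := dd_gt0 x0.
have [E|E] := boolP (delta <= dd x <= delta^-1); last first.
  rewrite (g_out xI E) mulr0 normr0; apply: mulr_ge0; first exact: ltW.
  by apply: mulr_ge0; [exact: sqr_ge0|exact: ltW].
have h1 : `|t| <= th * (a ^+ 2 * delta) / G0.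
  by apply/ltW/(lt_le_trans tt); rewrite ge_min lexx orbT.
rewrite ler_pdivlMr// in h1.
rewrite normrM (le_trans (ler_wpM2l (normr_ge0 t) (gG0 xI)))// (le_trans h1)//.
rewrite ler_pM2l//; case/andP: E => E _; case/andP: xI => ax _.
apply: ler_pM => //; rewrite ?sqr_ge0 ?(ltW delta_gt0)//.
by rewrite ler_pXn2r// nnegrE ?(ltW a0)// (le_trans (ltW a0)).
Qed.

(** This is u + t rho for u = r^3 / 3, up to the factor 3; [rt] is the perturbed radius and [dst]
    its derivative (u' + t g) / rt^2. *)
Let ut t x := r x ^+ 3 + 3 * t * rho x.
Let rt t x := cbrt (ut t x).
Let dst t x := (r x ^+ 2 * dr x + t * g x) / rt t x ^+ 2.

Let ut_bnd t x : `|t| < t0 -> a <= x <= 1 ->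
  [/\ 0 < ut t x, (1 - th) * r x <= rt t x & rt t x <= (1 + th) * r x].
Proof.
move=> tt xI; have rx := r_gt0 (inI xI).
have := small1 tt xI; rewrite ler_norml => /andP[h1 h2].
have r3 : 0 < r x ^+ 3 by rewrite exprn_gt0.
have th0 := th_gt0; have th8 := th_le8.
have u0 : 0 < ut t x by rewrite /ut; nra.
have rt0 := cbrt_gt0 u0; have rt3 := cbrtK (ltW u0).
rewrite -/(rt t x) in rt0 rt3.
split => //.
  have : ((1 - th) * r x) ^+ 3 <= rt t x ^+ 3.
    rewrite rt3 exprMn; apply: (@le_trans _ _ ((1 - th) * r x ^+ 3)); last by rewrite /ut; lra.
    by rewrite ler_pM2r//; nra.
  by rewrite ler_pXn2r ?nnegrE ?(ltW rt0)// mulr_ge0 ?(ltW rx)//; lra.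
have : rt t x ^+ 3 <= ((1 + th) * r x) ^+ 3.
  rewrite rt3 exprMn; apply: (@le_trans _ _ ((1 + th) * r x ^+ 3)); first by rewrite /ut; lra.
  by rewrite ler_pM2r//; nra.
by rewrite ler_pXn2r ?nnegrE ?(ltW rt0)// mulr_ge0 ?(ltW rx)//; lra.
Qed.

Let rt_gt0 t x : `|t| < t0 -> a <= x <= 1 -> 0 < rt t x.
Proof. by move=> tt xI; have [u0 _ _] := ut_bnd tt xI; exact: cbrt_gt0. Qed.

(** The perturbed stretch is a multiple of the old one with factor near 1, the form in which the
    growth condition on [psi'] applies. *)
Let dst_ratio t x : `|t| < t0 -> a <= x <= 1 ->
  exists k, [/\ dst t x = k * dr x, `|k - 1| <= gamma0 & 2^-1 <= k <= 2].
Proof.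
move=> tt xI; have x01 := inI xI; have rx := r_gt0 x01.
have [u0 h1 h2] := ut_bnd tt xI; have rtx := rt_gt0 tt xI.
have := small2 tt xI; rewrite ler_norml => /andP[h3 h4].
have E : r x ^+ 2 * dr x = x ^+ 2 * (dd x + v x).
  by rewrite (drE x01); field; rewrite gt_eqF.
have vx := v_ge0 x01; have ddx := dd_gt0 x01.
have x2 : 0 < x ^+ 2 by rewrite exprn_gt0//; case/andP: x01.
have w0 : 0 < r x ^+ 2 * dr x by rewrite E mulr_gt0// ltr_wpDr.
have th0 := th_gt0; have th8 := th_le8; have thg := th_gamma.
have h5 : x ^+ 2 * dd x <= r x ^+ 2 * dr x by rewrite E ler_pM2l// lerDl.
have h6 : (1 - th) * (r x ^+ 2 * dr x) <= r x ^+ 2 * dr x + t * g x by nra.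
have h7 : r x ^+ 2 * dr x + t * g x <= (1 + th) * (r x ^+ 2 * dr x) by nra.
pose k := dst t x / dr x.
have drx := dr_gt0 x01.
have kE : dst t x = k * dr x by rewrite divfK// gt_eqF.
have k2 : k * rt t x ^+ 2 * dr x = r x ^+ 2 * dr x + t * g x.
  by rewrite /k /dst; field; rewrite !gt_eqF.
have r2 : 0 < r x ^+ 2 by rewrite exprn_gt0.
have rt2 : 0 < rt t x ^+ 2 by rewrite exprn_gt0.
have l1 : (1 - th) ^+ 2 * r x ^+ 2 <= rt t x ^+ 2.
  by rewrite -exprMn ler_pXn2r ?nnegrE ?(ltW rtx)// mulr_ge0 ?(ltW rx)//; lra.
have l2 : rt t x ^+ 2 <= (1 + th) ^+ 2 * r x ^+ 2.
  by rewrite -exprMn ler_pXn2r ?nnegrE ?(ltW rtx)// mulr_ge0 ?(ltW rx)//; lra.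
have lo : 1 - 8 * th <= k.
  rewrite -(ler_pM2r rt2) -(ler_pM2r drx) k2; apply: le_trans h6.
  rewrite [X in _ <= X]mulrA ler_pM2r//; apply: (@le_trans _ _ ((1 - 8 * th) * ((1 + th) ^+ 2 * r x ^+ 2))).
    by rewrite ler_wpM2l//; lra.
  rewrite mulrA ler_pM2r//; nra.
have hi : k <= 1 + 8 * th.
  rewrite -(ler_pM2r rt2) -(ler_pM2r drx) k2; apply: (le_trans h7).
  rewrite mulrA ler_pM2r//; apply: (@le_trans _ _ ((1 + 8 * th) * ((1 - th) ^+ 2 * r x ^+ 2))).
    by rewrite [X in _ <= X]mulrA ler_pM2r//; nra.
  by rewrite ler_wpM2l//; lra.
have lo2 : 2^-1 <= k.
  rewrite -(ler_pM2r rt2) -(ler_pM2r drx) k2; apply: le_trans h6.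
  rewrite [X in _ <= X]mulrA ler_pM2r//; apply: (@le_trans _ _ (2^-1 * ((1 + th) ^+ 2 * r x ^+ 2))).
    by rewrite ler_wpM2l.
  rewrite mulrA ler_pM2r//; nra.
exists k; split => //; first by rewrite ler_norml; apply/andP; split; lra.
by apply/andP; split; lra.
Qed.

Let ddt t x := dd x + t * g x / x ^+ 2.

Let ddt_bnd t x : `|t| < t0 -> a <= x <= 1 ->
  dst t x * (rt t x / x) ^+ 2 - v x = ddt t x /\ 2^-1 * dd x <= ddt t x <= 2 * dd x.
Proof.
move=> tt xI; have x01 := inI xI; have rx := r_gt0 x01.
have rtx := rt_gt0 tt xI; have := small2 tt xI; rewrite ler_norml => /andP[h3 h4].
have x0 : 0 < x by case/andP: x01.
have x2 : 0 < x ^+ 2 by rewrite exprn_gt0.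
have ddx := dd_gt0 x01; have th0 := th_gt0; have th8 := th_le8.
split.
  by rewrite /dst /ddt /dd; field; rewrite !gt_eqF.
have E : ddt t x * x ^+ 2 = dd x * x ^+ 2 + t * g x.
  by rewrite /ddt; field; rewrite gt_eqF.
have p0 : 0 < dd x * x ^+ 2 by rewrite mulr_gt0.
by apply/andP; split; rewrite -(ler_pM2r x2) E; nra.
Qed.

Let adm_t t x : `|t| < t0 -> a <= x <= 1 -> admissible (rt t) (dst t) v x.
Proof.
move=> tt xI; have [E /andP[lo _]] := ddt_bnd tt xI; have x01 := inI xI.
rewrite /admissible v_ge0//= -subr_gt0 E; apply: lt_le_trans lo.
by rewrite mulr_gt0 ?invr_gt0 ?dd_gt0.
Qed.

Let prt t : `|t| < t0 -> primitive_on a 1 (rt t) (dst t).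
Proof.
move=> tt; have pra := primitiveS (ltW a0) (lexx 1) pr.
have a1' := ltW a1.
have p3 := primitive_mul a1' pra (primitive_mul a1' pra pra).
have pU := primitiveD p3 (primitiveZ (3 * t) prho).
have pos x : a <= x <= 1 -> 0 < r x * (r x * r x) + 3 * t * rho x.
  by move=> xI; have [] := ut_bnd tt xI; rewrite /ut !exprS expr0 mulr1.
have := primitive_chain (F := cbrt) (dF := fun y => (3 * cbrt y ^+ 2)^-1) a1' pU.
move=> /(_ (fun x xI => is_derive_cbrt (pos x xI)) (fun x xI => cbrt_der_cont (pos x xI))).
have uE x : r x * (r x * r x) + 3 * t * rho x = ut t x by rewrite /ut; ring.
apply: eq_primitive => x; rewrite in_itv/= => xI; rewrite /= uE//.
rewrite /dst -/(rt t x); field.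
by rewrite gt_eqF// rt_gt0.
Qed.

Let dA t x := g x / rt t x ^+ 2 - 2 * dst t x * rho x / rt t x ^+ 3.
Let dF t x := x ^+ 2 * (dpsi (dst t x) * dA t x
  + 2 * (dpsi (rt t x / x) * (rho x / rt t x ^+ 2 / x)) + dh (ddt t x) * (g x / x ^+ 2)).

Let dF_der (t x : R) : `|t| < t0 -> a <= x <= 1 ->
  is_derive t 1 (fun s => elastic psi h (rt s) (dst s) v x) (dF t x).
Proof.
move=> tt xI; have x01 := inI xI; have x0 : 0 < x by case/andP: x01.
have rtx := rt_gt0 tt xI; have [u0 _ _] := ut_bnd tt xI.
have [E /andP[ddt1 _]] := ddt_bnd tt xI.
have ddt0 : 0 < ddt t x by apply: lt_le_trans ddt1; rewrite mulr_gt0 ?dd_gt0.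
have dst0 : 0 < dst t x by apply: (admissible_stretch x0 (adm_t tt xI)).
have du : is_derive t 1 (fun s => ut s x) (3 * rho x).
  have := is_derive_affine (r x ^+ 3) (3 * rho x) t.
  by congr is_derive; apply/funext => s; rewrite /ut; ring.
have drt : is_derive t 1 (fun s => rt s x) (rho x / rt t x ^+ 2).
  have dc : is_derive t 1 (fun s => rt s x) ((3 * cbrt (ut t x) ^+ 2)^-1 * (3 * rho x)).
    exact: (is_derive_compose du (is_derive_cbrt u0)).
  apply: (is_derive_eq dc); rewrite -/(rt t x).
  by field; rewrite gt_eqF.
have drt2 : is_derive t 1 (fun s => rt s x ^+ 2) (2 * rt t x * (rho x / rt t x ^+ 2)).
  exact: (is_derive_compose drt (is_derive_sqr _)).
have dN : is_derive t 1 (fun s => r x ^+ 2 * dr x + s * g x) (g x).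
  have := is_derive_affine (r x ^+ 2 * dr x) (g x) t.
  by congr is_derive; apply/funext => s; rewrite [g x * s]mulrC.
have ddst : is_derive t 1 (fun s => dst s x) (dA t x).
  have dd' := @is_derive_div _ _ (fun s => rt s x ^+ 2) t _ _ (expf_neq0 2 (lt0r_neq0 rtx)) dN drt2.
  apply: (is_derive_eq dd').
  by rewrite /dA /dst; field; rewrite gt_eqF.
have dB : is_derive t 1 (fun s => rt s x / x) (rho x / rt t x ^+ 2 / x).
  have := is_derive_scale x^-1 drt; rewrite mulrC.
  by congr is_derive; apply/funext => s; rewrite mulrC.
have dH : is_derive t 1 (fun s => dst s x * (rt s x / x) ^+ 2 - v x) (g x / x ^+ 2).
  have dB2 := is_derive_compose dB (is_derive_sqr _).
  apply: is_derive_eq (is_derive_add (is_derive_mul ddst dB2) (is_derive_cst (- v x) t 1)) _.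
  by rewrite /dA /dst; field; rewrite !gt_eqF.
have B0 : 0 < rt t x / x by rewrite divr_gt0.
have p1 := is_derive_compose ddst (psi_der dst0).
have p2 := is_derive_scale 2 (is_derive_compose dB (psi_der B0)).
have p3 : is_derive t 1 (fun s => h (dst s x * (rt s x / x) ^+ 2 - v x)) (dh (ddt t x) * (g x / x ^+ 2)).
  by apply: (is_derive_compose dH); rewrite E; exact: h_der.
exact: is_derive_scale (is_derive_add (is_derive_add p1 p2) p3).
Qed.

Let M1 := K * (8 * G0 / ra ^+ 2 * (r 1 ^+ 2 / (a ^+ 2 * delta)) + 64 * G0 / ra ^+ 3).
Let M2 := 16 * K * G0 / (ra ^+ 3 * a).
Let M3 := (`|dh (delta / 2)| + `|dh (2 / delta)|) * G0.

Let G x := (M1 + M2) * (elastic psi h r dr v x + `|h d0|) + M3.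

(** Domination uniform in [t]. The [psi'] terms are bounded by K psi at the unperturbed stretches,
    hence by the energy density. The [h'] term is present only where [g] lives, and there the
    perturbed determinant stays in [delta / 2, 2 / delta]. *)
Let dF_le (t x : R) : `|t| < t0 -> a <= x <= 1 -> `|dF t x| <= G x.
Proof.
have between (l u y : R) : l <= y -> y <= u -> `|y| <= `|l| + `|u|.
  move=> ly yu; have := ler_norm (- l); have := ler_norm u; rewrite normrN.
  have := normr_ge0 l; have := normr_ge0 u => ? ? ? ?.
  by rewrite ler_norml; apply/andP; split; lra.
have halve (d y k : R) : 2^-1 * d <= y -> k <= d -> k / 2 <= y by move=> *; lra.
have double (d y k : R) : y <= 2 * d -> d <= k -> y <= 2 * k by move=> *; lra.
have coarse (y z : R) : 0 <= y -> 0 <= z -> 4 * y + 32 * z <= 8 * y + 64 * z by move=> *; lra.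
have coarse' (y : R) : 0 <= y -> 8 * y <= 16 * y by move=> *; lra.
move=> tt xI; have x01 := inI xI; have x0 : 0 < x by case/andP: x01.
have x1 : x <= 1 by case/andP: x01.
have ax : a <= x by case/andP: xI.
have rtx := rt_gt0 tt xI; have [u0 lo hi] := ut_bnd tt xI.
have [E /andP[ddt1 ddt2]] := ddt_bnd tt xI.
have ddt0 : 0 < ddt t x by apply: lt_le_trans ddt1; rewrite mulr_gt0 ?dd_gt0.
have dst0 : 0 < dst t x by apply: (admissible_stretch x0 (adm_t tt xI)).
have [k [kE kg /andP[k1 k2]]] := dst_ratio tt xI.
have drx := dr_gt0 x01; have rx := r_gt0 x01; have ddx := dd_gt0 x01.
have rar : ra <= r x by apply: r_mono.
have r1 : r x <= r 1 by apply: r_mono.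
have r10 : 0 < r 1 by apply: lt_le_trans r1.
have ra0' := ra0; have th8 := th_le8; have th0 := th_gt0; have G00 := G0_gt0.
have a0' := a0; have K0 := K_gt0; have delta0 := delta_gt0.
have rt2 : ra / 2 <= rt t x by nra.
have psi1 := psi_bound drx kg.
have psi2 : `|r x / x * dpsi (rt t x / x)| <= K * psi (r x / x).
  have rxx : 0 < r x / x by rewrite divr_gt0.
  have -> : rt t x / x = rt t x / r x * (r x / x) by field; rewrite !gt_eqF.
  apply: psi_bound => //.
  have -> : rt t x / r x - 1 = (rt t x - r x) / r x by field; rewrite gt_eqF.
  rewrite normrM normfV (gtr0_norm rx) ler_pdivrMr// ler_norml.
  have thg := th_gamma.
  by apply/andP; split; nra.
have [/andP[e1 e1'] /andP[e2 e2']] := energy_part x01.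
set EN := elastic psi h r dr v x + `|h d0| in e1 e1' e2 e2' *.
have x2 : 0 < x ^+ 2 by rewrite exprn_gt0.
have gx := gG0 xI; have rhox := rho_le xI.
have psi0 := psi_ge0 drx.
have T1 : `|x ^+ 2 * (dpsi (dst t x) * dA t x)| <= M1 * EN.
  have B1 : `|dpsi (dst t x)| * dr x <= K * psi (dr x).
    by rewrite kE; apply: le_trans psi1; rewrite normrM (gtr0_norm drx) mulrC.
  have B2 : `|dpsi (dst t x) * g x| <= K * psi (dr x) * (G0 * (r 1 ^+ 2 / (a ^+ 2 * delta))).
    have [Ed|Ed] := boolP (delta <= dd x <= delta^-1); last first.
      rewrite (g_out xI Ed) mulr0 normr0; apply: mulr_ge0; first by rewrite mulr_ge0// ltW.
      apply: mulr_ge0; first exact: ltW.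
      by rewrite divr_ge0 ?sqr_ge0// mulr_ge0 ?sqr_ge0// ltW.
    (* The growth condition controls s psi'(k s) rather than psi'; on the support of [g] the stretch
       is bounded below and can be divided out. *)
    have drlo : a ^+ 2 * delta / r 1 ^+ 2 <= dr x.
      rewrite (drE x01) ler_pdivlMr ?exprn_gt0//.
      rewrite mulrAC ler_pdivrMr ?exprn_gt0//.
      have v0 := v_ge0 x01; case/andP: Ed => Ed _.
      apply: ler_pM.
      - by rewrite mulr_ge0 ?sqr_ge0// ltW.
      - exact: sqr_ge0.
      - rewrite [leRHS]mulrC; apply: ler_pM; rewrite ?sqr_ge0 ?(ltW delta0)//; last lra.
        by rewrite ler_pXn2r ?nnegrE ?(ltW a0)// ltW.
      - by rewrite ler_pXn2r ?nnegrE ?(ltW rx)// (le_trans (ltW rx)).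
    have q0 : 0 < a ^+ 2 * delta / r 1 ^+ 2.
      by rewrite divr_gt0 ?mulr_gt0 ?exprn_gt0.
    have B3 : `|dpsi (dst t x)| <= K * psi (dr x) * (r 1 ^+ 2 / (a ^+ 2 * delta)).
      rewrite -[r 1 ^+ 2 / _]invf_div ler_pdivlMr//; apply: le_trans B1.
      by rewrite ler_wpM2l.
    rewrite normrM (_ : K * psi (dr x) * (G0 * _) = K * psi (dr x) * (r 1 ^+ 2 / (a ^+ 2 * delta)) * G0); last by ring.
    by apply: ler_pM.
  have i2 : (rt t x ^+ 2)^-1 <= 4 / ra ^+ 2.
    rewrite -[4 / _]invf_div lef_pV2 ?posrE ?divr_gt0 ?exprn_gt0//.
    rewrite (_ : ra ^+ 2 / 4 = (ra / 2) ^+ 2); last by field.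
    by rewrite ler_pXn2r ?nnegrE ?(ltW rtx)// ltW// divr_gt0.
  have i3 : (rt t x ^+ 3)^-1 <= 8 / ra ^+ 3.
    rewrite -[8 / _]invf_div lef_pV2 ?posrE ?divr_gt0 ?exprn_gt0//.
    rewrite (_ : ra ^+ 3 / 8 = (ra / 2) ^+ 3); last by field.
    by rewrite ler_pXn2r ?nnegrE ?(ltW rtx)// ltW// divr_gt0.
  have -> : x ^+ 2 * (dpsi (dst t x) * dA t x) = x ^+ 2 * (dpsi (dst t x) * g x * (rt t x ^+ 2)^-1
     - 2 * (dpsi (dst t x) * dst t x) * rho x * (rt t x ^+ 3)^-1).
    by rewrite /dA; ring.
  have C1 : `|dpsi (dst t x) * g x * (rt t x ^+ 2)^-1| <=
      K * psi (dr x) * (G0 * (r 1 ^+ 2 / (a ^+ 2 * delta))) * (4 / ra ^+ 2).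
    rewrite normrM [X in _ * X]ger0_norm ?invr_ge0 ?sqr_ge0//.
    by apply: ler_pM; rewrite ?invr_ge0 ?sqr_ge0.
  have C2 : `|2 * (dpsi (dst t x) * dst t x) * rho x * (rt t x ^+ 3)^-1| <=
      2 * (2 * (K * psi (dr x))) * G0 * (8 / ra ^+ 3).
    have : `|dpsi (dst t x) * dst t x| <= 2 * (K * psi (dr x)).
      rewrite [leLHS]normrM (gtr0_norm dst0).
      apply: (@le_trans _ _ (2 * (`|dpsi (dst t x)| * dr x))); last by rewrite ler_pM2l.
      rewrite [X in _ * X <= _]kE (_ : _ * (k * dr x) = k * (`|dpsi (dst t x)| * dr x)); last by ring.
      by rewrite ler_wpM2r// mulr_ge0// ltW.
    move: (dpsi (dst t x) * dst t x) => w wle.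
    rewrite normrM [X in _ * X]ger0_norm ?invr_ge0 ?exprn_ge0 ?(ltW rtx)//.
    apply: ler_pM; rewrite ?invr_ge0 ?exprn_ge0 ?(ltW rtx)//.
    rewrite normrM; apply: ler_pM => //.
    by rewrite normrM [X in X * _]ger0_norm// ler_pM2l.
  rewrite normrM (gtr0_norm x2).
  apply: (@le_trans _ _ (M1 * (x ^+ 2 * psi (dr x)))); last first.
    rewrite ler_wpM2l//; apply: mulr_ge0; first exact: ltW.
    apply: addr_ge0; last by rewrite divr_ge0 ?mulr_ge0 ?exprn_ge0 ?(ltW G00) ?(ltW ra0).
    by rewrite !mulr_ge0 ?invr_ge0 ?mulr_ge0 ?exprn_ge0 ?(ltW G00) ?(ltW ra0) ?(ltW a0) ?(ltW delta0) ?(ltW r10).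
  rewrite [leRHS]mulrCA ler_pM2l// (le_trans (ler_normB _ _))// (le_trans (lerD C1 C2))//.
  rewrite /M1; have q : 0 <= G0 / ra ^+ 2 * (r 1 ^+ 2 / (a ^+ 2 * delta)).
    by rewrite !mulr_ge0 ?invr_ge0 ?mulr_ge0 ?exprn_ge0 ?(ltW G00) ?(ltW ra0) ?(ltW a0) ?(ltW delta0) ?(ltW r10).
  have q2 : 0 <= G0 / ra ^+ 3 by rewrite divr_ge0 ?exprn_ge0 ?ltW.
  rewrite (_ : K * psi (dr x) * _ * _ = K * psi (dr x) * (4 * (G0 / ra ^+ 2 * (r 1 ^+ 2 / (a ^+ 2 * delta))))); last by ring.
  rewrite (_ : 2 * _ * _ * _ = K * psi (dr x) * (32 * (G0 / ra ^+ 3))); last by ring.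
  rewrite (_ : K * _ * psi (dr x) = K * psi (dr x) * (8 * (G0 / ra ^+ 2 * (r 1 ^+ 2 / (a ^+ 2 * delta))) + 64 * (G0 / ra ^+ 3))); last by ring.
  rewrite -mulrDr ler_wpM2l//; first by rewrite mulr_ge0// ltW.
  exact: coarse.
have T2 : `|x ^+ 2 * (2 * (dpsi (rt t x / x) * (rho x / rt t x ^+ 2 / x)))| <= M2 * EN.
  have psi0' : 0 <= psi (r x / x) by apply: psi_ge0; rewrite divr_gt0.
  have B1 : `|dpsi (rt t x / x)| * ra <= K * psi (r x / x).
    apply: le_trans psi2; rewrite normrM mulrC ler_wpM2r//.
    rewrite gtr0_norm ?divr_gt0// ler_pdivlMr//; nra.
  have B2 : `|dpsi (rt t x / x)| <= K * psi (r x / x) / ra by rewrite ler_pdivlMr.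
  have i2 : (rt t x ^+ 2)^-1 <= 4 / ra ^+ 2.
    rewrite -[4 / _]invf_div lef_pV2 ?posrE ?divr_gt0 ?exprn_gt0//.
    rewrite (_ : ra ^+ 2 / 4 = (ra / 2) ^+ 2); last by field.
    by rewrite ler_pXn2r ?nnegrE ?(ltW rtx)// ltW// divr_gt0.
  have i1 : x^-1 <= a^-1 by rewrite lef_pV2 ?posrE.
  have C : `|rho x / rt t x ^+ 2 / x| <= G0 * (4 / ra ^+ 2) * a^-1.
    rewrite !normrM [`|x^-1|]ger0_norm ?invr_ge0 ?(ltW x0)//.
    rewrite [`|(rt t x ^+ 2)^-1|]ger0_norm ?invr_ge0 ?sqr_ge0//.
    apply: ler_pM; rewrite ?mulr_ge0 ?invr_ge0 ?sqr_ge0 ?(ltW x0)//.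
    by apply: ler_pM; rewrite ?invr_ge0 ?sqr_ge0.
  rewrite normrM (gtr0_norm x2).
  apply: (@le_trans _ _ (M2 * (x ^+ 2 * psi (r x / x)))); last first.
    by rewrite ler_wpM2l// /M2 !mulr_ge0 ?invr_ge0 ?mulr_ge0 ?exprn_ge0// ltW.
  rewrite [leRHS]mulrCA ler_pM2l// normrM normrM [`|2|]ger0_norm//.
  apply: (@le_trans _ _ (2 * (K * psi (r x / x) / ra * (G0 * (4 / ra ^+ 2) * a^-1)))).
    by rewrite ler_pM2l//; apply: ler_pM.
  rewrite (_ : 2 * _ = 8 * (K * G0 / (ra ^+ 3 * a) * psi (r x / x))); last first.
    by field; rewrite !gt_eqF.
  rewrite (_ : M2 * _ = 16 * (K * G0 / (ra ^+ 3 * a) * psi (r x / x))); last first.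
    by rewrite /M2; ring.
  apply: coarse'.
  by rewrite !mulr_ge0 ?invr_ge0 ?mulr_ge0 ?exprn_ge0 ?(ltW K0) ?(ltW G00) ?(ltW ra0) ?(ltW a0).
have T3 : `|x ^+ 2 * (dh (ddt t x) * (g x / x ^+ 2))| <= M3.
  rewrite (_ : x ^+ 2 * _ = dh (ddt t x) * g x); last by field; rewrite gt_eqF.
  have [Ed|Ed] := boolP (delta <= dd x <= delta^-1); last first.
    by rewrite (g_out xI Ed) mulr0 normr0 /M3 mulr_ge0 ?addr_ge0// ltW.
  rewrite normrM; apply: ler_pM => //.
  case/andP: Ed => Ed1 Ed2.
  have m1 : dh (delta / 2) <= dh (ddt t x).
    have : delta / 2 <= ddt t x := halve _ _ _ ddt1 Ed1.
    rewrite le_eqVlt => /predU1P[->//|h1]; apply/ltW/dh_mono => //.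
    by rewrite divr_gt0.
  have m2 : dh (ddt t x) <= dh (2 / delta).
    have : ddt t x <= 2 / delta := double _ _ _ ddt2 Ed2.
    by rewrite le_eqVlt => /predU1P[->//|h1]; apply/ltW/dh_mono.
  exact: between.
have -> : dF t x = x ^+ 2 * (dpsi (dst t x) * dA t x) +
    x ^+ 2 * (2 * (dpsi (rt t x / x) * (rho x / rt t x ^+ 2 / x))) +
    x ^+ 2 * (dh (ddt t x) * (g x / x ^+ 2)) by rewrite /dF; ring.
rewrite /G -/EN [(M1 + M2) * _]mulrDl (le_trans (ler_normD _ _))// lerD//.
by rewrite (le_trans (ler_normD _ _))// lerD.
Qed.

Let dF_both (t x : R) : `|t| < t0 -> a <= x <= 1 -> exists2 l : R,
  is_derive t 1 (fun s => elastic psi h (rt s) (dst s) v x) l & `|l| <= G x.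
Proof. by move=> tt xI; exists (dF t x); [exact: dF_der|exact: dF_le]. Qed.

Let rt0E x : a <= x <= 1 -> rt 0 x = r x /\ dst 0 x = dr x.
Proof.
move=> xI; have rx := r_gt0 (inI xI).
have E : rt 0 x = r x by rewrite /rt /ut mulr0 mul0r addr0 exprK_cbrt// ltW.
by split => //; rewrite /dst E mul0r addr0; field; rewrite gt_eqF.
Qed.

Let iA' : intg a 1 (elastic psi h r dr v).
Proof. exact: intgS (ltW a0) (lexx 1) iA. Qed.

Let iG : intg a 1 G.
Proof.
by apply: intgD; [apply: intgZ; apply: intgD => //|]; exact: intg_cst.
Qed.

Let el0 x : a <= x <= 1 -> elastic psi h (rt 0) (dst 0) v x = elastic psi h r dr v x.
Proof. by move=> /rt0E[E1 E2]; rewrite /elastic E1 E2. Qed.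

Let iF (t : R) : `|t| < t0 -> intg a 1 (elastic psi h (rt t) (dst t) v).
Proof.
move=> tt; have pt := prt tt.
apply: (@intg_bound_oo _ _ _ 1 _ (fun x => `|elastic psi h r dr v x| + `|t| * G x)).
- apply: (@measurable_elastic _ psi h (fun x x0 => is_derive_cont (h_der x0)) (fun x x0 => is_derive_cont (psi_der x0))).
  + exact: ltW a0.
  + exact: primitive_continuous (ltW a1) pt.
  + exact: primitive_continuous (ltW a1) (primitiveS (ltW a0) (lexx 1) pv).
  + exact: intg_meas_oo pt.1.
  + by move=> x /andP[ax x1]; apply: rt_gt0 => //; rewrite !ltW.
  + by move=> x /andP[ax x1]; apply: adm_t => //; rewrite !ltW.
- by apply: intgD; [exact: intg_norm|apply: intgZ].
- move=> x /andP[/ltW ax /ltW x1]; have xI : a <= x <= 1 by rewrite ax.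
  have := @derive_increment _ (fun s => elastic psi h (rt s) (dst s) v x) t0 (G x) t.
  move=> /(_ (fun s st => dF_both st xI) tt) /=.
  rewrite el0// mul1r => H.
  rewrite -[elastic psi h (rt t) (dst t) v x](subrK (elastic psi h r dr v x)).
  by rewrite (le_trans (ler_normD _ _))// addrC lerD2l mulrC.
Qed.

(** Stationarity of the elastic energy along u + t rho, both signs of [t] being admissible; rho' = g
    is paired with [P] and rho with [Q]. *)
Lemma stretch_variation : itg a 1 (fun x => P x * g x + Q x * rho x) = 0.
Proof.
have n0 : `|0 : R| < t0 by rewrite normr0.
have Fmin t : `|t| < t0 -> itg a 1 (elastic psi h (rt 0) (dst 0) v) <=
    itg a 1 (elastic psi h (rt t) (dst t) v) + 0 * `|t|.
  move=> tt; rewrite mul0r addr0 (@eq_itg _ _ _ _ (elastic psi h r dr v)); last first.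
    by move=> x; rewrite in_itv/=; exact: el0.
  apply: r_min => //; [exact: prt| | |exact: iF|by move=> x; exact: adm_t].
  - rewrite /rt /ut /rho itg1 mulr0 addr0 exprK_cbrt//; exact: ltW.
  - rewrite /rt /ut /rho g_mean mulr0 addr0 exprK_cbrt// ltW// r_gt0//.
    by rewrite ltr01 lexx.
have := @first_variation _ a 1 t0 0 (fun t => elastic psi h (rt t) (dst t) v) (dF 0) G t0_gt0 iF iG.
move=> /(_ dF_both).
move=> /(_ (fun x xI => dF_der n0 xI) Fmin); rewrite normr_le0 => /eqP <-.
apply: eq_itg => x; rewrite in_itv/= => xI; have [E1 E2] := rt0E xI.
have x01 := inI xI; have rx := r_gt0 x01; have x0 : 0 < x by case/andP: x01.
rewrite /dF /dA E1 E2 /ddt mul0r mul0r addr0 /P /Q; field.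
by rewrite !gt_eqF.
Qed.

End Variation.
End StretchVariation.

(** * Regularity of the radius and of the stress *)

Section WithinCalculus.
Context {R : realType}.
Implicit Types (A : set R) (f g : R -> R).

Lemma within_comp A f g : {within A, continuous g} ->
  (forall x, A x -> {for g x, continuous f}) -> {within A, continuous (fun x => f (g x))}.
Proof.
move=> /subspace_continuousP cg cf; apply/subspace_continuousP => x Ax.
exact: cvg_comp (cg x Ax) (cf x Ax).
Qed.

Lemma within_cst A (k : R) : {within A, continuous (fun=> k)}.
Proof. by move=> x; exact: cvg_cst. Qed.

Lemma within_id A : {within A, continuous (fun x : R => x)}.
Proof. by apply: continuous_subspaceT => x; exact: cvg_id. Qed.

Lemma withinD A f g : {within A, continuous f} -> {within A, continuous g} ->
  {within A, continuous (fun x => f x + g x)}.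
Proof. by move=> cf cg x; exact: cvgD (cf x) (cg x). Qed.

Lemma withinN A f : {within A, continuous f} -> {within A, continuous (fun x => - f x)}.
Proof. by move=> cf x; exact: cvgN (cf x). Qed.

Lemma withinB A f g : {within A, continuous f} -> {within A, continuous g} ->
  {within A, continuous (fun x => f x - g x)}.
Proof. by move=> cf cg; apply: withinD => //; exact: withinN. Qed.

Lemma withinM A f g : {within A, continuous f} -> {within A, continuous g} ->
  {within A, continuous (fun x => f x * g x)}.
Proof. by move=> cf cg x; exact: cvgM (cf x) (cg x). Qed.

Lemma withinX A f n : {within A, continuous f} -> {within A, continuous (fun x => f x ^+ n)}.
Proof. by move=> cf; apply: (@within_comp A (fun y => y ^+ n) f) => // x _; exact: exprn_continuous. Qed.

Lemma withinV A f : {within A, continuous f} -> (forall x, A x -> f x != 0) ->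
  {within A, continuous (fun x => (f x)^-1)}.
Proof. by move=> cf f0; apply: (@within_comp A (fun y => y^-1) f) => // x /f0 fx; exact: cvgV fx cvg_id. Qed.

Lemma eq_within A f g : {in A, f =1 g} -> {within A, continuous f} -> {within A, continuous g}.
Proof. exact: subspace_eq_continuous. Qed.

End WithinCalculus.

(** * Differentiation relative to (0, 1] *)

Section HalfOpenInterval.
Context {R : realType}.
Local Notation A := (`]0%R, 1%R]%classic : set R).
Implicit Types (F G : R -> R) (x y l : R).

Lemma oc_itv x : A x <-> 0 < x <= 1.
Proof. by rewrite /= in_itv. Qed.

Lemma within_oc F a : 0 < a -> {within A, continuous F} -> {within `[a, 1], continuous F}.
Proof.
move=> a0 /continuous_withinP cF; apply/continuous_withinP => x /=.
rewrite in_itv/= => /andP[ax x1] e e0.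
have [|d d0 H] := cF x _ e e0; first by apply/oc_itv; rewrite (lt_le_trans a0).
exists d => // y /=; rewrite in_itv/= => /andP[ay y1] yd; apply: H => //.
by apply/oc_itv; rewrite (lt_le_trans a0).
Qed.

Lemma oc_within F : (forall a : R, 0 < a < 1 -> {within `[a, 1], continuous F}) ->
  {within A, continuous F}.
Proof.
move=> cF; apply/continuous_withinP => x /oc_itv/andP[x0 x1] e e0.
have x2 : 0 < x / 2 < 1 by apply/andP; split; lra.
have [|d d0 H] := (continuous_withinP _ _).1 (cF _ x2) x _ e e0.
  by rewrite /= in_itv/= x1 andbT; lra.
exists (Num.min d (x / 2)); first by rewrite lt_min d0; case/andP: x2.
move=> y /oc_itv/andP[y0 y1]; rewrite lt_min => /andP[yd]; rewrite ltr_norml => /andP[y2 _].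
by apply: H => //; rewrite /= in_itv/= y1 andbT; lra.
Qed.

Lemma within_oc_at F x : 0 < x < 1 -> {within A, continuous F} -> {for x, continuous F}.
Proof.
move=> /andP[x0 x1] /(within_oc (divr_gt0 x0 (ltr0n _ 2))); apply: within_at_itv.
by rewrite x1 andbT; lra.
Qed.

(** Only points of (0, 1] are compared, so at 1 this is the left derivative, in agreement with
    [deriv_on]. *)
Definition derives_oc F x l := forall e : R, 0 < e -> exists2 d : R, 0 < d &
  forall y, 0 < y <= 1 -> `|y - x| < d -> `|F y - F x - l * (y - x)| <= e * `|y - x|.

Lemma derives_oc_cvg F x l : derives_oc F x l ->
  (F y - F x) / (y - x) @[y --> within A x^'] --> l.
Proof.
move=> H; apply/cvgrPdist_le => e e0;  have [d d0 Hd] := H e e0.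
rewrite /within/=; apply/nbhs_ballP; exists d => //= y.
rewrite /ball/= distrC => yd yx /oc_itv Ay.
have yx0 : 0 < `|y - x| by rewrite normr_gt0 subr_eq0.
have yx1 : y - x != 0 by rewrite -normr_gt0.
rewrite distrC -[l](mulfK yx1) -mulrBl normrM normfV.
by rewrite ler_pdivrMr//; exact: Hd.
Qed.

(** Points slightly to the left of [x] belong to (0, 1] even for x = 1. Properness makes the limit
    in [deriv_on] unique. *)
Lemma within_oc_proper x : 0 < x <= 1 -> ProperFilter (within A x^').
Proof.
move=> /andP[x0 x1]; apply: Build_ProperFilter_ex => P.
rewrite /within/= => /nbhs_ballP[d /= d0 H].
pose m := Num.min (d / 2) (x / 2).
have m0 : 0 < m by rewrite lt_min !divr_gt0.
have md : m <= d / 2 by rewrite ge_min lexx.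
have mx : m <= x / 2 by rewrite ge_min lexx orbT.
exists (x - m); apply: (H (x - m)).
- by rewrite /ball/= opprB addrCA subrr addr0 gtr0_norm//; lra.
- by rewrite -subr_eq0 addrAC subrr sub0r oppr_eq0 gt_eqF.
- by apply/oc_itv; apply/andP; split; lra.
Qed.

Lemma derives_oc_deriv F x l : 0 < x <= 1 -> derives_oc F x l ->
  derivable_on A F x /\ deriv_on A F x = l.
Proof.
move=> x01 /derives_oc_cvg H; split; first by apply/cvg_ex; exists l.
by have := within_oc_proper x01 => ?; apply: cvg_lim.
Qed.

Lemma derives_oc_is_derive F x l : 0 < x < 1 -> derives_oc F x l -> is_derive x 1 F l.
Proof.
move=> /andP[x0 x1] H; apply/is_deriveP => e e0; have [d d0 Hd] := H e e0.
exists (Num.min d (Num.min x (1 - x))); first by rewrite !lt_min d0 x0/= subr_gt0.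
move=> y; rewrite !lt_min => /and3P[yd y1 y2]; apply: Hd => //.
by move: y1 y2; rewrite !ltr_norml => /andP[? ?] /andP[? ?]; apply/andP; split; lra.
Qed.

Lemma C1_oc F G : {within A, continuous G} ->
  (forall x, 0 < x <= 1 -> derives_oc F x (G x)) ->
  C1_on A F /\ (forall x, 0 < x <= 1 -> deriv_on A F x = G x).
Proof.
move=> cG H; have E x : 0 < x <= 1 -> deriv_on A F x = G x.
  by move=> x01; have [] := derives_oc_deriv x01 (H x x01).
split => //; split.
  by move=> x /oc_itv x01; have [] := derives_oc_deriv x01 (H x x01).
apply/continuous_withinP => x Ax e e0.
have [d d0 Hd] := (continuous_withinP _ _).1 cG x Ax e e0.
by exists d => // y Ay yd; rewrite !E; [exact: Hd|exact/oc_itv|exact/oc_itv].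
Qed.

Lemma derives_oc_itg F G : {within A, continuous G} ->
  (forall x y, 0 < x -> x <= y -> y <= 1 -> F y - F x = itg x y G) ->
  forall x, 0 < x <= 1 -> derives_oc F x (G x).
Proof.
move=> cG FG x /andP[x0 x1] e e0.
have [|d d0 H] := (continuous_withinP _ _).1 cG x _ e e0; first by apply/oc_itv; rewrite x0.
have key (a b : R) : 0 < a -> a <= b -> b <= 1 -> (forall z : R, a <= z <= b -> `|z - x| < d) ->
    `|F b - F a - G x * (b - a)| <= e * (b - a).
  move=> a0 ab b1 near_x.
  have iG : intg a b G.
    apply: (intgS (lexx a) b1 (intg_cont _)); exact: within_oc.
  rewrite FG// -itg_cst// -itgB//; last exact: intg_cst.
  apply: itg_bound => //; first by apply: intgB => //; exact: intg_cst.
  move=> z /[dup] zab /andP[az zb]; apply: H; last exact: near_x.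
  by apply/oc_itv; rewrite (lt_le_trans a0)//= (le_trans zb).
exists d => // y /andP[y0 y1] yd.
have [xy|yx] := leP x y.
  rewrite [`|y - x|]ger0_norm ?subr_ge0//; apply: key => // z /andP[xz zy].
  by move: yd; rewrite !ltr_norml => /andP[? ?]; apply/andP; split; lra.
rewrite -normrN (_ : - (F y - F x - G x * (y - x)) = F x - F y - G x * (x - y)); last by ring.
rewrite [`|y - x|]distrC [`|x - y|]gtr0_norm ?subr_gt0//; apply: key => //; first exact: ltW.
move=> z /andP[yz zx].
by move: yd; rewrite !ltr_norml => /andP[? ?]; apply/andP; split; lra.
Qed.

End HalfOpenInterval.

(** * Continuity of the radial stretch *)

Section StretchRegularity.
Context {R : realType}.
Local Notation mu := (@lebesgue_measure R).
Local Notation A := (`]0%R, 1%R]%classic : set R).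
Variables (psi dpsi h dh : R -> R) (d0 K gamma0 : R) (r dr v dv : R -> R).
Hypotheses (psi_der : forall x : R, 0 < x -> is_derive x 1 psi (dpsi x))
  (dpsi_cont : forall x : R, 0 < x -> {for x, continuous dpsi})
  (dpsi_mono : forall x y : R, 0 < x -> x <= y -> dpsi x <= dpsi y)
  (psi_ge0 : forall x : R, 0 < x -> 0 <= psi x)
  (h_der : forall x : R, 0 < x -> is_derive x 1 h (dh x))
  (dh_cont : forall x : R, 0 < x -> {for x, continuous dh})
  (dh_mono : forall x y : R, 0 < x -> x < y -> dh x < dh y)
  (dh_0 : forall M : R, exists2 e : R, 0 < e & forall d, 0 < d -> d < e -> dh d <= M)
  (dh_oo : forall M : R, exists2 D : R, 0 < D & forall d, D <= d -> M <= dh d)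
  (h_min : forall x : R, 0 < x -> h d0 <= h x)
  (K_gt0 : 0 < K) (gamma0_gt0 : 0 < gamma0)
  (psi_bound : forall s k : R, 0 < s -> `|k - 1| <= gamma0 -> `|s * dpsi (k * s)| <= K * psi s)
  (pr : primitive_on 0 1 r dr) (pv : primitive_on 0 1 v dv)
  (r_gt0 : forall x : R, 0 < x <= 1 -> 0 < r x)
  (adm : forall x : R, 0 < x <= 1 -> admissible r dr v x)
  (iA : intg 0 1 (elastic psi h r dr v))
  (r_min : forall (a : R) (s ds : R -> R), 0 < a < 1 -> primitive_on a 1 s ds ->
     s a = r a -> s 1 = r 1 -> intg a 1 (elastic psi h s ds v) ->
     (forall x : R, a <= x <= 1 -> admissible s ds v x) ->
     itg a 1 (elastic psi h r dr v) <= itg a 1 (elastic psi h s ds v)).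

Let dd x := dr x * (r x / x) ^+ 2 - v x.
Let P x := x ^+ 2 * dpsi (dr x) / r x ^+ 2 + dh (dd x).
Let Q x := - 2 * x ^+ 2 * dr x * dpsi (dr x) / r x ^+ 3 + 2 * x * dpsi (r x / x) / r x ^+ 2.
(** The formal equation P' = Q says that this function is constant. *)
Let T x := P x + itg x 1 Q.

Let dr0 := dr_gt0 adm.
Let dd0 := dd_gt0 adm.
Let rm := r_mono pr adm.
Let drE' x : 0 < x <= 1 -> dr x = (dd x + v x) * x ^+ 2 / r x ^+ 2 := drE dr v r_gt0 (x:=x).
Let energy' := energy_part psi_ge0 h_min r_gt0 adm.

Section OnInterval.
Variable a : R.
Hypothesis a01 : 0 < a < 1.

Let a0 : 0 < a. Proof. by case/andP: a01. Qed.
Let a1 : a < 1. Proof. by case/andP: a01. Qed.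
Let inI x : a <= x <= 1 -> 0 < x <= 1.
Proof. by move=> /andP[ax ->]; rewrite (lt_le_trans a0). Qed.

Let pra := primitiveS (ltW a0) (lexx 1) pr.
Let pva := primitiveS (ltW a0) (lexx 1) pv.
Let cr := primitive_continuous (ltW a1) pra.
Let cv := primitive_continuous (ltW a1) pva.

Let mdr : measurable_fun `]a, 1[ dr. Proof. exact: intg_meas_oo pra.1. Qed.
Let mr : measurable_fun `]a, 1[ r. Proof. exact: within_measurable_oo. Qed.
Let mv : measurable_fun `]a, 1[ v. Proof. exact: within_measurable_oo. Qed.

Let ooI x : `]a, 1[%classic x -> 0 < x <= 1.
Proof. by rewrite /= in_itv/= => /andP[ax x1]; rewrite (lt_trans a0)//= ltW. Qed.

Let minv (n : nat) (f : R -> R) : measurable_fun `]a, 1[ f -> (forall x, 0 < x <= 1 -> 0 < f x) ->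
  measurable_fun `]a, 1[ (fun x => (f x ^+ n)^-1).
Proof.
move=> mf f0; apply: (@measurable_pos_comp _ _ (fun y => (y ^+ n)^-1)) => //.
  move=> x x0; apply: cvgV; first by rewrite expf_neq0// gt_eqF.
  exact: exprn_continuous.
by move=> x /ooI; exact: f0.
Qed.

Let mid : measurable_fun `]a, 1[ (fun x : R => x). Proof. exact: measurable_id. Qed.
Let mquot : measurable_fun `]a, 1[ (fun x => r x / x).
Proof.
apply: measurable_funM => //.
by apply: (@minv 1 (fun x => x) mid) => x /andP[].
Qed.

Let mpsi (f : R -> R) : measurable_fun `]a, 1[ f -> (forall x, 0 < x <= 1 -> 0 < f x) ->
  measurable_fun `]a, 1[ (fun x => dpsi (f x)).
Proof.
move=> mf f0; apply: measurable_pos_comp => //.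
by move=> x /ooI; exact: f0.
Qed.

Let mQ : measurable_fun `]a, 1[ Q.
Proof.
have q0 x : 0 < x <= 1 -> 0 < r x / x.
  by move=> x01; rewrite divr_gt0 ?r_gt0//; case/andP: x01.
apply: measurable_funD.
  apply: measurable_funM; last exact: minv.
  apply: measurable_funM; last exact: mpsi.
  by apply: measurable_funM => //; apply: measurable_funM.
apply: measurable_funM; last exact: minv.
by apply: measurable_funM; [apply: measurable_funM|exact: mpsi].
Qed.

(** [Q] contains only s psi'(s) for s = r' and s = r / x, so the growth condition with factor 1
    bounds it by the energy density. *)
Lemma intg_Q : intg a 1 Q.
Proof.
pose ra := r a; have ra0 : 0 < ra by rewrite r_gt0// a0 ltW.
apply: (@intg_bound_oo _ _ _ (4 * K / ra ^+ 3) _ (fun x => elastic psi h r dr v x + `|h d0|)) => //.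
  by apply: intgD; [exact: intgS (ltW a0) (lexx 1) iA|exact: intg_cst].
move=> x /andP[ax x1]; have x01 : 0 < x <= 1 by rewrite (lt_trans a0)//= ltW.
have x0 : 0 < x by case/andP: x01.
have rx := r_gt0 x01; have drx := dr0 x01.
have rar : ra <= r x by apply: rm => //; exact: ltW.
have K0 := K_gt0; have q0 : 0 < r x / x by rewrite divr_gt0.
have g1 : `|(1 : R) - 1| <= gamma0 by rewrite subrr normr0 ltW.
have p1 := psi_bound drx g1; have p2 := psi_bound q0 g1.
rewrite mul1r in p1; rewrite mul1r in p2.
have [/andP[e1 e1'] /andP[e2 e2']] := energy' x01.
set EN := elastic psi h r dr v x + `|h d0| in e1 e1' e2 e2' *.
have i3 : (r x ^+ 3)^-1 <= (ra ^+ 3)^-1.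
  by rewrite lef_pV2 ?posrE ?exprn_gt0// ler_pXn2r// nnegrE ltW.
have i0 : 0 <= (r x ^+ 3)^-1 by rewrite invr_ge0 exprn_ge0// ltW.
have x2 : 0 <= x ^+ 2 by rewrite sqr_ge0.
have -> : Q x = 2 * (x ^+ 2 * (r x / x * dpsi (r x / x)) - x ^+ 2 * (dr x * dpsi (dr x))) * (r x ^+ 3)^-1.
  by rewrite /Q; field; rewrite !gt_eqF.
have b1 : `|x ^+ 2 * (dr x * dpsi (dr x))| <= K * EN.
  rewrite normrM (ger0_norm x2) (le_trans (ler_wpM2l x2 p1))// mulrCA ler_wpM2l//; exact: ltW.
have b2 : `|x ^+ 2 * (r x / x * dpsi (r x / x))| <= K * EN.
  rewrite normrM (ger0_norm x2) (le_trans (ler_wpM2l x2 p2))// mulrCA ler_wpM2l//; exact: ltW.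
rewrite normrM (ger0_norm i0) normrM gtr0_norm// (_ : 4 * K / ra ^+ 3 * EN = 2 * (K * EN + K * EN) * (ra ^+ 3)^-1); last by ring.
apply: ler_pM => //.
by rewrite ler_pM2l// (le_trans (ler_normB _ _))// lerD.
Qed.

Let mP : measurable_fun `]a, 1[ P.
Proof.
apply: measurable_funD.
  apply: measurable_funM; last exact: minv.
  by apply: measurable_funM; [exact: measurable_funX|exact: mpsi].
apply: measurable_pos_comp => //.
- by apply: measurable_funB => //; apply: measurable_funM => //; exact: measurable_funX.
- by move=> x /ooI; exact: dd0.
Qed.

Let iQ := intg_Q.

Let sv := @stretch_variation _ psi dpsi h dh d0 K gamma0 r dr v dv psi_der
  psi_ge0 h_der dh_mono h_min K_gt0 gamma0_gt0 psi_bound pr pv r_gt0 adm iA r_min a.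

(** The du Bois-Reymond argument on the band delta <= d <= 1 / delta, where [T] is bounded: the test
    function is T minus its mean over the band, cut off outside it, and its square turns out to have
    integral zero. *)
Lemma T_const_on (delta : R) : 0 < delta ->
  exists m : R, {ae mu, forall x : R, a < x < 1 -> delta <= dd x <= delta^-1 -> T x = m}.
Proof.
move=> del0; pose ra := r a.
have aI : 0 < a <= 1 by rewrite a0 ltW.
have ra0 : 0 < ra by rewrite r_gt0.
pose e (x : R) : R := if (a < x < 1) && (delta <= dd x <= delta^-1) then 1 else 0.
have mdd : measurable_fun `]a, 1[ dd.
  by apply: measurable_funB => //; apply: measurable_funM => //; exact: measurable_funX.
have me : measurable_fun `]a, 1[ e.
  pose D : set R := `]a, 1[ `&` dd @^-1` `[delta, delta^-1].
  have mD : measurable D by apply: mdd.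
  have -> : e = \1_D.
    apply/funext => x; rewrite indicE /e; have [H|H] := ifPn.
      by rewrite mem_set//; case/andP: H => H1 H2; split; rewrite /= in_itv.
    rewrite memNset// => -[/=]; rewrite !in_itv/= => H1 H2.
    by move: H; rewrite H1 H2.
  exact: measurable_indic.
pose q x := itg a x Q.
have pq : primitive_on a 1 q Q by split => // x _; rewrite /q itg1 add0r.
have TE x : a <= x <= 1 -> T x = P x + (q 1 - q x).
  by move=> /andP[ax x1]; rewrite /T (primitive_sub pq).
have cq := primitive_continuous (ltW a1) pq.
have mT : measurable_fun `]a, 1[ T.
  apply: (@eq_measurable_fun _ _ _ _ _ (fun x => P x + (q 1 - q x))).
    by move=> x; rewrite inE/= in_itv/= => /andP[ax x1]; rewrite TE// !ltW.
  by apply: measurable_funD mP _; apply: measurable_funB => //; exact: within_measurable_oo.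
have [B TB] : exists B, forall x, a <= x <= 1 -> delta <= dd x <= delta^-1 -> `|T x| <= B.
  have [Bq Hq] := within_bounded (ltW a1) cq.
  have [Bv Hv] := within_bounded (ltW a1) cv.
  pose lo := delta * a ^+ 2 / r 1 ^+ 2; pose hi := (delta^-1 + Bv) / ra ^+ 2.
  have r1 : 0 < r 1 by rewrite r_gt0// ltr01 lexx.
  have lo0 : 0 < lo by rewrite divr_gt0 ?mulr_gt0 ?exprn_gt0.
  exists ((`|dpsi lo| + `|dpsi hi|) / ra ^+ 2 + (`|dh delta| + `|dh delta^-1|) + (`|q 1| + Bq)).
  move=> x xI /andP[E1 E2]; have x01 := inI xI; have rx := r_gt0 x01.
  have x0 : 0 < x by case/andP: x01.
  case/andP: (xI) => ax x1.
  have rar : ra <= r x by exact: rm.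
  have rr1 : r x <= r 1 by exact: rm.
  have drx := dr0 x01; have v0 := v_ge0 adm x01.
  have vB : v x <= Bv := le_trans (ler_norm _) (Hv x xI).
  have ra2 : ra ^+ 2 <= r x ^+ 2 by rewrite ler_pXn2r// nnegrE ltW.
  have r12 : r x ^+ 2 <= r 1 ^+ 2 by rewrite ler_pXn2r// nnegrE ltW.
  have a2 : a ^+ 2 <= x ^+ 2 by rewrite ler_pXn2r// nnegrE ltW.
  have x21 : x ^+ 2 <= 1 by rewrite expr_le1// ltW.
  have x2 : 0 < x ^+ 2 by rewrite exprn_gt0.
  have rx2 : 0 < r x ^+ 2 by rewrite exprn_gt0.
  have ra20 : 0 < ra ^+ 2 by rewrite exprn_gt0.
  have lod : lo <= dr x.
    rewrite (drE' x01) ler_pdivlMr// /lo mulrAC ler_pdivrMr ?exprn_gt0//.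
    apply: ler_pM; [|exact: ltW|by apply: ler_pM; rewrite ?sqr_ge0 ?(ltW del0)//; lra|by []].
    by rewrite mulr_ge0 ?sqr_ge0// ltW.
  have hid : dr x <= hi.
    rewrite (drE' x01).
    have s0 : 0 <= dd x + v x by apply: addr_ge0 => //; apply/ltW/dd0.
    apply: ler_pM; [by apply: mulr_ge0 => //; exact: ltW|by rewrite invr_ge0 ltW| |by rewrite lef_pV2].
    by rewrite -[leRHS]mulr1; apply: ler_pM => //; [exact: ltW|exact: lerD].
  have m1 := dpsi_mono lo0 lod; have m2 := dpsi_mono drx hid.
  have dhm (y z : R) : 0 < y -> y <= z -> dh y <= dh z.
    by move=> y0; rewrite le_eqVlt => /predU1P[->//|yz]; exact/ltW/dh_mono.
  have m3 := dhm _ _ del0 E1; have m4 := dhm _ _ (dd0 x01) E2.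
  have sand (u y z : R) : y <= u -> u <= z -> `|u| <= `|y| + `|z|.
    move=> yu uz; have n1 := ler_norm (- y); rewrite normrN in n1.
    have n2 := ler_norm z; have n3 := normr_ge0 y; have n4 := normr_ge0 z.
    by rewrite ler_norml; apply/andP; split; lra.
  rewrite TE// /P (le_trans (ler_normD _ _))// lerD//; last first.
    by rewrite (le_trans (ler_normB _ _))// lerD2l Hq.
  rewrite (le_trans (ler_normD _ _))// lerD//; last exact: sand.
  rewrite normrM normfV (gtr0_norm rx2); apply: ler_pM; rewrite ?invr_ge0 ?(ltW rx2)//.
    rewrite normrM -[leRHS]mul1r (gtr0_norm x2); apply: ler_pM; rewrite ?(ltW x2)//.
    exact: sand.
  by rewrite lef_pV2.
have ie : intg a 1 e.
  apply: (@intg_bound_oo _ _ _ 1 _ (fun=> 1)) => //; first exact: intg_cst.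
  by move=> x _; rewrite /e; case: ifP; rewrite ?normr1 ?normr0 ?mulr1.
have B0 : 0 <= `|B| by [].
have iTe : intg a 1 (fun x => T x * e x).
  apply: (@intg_bound_oo _ _ _ `|B| _ (fun=> 1)) => //; first exact: measurable_funM.
    exact: intg_cst.
  move=> x /andP[ax x1]; rewrite /e; case: ifP => [/andP[_ E]|_]; last by rewrite mulr0 normr0 mulr1.
  by rewrite !mulr1 (le_trans (TB _ _ E))// ?ler_norm// !ltW.
(* If the band is a null set, any constant will do. *)
have [e0|e0] := eqVneq (itg a 1 e) 0.
  exists 0; apply: ae_imp (itg_ge0_eq0 ie _ e0) => [x H|x _]; last by rewrite /e; case: ifP.
  move=> /andP[ax x1] E; have /H : a <= x <= 1 by rewrite !ltW.
  by rewrite /e ax x1 E/= => /eqP; rewrite oner_eq0.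
pose m := itg a 1 (fun x => T x * e x) / itg a 1 e.
exists m.
pose g (x : R) := (T x - m) * e x.
have gE : g = (fun x => T x * e x - m * e x) by apply/funext => x; rewrite /g mulrBl.
have ig : intg a 1 g by rewrite gE; apply: intgB => //; exact: intgZ.
have g_mean : itg a 1 g = 0.
  by rewrite gE itgB//; [rewrite itgZ// /m divfK// subrr|exact: intgZ].
have gB (x : R) : a <= x <= 1 -> `|g x| <= `|B| + `|m|.
  move=> xI; rewrite /g /e; case: ifP => [/andP[_ E]|_]; last by rewrite mulr0 normr0 addr_ge0.
  by rewrite mulr1 (le_trans (ler_normB _ _))// lerD2r (le_trans (TB _ xI E))// ler_norm.
have g_out (x : R) : a <= x <= 1 -> ~~ (delta <= dd x <= delta^-1) -> g x = 0.
  by move=> _ E; rewrite /g /e (negbTE E) andbF mulr0.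
have G0 : 0 < `|B| + `|m| + 1 by rewrite ltr_wpDl// addr_ge0.
have gB' (x : R) : a <= x <= 1 -> `|g x| <= `|B| + `|m| + 1.
  by move=> /gB /le_trans; apply; rewrite lerDl.
pose rho x := itg a x g.
have V : itg a 1 (fun x => P x * g x + Q x * rho x) = 0.
  exact: sv a01 del0 G0 (intg_meas ig) gB' g_out g_mean.
have prho : primitive_on a 1 rho g by split => // x _; rewrite /rho itg1 add0r.
have [ipq qr] := primitive_mul (ltW a1) pq prho.
have iqg : intg a 1 (fun x => q x * g x).
  apply: (eq_intg (f := fun x => g x * q x)); first by move=> x _; rewrite mulrC.
  by apply: intg_mul_cont => //; exact: ltW.
have mg : measurable_fun `]a, 1[ g.
  by apply: measurable_funM => //; exact: measurable_funB.
have iTg : intg a 1 (fun x => T x * g x).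
  apply: (@intg_bound_oo _ _ _ (`|B| * (`|B| + `|m|)) _ (fun=> 1)).
  - exact: measurable_funM.
  - exact: intg_cst.
  move=> x /andP[ax x1]; have xI : a <= x <= 1 by rewrite !ltW.
  have [E|E] := boolP (delta <= dd x <= delta^-1); last first.
    by rewrite g_out// mulr0 normr0 mulr1 mulr_ge0// addr_ge0.
  rewrite mulr1 normrM; apply: ler_pM => //; last exact: gB.
  by rewrite (le_trans (TB _ xI E))// ler_norm.
have iPg : intg a 1 (fun x => P x * g x).
  apply: (@eq_intg _ _ _ (fun x => T x * g x + - q 1 * g x + q x * g x)).
    by move=> x; rewrite in_itv/= => xI; rewrite TE//; ring.
  by apply: intgD => //; apply: intgD => //; exact: intgZ.
have iQr : intg a 1 (fun x => Q x * rho x).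
  apply: intg_mul_cont => //; [exact: ltW|exact: primitive_continuous (ltW a1) prho].
(* [q] vanishes at [a] and [rho] at 1, so no boundary terms appear and the variational identity
   becomes int T g = 0. *)
have E1 : itg a 1 (fun x => Q x * rho x) = - itg a 1 (fun x => q x * g x).
  have qa : q a = 0 by rewrite /q itg1.
  have rho1 : rho 1 = 0 by [].
  by rewrite (itg_by_parts (ltW a1) pq prho) rho1 qa mulr0 mul0r subrr sub0r opprK.
have E2 : itg a 1 (fun x => T x * g x) = 0.
  rewrite (@eq_itg _ _ _ _ (fun x => (P x * g x + - (q x * g x)) + q 1 * g x)); last first.
    by move=> x; rewrite in_itv/= => xI; rewrite TE//; ring.
  rewrite itgD; [|by apply: intgD => //; exact: intgN|exact: intgZ].
  rewrite itgD//; last exact: intgN.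
  by rewrite itgN// itgZ// g_mean mulr0 addr0 -E1 -V itgD.
(* The indicator is idempotent, so g^2 = (T - m) g. *)
have g2E : (fun x => g x ^+ 2) = (fun x => T x * g x - m * g x).
  apply/funext => x; rewrite -mulrBl /g /e expr2.
  by case: ifP; rewrite ?mulr1 ?mulr0.
have ig2 : intg a 1 (fun x => g x ^+ 2).
  by rewrite g2E; apply: intgB => //; exact: intgZ.
have E3 : itg a 1 (fun x => g x ^+ 2) = 0.
  by rewrite g2E itgB//; [rewrite itgZ// g_mean E2 mulr0 subrr|exact: intgZ].
have := itg_ge0_eq0 ig2 (fun x _ => sqr_ge0 _) E3; apply: ae_imp => x H /andP[ax x1] E.
have /H/eqP : a <= x <= 1 by rewrite !ltW.
by rewrite sqrf_eq0 /g /e ax x1 E/= mulr1 subr_eq0 => /eqP.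
Qed.

End OnInterval.
Let band (d : R) : 0 < d -> exists N : nat, forall n, (N <= n)%N ->
  (n.+2%:R)^-1 < d /\ d <= (n.+2%:R^-1)^-1.
Proof.
move=> d0'; have dv0 : 0 < d^-1 by rewrite invr_gt0.
exists (Num.bound (d + d^-1)) => n Nn.
have h1 : d + d^-1 < n.+2%:R.
  apply: lt_le_trans (archi_boundP _) _; first by rewrite addr_ge0// ltW.
  by rewrite ler_nat (leq_trans Nn)// ltnW.
split; last by rewrite invrK; lra.
by rewrite invf_plt ?posrE//; lra.
Qed.

(** The bands increase as delta decreases, and a point of one band that is good for all of them
    forces all later constants to agree. The same argument, with the left ends 1 / (n + 2) in place
    of the bands, removes [a]. *)
Lemma T_const : exists m : R, {ae mu, forall x : R, 0 < x < 1 -> T x = m}.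
Proof.
have step (a : R) : 0 < a < 1 -> exists m : R, {ae mu, forall x : R, a < x < 1 -> T x = m}.
  move=> a01; have /choice[mn Hn] (n : nat) : exists m : R, {ae mu, forall x : R, a < x < 1 ->
      (n.+2%:R)^-1 <= dd x <= (n.+2%:R^-1)^-1 -> T x = m}.
    by apply: T_const_on => //; rewrite invr_gt0.
  have a0 : 0 < a by case/andP: a01.
  have H := ae_forall Hn.
  have [x0 x0I Hx0] := ae_ex (proj2 (andP a01)) H.
  have inI x : a < x < 1 -> 0 < x <= 1 by move=> /andP[ax /ltW->]; rewrite (lt_trans a0).
  have [N HN] := band (dd0 (inI x0 x0I)).
  exists (mn N); apply: ae_imp H => x Hx xI.
  have [M HM] := band (dd0 (inI x xI)).
  have [l1 l2] := HM _ (leq_maxr N M); have [l3 l4] := HN _ (leq_maxl N M).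
  have [l5 l6] := HN N (leqnn N).
  rewrite (Hx (maxn N M) xI) ?(ltW l1)// -(Hx0 (maxn N M) x0I) ?(ltW l3)//.
  by rewrite (Hx0 N x0I) ?(ltW l5).
have hn n : 0 < (n.+2%:R^-1 : R) < 1 by rewrite invr_gt0 ltr0n/= invf_lt1 ?ltr0n// ltr1n.
have /choice[mk Hk] (n : nat) := step _ (hn n).
have H := ae_forall Hk; have h2 : (2^-1 : R) < 1 by rewrite invf_lt1 ?ltr0n// ltr1n.
have [x0 /andP[x0a x01] Hx0] := ae_ex h2 H.
exists (mk 0%N); apply: ae_imp H => x Hx /andP[x0' x1].
have [N HN] := band x0'; have [l1 _] := HN N (leqnn N).
rewrite (Hx N) ?l1// -(Hx0 N) ?(Hx0 0%N) ?x0a ?x01//.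
rewrite andbT; apply: le_lt_trans x0a.
by rewrite lef_pV2 ?posrE ?ltr0n// ler_nat.
Qed.

(** At each x the identity for [T] is solved for the determinant [d] rather than for the stretch:
    [d] ranges over all of (0, oo), whereas the range of admissible stretches varies with x. The
    root exists at every x and is continuous, and it coincides with the determinant of the minimizer
    wherever the identity holds; [sg] is the stretch belonging to it. *)
Lemma stretch_regularity : exists (sg : R -> R) (m : R),
  [/\ {within A, continuous sg},
      forall x : R, 0 < x <= 1 -> admissible r sg v x,
      forall a : R, 0 < a < 1 -> primitive_on a 1 r sg,
      {ae mu, forall x : R, 0 < x < 1 -> dr x = sg x} &
      forall x : R, 0 < x <= 1 ->
        x ^+ 2 * dpsi (sg x) / r x ^+ 2 + dh (sg x * (r x / x) ^+ 2 - v x) =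
        m - itg x 1 (fun x => - 2 * x ^+ 2 * sg x * dpsi (sg x) / r x ^+ 3
                              + 2 * x * dpsi (r x / x) / r x ^+ 2)].
Proof.
have [m Tm] := T_const.
have cv : {within A, continuous v}.
  by apply: oc_within => a /andP[a0 a1]; apply: (primitive_continuous (ltW a1) (primitiveS (ltW a0) (lexx 1) pv)).
have cr : {within A, continuous r}.
  by apply: oc_within => a /andP[a0 a1]; apply: (primitive_continuous (ltW a1) (primitiveS (ltW a0) (lexx 1) pr)).
pose w d x := (d + v x) * x ^+ 2 / r x ^+ 2.
pose G x d := x ^+ 2 * dpsi (w d x) / r x ^+ 2 + dh d.
pose p x := m - itg x 1 Q.
have x2r2 x : 0 < x <= 1 -> 0 < x ^+ 2 /\ 0 < r x ^+ 2.
  by move=> x01; rewrite !exprn_gt0 ?r_gt0//; case/andP: x01.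
have w0 d x : 0 < d -> 0 < x <= 1 -> 0 < w d x.
  move=> d0' x01; have [x2 r2] := x2r2 x x01.
  by apply: divr_gt0 => //; apply: mulr_gt0 => //; rewrite ltr_wpDr// (v_ge0 adm).
have wm d1 d2 x : d1 <= d2 -> 0 < x <= 1 -> w d1 x <= w d2 x.
  move=> d12 x01; have [x2 r2] := x2r2 x x01.
  by rewrite /w ler_pM2r ?invr_gt0// ler_pM2r// lerD2r.
have Gm x : A x -> forall d1 d2 : R, 0 < d1 -> d1 < d2 -> G x d1 < G x d2.
  move=> /oc_itv x01 d1 d2 d10 d12; have [x2 r2] := x2r2 x x01.
  rewrite /G ler_ltD//; last exact: dh_mono.
  rewrite ler_pM2r ?invr_gt0// ler_pM2l//.
  by apply: dpsi_mono; [exact: w0|apply: wm => //; exact: ltW].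
have AP x : A x -> 0 < x <= 1 by move=> /oc_itv.
have x2n x : A x -> x ^+ 2 != 0 by move=> /AP /x2r2[/lt0r_neq0].
have r2n x : A x -> r x ^+ 2 != 0 by move=> /AP /x2r2[_ /lt0r_neq0].
have cx2 : {within A, continuous (fun x : R => x ^+ 2)} by apply: withinX; exact: within_id.
have cr2 : {within A, continuous (fun x => (r x ^+ 2)^-1)} by apply: withinV => //; exact: withinX.
have cw d : {within A, continuous d} -> {within A, continuous (fun x => w (d x) x)}.
  by move=> cd; apply: withinM => //; apply: withinM => //; exact: withinD.
have cQ : {within A, continuous (fun x => itg x 1 Q)}.
  apply: oc_within => a a01; have iQ := intg_Q a01.
  have pq : primitive_on a 1 (fun x => itg a x Q) Q by split => // x _; rewrite itg1 add0r.
  apply: (@eq_within _ _ (fun x => itg a 1 Q - itg a x Q)).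
    by move=> x; rewrite inE/= in_itv/= => /andP[ax x1]; rewrite (primitive_sub pq).
  apply: withinB; first exact: within_cst.
  by apply: primitive_continuous pq; case/andP: a01 => _ /ltW.
have cG d : 0 < d -> {within A, continuous (fun x => G x d - p x)}.
  move=> d0'; apply: withinB; last by apply: withinB => //; exact: within_cst.
  apply: withinD; last exact: within_cst.
  apply: withinM => //; apply: withinM => //.
  apply: (@within_comp _ _ dpsi (w d)); first by apply: cw; exact: within_cst.
  by move=> x /AP x01; apply: dpsi_cont; exact: w0.
(* The [psi'] term is monotone in [d], so on either side of d = 1 it is bounded by its value there
   and h' -> -oo, +oo decides. *)
have Gex x : A x -> exists2 d : R, 0 < d & G x d = p x.
  move=> /AP x01; have [x2 r2] := x2r2 x x01.
  pose c1 := x ^+ 2 * dpsi (w 1 x) / r x ^+ 2.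
  have le_part d1 d2 : 0 < d1 -> d1 <= d2 ->
      x ^+ 2 * dpsi (w d1 x) / r x ^+ 2 <= x ^+ 2 * dpsi (w d2 x) / r x ^+ 2.
    move=> d10 d12; rewrite ler_pM2r ?invr_gt0// ler_pM2l//.
    by apply: dpsi_mono; [exact: w0|exact: wm].
  have [e e0 He] := dh_0 (p x - c1); have [D D0 HD] := dh_oo (p x - c1).
  pose d1 := Num.min (e / 2) 1; pose d2 := Num.max D 1.
  have d10 : 0 < d1 by rewrite lt_min divr_gt0/=.
  have d1e : d1 < e by apply: (@le_lt_trans _ _ (e / 2)); [rewrite ge_min lexx|lra].
  have d11 : d1 <= 1 by rewrite ge_min lexx orbT.
  have d21 : 1 <= d2 by rewrite le_max lexx orbT.
  have d2D : D <= d2 by rewrite le_max lexx.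
  have g1 : G x d1 <= p x.
    by have := le_part _ _ d10 d11; have := He _ d10 d1e; rewrite /G -/c1; lra.
  have g2 : p x <= G x d2.
    by have := le_part _ _ ltr01 d21; have := HD _ d2D; rewrite /G -/c1; lra.
  have [|||d dI Gd] := @IVT _ (G x) d1 d2 (p x); first exact: le_trans d21.
  - have dpos d : `[d1, d2]%classic d -> 0 < d.
      by rewrite /= in_itv/= => /andP[/(lt_le_trans d10)].
    apply: withinD; last by apply: (@within_comp _ _ dh id) => [|d /dpos/dh_cont//]; exact: within_id.
    apply: withinM; last exact: within_cst.
    apply: withinM; first exact: within_cst.
    apply: (@within_comp _ _ dpsi (fun d => w d x)).
      apply: withinM; last exact: within_cst.
      apply: withinM; last exact: within_cst.
      by apply: withinD; [exact: within_id|exact: within_cst].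
    by move=> d /dpos d0'; apply: dpsi_cont; exact: w0.
  - by apply/andP; split; [rewrite ge_min g1|rewrite le_max g2 orbT].
  by exists d => //; move: dI; rewrite in_itv/= => /andP[/(lt_le_trans d10)].
have [s [Hs cs]] := implicit_monotone Gm Gex cG.
pose sg x := w (s x) x.
have csg : {within A, continuous sg} by exact: cw.
have sgE x : 0 < x <= 1 -> sg x * (r x / x) ^+ 2 - v x = s x.
  move=> x01; have [x2 r2] := x2r2 x x01; rewrite /sg /w; field.
  by apply/andP; split; rewrite gt_eqF ?r_gt0//; case/andP: x01.
have dds : {ae mu, forall x : R, 0 < x < 1 -> dr x = sg x}.
  apply: ae_imp Tm => x Tx /[dup] /Tx {}Tx /andP[x0 x1].
  have x01 : 0 < x <= 1 by rewrite x0 ltW.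
  have Ax : A x by exact/oc_itv.
  have ws : w (dd x) x = dr x by rewrite (drE' x01).
  have Gd : G x (dd x) = p x by rewrite /p -Tx /T /P /G ws addrK.
  have [s0 Gs] := Hs x Ax.
  have E : dd x = s x.
    case: (ltgtP (dd x) (s x)) => // [/(Gm x Ax _ _ (dd0 x01))|/(Gm x Ax _ _ s0)].
      by rewrite Gd Gs ltxx.
    by rewrite Gd Gs ltxx.
  by rewrite -ws E.
have psg a : 0 < a < 1 -> primitive_on a 1 r sg.
  move=> /andP[a0 a1]; apply: (primitive_ae (primitiveS (ltW a0) (lexx 1) pr)).
    apply: within_measurable_oo; exact: within_oc.
  by apply: ae_imp dds => x Hx /andP[ax x1]; apply: Hx; rewrite (lt_trans a0).
exists sg, m; split => //.
  move=> x x01; rewrite /admissible (v_ge0 adm)//= -subr_gt0 sgE//.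
  by have [] := Hs x ((oc_itv x).2 x01).
move=> x x01; rewrite sgE//.
(* It remains to exchange [dr] for [sg] under the integral, where they agree almost everywhere. *)
have [_ Gs] := Hs x ((oc_itv x).2 x01); rewrite -[LHS]/(G x (s x)) Gs /p; congr (_ - _).
case/andP: (x01) => x0; rewrite le_eqVlt => /predU1P[->|x1]; first by rewrite !itg1.
have xI : 0 < x < 1 by rewrite x0.
have oc z : x <= z <= 1 -> 0 < z <= 1 by move=> /andP[xz ->]; rewrite (lt_le_trans x0).
apply: (proj2 (ae_itg (intg_Q xI) _ _)).
  apply: (intg_meas (intg_cont (within_oc x0 _))).
  have cid := @within_id _ A.
  apply: withinD.
    apply: withinM; last first.
      apply: withinV; first exact: withinX.
      by move=> z /AP z01; rewrite expf_neq0// gt_eqF// r_gt0.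
    apply: withinM.
      by apply: withinM => //; apply: withinM => //; exact: within_cst.
    apply: (@within_comp _ _ dpsi sg) => // z /AP z01; apply: dpsi_cont; apply: w0 => //.
    by have [] := Hs z ((oc_itv z).2 z01).
  apply: withinM => //; apply: withinM; first by apply: withinM => //; exact: within_cst.
  apply: (@within_comp _ _ dpsi (fun x => r x / x)).
    by apply: withinM => //; apply: withinV => // z /AP/andP[z0 _]; rewrite gt_eqF.
  by move=> z /AP z01; apply: dpsi_cont; rewrite divr_gt0 ?r_gt0//; case/andP: z01.
apply: ae_imp (ae_and dds (@ae_neq R 1)) => z [Hz z1] /andP[xz z1'].
by rewrite /Q Hz// (lt_le_trans x0 xz)/= lt_neqAle z1.
Qed.

End StretchRegularity.

(** * Differentiability of the radial stress *)

Section StressRegularity.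
Context {R : realType}.
Local Notation A := (`]0%R, 1%R]%classic : set R).
Variables (dpsi dh r v sg : R -> R) (m : R).
Hypotheses (dpsi_cont : forall x : R, 0 < x -> {for x, continuous dpsi})
  (dh_cont : forall x : R, 0 < x -> {for x, continuous dh})
  (cv : {within A, continuous v}) (csg : {within A, continuous sg})
  (r_gt0 : forall x : R, 0 < x <= 1 -> 0 < r x)
  (adm : forall x : R, 0 < x <= 1 -> admissible r sg v x)
  (pr : forall a : R, 0 < a < 1 -> primitive_on a 1 r sg).

Let Q x := - 2 * x ^+ 2 * sg x * dpsi (sg x) / r x ^+ 3 + 2 * x * dpsi (r x / x) / r x ^+ 2.
Hypothesis eqn : forall x : R, 0 < x <= 1 ->
  x ^+ 2 * dpsi (sg x) / r x ^+ 2 + dh (sg x * (r x / x) ^+ 2 - v x) = m - itg x 1 Q.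

Let AP x : A x -> 0 < x <= 1. Proof. by move=> /oc_itv. Qed.
Let xn x : A x -> x != 0. Proof. by move=> /AP/andP[x0 _]; rewrite gt_eqF. Qed.

Lemma within_radius : {within A, continuous r}.
Proof.
apply: oc_within => a a01; have [_ a1] := andP a01.
exact: primitive_continuous (ltW a1) (pr a01).
Qed.

Lemma derives_oc_radius x : 0 < x <= 1 -> derives_oc r x (sg x).
Proof.
apply: derives_oc_itg => // y z y0 yz z1.
have a01 : 0 < y / 2 < 1 by apply/andP; split; lra.
by apply: (primitive_sub (pr a01)) => //; lra.
Qed.

Let cq : {within A, continuous (fun x => r x / x)}.
Proof.
apply: withinM; first exact: within_radius.
by apply: withinV; [exact: within_id|exact: xn].
Qed.

Lemma within_density : {within A, continuous (fun x => sg x * (r x / x) ^+ 2)}.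
Proof. by apply: withinM => //; exact: withinX. Qed.

Let q0 x : A x -> 0 < r x / x.
Proof. by move=> /AP x01; rewrite divr_gt0 ?r_gt0//; case/andP: x01. Qed.

(** This is 2x times the partial derivative of the stored energy in its second argument, the
    right-hand side of the equilibrium equation. *)
Let N x := 2 * x * (dpsi (r x / x) + dh (sg x * (r x / x) ^+ 2 - v x) * (sg x * (r x / x))).

Let cN : {within A, continuous N}.
Proof.
have cid := @within_id _ A.
apply: withinM; first by apply: withinM => //; exact: within_cst.
apply: withinD.
  by apply: (@within_comp _ _ dpsi (fun x => r x / x)) => // x /q0/dpsi_cont.
apply: withinM; last exact: withinM.
apply: (@within_comp _ _ dh (fun x => sg x * (r x / x) ^+ 2 - v x)).
  by apply: withinB => //; exact: within_density.
by move=> x /AP /adm/andP[_ ?]; apply: dh_cont; rewrite subr_gt0.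
Qed.

Let cQ : {within A, continuous Q}.
Proof.
have cid := @within_id _ A; have cr := within_radius.
have rn x k : A x -> r x ^+ k != 0 by move=> /AP x01; rewrite expf_neq0// gt_eqF// r_gt0.
apply: withinD.
  apply: withinM; last by apply: withinV => [|x /rn//]; exact: withinX.
  apply: withinM.
    by apply: withinM => //; apply: withinM; [exact: within_cst|exact: withinX].
  apply: (@within_comp _ _ dpsi sg) => // x /AP /[dup]/adm ax /andP[x0 _].
  by apply: dpsi_cont; exact: admissible_stretch ax.
apply: withinM; last by apply: withinV => [|x /rn//]; exact: withinX.
apply: withinM; first by apply: withinM => //; exact: within_cst.
by apply: (@within_comp _ _ dpsi (fun x => r x / x)) => // x /q0/dpsi_cont.
Qed.

(** The stress is r^2 times the left-hand side of [eqn], hence r^2 (m - int Q): a product of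
    functions with known continuous densities, so that [sg] never has to be differentiated. The
    product rule turns 2 r r' P + r^2 Q into [N]. *)
Lemma stress_regularity (S : R -> R) :
  (forall x : R, 0 < x <= 1 ->
     S x = x ^+ 2 * (dpsi (sg x) + dh (sg x * (r x / x) ^+ 2 - v x) * (r x / x) ^+ 2)) ->
  {within A, continuous N} /\ forall x, 0 < x <= 1 -> derives_oc S x (N x).
Proof.
move=> SE; split => // x x01; apply: derives_oc_itg => // y z y0 yz z1.
pose a := y / 2; have a01 : 0 < a < 1 by rewrite /a; apply/andP; split; lra.
have [a0 a1] := andP a01; have ay : a <= y by rewrite /a; lra.
have oc t : a <= t <= 1 -> 0 < t <= 1 by move=> /andP[h1 ->]; rewrite (lt_le_trans a0).
have iQ : intg a 1 Q by apply: intg_cont; exact: within_oc.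
have pQ : primitive_on a 1 (fun x => m - itg x 1 Q) Q.
  split => // t /andP[h1 h2].
  rewrite (itg_cat h1 h2 iQ); ring.
have pr2 := primitive_mul (ltW a1) (pr a01) (pr a01).
have pS : primitive_on a 1 S N.
  apply: eq_primitive (primitive_mul (ltW a1) pr2 pQ) => t; rewrite in_itv/= => /oc t01.
    rewrite -eqn// SE//; field; have rt := r_gt0 t01.
    by rewrite !gt_eqF//; case/andP: t01.
  rewrite -eqn// /N /Q; field; have rt := r_gt0 t01.
  by rewrite !gt_eqF//; case/andP: t01.
exact: primitive_sub pS _ _ _.
Qed.

End StressRegularity.

(** * Reparametrisations of the damage *)

Section TentCalculus.
Context {R : realType}.
Implicit Types (P L E : R -> R) (x y : R).

(** McShane's formula F(x) = sup of E(y) - |L(y) - L(x)| over S, which extends a function that is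
    1-Lipschitz for the pseudo-distance defined by [L]. It will extend a continuity estimate from a
    set of full measure. *)
Lemma mcshane_extension (S : set R) E L : S !=set0 ->
  (forall x y, S x -> S y -> `|E y - E x| <= `|L y - L x|) ->
  exists F : R -> R, (forall x, S x -> F x = E x) /\
    forall x y, `|F y - F x| <= `|L y - L x|.
Proof.
move=> [y0 Sy0] HE.
pose T x : set R := [set z | exists2 y, S y & z = E y - `|L y - L x|].
have Tub x : ubound (T x) (E y0 + `|L y0 - L x|).
  move=> _ [y Sy ->]; have := HE _ _ Sy0 Sy; rewrite ler_norml => /andP[_ H].
  have := ler_normD (L y - L x) (L x - L y0).
  rewrite (_ : L y - L x + (L x - L y0) = L y - L y0); last by ring.
  by rewrite [`|L x - L y0|]distrC; lra.
have Tsup x : has_sup (T x).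
  split; last by exists (E y0 + `|L y0 - L x|); exact: Tub.
  by exists (E y0 - `|L y0 - L x|), y0.
have half x y : sup (T y) <= sup (T x) + `|L y - L x|.
  apply: ge_sup; first by case: (Tsup y).
  move=> _ [z Sz ->]; apply: (@le_trans _ _ (E z - `|L z - L x| + `|L y - L x|)).
    have := ler_normD (L z - L y) (L y - L x).
    rewrite (_ : L z - L y + (L y - L x) = L z - L x); last by ring.
    by lra.
  rewrite lerD2r; apply: ub_le_sup; first by case: (Tsup x).
  by exists z.
exists (fun x => sup (T x)); split => [x Sx|x y].
  apply/eqP; rewrite eq_le; apply/andP; split.
    apply: ge_sup; first by case: (Tsup x).
    move=> _ [z Sz ->]; have := HE _ _ Sx Sz; rewrite ler_norml => /andP[_].
    by lra.
  apply: ub_le_sup; first by case: (Tsup x).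
  by exists x => //; rewrite subrr normr0 subr0.
have h1 := half x y; have h2 := half y x; rewrite [`|L x - L y|]distrC in h2.
by rewrite ler_norml; apply/andP; split; lra.
Qed.

(* Two tents over [x, x + l, y] and [x + l, y, y + l], with [l] tending to 0. *)
Lemma tent_limit P L x y (n0 fx fy : R) : x < y -> y < n0 ->
  {within `[x, n0], continuous L} ->
  (forall p m n, x <= p -> p < m -> m < n -> n <= n0 ->
     `|(P n - P m) / (n - m) - (P m - P p) / (m - p)| <= L n - L p) ->
  is_derive x 1 P fx -> is_derive y 1 P fy -> `|fy - fx| <= 2 * (L y - L x).
Proof.
move=> xy yn /continuous_withinP cL tent /is_deriveP dx /is_deriveP dy.
apply/ler_addgt0Pr => e0 e00; pose e := e0 / 4; have e_gt0 : 0 < e by rewrite divr_gt0.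
have [d1 d10 H1] := dx e e_gt0; have [d2 d20 H2] := dy e e_gt0.
have [|d3 d30 H3] := cL x _ e e_gt0; first by rewrite /= in_itv/= lexx ltW// (lt_trans xy).
have [|d4 d40 H4] := cL y _ e e_gt0; first by rewrite /= in_itv/= !ltW.
(* Small enough for both derivative estimates, for [L] to move by at most [e] near x and y, and for
   both tents to fit into [x, n0]. *)
pose l := Num.min (Num.min d1 d2) (Num.min (Num.min d3 d4) (Num.min (y - x) (n0 - y))) / 2.
have l0 : 0 < l by rewrite divr_gt0// !lt_min d10 d20 d30 d40 !subr_gt0 xy yn.
have : 2 * l <= Num.min (Num.min d1 d2) (Num.min (Num.min d3 d4) (Num.min (y - x) (n0 - y))).
  by rewrite mulrC divfK.
rewrite !le_min => /andP[/andP[l1 l2] /andP[/andP[l3 l4] /andP[l5 l6]]].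
have quo z (fz d : R) : 2 * l <= d -> (forall w : R, `|w - z| < d ->
    `|P w - P z - fz * (w - z)| <= e * `|w - z|) -> `|(P (z + l) - P z) / l - fz| <= e.
  move=> ld H; have := H (z + l); rewrite addrAC subrr add0r gtr0_norm// => /(_ ltac:(lra)).
  rewrite -(ler_pdivrMr _ _ l0) -[X in _ / X]gtr0_norm// -normf_div.
  by rewrite mulrBl mulfK// gt_eqF.
have q1 := quo _ _ _ l1 H1; have q2 := quo _ _ _ l2 H2.
have L3 : `|L (x + l) - L x| <= e.
  apply: H3; last by rewrite addrAC subrr add0r gtr0_norm//; lra.
  by rewrite /= in_itv/=; apply/andP; split; lra.
have L4 : `|L (y + l) - L y| <= e.
  apply: H4; last by rewrite addrAC subrr add0r gtr0_norm//; lra.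
  by rewrite /= in_itv/=; apply/andP; split; lra.
have h1 : x < x + l by rewrite ltrDl.
have h2 : x + l < y by lra.
have h3 : y < y + l by rewrite ltrDl.
have h4 : y + l <= n0 by lra.
have t1 := tent _ _ _ (lexx x) h1 h2 (ltW yn).
have t2 := tent _ _ _ (ltW h1) h2 h3 h4.
move: t1 t2; rewrite [x + l - x]addrAC subrr add0r [y + l - y]addrAC subrr add0r.
move: q1 q2 L3 L4; rewrite !ler_norml.
move: ((P (x + l) - P x) / l) ((P (y + l) - P y) / l) ((P y - P (x + l)) / (y - (x + l))).
move=> a b c /andP[? ?] /andP[? ?] /andP[? ?] /andP[? ?] /andP[? ?] /andP[? ?].
have e4 : 4 * e = e0 by rewrite /e; field.
by apply/andP; split; lra.
Qed.

Lemma primitive_affine (k m p q : R) (v dv : R -> R) : 0 < k -> p <= q ->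
  primitive_on (k * p + m) (k * q + m) v dv ->
  primitive_on p q (fun z => v (k * z + m)) (fun z => k * dv (k * z + m)).
Proof.
move=> k0 pq [iv vE]; split; first by apply: intgZ; exact: intg_affine.
move=> x /andP[px xq]; rewrite vE; last by rewrite !lerD2r !ler_pM2l// px.
congr (_ + _); rewrite itgZ; last first.
  by apply: intg_affine => //; apply: intgS iv => //; rewrite lerD2r ler_pM2l.
by rewrite itg_affine//; apply: intgS iv => //; rewrite lerD2r ler_pM2l.
Qed.

(** The mean value inequality for s |-> h(d + s) + b0 s. Here [b0] stands for -h'(d), exactly or,
    with b0 = 0, not at all. *)
Lemma increment_affine (h dh : R -> R) (b0 M eta d t : R) :
  (forall z : R, `|z - d| < eta -> is_derive z 1 h (dh z) /\ `|dh z + b0| <= M) ->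
  `|t| < eta -> h (d + t) <= h d - b0 * t + M * `|t|.
Proof.
move=> H tt; have := @derive_increment _ (fun s => h (s + d) + b0 * s) eta M t.
have dF (s : R) : `|s| < eta -> exists2 l : R,
    is_derive s 1 (fun s => h (s + d) + b0 * s) l & `|l| <= M.
  move=> ss; have [|dh' hM] := H (s + d); first by rewrite addrK.
  exists (dh (s + d) + b0) => //; apply: is_derive_add.
    have dg : is_derive s 1 (fun y => y + d) 1.
      have := is_derive_affine d 1 s; congr is_derive.
      by apply/funext => y; rewrite mul1r addrC.
    by have := @is_derive_compose _ h (fun y => y + d) s _ _ dg dh'; rewrite mulr1.
  have := is_derive_affine 0 b0 s; congr is_derive.
  by apply/funext => y; rewrite add0r.
move=> /(_ dF tt); rewrite add0r mulr0 addr0 ler_norml => /andP[_].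
by rewrite [t + d]addrC; lra.
Qed.

Lemma le_of_competitor (x y a b k : R) : x <= y -> y <= x - a + b + k -> a <= b + k.
Proof. lra. Qed.

End TentCalculus.

(** * The density of the energy along a reparametrisation *)

Section TentDensity.
Context {R : realType}.

(** The substitution z = w - t th(w), u(z) = v(w), with d = th', turns z^2 (F + |u'|^al) dz into (1
    - t d) (w - t th)^2 (F + (1 - t d)^(-al) K) dw; this is the derivative of the latter in t. *)
Definition tent_slope (al F K d th w t : R) : R :=
  - d * ((w - t * th) ^+ 2 * (F + (1 - t * d) `^ (- al) * K)) +
  (1 - t * d) * (2 * (w - t * th) * (- th) * (F + (1 - t * d) `^ (- al) * K) +
    (w - t * th) ^+ 2 * (al * (1 - t * d) `^ (- al - 1) * d * K)).

Lemma is_derive_tent_density (al F K d th w t : R) : 0 < 1 - t * d ->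
  is_derive t 1 (fun s => (1 - s * d) * (w - s * th) ^+ 2 * (F + (1 - s * d) `^ (- al) * K))
    (tent_slope al F K d th w t).
Proof.
move=> k0.
have lin (u b : R) : is_derive t 1 (fun s => u - s * b) (- b).
  have := is_derive_affine u (- b) t; congr is_derive.
  by apply/funext => s; rewrite mulNr mulrC.
have dk := lin 1 d; have dy := lin w th.
have dy2 := is_derive_compose dy (is_derive_sqr _).
have dp := is_derive_compose dk (is_derive1_powR (- al) k0).
have dB := is_derive_add (is_derive_cst F t 1) (is_derive_mul dp (is_derive_cst K t 1)).
have := is_derive_mul (is_derive_mul dk dy2) dB.
move=> H; apply: (is_derive_eq H).
by rewrite /tent_slope /=; ring.
Qed.

(** For |t d| <= 1/2 the factor 1 - t d lies in [1/2, 3/2], so its powers -al and -al - 1 are at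
    most 2^al and 2^(al + 1). The bound is independent of [t], as dominated differentiation
    requires. *)
Lemma tent_slope_bound (al F K d th w t L : R) : 0 <= al -> 0 <= K -> `|d| <= L ->
  `|th| <= 1 -> `|w| <= 1 -> `|t| <= 1 -> `|t * d| <= 2^-1 ->
  `|tent_slope al F K d th w t| <= 2 `^ al * (4 * L + 6 + 12 * al * L) * (`|F| + K).
Proof.
move=> al0 K0 dL th1 w1 t1 td.
set k := 1 - t * d; set y := w - t * th.
move: td; rewrite ler_norml => /andP[td1 td2].
have k1 : 2^-1 <= k by rewrite /k; lra.
have k2 : k <= 3 / 2 by rewrite /k; lra.
have k0 : 0 < k by apply: lt_le_trans k1; rewrite invr_gt0.
have y2 : `|y| <= 2.
  rewrite /y (le_trans (ler_normB _ _))// normrM.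
  have : `|t| * `|th| <= 1 by rewrite -[leRHS]mulr1; apply: ler_pM.
  by lra.
have one (b : R) : 1 = 1 `^ b by rewrite powR1.
have pwk (b : R) : 0 <= b -> 0 <= k `^ (- b) <= 2 `^ b.
  move=> b0; rewrite powR_ge0/= powRN invf_ple ?posrE ?powR_gt0//.
  rewrite -(ler_pM2l (powR_gt0 b (ltr0n R 2))) mulfV ?gt_eqF ?powR_gt0//.
  rewrite -powRM ?(ltW k0)// [leLHS](one b).
  by apply: ge0_ler_powR => //; rewrite ?nnegrE ?mulr_ge0 ?(ltW k0)//; lra.
have B1 : 1 <= 2 `^ al.
  by rewrite [leLHS](one al); apply: ge0_ler_powR; rewrite ?nnegrE//; lra.
have /andP[p0 pB] := pwk al al0.
have al1 : 0 <= al + 1 by lra.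
have /andP[q0 qB] := pwk (al + 1) al1.
have E2 : 2 `^ (al + 1) = 2 `^ al * 2 :> R by rewrite powRD ?powRr1// pnatr_eq0 implybT.
rewrite E2 in qB.
rewrite (_ : - (al + 1) = - al - 1) in q0 qB; last by ring.
rewrite /tent_slope -/k -/y; set B := 2 `^ al in B1 pB qB *; set S := `|F| + K.
have F0 := normr_ge0 F.
have L0 : 0 <= L by apply: le_trans dL.
have X : `|F + k `^ (- al) * K| <= B * S.
  rewrite (le_trans (ler_normD _ _))// normrM (ger0_norm p0) (ger0_norm K0) /S mulrDr.
  by apply: lerD; [rewrite -[leLHS]mul1r|]; apply: ler_wpM2r.
have Y : `|y ^+ 2| <= 4.
  rewrite normrX (_ : 4 = 2 ^+ 2); last by ring.
  by rewrite ler_pXn2r// nnegrE.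
have Z : `|al * k `^ (- al - 1) * d * K| <= al * (B * 2) * L * S.
  rewrite !normrM (ger0_norm al0) (ger0_norm q0) (ger0_norm K0).
  apply: ler_pM; rewrite ?mulr_ge0//; last by rewrite /S lerDr.
  by apply: ler_pM; rewrite ?mulr_ge0//; apply: ler_wpM2l.
have BS : 0 <= B * S by apply: mulr_ge0; [lra|rewrite addr_ge0].
have T1 : `|- d * (y ^+ 2 * (F + k `^ (- al) * K))| <= L * (4 * (B * S)).
  by rewrite normrM normrN; apply: ler_pM => //; rewrite normrM; apply: ler_pM.
have T2 : `|2 * y * - th * (F + k `^ (- al) * K)| <= 2 * 2 * 1 * (B * S).
  rewrite normrM; apply: ler_pM => //; rewrite normrM; apply: ler_pM; rewrite ?normrN//.
  by rewrite normrM; apply: ler_pM; rewrite ?normr_nat.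
have T3 : `|y ^+ 2 * (al * k `^ (- al - 1) * d * K)| <= 4 * (al * (B * 2) * L * S).
  by rewrite normrM; apply: ler_pM.
have T4 : `|k * (2 * y * - th * (F + k `^ (- al) * K) + y ^+ 2 * (al * k `^ (- al - 1) * d * K))|
    <= 3 / 2 * (2 * 2 * 1 * (B * S) + 4 * (al * (B * 2) * L * S)).
  rewrite normrM (gtr0_norm k0); apply: ler_pM => //; first exact: ltW.
  by rewrite (le_trans (ler_normD _ _))// lerD.
rewrite (le_trans (ler_normD _ _))// (le_trans (lerD T1 T4))//.
by rewrite le_eqVlt; apply/orP; left; apply/eqP; field.
Qed.

End TentDensity.

(** * The variational problem for the damage with the radius frozen *)

Section DamageProblem.
Context {R : realType}.
Local Notation mu := (@lebesgue_measure R).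
Local Notation A := (`]0%R, 1%R]%classic : set R).
Variables (D v dv h dh phi : R -> R) (e c alpha : R).

(** The part of the total density that changes with the damage; the [psi] terms are constant once
    the radius is fixed. *)
Definition lagrangian (w dw : R -> R) (x : R) : R :=
  x ^+ 2 * (h (D x - w x) + c * phi (w x) + e * `|dw x| `^ alpha).

(** All that is kept of the coupled problem. [dv] is a parameter because the record is used twice:
    for the given weak derivative and, later, for the continuous one. *)
Record damage_problem : Prop := DamageProblem {
  dp_e_gt0 : 0 < e;
  dp_c_gt0 : 0 < c;
  dp_alpha_gt1 : 1 < alpha;
  dp_phi_cont : continuous phi;
  dp_h_der : forall x : R, 0 < x -> is_derive x 1 h (dh x);
  dp_dh_cont : forall x : R, 0 < x -> {for x, continuous dh};
  dp_D_cont : {within A, continuous D};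
  dp_primitive : forall a : R, 0 < a < 1 -> primitive_on a 1 v dv;
  dp_adm : forall x : R, 0 < x <= 1 -> 0 <= v x < D x;
  dp_intg : forall a : R, 0 < a < 1 -> intg a 1 (fun x => `|dv x| `^ alpha);
  dp_min : forall (a : R) (w dw : R -> R), 0 < a < 1 -> primitive_on a 1 w dw ->
    w a = v a -> w 1 = v 1 -> intg a 1 (fun x => `|dw x| `^ alpha) ->
    (forall x : R, a <= x <= 1 -> 0 <= w x < D x) ->
    itg a 1 (lagrangian v dv) <= itg a 1 (lagrangian w dw) }.

Hypothesis dp : damage_problem.

Let e_gt0 := dp_e_gt0 dp.
Let alpha_gt1 := dp_alpha_gt1 dp.
Let phi_cont := dp_phi_cont dp.
Let h_der := dp_h_der dp.
Let cD := dp_D_cont dp.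
Let pv := dp_primitive dp.
Let v_adm := dp_adm dp.
Let iv := dp_intg dp.
Let v_min := dp_min dp.

Lemma intg_lagrangian (a b : R) (w dw : R -> R) : 0 < a -> b <= 1 -> {within `[a, b], continuous w} ->
  intg a b (fun x => `|dw x| `^ alpha) -> (forall x : R, a <= x <= b -> w x < D x) ->
  intg a b (lagrangian w dw).
Proof.
move=> a0 b1 cw iw wD.
have cDab : {within `[a, b], continuous D}.
  by apply: continuous_subspaceW (within_oc a0 cD); apply: subset_itvl; rewrite bnd_simp.
have cx2 : {within `[a, b], continuous (fun x : R => x ^+ 2)} by apply: withinX; exact: within_id.
apply: (@eq_intg _ _ _ (fun x => x ^+ 2 * (h (D x - w x) + c * phi (w x)) + e * (`|dw x| `^ alpha * x ^+ 2))).
  by move=> x _; rewrite /lagrangian; ring.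
have [ab|ba] := leP a b; last first.
  by rewrite /intg set_itv_ge -?leNgt -?ltNge//; exact: integrable_set0.
apply: intgD; last by apply: intgZ; exact: intg_mul_cont.
apply: intg_cont; apply: withinM => //; apply: withinD.
  apply: (@within_comp _ _ h (fun x => D x - w x)); first exact: withinB.
  move=> x /=; rewrite in_itv/= => /wD wx; apply: is_derive_cont (h_der _).
  by rewrite subr_gt0.
apply: withinM; first exact: within_cst.
by apply: within_comp cw _ => x _; exact: phi_cont.
Qed.

(** A competitor on [p, n] is continued by [v] on [n, 1], and the common energy there cancels. *)
Lemma damage_min_on (p n : R) (w dw : R -> R) : 0 < p -> p < n -> n <= 1 ->
  primitive_on p n w dw -> w p = v p -> w n = v n -> intg p n (fun x => `|dw x| `^ alpha) ->
  (forall x : R, p <= x <= n -> 0 <= w x < D x) ->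
  itg p n (lagrangian v dv) <= itg p n (lagrangian w dw).
Proof.
move=> p0 pn n1 pw wp wn iw adm.
have p01 : 0 < p < 1 by rewrite p0 (lt_le_trans pn).
have pvp := pv p01.
pose u x := if x <= n then w x else v x; pose du x := if x <= n then dw x else dv x.
have pu : primitive_on p 1 u du.
  apply: primitive_glue => //; first exact: ltW.
  exact: primitiveS (ltW pn) (lexx 1) pvp.
have nE : {in `]n, 1[, du =1 dv} /\ {in `[n, 1], u =1 v}.
  split => x; rewrite in_itv/= => /andP[nx _]; first by rewrite /du leNgt nx.
  by rewrite /u; case: (leP x n) => // xn; rewrite (_ : x = n)//; apply/eqP; rewrite eq_le xn.
have pE : {in `[p, n], du =1 dw} /\ {in `[p, n], u =1 w}.
  by split => x; rewrite in_itv/= => /andP[_ xn]; rewrite /du /u xn.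
have iv1 : intg n 1 (fun x => `|dv x| `^ alpha) by apply: intgS (iv p01) => //; exact: ltW.
have idu : intg p 1 (fun x => `|du x| `^ alpha).
  apply: (intg_cat (ltW pn) n1).
    by apply: eq_intg iw => x xI; rewrite pE.1.
  by apply: eq_intg_oo iv1 => x xI; rewrite nE.1.
have uadm x : p <= x <= 1 -> 0 <= u x < D x.
  move=> /andP[px x1]; rewrite /u; case: (leP x n) => xn; first by apply: adm; rewrite px.
  by apply: v_adm; rewrite x1 (lt_le_trans p0).
have Up : u p = v p by rewrite /u ltW.
have U1 : u 1 = v 1.
  rewrite /u; case: (leP 1 n) => // n1'.
  by have -> : 1 = n by apply/eqP; rewrite eq_le n1 n1'.
have ilv : intg p 1 (lagrangian v dv).
  apply: intg_lagrangian => //; [exact: primitive_continuous (ltW (proj2 (andP p01))) pvp|exact: iv|].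
  by move=> x /andP[px x1]; have /andP[] := v_adm (x:=x) ltac:(by rewrite x1 (lt_le_trans p0)).
have ilu : intg p 1 (lagrangian u du).
  apply: intg_lagrangian => //; first exact: primitive_continuous (ltW (proj2 (andP p01))) pu.
  by move=> x /uadm/andP[].
have := v_min p01 pu Up U1 idu uadm.
rewrite (itg_cat (ltW pn) n1 ilv) (itg_cat (ltW pn) n1 ilu).
rewrite (@eq_itg _ p n (lagrangian u du) (lagrangian w dw)); last first.
  by move=> x xI; rewrite /lagrangian pE.1// pE.2.
rewrite (@eq_itg_oo _ n 1 (lagrangian u du) (lagrangian v dv)) ?lerD2r//.
  move=> x xI; rewrite /lagrangian nE.1// nE.2//.
  by move: xI; rewrite !in_itv/= => /andP[? ?]; rewrite !ltW.
exact: intgS (ltW pn) (lexx 1) ilu.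
Qed.

Section Tent.
Variables (b0 : R).
Let Kd x := e * `|dv x| `^ alpha.
Let F x := c * phi (v x) + b0 * v x.
(** For the density L = x^2 (K + F), linearised in the elastic term, this is Noether's quantity v'
    dL/dv' - L, and [gs] is the explicit derivative of L in x; formally Es' = - gs. *)
Let Es x := x ^+ 2 * ((alpha - 1) * Kd x - F x).
Let gs x := 2 * x * (Kd x + F x).
Let Lg (u du : R -> R) z := z ^+ 2 * (c * phi (u z) + b0 * u z + e * `|du z| `^ alpha).

Let oc_cont (a b : R) (f : R -> R) : 0 < a -> b <= 1 -> {within A, continuous f} ->
  {within `[a, b], continuous f}.
Proof.
move=> a0 b1 cf; apply: continuous_subspaceW (within_oc a0 cf).
by apply: subset_itvl; rewrite bnd_simp.
Qed.

Let cv : {within A, continuous v}.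
Proof. by apply: oc_within => a /[dup]/andP[_ /ltW a1] /pv/(primitive_continuous a1). Qed.

Let cF : {within A, continuous F}.
Proof.
apply: withinD; last by apply: withinM => //; exact: within_cst.
apply: withinM; first exact: within_cst.
by apply: (@within_comp _ _ phi v) => // x _; exact: phi_cont.
Qed.

Let i_K (a b : R) : 0 < a -> b <= 1 -> intg a b Kd.
Proof.
move=> a0 b1; apply: intgZ; have [ab|ba] := ltP a 1.
  by apply: intgS (lexx a) b1 (iv _); rewrite a0.
apply: (@intgS _ 2^-1 1) => //; last by apply: iv; apply/andP; split; lra.
by apply: le_trans ba; lra.
Qed.

Let weighted (a b k : R) (w : R -> R) : 0 < a -> b <= 1 -> {within `[a, b], continuous w} ->
  intg a b (fun x => w x * (F x + k * Kd x)).
Proof.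
move=> a0 b1 cw; have [ab|ba] := leP a b; last first.
  by rewrite /intg set_itv_ge -?leNgt -?ltNge//; exact: integrable_set0.
apply: (@eq_intg _ _ _ (fun x => w x * F x + k * (Kd x * w x))); first by move=> x _; ring.
apply: intgD; last by apply/intgZ/intg_mul_cont => //; exact: i_K.
by apply: intg_cont; apply: withinM => //; exact: oc_cont.
Qed.

(** One affine piece of a reparametrisation. [V] is transported along with [v], since the total
    variation will measure the error in the elastic term. *)
Let tent_piece (k m p q : R) (V dV : R -> R) : 0 < k -> p <= q -> 0 < k * p + m -> k * q + m <= 1 ->
  primitive_on (k * p + m) (k * q + m) V dV ->
  let u := fun z => v (k * z + m) in let du := fun z => k * dv (k * z + m) in
  [/\ primitive_on p q u du, intg p q (fun z => `|du z| `^ alpha),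
     intg p q (Lg u du) /\ intg (k * p + m) (k * q + m)
       (fun w => k^-1 * ((w - m) / k) ^+ 2 * (F w + k `^ alpha * Kd w)),
     itg p q (Lg u du) = itg (k * p + m) (k * q + m)
       (fun w => k^-1 * ((w - m) / k) ^+ 2 * (F w + k `^ alpha * Kd w)) &
     intg p q (fun z => V (k * z + m)) /\
     itg p q (fun z => V (k * z + m)) = k^-1 * itg (k * p + m) (k * q + m) V].
Proof.
move=> k0 pq P0 Q1 pV u du; set P := k * p + m in P0 *; set Q := k * q + m in Q1 *.
have PQ : P <= Q by rewrite lerD2r ler_pM2l.
have pP : primitive_on P Q v dv.
  have [P1|P1] := ltP P 1; first by apply: primitiveS (lexx P) Q1 (pv _); rewrite P0.
  have h2 : 0 < (2^-1 : R) < 1 by apply/andP; split; lra.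
  by apply: primitiveS Q1 (pv h2); apply: le_trans P1; lra.
have iW : intg P Q (fun w => k^-1 * ((w - m) / k) ^+ 2 * (F w + k `^ alpha * Kd w)).
  apply: weighted => //; apply: withinM; first exact: within_cst.
  apply: withinX; apply: withinM; last exact: within_cst.
  by apply: withinB; [exact: within_id|exact: within_cst].
have kn : k != 0 by rewrite gt_eqF.
have LE z : Lg u du z = k * (k^-1 * ((k * z + m - m) / k) ^+ 2 * (F (k * z + m) + k `^ alpha * Kd (k * z + m))).
  rewrite /Lg /Kd /du /u normrM (gtr0_norm k0) powRM ?(ltW k0)// addrK.
  by rewrite /F; field.
have iV := intg_cont (primitive_continuous PQ pV).
have LgE : Lg u du = (fun z => k * (k^-1 * ((k * z + m - m) / k) ^+ 2 * (F (k * z + m) + k `^ alpha * Kd (k * z + m)))).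
  exact/funext.
split.
- exact: primitive_affine.
- apply: (@eq_intg _ _ _ (fun z => k `^ alpha * e^-1 * Kd (k * z + m))).
    move=> z _; rewrite /Kd /du normrM (gtr0_norm k0) powRM ?(ltW k0)//.
    by field; rewrite gt_eqF.
  by apply: intgZ; apply: (@intg_affine _ k m p q Kd) => //; exact: i_K.
- split => //; rewrite LgE; apply: intgZ; exact: (intg_affine k0 iW).
- rewrite LgE itgZ; last exact: (intg_affine k0 iW).
  by rewrite (itg_affine k0 iW).
- split; first exact: intg_affine.
  by apply: (mulfI kn); rewrite mulrA mulfV// mul1r itg_affine.
Qed.

Section Estimate.
Variables (p m n M eta : R).
Hypotheses (p_gt0 : 0 < p) (pm : p < m) (mn : m < n) (n_le1 : n <= 1) (eta_gt0 : 0 < eta)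
  (M_ge0 : 0 <= M)
  (dh_near : forall z x : R, p <= z <= n -> `|x - (D z - v z)| < eta -> 0 < x /\ `|dh x + b0| <= M).

Let l1 := m - p.
Let l2 := n - m.
Let l10 : 0 < l1. Proof. by rewrite subr_gt0. Qed.
Let l20 : 0 < l2. Proof. by rewrite subr_gt0. Qed.
Let pn : p < n. Proof. exact: lt_trans mn. Qed.
Let inA x : p <= x <= n -> 0 < x <= 1.
Proof. by move=> /andP[px xn]; rewrite (lt_le_trans p_gt0 px) (le_trans xn). Qed.

Let th w := if w <= m then (w - p) / l1 else (n - w) / l2.
Let dth w := if w <= m then l1^-1 else - l2^-1.
(** The density of the reparametrised damage after substituting back to the variable of [v], with
    the tent [th] of height 1 at [m] as displacement. The dependence on [s] is now explicit and
    smooth. *)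
Let f s w := (1 - s * dth w) * (w - s * th w) ^+ 2 * (F w + (1 - s * dth w) `^ (- alpha) * Kd w).
Let W := itg p n (fun x => `|dv x|).
Let V x := itg p x (fun x => `|dv x|).

Let pvn : primitive_on p n v dv.
Proof. by apply: primitiveS (lexx p) n_le1 (pv _); rewrite p_gt0 (lt_le_trans pn). Qed.
Let idv : intg p n (fun x => `|dv x|). Proof. exact: intg_norm pvn.1. Qed.
Let pV : primitive_on p n V (fun x => `|dv x|).
Proof. by split => // x _; rewrite /V itg1 add0r. Qed.

Let V_mono x y : p <= x -> x <= y -> y <= n -> `|v y - v x| <= V y - V x.
Proof.
move=> px xy yn; rewrite (primitive_sub pvn px xy yn) (primitive_sub pV px xy yn).
by apply: norm_itg; exact: intgS px yn pvn.1.
Qed.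

Let V_range x : p <= x <= n -> 0 <= V x <= W.
Proof.
move=> /andP[px xn]; rewrite /V /W; apply/andP; split; first exact: itg_ge0.
by apply: ge0_le_itg.
Qed.

Let gap : exists2 t0 : R, 0 < t0 & forall x y : R, p <= x <= n -> p <= y <= n ->
  `|y - x| < t0 -> `|v y - v x| < eta.
Proof.
have [t0 t00 H] := primitive_unif (ltW pn) pvn (divr_gt0 eta_gt0 (ltr0n _ 2)).
have e0 := eta_gt0.
by exists t0 => // x y xI yI xy; apply: le_lt_trans (H x y xI yI xy) _; lra.
Qed.

(** The competitor is v o om with [om] the inverse of w |-> w - s th(w): it takes only values of
    [v], hence stays nonnegative, and keeps the values at the ends. Its elastic term differs from
    the linearised one by at most M int |v o om - v|, and that integral is at most W |s|. *)
Let competitor (s : R) : `|s| < l1 / 2 -> `|s| < l2 / 2 ->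
  (forall x y : R, p <= x <= n -> p <= y <= n -> `|y - x| <= `|s| -> `|v y - v x| < eta) ->
  intg p n (f s) /\ itg p n (Lg v dv) <= itg p n (f s) + M * W * `|s|.
Proof.
rewrite !ltr_norml => /andP[s1 s2] /andP[s3 s4] near_v.
(* [om] maps [p, m - s] affinely onto [p, m] with slope [k1], and [m - s, n] onto [m, n] with slope
   [k2]. *)
pose k1 := l1 / (l1 - s); pose k2 := l2 / (l2 + s).
pose m1 := p - k1 * p; pose m2 := n - k2 * n.
have l10' := l10; have l20' := l20.
have d1 : 0 < l1 - s by lra.
have d2 : 0 < l2 + s by lra.
have k10 : 0 < k1 by rewrite divr_gt0.
have k20 : 0 < k2 by rewrite divr_gt0.
have E1 : k1 * p + m1 = p by rewrite /m1 addrC subrK.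
have E2 : k1 * (m - s) + m1 = m.
  have -> : k1 * (m - s) + m1 = p + k1 * (l1 - s) by rewrite /m1 /l1; ring.
  by rewrite /k1 divfK ?gt_eqF// /l1 addrC subrK.
have E3 : k2 * (m - s) + m2 = m.
  have -> : k2 * (m - s) + m2 = n - k2 * (l2 + s) by rewrite /m2 /l2; ring.
  by rewrite /k2 divfK ?gt_eqF// /l2 opprB addrC subrK.
have E4 : k2 * n + m2 = n by rewrite /m2 addrC subrK.
have ps : p <= m - s by rewrite /l1 in s2 s1 l10' *; lra.
have sn : m - s <= n by rewrite /l2 in s3 s4 l20' *; lra.
have pV1 : primitive_on (k1 * p + m1) (k1 * (m - s) + m1) V (fun x => `|dv x|).
  by rewrite E1 E2; apply: primitiveS pV => //; exact: ltW.
have pV2 : primitive_on (k2 * (m - s) + m2) (k2 * n + m2) V (fun x => `|dv x|).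
  by rewrite E3 E4; apply: primitiveS pV => //; exact: ltW.
have m_le1 : m <= 1 by rewrite (le_trans (ltW mn)).
have m_gt0 : 0 < m by rewrite (lt_trans p_gt0).
have := @tent_piece k1 m1 p (m - s) V (fun x => `|dv x|) k10 ps.
rewrite E1 E2 => /(_ p_gt0 m_le1)[|pu1 iu1 [iL1 iG1] L1 [iV1 V1]].
  by apply: primitiveS pV => //; exact: ltW.
have := @tent_piece k2 m2 (m - s) n V (fun x => `|dv x|) k20 sn.
rewrite E3 E4 => /(_ m_gt0 n_le1)[|pu2 iu2 [iL2 iG2] L2 [iV2 V2]].
  by apply: primitiveS pV => //; exact: ltW.
set u1 := fun z => v (k1 * z + m1) in pu1 iL1 L1.
set du1 := fun z => k1 * _ in pu1 iu1 iL1 L1.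
set u2 := fun z => v (k2 * z + m2) in pu2 iL2 L2.
set du2 := fun z => k2 * _ in pu2 iu2 iL2 L2.
have pw (k : R) : 0 < k -> k^-1 `^ (- alpha) = k `^ alpha.
  by move=> k0; rewrite -powR_inv1 ?(ltW k0)// -powRrM mulrNN mul1r.
have f1 w : p <= w <= m -> f s w = k1^-1 * ((w - m1) / k1) ^+ 2 * (F w + k1 `^ alpha * Kd w).
  move=> /andP[pw' wm]; have kE : 1 - s * dth w = k1^-1.
    by rewrite /dth wm /k1; field; rewrite !gt_eqF.
  rewrite /f kE pw//; congr (_ * _ ^+ 2 * _).
  by rewrite /th wm /m1 /k1; field; rewrite !gt_eqF.
have f2 w : m < w <= n -> f s w = k2^-1 * ((w - m2) / k2) ^+ 2 * (F w + k2 `^ alpha * Kd w).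
  move=> /andP[mw wn]; have kE : 1 - s * dth w = k2^-1.
    by rewrite /dth leNgt mw /k2 /=; field; rewrite !gt_eqF.
  rewrite /f kE pw//; congr (_ * _ ^+ 2 * _).
  by rewrite /th leNgt mw /m2 /k2 /=; field; rewrite !gt_eqF.
have if1 : intg p m (f s).
  by apply: eq_intg iG1 => w; rewrite in_itv/= => wI; rewrite f1.
have if2 : intg m n (f s).
  apply: eq_intg_oo iG2 => w; rewrite in_itv/= => /andP[mw wn].
  by rewrite f2// mw ltW.
have ifs : intg p n (f s) by apply: intg_cat if1 if2; exact: ltW.
split => //.
pose u z := if z <= m - s then u1 z else u2 z.
pose du z := if z <= m - s then du1 z else du2 z.
have glue : u1 (m - s) = u2 (m - s) by rewrite /u1 /u2 E2 E3.
have pu : primitive_on p n u du by exact: primitive_glue.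
pose om z := if z <= m - s then k1 * z + m1 else k2 * z + m2.
have uE z : u z = v (om z) by rewrite /u /om; case: ifP.
have om1 z : om z - z = if z <= m - s then s / (l1 - s) * (z - p) else s / (l2 + s) * (n - z).
  rewrite /om; case: ifP => _.
    by rewrite /m1 /k1; field; rewrite gt_eqF.
  by rewrite /m2 /k2; field; rewrite gt_eqF.
have om_frac z : p <= z <= n -> exists2 k : R, 0 <= k <= 1 & om z - z = k * s.
  move=> /andP[pz zn]; rewrite om1; case: (leP z (m - s)) => zm.
    exists ((z - p) / (l1 - s)); last by ring.
    apply/andP; split; first by rewrite divr_ge0 ?(ltW d1)// subr_ge0.
    by rewrite ler_pdivrMr// mul1r (_ : l1 - s = m - s - p) ?lerD2r// /l1; ring.
  exists ((n - z) / (l2 + s)); last by ring.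
  apply/andP; split; first by rewrite divr_ge0 ?(ltW d2)// subr_ge0.
  by rewrite ler_pdivrMr// mul1r (_ : l2 + s = n - (m - s)) ?lerD2l ?lerN2 ?(ltW zm)// /l2; ring.
have om_range z : p <= z <= n -> p <= om z <= n.
  move=> /andP[pz zn]; rewrite /om; case: (leP z (m - s)) => zm.
    apply/andP; split; first by rewrite -[leLHS]E1 lerD2r ler_pM2l.
    by apply: le_trans (ltW mn); rewrite -[leRHS]E2 lerD2r ler_pM2l.
  apply/andP; split; last by rewrite -[leRHS]E4 lerD2r ler_pM2l.
  by apply: le_trans (ltW pm) _; rewrite -[leLHS]E3 lerD2r ler_pM2l// ltW.
have om_close z : p <= z <= n -> `|om z - z| <= `|s|.
  move=> /om_frac[k /andP[k0 k1'] ->]; rewrite normrM ger0_norm//.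
  by rewrite -[leRHS]mul1r ler_wpM2r.
(* [om z - z] has the sign of [s] and [V] is nondecreasing, so this factor replaces an absolute
   value and keeps the bound linear in V o om. *)
pose sg : R := if 0 <= s then 1 else -1.
have u_v z : p <= z <= n -> `|u z - v z| <= sg * (V (om z) - V z).
  move=> zI; have [k /andP[k0 _] kE] := om_frac z zI; have oI := om_range z zI.
  have /andP[pz zn] := zI; have /andP[po on'] := oI.
  rewrite uE /sg; case: (leP 0 s) => s0.
    by rewrite mul1r; apply: V_mono => //; rewrite -subr_ge0 kE mulr_ge0.
  rewrite distrC mulN1r opprB; apply: V_mono => //.
  by rewrite -subr_le0 kE mulr_ge0_le0// ltW.
have u_near z : p <= z <= n -> `|u z - v z| < eta.
  by move=> zI; rewrite uE; apply: near_v => //; [exact: om_range|exact: om_close].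
have idu : intg p n (fun z => `|du z| `^ alpha).
  apply: (intg_cat ps sn).
    by apply: eq_intg iu1 => z; rewrite in_itv/= => /andP[_ zm]; rewrite /du zm.
  by apply: eq_intg_oo iu2 => z; rewrite in_itv/= => /andP[mz _]; rewrite /du leNgt mz.
have u_adm z : p <= z <= n -> 0 <= u z < D z.
  move=> zI; have /andP[v0 _] := v_adm (inA (om_range z zI)).
  rewrite uE v0/= -subr_gt0.
  have [|//] := @dh_near z (D z - v (om z)) zI.
  by rewrite (_ : _ - _ = - (u z - v z)) ?normrN ?u_near// uE; ring.
have up : u p = v p by rewrite /u ps /u1 E1.
have un : u n = v n.
  rewrite /u; case: (leP n (m - s)) => nm; last by rewrite /u2 E4.
  have nE : n = m - s by apply/eqP; rewrite eq_le nm sn.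
  by rewrite nE glue -nE /u2 E4.
have := damage_min_on p_gt0 pn n_le1 pu up un idu u_adm.
have iLu : intg p n (Lg u du).
  apply: (intg_cat ps sn).
    by apply: eq_intg iL1 => z; rewrite in_itv/= => /andP[_ zm]; rewrite /Lg /u /du zm.
  by apply: eq_intg_oo iL2 => z; rewrite in_itv/= => /andP[mz _]; rewrite /Lg /u /du leNgt mz.
have LuE : itg p n (Lg u du) = itg p n (f s).
  rewrite (itg_cat ps sn iLu) (itg_cat (ltW pm) (ltW mn) ifs); congr (_ + _).
    rewrite (@eq_itg _ _ _ _ (Lg u1 du1)); last first.
      by move=> z; rewrite in_itv/= => /andP[_ zm]; rewrite /Lg /u /du zm.
    by rewrite L1; apply: eq_itg => w; rewrite in_itv/= => wI; rewrite f1.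
  rewrite (@eq_itg_oo _ _ _ (Lg u du) (Lg u2 du2)); last 2 first.
  - by move=> z; rewrite in_itv/= => /andP[mz _]; rewrite /Lg /u /du leNgt mz.
  - exact: intgS ps (lexx n) iLu.
  rewrite L2; apply: eq_itg_oo => //.
  by move=> w; rewrite in_itv/= => /andP[mw wn]; rewrite f2// mw ltW.
have iLv : intg p n (Lg v dv).
  apply: (@eq_intg _ _ _ (fun x => x ^+ 2 * (F x + 1 * Kd x))).
    by move=> x _; rewrite /Lg /F /Kd mul1r.
  by apply: weighted => //; apply: withinX; exact: within_id.
have ilv : intg p n (lagrangian v dv).
  apply: intg_lagrangian => //; first exact: primitive_continuous (ltW pn) pvn.
    by apply: intgS (lexx p) n_le1 (iv _); rewrite p_gt0 (lt_le_trans pn).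
  by move=> x /inA/v_adm/andP[].
have ilu : intg p n (lagrangian u du).
  apply: intg_lagrangian => //; first exact: primitive_continuous (ltW pn) pu.
  by move=> x /u_adm/andP[].
have cVpn := primitive_continuous (ltW pn) pV.
have iVpn : intg p n V by exact: intg_cont.
pose Vu z := V (om z).
have iVu : intg p n Vu.
  apply: (intg_cat ps sn).
    by apply: eq_intg iV1 => z; rewrite in_itv/= => /andP[_ zm]; rewrite /Vu /om zm.
  by apply: eq_intg_oo iV2 => z; rewrite in_itv/= => /andP[mz _]; rewrite /Vu /om leNgt mz.
have VuE : itg p n Vu = k1^-1 * itg p m V + k2^-1 * itg m n V.
  rewrite (itg_cat ps sn iVu); congr (_ + _).
    rewrite -V1; apply: eq_itg => z.
    by rewrite in_itv/= => /andP[_ zm]; rewrite /Vu /om zm.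
  rewrite -V2; apply: eq_itg_oo; last exact: intgS ps (lexx n) iVu.
  by move=> z; rewrite in_itv/= => /andP[mz _]; rewrite /Vu /om leNgt mz.
have bound : itg p n (lagrangian u du) <=
    itg p n (lagrangian v dv) - itg p n (Lg v dv) + itg p n (Lg u du) + M * (sg * (itg p n Vu - itg p n V)).
  have i1 : intg p n (fun z => lagrangian v dv z - Lg v dv z + Lg u du z).
    by apply: intgD => //; exact: intgB.
  have i2 : intg p n (fun z => sg * (Vu z - V z)) by apply: intgZ; exact: intgB.
  rewrite -itgB// -itgD//; last exact: intgB.
  rewrite -itgB// -itgZ//; last exact: intgB.
  rewrite -itgZ// -itgD//; last exact: intgZ.
  apply: le_itg => //; first by apply: intgD => //; exact: intgZ.
  move=> z zI; have x01 := inA zI.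
  have z2 : 0 <= z ^+ 2 <= 1 by rewrite sqr_ge0 expr_le1//; case/andP: x01 => [/ltW].
  have uv := u_v z zI; have un' := u_near z zI.
  have hI : h (D z - u z) <= h (D z - v z) + b0 * (u z - v z) + M * (sg * (Vu z - V z)).
    have := @increment_affine _ h dh b0 M eta (D z - v z) (v z - u z).
    rewrite [`|v z - u z|]distrC => /(_ _ un').
    rewrite (_ : D z - v z + (v z - u z) = D z - u z); last by ring.
    have Mle := ler_wpM2l M_ge0 uv.
    move=> H; apply: le_trans (H _) _; last by apply: lerD => //; rewrite -mulrN opprB.
    by move=> x xe; have [x0 xM] := dh_near zI xe; split => //; exact: h_der.
  have Q0 : 0 <= M * (sg * (Vu z - V z)).
    by apply: mulr_ge0 => //; apply: le_trans uv.
  rewrite /lagrangian /Lg; case/andP: z2 => z2 z2'.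
  rewrite -subr_ge0 (_ : _ - _ = z ^+ 2 * (h (D z - v z) + b0 * (u z - v z)
    + M * (sg * (Vu z - V z)) - h (D z - u z)) + (1 - z ^+ 2) * (M * (sg * (Vu z - V z)))); last by ring.
  by apply: addr_ge0; apply: mulr_ge0 => //; rewrite subr_ge0.
(* The difference is s times (mean of V over [m, n] minus mean of V over [p, m]), and both means lie
   in [0, W]. *)
move=> vm; have Vb : sg * (itg p n Vu - itg p n V) <= W * `|s|.
  rewrite VuE (itg_cat (ltW pm) (ltW mn) iVpn).
  have k1E : k1^-1 = 1 - s / l1 by rewrite /k1; field; rewrite !gt_eqF.
  have k2E : k2^-1 = 1 + s / l2 by rewrite /k2; field; rewrite !gt_eqF.
  have avg a b l : p <= a -> a < b -> b <= n -> l = b - a -> 0 <= itg a b V / l <= W.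
    move=> pa ab bn ->; have ab0 : 0 < b - a by rewrite subr_gt0.
    have VI x : a <= x <= b -> 0 <= V x <= W.
      by move=> /andP[ax xb]; apply: V_range; rewrite (le_trans pa)//= (le_trans xb).
    rewrite divr_ge0 ?(ltW ab0)//=; last by apply: itg_ge0 => x /VI/andP[].
    rewrite ler_pdivrMr// -itg_cst ?(ltW ab)//; apply: le_itg; [exact: intgS pa bn iVpn|exact: intg_cst|].
    by move=> x /VI/andP[].
  have /andP[a1 a2] := avg p m l1 (lexx p) pm (ltW mn) erefl.
  have /andP[a3 a4] := avg m n l2 (ltW pm) mn (lexx n) erefl.
  rewrite k1E k2E (_ : _ - _ = s * (itg m n V / l2 - itg p m V / l1)); last by ring.
  rewrite mulrA [leRHS]mulrC.
  have -> : sg * s = `|s|.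
    rewrite /sg; have [s0|s0] := boolP (0 <= s); first by rewrite mul1r ger0_norm.
    by rewrite mulN1r ltr0_norm// ltNge.
  rewrite ler_wpM2l// -[leRHS]subr0; exact: lerB.
have Mb := ler_wpM2l M_ge0 Vb; rewrite -[M * W * _]mulrA.
rewrite LuE in bound.
exact: le_trans (le_of_competitor vm bound) (lerD (lexx _) Mb).
Qed.

Let L := l1^-1 + l2^-1.
Let dth_le w : `|dth w| <= L.
Proof.
have h1 : 0 < l1^-1 by rewrite invr_gt0.
have h2 : 0 < l2^-1 by rewrite invr_gt0.
rewrite /dth /L; case: ifP => _; first by rewrite gtr0_norm// lerDl ltW.
by rewrite normrN gtr0_norm// lerDr ltW.
Qed.

Let th_le w : p <= w <= n -> 0 <= th w <= 1.
Proof.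
move=> /andP[pw wn]; rewrite /th; have [wm|mw] := leP w m.
  by rewrite divr_ge0 ?subr_ge0 ?(ltW pm)//= ler_pdivrMr// mul1r lerD2r.
by rewrite divr_ge0 ?subr_ge0 ?(ltW mn)//= ler_pdivrMr// mul1r lerD2l lerN2 ltW.
Qed.

Let pth : primitive_on p n th dth.
Proof.
apply: primitive_glue; [exact: ltW|exact: ltW| | |].
- have := primitiveZ l1^-1 (primitiveD (primitive_id p m) (primitive_cst p m (- p))).
  by apply: eq_primitive => x _ /=; rewrite ?addr0 ?mulr1// mulrC.
- have := primitiveZ (- l2^-1) (primitiveD (primitive_id m n) (primitive_cst m n (- n))).
  by apply: eq_primitive => x _ /=; rewrite ?addr0 ?mulr1// mulNr -mulrN opprB mulrC.
- by rewrite /l1 /l2 !mulfV ?gt_eqF.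
Qed.

Let G0 x := itg p x gs.

(** The first variation along the tent is int (th' Es - th gs), bounded by M W. Integrating the
    second term by parts leaves th' (Es + G0), and th' is 1 / l1 on one side and -1 / l2 on the
    other, hence a difference of mean values over adjacent intervals. *)
Lemma tent_estimate :
  `|itg m n (fun x => Es x + G0 x) / l2 - itg p m (fun x => Es x + G0 x) / l1| <= M * W.
Proof.
have [t1 t10 Ht1] := gap; have p0' := p_gt0; have l10' := l10; have l20' := l20.
have L0 : 0 < L by rewrite addr_gt0 ?invr_gt0.
(* Half lengths keep both pieces nondegenerate, [t1] keeps the competitor where [h'] is controlled,
   and the last two entries are those of the bound on the slope. *)
pose t0 := Num.min (Num.min (l1 / 2) (l2 / 2)) (Num.min t1 (Num.min 1 (2 * L)^-1)).
have t00 : 0 < t0 by rewrite !lt_min t10 ltr01 !divr_gt0// invr_gt0 mulr_gt0.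
have split_t (t : R) : `|t| < t0 -> [/\ `|t| < l1 / 2, `|t| < l2 / 2, `|t| < t1, `|t| <= 1 &
    `|t| * L <= 2^-1].
  rewrite !lt_min => /andP[/andP[? ?] /and3P[? ? h3]]; split => //; first exact: ltW.
  by rewrite -ler_pdivlMr// -invfM ltW.
have comp (t : R) : `|t| < t0 -> intg p n (f t) /\
    itg p n (Lg v dv) <= itg p n (f t) + M * W * `|t|.
  move=> /split_t[h1 h2 h3 _ _]; apply: competitor => // x y xI yI xy.
  by apply: Ht1 => //; exact: le_lt_trans h3.
have Kd0 w : 0 <= Kd w by rewrite mulr_ge0 ?powR_ge0// ltW.
have td (t w : R) : `|t| < t0 -> `|t * dth w| <= 2^-1.
  move=> /split_t[_ _ _ _]; rewrite normrM; apply: le_trans.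
  by rewrite ler_wpM2l.
pose df w := tent_slope alpha (F w) (Kd w) (dth w) (th w) w 0.
pose Gb w := 2 `^ alpha * (4 * L + 6 + 12 * alpha * L) * (`|F w| + Kd w).
have al0 : 0 <= alpha by apply: le_trans (ltW alpha_gt1); exact: ler01.
have der (t w : R) : `|t| < t0 -> is_derive t 1 (f^~ w) (tent_slope alpha (F w) (Kd w) (dth w) (th w) w t).
  move=> /td -/(_ w); rewrite ler_norml => /andP[_ td1].
  by apply: is_derive_tent_density; move: td1; move: (t * dth w) => z; lra.
have bnd (t w : R) : `|t| < t0 -> p <= w <= n -> `|tent_slope alpha (F w) (Kd w) (dth w) (th w) w t| <= Gb w.
  move=> tt wI; have [_ _ _ tle1 _] := split_t _ tt.
  have /andP[th0 th1] := th_le wI; have /andP[w0 w1] := inA wI.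
  apply: tent_slope_bound => //; [by rewrite ger0_norm|by rewrite gtr0_norm|exact: td].
have iG : intg p n Gb.
  apply: intgZ; apply: intgD; last exact: i_K.
  by apply: intg_norm; apply: intg_cont; exact: oc_cont.
have n0 : `|0 : R| < t0 by rewrite normr0.
have := @first_variation _ p n t0 (M * W) f df Gb t00 (fun t tt => (comp t tt).1) iG.
have both (t w : R) : `|t| < t0 -> p <= w <= n -> exists2 l : R, is_derive t 1 (f^~ w) l & `|l| <= Gb w.
  by move=> tt wI; exists (tent_slope alpha (F w) (Kd w) (dth w) (th w) w t); [exact: der|exact: bnd].
move=> /(_ both (fun w _ => der 0 w n0)).
have f0 : itg p n (f 0) = itg p n (Lg v dv).
  apply: eq_itg => w _; rewrite /f !mul0r !subr0 mul1r powR1 mul1r.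
  by rewrite /Lg /F /Kd; ring.
rewrite f0 => /(_ (fun t tt => (comp t tt).2)).
rewrite distrC; congr (`|_| <= _).
have igs : intg p n gs.
  apply: (@eq_intg _ _ _ (fun w => (2 * w) * (F w + 1 * Kd w))).
    by move=> w _; rewrite /gs mul1r [F w + _]addrC.
  by apply: weighted => //; apply: withinM; [exact: within_cst|exact: within_id].
have iEs : intg p n Es.
  apply: (@eq_intg _ _ _ (fun w => (- w ^+ 2) * (F w + (1 - alpha) * Kd w))).
    by move=> w _; rewrite /Es; ring.
  by apply: weighted => //; apply: withinN; apply: withinX; exact: within_id.
have pG : primitive_on p n G0 gs by split => // x _; rewrite /G0 itg1 add0r.
have dfE w : df w = dth w * Es w - th w * gs w.
  by rewrite /df /tent_slope !mul0r !subr0 !powR1 /Es /gs; ring.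
have iG0 : intg p n G0 by apply: intg_cont; exact: primitive_continuous (ltW pn) pG.
have idE : intg p n (fun w => dth w * Es w).
  apply: (intg_cat (ltW pm) (ltW mn)).
    apply: (@eq_intg _ _ _ (fun w => l1^-1 * Es w)).
      by move=> w; rewrite in_itv/= => /andP[_ wm]; rewrite /dth wm.
    by apply: intgZ; apply: intgS iEs => //; exact: ltW.
  apply: (@eq_intg_oo _ _ _ (fun w => - l2^-1 * Es w)).
    by move=> w; rewrite in_itv/= => /andP[mw _]; rewrite /dth leNgt mw.
  by apply: intgZ; apply: intgS iEs => //; exact: ltW.
have idG : intg p n (fun w => dth w * G0 w).
  apply: intg_mul_cont; [exact: ltW|exact: pth.1|exact: primitive_continuous (ltW pn) pG].
have itg_th : intg p n (fun w => th w * gs w).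
  apply: (@eq_intg _ _ _ (fun w => gs w * th w)); first by move=> w _; rewrite mulrC.
  apply: intg_mul_cont => //; [exact: ltW|exact: primitive_continuous (ltW pn) pth].
have parts : itg p n (fun w => th w * gs w) = - itg p n (fun w => dth w * G0 w).
  rewrite (itg_by_parts (ltW pn) pth pG).
  have -> : th p = 0 by rewrite /th (ltW pm) subrr mul0r.
  have -> : th n = 0 by rewrite /th leNgt mn/= subrr mul0r.
  by rewrite !mul0r subrr sub0r.
have dE w : p <= w <= n -> df w = dth w * (Es w + G0 w) - (th w * gs w + dth w * G0 w).
  by move=> _; rewrite dfE; ring.
have iEG : intg p n (fun w => dth w * (Es w + G0 w)).
  by apply: (@eq_intg _ _ _ (fun w => dth w * Es w + dth w * G0 w)) => [w _|]; [rewrite mulrDr|exact: intgD].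
have iS : intg p n (fun w => Es w + G0 w) by exact: intgD.
rewrite (@eq_itg _ _ _ _ (fun w => dth w * (Es w + G0 w) - (th w * gs w + dth w * G0 w))); last first.
  by move=> w; rewrite in_itv/= => wI; rewrite dE.
rewrite itgB//; last exact: intgD.
rewrite itgD// parts addNr subr0 (itg_cat (ltW pm) (ltW mn) iEG).
rewrite (@eq_itg _ p m _ (fun w => l1^-1 * (Es w + G0 w))); last first.
  by move=> w; rewrite in_itv/= => /andP[_ wm]; rewrite /dth wm.
rewrite (@eq_itg_oo _ m n _ (fun w => - l2^-1 * (Es w + G0 w))); last 2 first.
- by move=> w; rewrite in_itv/= => /andP[mw _]; rewrite /dth leNgt mw.
- exact: intgS (ltW pm) (lexx n) iEG.
rewrite !itgZ; [by rewrite mulNr ![_^-1 * _]mulrC|exact: intgS (ltW pm) (lexx n) iS|].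
exact: intgS (lexx p) (ltW mn) iS.
Qed.

End Estimate.

End Tent.

End DamageProblem.

(** * Continuity of the damage gradient *)

Section DamageGradient.
Context {R : realType}.
Local Notation mu := (@lebesgue_measure R).
Local Notation A := (`]0%R, 1%R]%classic : set R).

Lemma norm_powR_continuous (p : R) : 0 < p -> continuous (fun x : R => `|x| `^ p).
Proof.
move=> p0 x; have [->|x0] := eqVneq x 0; last first.
  have nx : 0 < `|x| by rewrite normr_gt0.
  apply: (@continuous_comp _ _ _ (fun x : R => `|x|) (fun y : R => y `^ p)).
    exact: norm_continuous.
  exact: is_derive_cont (is_derive1_powR p nx).
apply/continuous_forP => e e0; exists (e `^ p^-1); first exact: powR_gt0.
move=> y; rewrite subr0 => ye; rewrite normr0 powR0 ?gt_eqF// subr0 ger0_norm ?powR_ge0//.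
rewrite -[leRHS](powRr1 (ltW e0)) -(mulVf (lt0r_neq0 p0)) powRrM.
by apply: ge0_ler_powR; rewrite ?nnegrE ?powR_ge0// ltW.
Qed.

(** Lebesgue's differentiation theorem, for [f] extended by zero. *)
Lemma itg_derive_ae (a b : R) (f : R -> R) : intg a b f ->
  {ae mu, forall x : R, a < x < b -> is_derive x 1 (fun y => itg a y f) (f x)}.
Proof.
move=> iff.
pose g := f \_ `[a, b].
have ig : mu.-integrable setT (EFin \o g).
  by rewrite -restrict_EFin -integrable_mkcond.
have locg : locally_integrable setT g by apply: open_integrable_locally => //; exact: openT.
have := lebesgue_differentiation locg; apply: ae_imp => x gx /andP[ax xb].
have ig' : mu.-integrable [set` Interval (BLeft a) (BRight b)] (EFin \o g).
  by apply: integrableS ig.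
have ftc := fun lt_ax => FTC1_lebesgue_pt xb ig' lt_ax gx.
have [|] := ftc; first by rewrite lte_fin.
set F := fun y => _ => dF; rewrite derive1E => Fx.
have gfx : g x = f x by rewrite /g patchE mem_set//= in_itv/= !ltW.
have dF' : is_derive x 1 F (f x) by rewrite -gfx -Fx; exact: DeriveDef.
apply/is_deriveP => e e0; have [d d0 H] := (is_deriveP _ _ _).1 dF' e e0.
exists (Num.min d (Num.min (x - a) (b - x))); first by rewrite !lt_min d0 !subr_gt0 ax.
have FE y : a <= y <= b -> F y = itg a y f.
  move=> /andP[ay yb]; apply: eq_Rintegral => z; rewrite inE/= in_itv/= => /andP[az zy].
  by rewrite /g patchE mem_set//= in_itv/= az (le_trans zy).
move=> y; rewrite !lt_min => /and3P[yd y1 y2]; have := H y yd.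
rewrite !FE ?(ltW ax) ?(ltW xb)//.
by move: y1 y2; rewrite !ltr_norml => /andP[? ?] /andP[? ?]; apply/andP; split; lra.
Qed.

Lemma within_oc_itv (a b : R) (f : R -> R) : 0 < a -> b <= 1 -> {within A, continuous f} ->
  {within `[a, b], continuous f}.
Proof.
move=> a0 b1 cf; apply: continuous_subspaceW (within_oc a0 cf).
by apply: subset_itvl; rewrite bnd_simp.
Qed.

Variables (D v dv h dh phi : R -> R) (e c alpha : R).
Hypothesis dp : damage_problem D v dv h dh phi e c alpha.

Let e_gt0 := dp_e_gt0 dp.
Let alpha_gt1 := dp_alpha_gt1 dp.

Lemma dp_v_cont : {within A, continuous v}.
Proof.
by apply: oc_within => a /[dup]/andP[_ /ltW a1] /(dp_primitive dp)/(primitive_continuous a1).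
Qed.

Lemma dp_gap_cont : {within A, continuous (fun x => D x - v x)}.
Proof. by apply: withinB; [exact: (dp_D_cont dp)|exact: dp_v_cont]. Qed.

Lemma dp_gap_gt0 x : 0 < x <= 1 -> 0 < D x - v x.
Proof. by move=> /(dp_adm dp)/andP[_]; rewrite subr_gt0. Qed.

(** With b0 = - h'(D - v) at x any positive [M] is allowed: this is how the error of the
    conservation law is made small near one point. *)
Lemma gap_near_at (b0 M x : R) : 0 < x <= 1 -> `|dh (D x - v x) + b0| < M ->
  exists2 d : R, 0 < d & exists2 eta : R, 0 < eta & forall z y : R, 0 < z <= 1 -> `|z - x| < d ->
    `|y - (D z - v z)| < eta -> 0 < y /\ `|dh y + b0| <= M.
Proof.
move=> x01 xM; have d0 := dp_gap_gt0 x01.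
have eM : 0 < M - `|dh (D x - v x) + b0| by rewrite subr_gt0.
have [e1 e10 H1] := (continuous_forP _ _).1 (dp_dh_cont dp d0) _ eM.
pose eta := Num.min (D x - v x) e1 / 2.
have eta0 : 0 < eta by rewrite divr_gt0// lt_min d0.
have [d d_gt0 H2] := (continuous_withinP _ _).1 dp_gap_cont x ((oc_itv x).2 x01) _ (divr_gt0 eta0 (ltr0n _ 2)).
exists d => //; exists eta => // z y z01 zx yz.
have h2 := H2 z ((oc_itv z).2 z01) zx.
have m1 : 2 * eta <= D x - v x by rewrite mulrC divfK// ge_min lexx.
have m2 : 2 * eta <= e1 by rewrite mulrC divfK// ge_min lexx orbT.
have yx : `|y - (D x - v x)| < 2 * eta.
  rewrite (_ : y - _ = y - (D z - v z) + (D z - v z - (D x - v x))); last by ring.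
  by rewrite (le_lt_trans (ler_normD _ _))//; lra.
split.
  by move: yx; rewrite ltr_norml => /andP[y1 _]; lra.
have h3 := H1 y (lt_le_trans yx m2).
rewrite (_ : dh y + b0 = dh y - dh (D x - v x) + (dh (D x - v x) + b0)); last by ring.
by rewrite (le_trans (ler_normD _ _))//; lra.
Qed.

(** On [a, 1] the gap D - v has a positive minimum and is bounded, so h' is bounded near all its
    values. This crude version has b0 = 0. *)
Lemma gap_near (a : R) : 0 < a < 1 -> exists M eta : R, [/\ 0 <= M, 0 < eta &
  forall z y : R, a <= z <= 1 -> `|y - (D z - v z)| < eta -> 0 < y /\ `|dh y + 0| <= M].
Proof.
move=> /andP[a0 a1]; have cg := within_oc a0 dp_gap_cont.
have [z0 z0I zmin] := EVT_min (ltW a1) cg.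
have [B HB] := within_bounded (ltW a1) cg.
have oc z : a <= z <= 1 -> 0 < z <= 1 by move=> /andP[az ->]; rewrite (lt_le_trans a0).
set m := D z0 - v z0 in zmin.
have m0 : 0 < m by apply: dp_gap_gt0; apply: oc; rewrite in_itv/= in z0I.
have mB : m / 2 <= B + m.
  have := HB z0; rewrite in_itv/= in z0I => /(_ z0I) => /(le_trans (ler_norm _)).
  by rewrite -/m; lra.
have cdh : {within `[m / 2, B + m], continuous dh}.
  apply/continuous_withinP => x /=; rewrite in_itv/= => /andP[xm _] eps eps0.
  have x0 : 0 < x by apply: lt_le_trans xm; rewrite divr_gt0.
  have [d d0 H] := (continuous_forP _ _).1 (dp_dh_cont dp x0) _ eps0.
  by exists d => // y _; exact: H.
have [M HM] := within_bounded mB cdh.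
exists `|M|, (m / 2); split => //; first by rewrite divr_gt0.
move=> z y zI; have := HB z zI; have := zmin z; rewrite in_itv/= => /(_ zI).
move=> zm /(le_trans (ler_norm _)) zB; rewrite ltr_norml => /andP[y1 y2].
have y3 : m / 2 <= y by lra.
split; first by apply: lt_le_trans y3; rewrite divr_gt0.
rewrite addr0 (le_trans (HM y _))// ?ler_norm//.
by rewrite y3/=; lra.
Qed.

(** Noether's quantity of the tent computation, and below it its source, now with the slope as an
    argument so that it can depend on the point considered. *)
Definition excess (b0 x : R) : R :=
  x ^+ 2 * ((alpha - 1) * (e * `|dv x| `^ alpha) - (c * phi (v x) + b0 * v x)).
Definition source (b0 x : R) : R :=
  2 * x * (e * `|dv x| `^ alpha + (c * phi (v x) + b0 * v x)).

Lemma dp_intg_pow (a b : R) : 0 < a -> b <= 1 -> intg a b (fun x => `|dv x| `^ alpha).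
Proof.
move=> a0 b1; have [a1|a1] := ltP a 1.
  by apply: intgS (lexx a) b1 (dp_intg dp _); rewrite a0.
apply: (@intgS _ 2^-1 1) => //; last by apply: (dp_intg dp); apply/andP; split; lra.
by apply: le_trans a1; lra.
Qed.

Lemma dp_phi_v : {within A, continuous (fun x => phi (v x))}.
Proof.
by apply: (@within_comp _ _ phi v); [exact: dp_v_cont|move=> x _; exact: (dp_phi_cont dp)].
Qed.

Lemma intg_weighted_power (b0 k a b : R) (w : R -> R) : 0 < a -> a <= b -> b <= 1 ->
  {within `[a, b], continuous w} ->
  intg a b (fun x => w x * (k * (e * `|dv x| `^ alpha) + (c * phi (v x) + b0 * v x))).
Proof.
move=> a0 ab b1 cw.
apply: (@eq_intg _ _ _ (fun x => w x * (c * phi (v x) + b0 * v x) +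
    k * e * (`|dv x| `^ alpha * w x))); first by move=> x _; ring.
apply: intgD; last by apply/intgZ/intg_mul_cont => //; exact: dp_intg_pow.
apply: intg_cont; apply: withinM => //; apply: withinD.
  by apply: withinM; [exact: within_cst|exact: within_oc_itv dp_phi_v].
by apply: withinM; [exact: within_cst|exact: within_oc_itv dp_v_cont].
Qed.

Lemma intg_excess (b0 a b : R) : 0 < a -> a <= b -> b <= 1 -> intg a b (excess b0).
Proof.
move=> a0 ab b1; have := @intg_weighted_power b0 (1 - alpha) a b (fun x => - x ^+ 2) a0 ab b1.
move=> /(_ ltac:(by apply: withinN; apply: withinX; exact: within_id)).
by apply: eq_intg => x _; rewrite /excess; ring.
Qed.

Lemma intg_source (b0 a b : R) : 0 < a -> a <= b -> b <= 1 -> intg a b (source b0).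
Proof.
move=> a0 ab b1; have := @intg_weighted_power b0 1 a b (fun x => 2 * x) a0 ab b1.
move=> /(_ ltac:(by apply: withinM; [exact: within_cst|exact: within_id])).
by apply: eq_intg => x _; rewrite /source; ring.
Qed.

(* The approximate conservation law behind the regularity of [v]: [excess + int source] is constant up to an error [M int |v'|]. *)
Lemma conservation (b0 a b M eta : R) : 0 < a -> a < b -> b <= 1 -> 0 < eta -> 0 <= M ->
  (forall z y : R, a <= z <= b -> `|y - (D z - v z)| < eta -> 0 < y /\ `|dh y + b0| <= M) ->
  let Psi x := excess b0 x + itg a x (source b0) in
  forall x y : R, a <= x -> x < y -> y < b ->
    is_derive x 1 (fun z => itg a z Psi) (Psi x) -> is_derive y 1 (fun z => itg a z Psi) (Psi y) ->
    `|Psi y - Psi x| <= 2 * M * itg x y (fun z => `|dv z|).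
Proof.
move=> a0 ab b1 eta0 M0 near_gap Psi x y ax xy yb dx dy.
have a01 : 0 < a < 1 by rewrite a0 (lt_le_trans ab).
have pv : primitive_on a b v dv by exact: primitiveS (lexx a) b1 (dp_primitive dp a01).
have idv := intg_norm pv.1.
have isrc : intg a b (source b0) by apply: intg_source => //; exact: ltW.
have psrc : primitive_on a b (fun x => itg a x (source b0)) (source b0).
  by split => // z _; rewrite itg1 add0r.
have iPsi : intg a b Psi.
  apply: intgD; first by apply: intg_excess => //; exact: ltW.
  by apply: intg_cont; exact: primitive_continuous (ltW ab) psrc.
pose L z := M * itg a z (fun z => `|dv z|).
have pL : primitive_on a b L (fun z => M * `|dv z|).
  by apply: primitiveZ; split => // z _; rewrite itg1 add0r.
have LE p n : a <= p -> p <= n -> n <= b -> L n - L p = M * itg p n (fun z => `|dv z|).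
  move=> ap pn nb; rewrite (primitive_sub pL)// itgZ//; exact: intgS ap nb idv.
have xb : x <= b by apply: ltW; exact: lt_trans yb.
rewrite -mulrA -LE ?(ltW xy) ?(ltW yb)//.
apply: (tent_limit (n0 := b) xy yb _ _ dx dy).
  by apply: continuous_subspaceW (primitive_continuous (ltW ab) pL); apply: subset_itvr; rewrite bnd_simp.
move=> p m n xp pm mn nb.
have ap : a <= p by exact: le_trans xp.
have pn := lt_trans pm mn.
have am : a <= m := le_trans ap (ltW pm).
have PE s t : a <= s -> s < t -> t <= b -> itg a t Psi - itg a s Psi = itg s t Psi.
  by move=> as_ st tb; exact: (itg_sub as_ (ltW st) tb iPsi).
have mb : m <= b by apply: ltW; exact: lt_le_trans nb.
have p0 : 0 < p by exact: lt_le_trans ap.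
rewrite !PE// LE// ?(ltW pn)//.
have := tent_estimate dp p0 pm mn (le_trans nb b1) eta0 M0.
have near_pn z q : p <= z <= n -> `|q - (D z - v z)| < eta -> 0 < q /\ `|dh q + b0| <= M.
  by move=> /andP[pz zn]; apply: near_gap; rewrite (le_trans ap pz)/=; exact: le_trans nb.
move=> /(_ b0 near_pn).
set G := fun x => _ + _.
(* On [p, n] the functions [Psi] and [G] differ by a constant, so differences of mean values
   agree. *)
have key s t : p <= s -> s < t -> t <= n -> itg s t Psi / (t - s) = itg s t G / (t - s) + itg a p (source b0).
  move=> ps st tn; have st0 : t - s != 0 by rewrite gt_eqF// subr_gt0.
  have as_ : a <= s := le_trans ap ps.
  have tb : t <= b := le_trans tn nb.
  have GE z : s <= z <= t -> Psi z = G z + itg a p (source b0).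
    move=> /andP[sz zt]; have pz := le_trans ps sz.
    rewrite /Psi (itg_cat ap pz); last exact: intgS (lexx a) (le_trans zt tb) isrc.
    by rewrite /G /excess /source; ring.
  have iG : intg s t G.
    apply: (@eq_intg _ _ _ (fun z => Psi z - itg a p (source b0))).
      by move=> z; rewrite in_itv/= => /GE ->; rewrite addrK.
    by apply: intgB; [exact: intgS as_ tb iPsi|exact: intg_cst].
  rewrite (@eq_itg _ s t Psi (fun z => G z + itg a p (source b0))).
    by rewrite itgD//; [rewrite itg_cst ?(ltW st)// mulrDl mulfK|exact: intg_cst].
  by move=> z; rewrite in_itv/=; exact: GE.
have cancel (x2 y2 x1 y1 k : R) : x2 = y2 + k -> x1 = y1 + k -> x2 - x1 = y2 - y1.
  by move=> -> ->; rewrite opprD addrACA subrr addr0.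
have E := cancel _ _ _ _ _ (key m n (ltW pm) mn (lexx n)) (key p m (lexx p) pm (ltW mn)).
by move=> H; exact: (eq_ind_r (fun z => `|z| <= M * itg p n (fun z => `|dv z|)) H E).
Qed.

(** On the full set of points where int Psi has derivative [Psi], the conservation law bounds
    increments of [Psi] by those of the continuous function [L]. The McShane extension is therefore
    continuous and agrees with [Psi] almost everywhere. *)
Lemma gradient_modulus (a : R) : 0 < a < 1 -> exists sigma : R -> R,
  [/\ {within `[a, 1], continuous sigma}, forall x, 0 <= sigma x &
      {ae mu, forall x : R, a < x < 1 -> `|dv x| = sigma x}].
Proof.
move=> /[dup] a01 /andP[a0 a1].
have [M [eta [M0 eta0 near_gap]]] := gap_near a01.
have pv := dp_primitive dp a01; have idv := intg_norm pv.1.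
pose Psi x := excess 0 x + itg a x (source 0).
have isrc : intg a 1 (source 0) by apply: intg_source => //; exact: ltW.
have psrc : primitive_on a 1 (fun x => itg a x (source 0)) (source 0).
  by split => // z _; rewrite itg1 add0r.
have csrc := primitive_continuous (ltW a1) psrc.
have iPsi : intg a 1 Psi.
  by apply: intgD; [apply: intg_excess => //; exact: ltW|exact: intg_cont].
pose L x := 2 * M * itg a x (fun z => `|dv z|).
have pL : primitive_on a 1 L (fun z => 2 * M * `|dv z|).
  by apply: primitiveZ; split => // z _; rewrite itg1 add0r.
pose S : set R := [set x | a < x < 1 /\ is_derive x 1 (fun z => itg a z Psi) (Psi x)].
have Sae := itg_derive_ae iPsi.
have S0 : S !=set0 by have [x xI Hx] := ae_ex a1 Sae; exists x; split => //; exact: Hx.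
have half x y : S x -> S y -> x < y -> `|Psi y - Psi x| <= `|L y - L x|.
  move=> [/andP[ax x1] dx] [/andP[ay y1] dy] xy; apply: le_trans (ler_norm _).
  have yle := ltW y1; rewrite (primitive_sub pL (ltW ax) (ltW xy) yle).
  rewrite itgZ; last exact: intgS (ltW ax) yle idv.
  exact: (conservation a0 a1 (lexx 1) eta0 M0 near_gap (ltW ax) xy y1 dx dy).
have HS x y : S x -> S y -> `|Psi y - Psi x| <= `|L y - L x|.
  move=> Sx Sy; case: (ltgtP x y) => [xy|yx|->]; first exact: half.
    by rewrite distrC [leRHS]distrC; exact: half.
  by rewrite !subrr normr0.
have [F [FS FL]] := mcshane_extension S0 HS.
have cF : {within `[a, 1], continuous F}.
  apply/continuous_withinP => x xI eps eps0.
  have [d d0 H] := (continuous_withinP _ _).1 (primitive_continuous (ltW a1) pL) x xI eps eps0.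
  by exists d => // y yI yx; apply: le_trans (FL _ _) (H y yI yx).
(* The definition of [Psi], solved for e |v'|^alpha. *)
pose Kh x := ((F x - itg a x (source 0)) / x ^+ 2 + (c * phi (v x) + 0 * v x)) / (alpha - 1).
have al0 : 0 < alpha - 1 by rewrite subr_gt0.
have al1 : 0 < alpha by apply: lt_trans (alpha_gt1); exact: ltr01.
have cKh : {within `[a, 1], continuous Kh}.
  apply: withinM; last exact: within_cst.
  apply: withinD.
    apply: withinM; first exact: withinB.
    apply: withinV; first by apply: withinX; exact: within_id.
    move=> x /=; rewrite in_itv/= => /andP[ax _].
    by rewrite expf_neq0// gt_eqF// (lt_le_trans a0).
  apply: withinD; first by apply: withinM; [exact: within_cst|exact: within_oc_itv dp_phi_v].
  by apply: withinM; [exact: within_cst|exact: within_oc_itv dp_v_cont].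
exists (fun x => `|Kh x / e| `^ alpha^-1); split.
- apply: (@within_comp _ _ (fun x => `|x| `^ alpha^-1) (fun x => Kh x / e)).
    by apply: withinM => //; exact: within_cst.
  by move=> x _; apply: norm_powR_continuous; rewrite invr_gt0.
- by move=> x; exact: powR_ge0.
apply: ae_imp Sae => x Sx xI; have /FS Fx : S x by split => //; exact: Sx.
have x0 : x != 0 by case/andP: xI => ax _; rewrite gt_eqF// (lt_trans a0).
have -> : Kh x / e = `|dv x| `^ alpha.
  rewrite /Kh Fx /Psi /excess; field.
  by rewrite x0 !gt_eqF.
by rewrite [`|_ `^ alpha|]ger0_norm ?powR_ge0// -powRrM mulfV ?powRr1// gt_eqF.
Qed.

End DamageGradient.

(** * Strict derivatives from chords *)

Section StrongDerivative.
Context {R : realType}.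
Local Notation A := (`]0%R, 1%R]%classic : set R).
Implicit Types (v g : R -> R).

Definition slope v x1 x2 : R := (v x2 - v x1) / (x2 - x1).

(** Both ends of the chord are free, on either side of [x0] or on the same side. A limit of slopes
    along such pairs is a strict derivative, from which continuity of the derivative comes without
    further work. *)
Definition near_pairs (x0 : R) (P : R -> R -> Prop) := exists2 d : R, 0 < d &
  forall x1 x2 : R, 0 < x1 -> x1 < x2 -> x2 <= 1 -> `|x1 - x0| < d -> `|x2 - x0| < d -> P x1 x2.

Lemma near_pairs_and x0 P Q : near_pairs x0 P -> near_pairs x0 Q ->
  near_pairs x0 (fun x1 x2 => P x1 x2 /\ Q x1 x2).
Proof.
move=> [d d0 HP] [d' d0' HQ]; exists (Num.min d d'); first by rewrite lt_min d0.
move=> x1 x2 h1 h2 h3; rewrite !lt_min => /andP[? ?] /andP[? ?].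
by split; [apply: HP|apply: HQ].
Qed.

(** Such conditions are not vacuous: a partner is found to the left of [x], hence also for x = 1. *)
Lemma near_pairs_ex x0 P x : 0 < x <= 1 -> near_pairs x0 P ->
  exists2 d : R, 0 < d & (`|x - x0| < d -> exists y, P x y \/ P y x).
Proof.
move=> /andP[x0' x1] [d d0 H]; exists d => // xd.
pose m := Num.min (x / 2) ((d - `|x - x0|) / 2).
have m0 : 0 < m by rewrite lt_min !divr_gt0// subr_gt0.
have m1 : m <= x / 2 by rewrite ge_min lexx.
have m2 : m <= (d - `|x - x0|) / 2 by rewrite ge_min lexx orbT.
exists (x - m); right; apply: H => //; first by lra.
  by lra.
rewrite (_ : x - m - x0 = (x - x0) - m); last by ring.
by rewrite (le_lt_trans (ler_normB _ _))// (gtr0_norm m0); lra.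
Qed.

(* Move one chord continuously to the other. *)
Lemma slope_sign v (x0 d : R) : {within A, continuous v} ->
  (forall x1 x2 : R, 0 < x1 -> x1 < x2 -> x2 <= 1 -> `|x1 - x0| < d -> `|x2 - x0| < d ->
    v x1 != v x2) ->
  (forall x1 x2 : R, 0 < x1 -> x1 < x2 -> x2 <= 1 -> `|x1 - x0| < d -> `|x2 - x0| < d ->
    v x1 < v x2) \/
  (forall x1 x2 : R, 0 < x1 -> x1 < x2 -> x2 <= 1 -> `|x1 - x0| < d -> `|x2 - x0| < d ->
    v x2 < v x1).
Proof.
move=> cv inj; have [|H] := pselect (exists x1 x2 : R, [/\ 0 < x1, x1 < x2 & x2 <= 1] /\
    [/\ `|x1 - x0| < d, `|x2 - x0| < d & v x1 < v x2]); last first.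
  right => x1 x2 h1 h2 h3 h4 h5; rewrite lt_neqAle eq_sym inj//= leNgt; apply/negP => lt.
  by apply: H; exists x1, x2.
move=> [x1 [x2 [[x10 x12 x21] [x1d x2d vx]]]]; left => y1 y2 y10 y12 y21 y1d y2d.
rewrite lt_neqAle inj//= leNgt; apply/negP => vy.
pose p (x y t : R) := x + t * (y - x).
pose F t := v (p x2 y2 t) - v (p x1 y1 t).
have pt (x y t : R) : 0 <= t <= 1 -> p x y t = (1 - t) * x + t * y by move=> _; rewrite /p; ring.
have pA (x y t : R) : 0 <= t <= 1 -> 0 < x <= 1 -> 0 < y <= 1 -> 0 < p x y t <= 1.
  move=> /[dup]/(pt x y)-> /andP[t0 t1] /andP[x0' x1'] /andP[y0 y1'].
  by apply/andP; split; [have [->|?] := eqVneq t 0; [rewrite subr0 mul1r mul0r addr0|]|]; nra.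
have pd (x y t : R) : 0 <= t <= 1 -> `|x - x0| < d -> `|y - x0| < d -> `|p x y t - x0| < d.
  move=> /[dup]/(pt x y)-> /andP[t0 t1] xd yd.
  rewrite (_ : _ - x0 = (1 - t) * (x - x0) + t * (y - x0)); last by ring.
  rewrite (le_lt_trans (ler_normD _ _))// !normrM (ger0_norm t0) ger0_norm ?subr_ge0//.
  by have [->|?] := eqVneq t 0; [rewrite subr0 mul1r mul0r addr0|nra].
have x1A : 0 < x1 <= 1 by rewrite x10 ltW// (lt_le_trans x12).
have x2A : 0 < x2 <= 1 by rewrite x21 (lt_trans x10).
have y1A : 0 < y1 <= 1 by rewrite y10 ltW// (lt_le_trans y12).
have y2A : 0 < y2 <= 1 by rewrite y21 (lt_trans y10).
have cp x y : 0 < x <= 1 -> 0 < y <= 1 -> {within `[0, 1], continuous (fun t => v (p x y t))}.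
  move=> xA yA; apply/continuous_withinP => t; rewrite /= in_itv/= => tI e e0.
  have [e1 e10 H] := (continuous_withinP _ _).1 cv _ ((oc_itv _).2 (pA x y t tI xA yA)) e e0.
  have [e2 e20 H2] := (continuous_forP _ _).1 (is_derive_cont (is_derive_affine x (y - x) t)) _ (divr_gt0 e10 (ltr0n _ 2)).
  exists e2 => // s; rewrite /= in_itv/= => sI st; apply: H; first exact/oc_itv/pA.
  have := H2 s st; rewrite /p ![_ * (y - x)]mulrC; move/le_lt_trans; apply; lra.
have cF : {within `[0, 1], continuous F} by apply: withinB; exact: cp.
have [|t tI Ft] := @IVT _ F 0 1 0 ler01 cF.
  rewrite /F /p !mul0r !mul1r !addr0 !(addrC _ (_ - _)) !subrK.
  by rewrite ge_min le_max !subr_ge0 !subr_le0 (ltW vx) (ltW vy) orbT.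
rewrite in_itv/= in tI; have /eqP := Ft; rewrite subr_eq0 eq_sym => /negP[]; apply/negP.
have lt12 : p x1 y1 t < p x2 y2 t.
  rewrite !pt//; case/andP: tI => t0 t1.
  by have [->|?] := eqVneq t 0; [rewrite subr0 !mul1r !mul0r !addr0|nra].
have /andP[? _] := pA _ _ _ tI x1A y1A; have /andP[_ ?] := pA _ _ _ tI x2A y2A.
by apply: inj => //; exact: pd.
Qed.

(** If s0 > 0, chords near [x0] are not horizontal, so [v] is injective there and all chords have
    one sign; convergence of the absolute slopes is then convergence of the slopes. If s0 = 0 the
    sign does not matter. *)
Lemma strong_derivative v (x0 s0 : R) : {within A, continuous v} -> 0 <= s0 ->
  (forall e : R, 0 < e -> near_pairs x0 (fun x1 x2 => `| `|slope v x1 x2| - s0| <= e)) ->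
  exists2 g, `|g| = s0 & forall e : R, 0 < e -> near_pairs x0 (fun x1 x2 => `|slope v x1 x2 - g| <= e).
Proof.
move=> cv; rewrite le_eqVlt => /predU1P[<- H|s00 H].
  exists 0; first by rewrite normr0.
  move=> e e0; have [d d0 Hd] := H e e0; exists d => // x1 x2 h1 h2 h3 h4 h5.
  by have := Hd x1 x2 h1 h2 h3 h4 h5; rewrite !subr0 normr_id.
have [d d0 Hd] := H _ (divr_gt0 s00 (ltr0n _ 2)).
have inj x1 x2 : 0 < x1 -> x1 < x2 -> x2 <= 1 -> `|x1 - x0| < d -> `|x2 - x0| < d -> v x1 != v x2.
  move=> h1 h2 h3 h4 h5; apply/eqP => E; have := Hd x1 x2 h1 h2 h3 h4 h5.
  by rewrite /slope E subrr mul0r normr0 sub0r normrN gtr0_norm//; lra.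
have fin (sg : R) : `|sg| = 1 -> (forall x1 x2 : R, 0 < x1 -> x1 < x2 -> x2 <= 1 -> `|x1 - x0| < d -> `|x2 - x0| < d ->
    slope v x1 x2 = sg * `|slope v x1 x2|) ->
    exists2 g, `|g| = s0 & forall e : R, 0 < e -> near_pairs x0 (fun x1 x2 => `|slope v x1 x2 - g| <= e).
  move=> sg1 Hs; exists (sg * s0); first by rewrite normrM sg1 mul1r gtr0_norm.
  move=> e e0; have [d' d0' Hd'] := H e e0; exists (Num.min d d'); first by rewrite lt_min d0.
  move=> x1 x2 h1 h2 h3; rewrite !lt_min => /andP[h4 h5] /andP[h6 h7].
  by rewrite Hs// -mulrBr normrM sg1 mul1r Hd'.
have [up|down] := slope_sign cv inj.
  apply: (fin 1); first by rewrite normr1.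
  move=> x1 x2 h1 h2 h3 h4 h5; rewrite mul1r ger0_norm// divr_ge0 ?subr_ge0 ?(ltW h2)//.
  by rewrite ltW// up.
apply: (fin (-1)); first by rewrite normrN normr1.
move=> x1 x2 h1 h2 h3 h4 h5; rewrite mulN1r ler0_norm ?opprK//.
by rewrite mulr_le0_ge0 ?invr_ge0 ?subr_ge0 ?(ltW h2)// subr_le0 ltW// down.
Qed.

Lemma strong_derives_oc v (x g : R) : 0 < x <= 1 ->
  (forall e : R, 0 < e -> near_pairs x (fun x1 x2 => `|slope v x1 x2 - g| <= e)) ->
  derives_oc v x g.
Proof.
move=> /andP[x0 x1] H e e0; have [d d0 Hd] := H e e0; exists d => // y /andP[y0 y1] yd.
have n0 : `|x - x| < d by rewrite subrr normr0.
case: (ltgtP x y) => [xy|yx|->]; last by rewrite !subrr mulr0 subrr normr0 mulr0.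
  have := Hd x y x0 xy y1 n0 yd; have yx0 : 0 < y - x by rewrite subr_gt0.
  move=> Hs; rewrite (_ : v y - v x - g * (y - x) = (slope v x y - g) * (y - x)).
    by rewrite normrM ler_wpM2r.
  by rewrite /slope; field; rewrite gt_eqF.
have := Hd y x y0 yx x1 yd n0; have yx0 : 0 < x - y by rewrite subr_gt0.
move=> Hs; rewrite (_ : v y - v x - g * (y - x) = (slope v y x - g) * (y - x)).
  by rewrite normrM ler_wpM2r.
by rewrite /slope; field; rewrite gt_eqF.
Qed.

(** g(x) and g(y) are compared through one chord so close to [y] that it counts for both points. *)
Lemma strong_continuous v g : (forall x : R, 0 < x <= 1 -> forall e : R, 0 < e ->
    near_pairs x (fun x1 x2 => `|slope v x1 x2 - g x| <= e)) -> {within A, continuous g}.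
Proof.
move=> H; apply/continuous_withinP => x /oc_itv xA e e0.
have e2 : 0 < e / 2 by rewrite divr_gt0.
have [d d0 Hd] := H x xA _ e2; exists d => // y /oc_itv yA yd.
have Hx : near_pairs y (fun x1 x2 => `|slope v x1 x2 - g x| <= e / 2).
  exists (d - `|y - x|); first by rewrite subr_gt0.
  move=> x1 x2 h1 h2 h3 h4 h5; apply: Hd => //.
    by rewrite (_ : x1 - x = x1 - y + (y - x)); [rewrite (le_lt_trans (ler_normD _ _))//; lra|ring].
  by rewrite (_ : x2 - x = x2 - y + (y - x)); [rewrite (le_lt_trans (ler_normD _ _))//; lra|ring].
have [d' d'0] := near_pairs_ex yA (near_pairs_and Hx (H y yA _ e2)).
rewrite subrr normr0 => /(_ d'0)[z Hz].
have key (s : R) : `|s - g x| <= e / 2 /\ `|s - g y| <= e / 2 -> `|g y - g x| <= e.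
  move=> [s1 s2]; rewrite (_ : g y - g x = s - g x - (s - g y)); last by ring.
  by rewrite (le_trans (ler_normB _ _))//; lra.
by case: Hz => /key.
Qed.

End StrongDerivative.

(** * Continuous differentiability of the damage *)

Section DamageC1.
Context {R : realType}.
Local Notation mu := (@lebesgue_measure R).
Local Notation A := (`]0%R, 1%R]%classic : set R).
Variables (D v dv h dh phi : R -> R) (e c alpha : R).
Hypothesis dp : damage_problem D v dv h dh phi e c alpha.

Let e_gt0 := dp_e_gt0 dp.
Let alpha_gt1 := dp_alpha_gt1 dp.
Let al0 : 0 < alpha. Proof. by apply: lt_trans alpha_gt1; exact: ltr01. Qed.

Lemma potential_near (x0 eps : R) : 0 < x0 <= 1 -> 0 < eps -> exists2 d : R, 0 < d &
  forall z w : R, 0 < z <= 1 -> `|z - x0| < d -> `|w - v x0| < d ->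
    w < D z /\ `|h (D z - w) + c * phi w - (h (D x0 - v x0) + c * phi (v x0))| <= eps.
Proof.
move=> x01 eps0; have d0 := dp_gap_gt0 dp x01; have c0 := dp_c_gt0 dp.
have ch := is_derive_cont (dp_h_der dp d0).
have eps2 : 0 < eps / 2 by rewrite divr_gt0.
have [e1 e10 H1] := (continuous_forP _ _).1 ch _ eps2.
have epsc : 0 < eps / 2 / c by rewrite divr_gt0.
have cphi : {for v x0, continuous phi} by exact: (dp_phi_cont dp).
have [e2 e20 H2] := (continuous_forP _ _).1 cphi _ epsc.
pose m := Num.min (D x0 - v x0) e1 / 3.
have m0 : 0 < m by rewrite divr_gt0// lt_min d0.
have m1 : 3 * m <= D x0 - v x0 by rewrite mulrC divfK// ge_min lexx.
have m2 : 3 * m <= e1 by rewrite mulrC divfK// ge_min lexx orbT.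
have [d dpos H3] := (continuous_withinP _ _).1 (dp_D_cont dp) x0 ((oc_itv x0).2 x01) _ m0.
exists (Num.min d (Num.min m e2)); first by rewrite !lt_min dpos m0.
move=> z w z01; rewrite !lt_min => /and3P[zd _ _] /and3P[_ wm we].
have Dz := H3 z ((oc_itv z).2 z01) zd.
have close : `|(D z - w) - (D x0 - v x0)| < 3 * m.
  rewrite (_ : D z - w - _ = (D z - D x0) - (w - v x0)); last by ring.
  by rewrite (le_lt_trans (ler_normB _ _))//; lra.
split; first by move: close; rewrite ltr_norml => /andP[? _]; lra.
have h1 := H1 _ (lt_le_trans close m2); have h2 := H2 w we.
rewrite (_ : _ - _ = (h (D z - w) - h (D x0 - v x0)) + c * (phi w - phi (v x0))); last by ring.
rewrite (le_trans (ler_normD _ _))// normrM (gtr0_norm c0).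
have : c * `|phi w - phi (v x0)| <= eps / 2 by rewrite mulrC -ler_pdivlMr.
by lra.
Qed.

(** Both bounds carry the weight z^2, whose positive integral divides out. *)
Lemma energy_squeeze (x1 x2 lo hi : R) (f g : R -> R) : 0 < x1 -> x1 < x2 ->
  intg x1 x2 f -> intg x1 x2 g ->
  (forall z, x1 <= z <= x2 -> z ^+ 2 * lo <= f z) ->
  (forall z, x1 <= z <= x2 -> g z <= z ^+ 2 * hi) ->
  itg x1 x2 f <= itg x1 x2 g -> lo <= hi.
Proof.
move=> x10 x12 iF iG Hf Hg fg.
have isq : intg x1 x2 (fun z => z ^+ 2) by apply: intg_cont; apply: withinX; exact: within_id.
pose Z := itg x1 x2 (fun z => z ^+ 2).
have Z0 : 0 < Z.
  apply: (@lt_le_trans _ _ (x1 ^+ 2 * (x2 - x1))); first by rewrite mulr_gt0 ?exprn_gt0 ?subr_gt0.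
  rewrite -itg_cst ?(ltW x12)//; apply: le_itg => //; first exact: intg_cst.
  by move=> z /andP[zl _]; rewrite ler_pXn2r// nnegrE ltW// (lt_le_trans x10).
have h1 : lo * Z <= itg x1 x2 f.
  rewrite -itgZ//; apply: le_itg; [exact: intgZ|by []|].
  by move=> z /Hf; rewrite mulrC.
have h2 : itg x1 x2 g <= hi * Z.
  rewrite -itgZ//; apply: le_itg; [by []|exact: intgZ|].
  by move=> z /Hg; rewrite [hi * _]mulrC.
by rewrite -(ler_pM2r Z0); exact: le_trans h1 (le_trans fg h2).
Qed.

Lemma lagrangian_bounds (w dw : R -> R) (H0 eps s z : R) : 0 <= s ->
  `|h (D z - w z) + c * phi (w z) - H0| <= eps ->
  (s <= `|dw z| -> z ^+ 2 * (H0 - eps + e * s `^ alpha) <= lagrangian D h phi e c alpha w dw z) /\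
  (`|dw z| <= s -> lagrangian D h phi e c alpha w dw z <= z ^+ 2 * (H0 + eps + e * s `^ alpha)).
Proof.
move=> s0; rewrite ler_norml => /andP[h1 h2]; split => sw; rewrite ler_wpM2l ?sqr_ge0//.
  have : e * s `^ alpha <= e * `|dw z| `^ alpha.
    by rewrite ler_pM2l//; apply: ge0_ler_powR; rewrite ?nnegrE ?(ltW al0).
  by lra.
have : e * `|dw z| `^ alpha <= e * s `^ alpha.
  by rewrite ler_pM2l//; apply: ge0_ler_powR; rewrite ?nnegrE ?(ltW al0).
by lra.
Qed.

Section Modulus.
Variables (a x0 : R) (sigma : R -> R).
Hypotheses (a0 : 0 < a) (ax : a < x0) (x01 : x0 <= 1)
  (c_sigma : {within `[a, 1], continuous sigma}) (sigma_ge0 : forall x, 0 <= sigma x)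
  (dv_sigma : {ae mu, forall x : R, a < x < 1 -> `|dv x| = sigma x}).

Let x0A : 0 < x0 <= 1. Proof. by rewrite x01 (lt_trans a0). Qed.

Let local_pairs (d : R) : 0 < d -> exists2 d' : R, 0 < d' & d' <= d /\
  forall x : R, `|x - x0| < d' -> a < x.
Proof.
move=> d0; exists (Num.min d (x0 - a)); first by rewrite lt_min d0 subr_gt0.
split; first by rewrite ge_min lexx.
by move=> x; rewrite lt_min ltr_norml => /andP[_ ]; rewrite ltr_norml => /andP[? _]; lra.
Qed.

Let ae_on (x1 x2 : R) (f g : R -> R) : a < x1 -> x2 <= 1 ->
  (forall x, x1 <= x <= x2 -> `|dv x| = sigma x -> f x = g x) ->
  {ae mu, forall x : R, x1 <= x <= x2 -> f x = g x}.
Proof.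
move=> ax1 x21 H; apply: ae_imp (ae_and dv_sigma (@ae_neq R 1)) => x [Hx xn] xI.
apply: H => //; apply: Hx; case/andP: xI => xl xr.
by rewrite (lt_le_trans ax1 xl)/= lt_neqAle xn (le_trans xr).
Qed.

(** A chord slope is a mean of v', and |v'| = sigma is close to sigma(x0). *)
Lemma slope_le (eps : R) : 0 < eps -> near_pairs x0 (fun x1 x2 => `|slope v x1 x2| <= sigma x0 + eps).
Proof.
move=> eps0; have x0I : `[a, 1]%classic x0 by rewrite /= in_itv/= x01 ltW.
have [d d0 H] := (continuous_withinP _ _).1 c_sigma x0 x0I _ eps0.
have [d' d'0 [d'd Ha]] := local_pairs d0.
exists d' => // x1 x2 x10 x12 x21 x1d x2d.
have ax1 := Ha _ x1d; have x1_01 : 0 < x1 < 1 by rewrite x10 (lt_le_trans x12).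
have pv := primitiveS (lexx x1) x21 (dp_primitive dp x1_01).
rewrite /slope (primitive_sub pv (lexx x1) (ltW x12) (lexx x2)).
have x120 : 0 < x2 - x1 by rewrite subr_gt0.
rewrite normrM normfV (gtr0_norm x120) ler_pdivrMr//.
rewrite (le_trans (norm_itg pv.1))//.
have cs : {within `[x1, x2], continuous sigma}.
  by apply: continuous_subspaceW c_sigma; apply: subset_itvScc; rewrite bnd_simp// ltW.
have [is_ ->] := ae_itg (intg_norm pv.1) (intg_meas (intg_cont cs)) (ae_on ax1 x21 (fun x _ E => E)).
rewrite -itg_cst ?(ltW x12)//; apply: le_itg => //; first exact: intg_cst.
move=> x /andP[xl xr]; have : `|sigma x - sigma x0| <= eps.
  apply: H; first by rewrite /= in_itv/= (le_trans xr x21) (ltW (lt_le_trans ax1 xl)).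
  apply: lt_le_trans d'd; move: x1d x2d; rewrite !ltr_norml => /andP[? ?] /andP[? ?].
  by apply/andP; split; lra.
by rewrite ler_norml => /andP[_]; lra.
Qed.

(* Otherwise replacing [v] by its chord would lower the energy. *)
Lemma slope_ge (s1 s2 : R) : 0 <= s1 -> s1 < s2 -> s2 < sigma x0 ->
  near_pairs x0 (fun x1 x2 => s1 <= `|slope v x1 x2|).
Proof.
move=> s10 s12 s2s.
have contra_gap (x y H : R) : 0 < x - y -> H - (x - y) / 4 + x <= H + (x - y) / 4 + y -> False.
  by move=> *; lra.
have gap : 0 < e * (s2 `^ alpha - s1 `^ alpha).
  rewrite mulr_gt0// subr_gt0 gt0_ltr_powR// ?nnegrE ?ltW//; exact: le_lt_trans s12.
(* A quarter of the gain in gradient energy: the lower-order terms of [v] and of its chord may each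
   be off by [eps], which uses up only half of the gain. *)
pose eps := (e * s2 `^ alpha - e * s1 `^ alpha) / 4.
have eps0 : 0 < eps by rewrite divr_gt0// -mulrBr.
have [d1 d10 H1] := potential_near x0A eps0.
have [d2 d20 H2] := (continuous_withinP _ _).1 (dp_v_cont dp) x0 ((oc_itv x0).2 x0A) _ (divr_gt0 d10 (ltr0n _ 2)).
have x0I : `[a, 1]%classic x0 by rewrite /= in_itv/= x01 ltW.
have ss0 : 0 < sigma x0 - s2 by rewrite subr_gt0.
have [d3 d30 H3] := (continuous_withinP _ _).1 c_sigma x0 x0I _ ss0.
have dd0 : 0 < Num.min d1 (Num.min d2 d3) by rewrite !lt_min d10 d20.
have [d d_gt0 [d_le Ha]] := local_pairs dd0.
move: d_le; rewrite !le_min => /and3P[dd1 dd2 dd3].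
exists d => // x1 x2 x10 x12 x21 x1d x2d; rewrite leNgt; apply/negP => small.
have ax1 := Ha _ x1d; have x1_01 : 0 < x1 < 1 by rewrite x10 (lt_le_trans x12).
have x120 : 0 < x2 - x1 by rewrite subr_gt0.
set p := slope v x1 x2 in small.
pose u z := v x1 + p * (z - x1).
have pu : primitive_on x1 x2 u (fun=> p).
  have := primitiveD (primitive_cst x1 x2 (v x1))
    (primitiveZ p (primitiveD (primitive_id x1 x2) (primitive_cst x1 x2 (- x1)))).
  by apply: eq_primitive => z _ //=; rewrite addr0 mulr1 add0r.
have near_z z : x1 <= z <= x2 -> `|z - x0| < d.
  move=> /andP[zl zr]; move: x1d x2d; rewrite !ltr_norml => /andP[? ?] /andP[? ?].
  by apply/andP; split; lra.
have zA z : x1 <= z <= x2 -> 0 < z <= 1.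
  by move=> /andP[zl zr]; rewrite (lt_le_trans x10 zl) (le_trans zr).
have vz z : x1 <= z <= x2 -> `|v z - v x0| <= d1 / 2.
  move=> zI; apply: H2; first exact/oc_itv/zA.
  exact: lt_le_trans (near_z z zI) dd2.
have x1I : x1 <= x1 <= x2 by rewrite lexx ltW.
have x2I : x1 <= x2 <= x2 by rewrite lexx ltW.
have u1 : u x1 = v x1 by rewrite /u subrr mulr0 addr0.
have u2 : u x2 = v x2.
  by rewrite /u /p /slope; field; rewrite gt_eqF.
have uE z : x1 <= z <= x2 -> exists2 t : R, 0 <= t <= 1 & u z = (1 - t) * v x1 + t * v x2.
  move=> /andP[zl zr]; exists ((z - x1) / (x2 - x1)).
    by rewrite divr_ge0 ?subr_ge0 ?(ltW x12)//= ler_pdivrMr// mul1r lerD2r.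
  by rewrite /u /p /slope; field; rewrite gt_eqF.
have uz z : x1 <= z <= x2 -> 0 <= u z /\ `|u z - v x0| < d1.
  move=> zI; have [t /andP[t0 t1] ->] := uE z zI.
  have /andP[v10 _] := dp_adm dp (zA _ x1I); have /andP[v20 _] := dp_adm dp (zA _ x2I).
  split; first by rewrite addr_ge0 ?mulr_ge0 ?subr_ge0.
  have := vz _ x1I; have := vz _ x2I; rewrite !ler_norml ltr_norml.
  move=> /andP[? ?] /andP[? ?]; apply/andP; split; nra.
have potu z zI := H1 z (u z) (zA z zI) (lt_le_trans (near_z z zI) dd1) (proj2 (uz z zI)).
have vlt z : x1 <= z <= x2 -> `|v z - v x0| < d1 by move=> /vz /le_lt_trans; apply; lra.
have potv z zI := H1 z (v z) (zA z zI) (lt_le_trans (near_z z zI) dd1) (vlt z zI).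
have ipow : intg x1 x2 (fun=> `|p| `^ alpha) by exact: intg_cst.
have vm := damage_min_on dp x10 x12 x21 pu u1 u2 ipow.
have uadm z : x1 <= z <= x2 -> 0 <= u z < D z.
  by move=> zI; have [-> _] := uz z zI; have [-> _] := potu z zI.
have {}vm := vm uadm.
have pvx := primitiveS (lexx x1) x21 (dp_primitive dp x1_01).
have ilv : intg x1 x2 (lagrangian D h phi e c alpha v dv).
  apply: (intg_lagrangian dp) => //; [exact: primitive_continuous (ltW x12) pvx|exact: (dp_intg_pow dp)|].
  by move=> z /zA/(dp_adm dp)/andP[].
have ilu : intg x1 x2 (lagrangian D h phi e c alpha u (fun=> p)).
  apply: (intg_lagrangian dp) => //; first exact: primitive_continuous (ltW x12) pu.
  by move=> z /uadm/andP[].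
have cs : {within `[x1, x2], continuous sigma}.
  by apply: continuous_subspaceW c_sigma; apply: subset_itvScc; rewrite bnd_simp// ltW.
pose G z := lagrangian D h phi e c alpha v sigma z.
have iG0 : intg x1 x2 G.
  apply: (intg_lagrangian dp) => //; first exact: primitive_continuous (ltW x12) pvx.
    apply: intg_cont; apply: (@within_comp _ _ (fun x => `|x| `^ alpha) sigma) => // x _.
    exact: norm_powR_continuous.
  by move=> z /zA/(dp_adm dp)/andP[].
have aeG : {ae mu, forall x : R, x1 <= x <= x2 -> lagrangian D h phi e c alpha v dv x = G x}.
  by apply: ae_on => // x _ E; rewrite /G /lagrangian E (ger0_norm (sigma_ge0 x)).
have [iG vG] := ae_itg ilv (intg_meas iG0) aeG.
rewrite vG in vm.
set H0 := h (D x0 - v x0) + c * phi (v x0) in H1 potu potv.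
have s20 : 0 <= s2 := le_trans s10 (ltW s12).
have lo z : x1 <= z <= x2 -> z ^+ 2 * (H0 - eps + e * s2 `^ alpha) <= G z.
  move=> zI; apply: (proj1 (lagrangian_bounds sigma s20 (proj2 (potv z zI)))).
  have sz : `|sigma z - sigma x0| <= sigma x0 - s2.
    apply: H3; last exact: lt_le_trans (near_z z zI) dd3.
    by case/andP: zI => zl zr; rewrite /= in_itv/= (le_trans zr x21) (ltW (lt_le_trans ax1 zl)).
  apply: le_trans (ler_norm _); move: sz; rewrite ler_norml => /andP[+ _].
  by rewrite opprB lerD2r.
have hi z : x1 <= z <= x2 ->
    lagrangian D h phi e c alpha u (fun=> p) z <= z ^+ 2 * (H0 + eps + e * s1 `^ alpha).
  by move=> zI; apply: (proj2 (lagrangian_bounds (fun=> p) s10 (proj2 (potu z zI)))); exact: ltW.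
have := energy_squeeze x10 x12 iG0 ilu lo hi vm.
by apply: contra_gap; rewrite -mulrBr.
Qed.

(** For sigma(x0) < eps the upper bound is enough; otherwise the lower one is used with sigma(x0) -
    eps < sigma(x0) - eps / 2. *)
Lemma slope_modulus (eps : R) : 0 < eps ->
  near_pairs x0 (fun x1 x2 => `| `|slope v x1 x2| - sigma x0| <= eps).
Proof.
move=> eps0; have [small|big] := ltP (sigma x0) eps.
  have [d d0 H] := slope_le eps0; exists d => // x1 x2 h1 h2 h3 h4 h5.
  have := H x1 x2 h1 h2 h3 h4 h5; have := normr_ge0 (slope v x1 x2); have := sigma_ge0 x0.
  by move=> ? ? ?; rewrite ler_norml; apply/andP; split; lra.
have [|||d d0 H] := near_pairs_and (slope_le eps0) (@slope_ge (sigma x0 - eps) (sigma x0 - eps / 2) _ _ _); try lra.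
exists d => // x1 x2 h1 h2 h3 h4 h5; have [? ?] := H x1 x2 h1 h2 h3 h4 h5.
by rewrite ler_norml; apply/andP; split; lra.
Qed.

End Modulus.
Lemma primitive_of_derives (g : R -> R) (a : R) : 0 < a < 1 -> {within A, continuous v} ->
  {within A, continuous g} -> (forall x, 0 < x <= 1 -> derives_oc v x (g x)) -> primitive_on a 1 v g.
Proof.
move=> /andP[a0 a1] cv cg dg.
have ig : intg a 1 g by apply: intg_cont; exact: within_oc.
split => // x /andP[ax x1].
pose W y := v y - itg a y g.
have pg : primitive_on a 1 (fun y => itg a y g) g by split => // z _; rewrite itg1 add0r.
have cW : {within `[a, x], continuous W}.
  apply: withinB; first exact: within_oc_itv.
  by apply: continuous_subspaceW (primitive_continuous (ltW a1) pg); apply: subset_itvl; rewrite bnd_simp.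
have dW y : y \in `]a, x[ -> is_derive y 1 W 0.
  rewrite in_itv/= => /andP[ay yx]; have y01 : 0 < y < 1 by rewrite (lt_trans a0)//= (lt_le_trans yx).
  have d1 := derives_oc_is_derive y01 (dg y ltac:(by case/andP: y01 => -> /ltW ->)).
  have d2 := is_derive_itg ay (lt_le_trans yx x1) ig (within_oc_at y01 cg).
  have := is_deriveB d1 d2.
  by rewrite subrr.
have [z _] := MVT_segment ax dW cW.
rewrite mul0r /W itg1 subr0 => /eqP; rewrite subr_eq0 => /eqP <-.
by rewrite subrK.
Qed.

(** The density sees only |v'|, so minimality passes to any density of [v] with the same modulus. *)
Lemma damage_problem_modulus (g : R -> R) : {within A, continuous g} ->
  (forall a : R, 0 < a < 1 -> primitive_on a 1 v g) ->
  {ae mu, forall x : R, 0 < x < 1 -> `|dv x| = `|g x|} -> damage_problem D v g h dh phi e c alpha.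
Proof.
move=> cg pg aeg.
have ig a : 0 < a < 1 -> intg a 1 (fun x => `|g x| `^ alpha).
  move=> /andP[a0 _]; apply: intg_cont; apply: (@within_comp _ _ (fun x => `|x| `^ alpha) g).
    exact: within_oc.
  by move=> x _; exact: norm_powR_continuous.
apply: (DamageProblem e_gt0 (dp_c_gt0 dp) alpha_gt1 (dp_phi_cont dp) (dp_h_der dp) (dp_dh_cont dp)
  (dp_D_cont dp) pg (dp_adm dp) ig).
move=> a w dw a01 pw wa w1 iw wadm; apply: le_trans (dp_min dp a01 pw wa w1 iw wadm).
have [a0 a1] := andP a01.
have il dw' : intg a 1 (fun x => `|dw' x| `^ alpha) -> intg a 1 (lagrangian D h phi e c alpha v dw').
  move=> iw'; apply: (intg_lagrangian dp) => //; first exact: within_oc (dp_v_cont dp).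
  move=> z /andP[az z1]; have zA : 0 < z <= 1 by rewrite z1 (lt_le_trans a0).
  by have /andP[] := dp_adm dp zA.
have E : {ae mu, forall x : R, a <= x <= 1 ->
    lagrangian D h phi e c alpha v dv x = lagrangian D h phi e c alpha v g x}.
  apply: ae_imp (ae_and aeg (@ae_neq R 1)) => x [Hx xn] /andP[ax x1].
  by rewrite /lagrangian Hx// (lt_le_trans a0 ax)/= lt_neqAle xn.
by have [_ ->] := ae_itg (il _ (dp_intg dp a01)) (intg_meas (il _ (ig a a01))) E.
Qed.

(** The moduli obtained on the intervals [a, 1] a priori depend on [a]; chord slopes identify each
    of them with |g|, and [g] is defined through the one for a = x / 2. *)
Lemma damage_C1 : exists g : R -> R,
  [/\ {within A, continuous g}, forall x, 0 < x <= 1 -> derives_oc v x (g x) &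
      damage_problem D v g h dh phi e c alpha] /\
  {ae mu, forall x : R, 0 < x < 1 -> `|dv x| = `|g x|}.
Proof.
have /choice[sig Hs] (a : R) : exists sigma : R -> R, 0 < a < 1 ->
    [/\ {within `[a, 1], continuous sigma}, forall x, 0 <= sigma x &
      {ae mu, forall x : R, a < x < 1 -> `|dv x| = sigma x}].
  have [a01|na] := pselect (0 < a < 1); last by exists (fun=> 0).
  by have [sigma Hsig] := gradient_modulus dp a01; exists sigma.
have sig_slope (a x : R) : 0 < a -> a < x -> x <= 1 -> forall eps : R, 0 < eps ->
    near_pairs x (fun x1 x2 => `| `|slope v x1 x2| - sig a x| <= eps).
  move=> a0 ax x1 eps eps0; have [|h1 h2 h3] := Hs a; first by rewrite a0 (lt_le_trans ax).
  exact: (slope_modulus a0 ax x1 h1 h2 h3).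
have half (x : R) : 0 < x <= 1 -> 0 < x / 2 /\ x / 2 < x.
  by move=> /andP[x0 _]; split; lra.
have /choice[g Hg] (x : R) : exists g : R, 0 < x <= 1 -> `|g| = sig (x / 2) x /\
    forall eps : R, 0 < eps -> near_pairs x (fun x1 x2 => `|slope v x1 x2 - g| <= eps).
  have [x01|nx] := pselect (0 < x <= 1); last by exists 0.
  have [h1 h2] := half x x01; case/andP: (x01) => _ x1.
  have s0 : 0 <= sig (x / 2) x.
    by have [|_ ->] := Hs (x / 2); rewrite ?h1 ?(lt_le_trans h2).
  have [g gs Hg] := strong_derivative (dp_v_cont dp) s0 (sig_slope _ _ h1 h2 x1).
  by exists g.
have strong x x01 := (Hg x x01).2.
have cg := strong_continuous strong.
have dg x x01 := strong_derives_oc x01 (strong x x01).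
(* A single short chord near [x] has absolute slope close to both numbers. *)
have gsig (a x : R) : 0 < a -> a < x -> x <= 1 -> `|g x| = sig a x.
  move=> a0 ax x1; have x01 : 0 < x <= 1 by rewrite x1 (lt_trans a0).
  apply/eqP; rewrite -subr_eq0 -normr_le0; apply/ler_addgt0Pr => eps eps0; rewrite add0r.
  have e2 : 0 < eps / 2 by rewrite divr_gt0.
  have [d d0] := near_pairs_ex x01 (near_pairs_and (sig_slope a x a0 ax x1 _ e2) (strong x x01 _ e2)).
  rewrite subrr normr0 => /(_ d0)[y].
  have key (s : R) : `| `|s| - sig a x| <= eps / 2 /\ `|s - g x| <= eps / 2 -> `| `|g x| - sig a x| <= eps.
    move=> [s1 s2]; have s3 := le_trans (ler_dist_dist s (g x)) s2.
    rewrite (_ : `|g x| - sig a x = `|s| - sig a x - (`|s| - `|g x|)); last by ring.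
    by rewrite (le_trans (ler_normB _ _))//; lra.
  by case => /key.
have aeg : {ae mu, forall x : R, 0 < x < 1 -> `|dv x| = `|g x|}.
  have hn n : 0 < (n.+2%:R^-1 : R) < 1 by rewrite invr_gt0 ltr0n/= invf_lt1 ?ltr0n// ltr1n.
  have aen n : {ae mu, forall x : R, n.+2%:R^-1 < x < 1 -> `|dv x| = sig n.+2%:R^-1 x}.
    by have [] := Hs _ (hn n).
  apply: ae_imp (ae_forall aen) => x Hx /andP[x0 x1].
  have xv : 0 < x^-1 by rewrite invr_gt0.
  have nx : (Num.bound x^-1).+2%:R^-1 < x.
    rewrite invf_plt ?posrE//; apply: lt_le_trans (archi_boundP (ltW xv)) _.
    by rewrite ler_nat; apply: leqW; apply: leqW.
  have /andP[n0 _] := hn (Num.bound x^-1).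
  by rewrite (Hx (Num.bound x^-1)) ?nx//; apply/esym/gsig => //; exact: ltW.
have pg a : 0 < a < 1 -> primitive_on a 1 v g.
  by move=> a01; apply: primitive_of_derives => //; exact: (dp_v_cont dp).
exists g; split; last exact: aeg.
split; [exact: cg|exact: dg|exact: damage_problem_modulus].
Qed.

End DamageC1.

(** * The flux where it does not vanish *)

Section SignedPower.
Context {R : realType}.

(** Uniform continuity by the covering argument; pairs that straddle the common end of two intervals
    are handled by continuity at that end. *)
Lemma within_unif (a b e : R) (f : R -> R) : a <= b -> {within `[a, b], continuous f} -> 0 < e ->
  exists2 d : R, 0 < d & forall x y : R, a <= x <= b -> a <= y <= b -> `|y - x| < d ->
    `|f y - f x| <= e.
Proof.
move=> ab /continuous_withinP cf e0.
have e2 : 0 < e / 2 by rewrite divr_gt0.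
have cf' x : a <= x <= b -> exists2 d : R, 0 < d & forall y, a <= y <= b ->
    `|y - x| < d -> `|f y - f x| <= e / 2.
  move=> xI; have [|d d0 H] := cf x _ _ e2; first by rewrite /= in_itv.
  by exists d => // y yI; apply: H; rewrite /= in_itv.
pose P (p q : R) := exists2 d : R, 0 < d & forall x y : R, p <= x <= q -> p <= y <= q ->
  `|y - x| < d -> `|f y - f x| <= e.
apply: (@local_to_global _ a b P) => //.
  move=> x xI; have [d d0 H] := cf' x xI; exists d => // p q ap px xq qb pd qd.
  exists 1 => // s t /andP[ps sq] /andP[pt tq] _.
  have h1 : `|f s - f x| <= e / 2.
    by apply: H; [rewrite (le_trans ap)//= (le_trans sq)|rewrite ltr_norml; apply/andP; split; lra].
  have h2 : `|f t - f x| <= e / 2.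
    by apply: H; [rewrite (le_trans ap)//= (le_trans tq)|rewrite ltr_norml; apply/andP; split; lra].
  rewrite (_ : f t - f s = f t - f x - (f s - f x)); last by ring.
  by rewrite (le_trans (ler_normB _ _))//; lra.
move=> x y z ax xy yz zb [d1 d10 H1] [d2 d20 H2].
have yI : a <= y <= b by rewrite (le_trans ax)//= (le_trans yz).
have [d3 d30 H3] := cf' y yI.
exists (Num.min d1 (Num.min d2 d3)); first by rewrite !lt_min d10 d20.
have cross s t : x <= s <= y -> y <= t <= z -> `|t - s| < d3 -> `|f t - f s| <= e.
  move=> /andP[xs sy] /andP[yt tz]; rewrite ltr_norml => /andP[_ ts].
  have h1 : `|f s - f y| <= e / 2.
    apply: H3; first by rewrite (le_trans ax)//= (le_trans sy)//; case/andP: yI.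
    by rewrite ltr_norml; apply/andP; split; lra.
  have h2 : `|f t - f y| <= e / 2.
    apply: H3; first by rewrite (le_trans tz)// andbT (le_trans _ yt)//; case/andP: yI.
    by rewrite ltr_norml; apply/andP; split; lra.
  rewrite (_ : f t - f s = f t - f y - (f s - f y)); last by ring.
  by rewrite (le_trans (ler_normB _ _))//; lra.
move=> s t /andP[xs sz] /andP[xt tz]; rewrite !lt_min => /and3P[h1 h2 h3].
have [sy|ys] := leP s y; have [ty|yt] := leP t y.
- by apply: H1; rewrite ?xs ?xt.
- by apply: cross; rewrite ?xs ?tz ?(ltW yt).
- by rewrite distrC; apply: cross; rewrite ?xt ?sz ?(ltW ys)// distrC.
- by apply: H2; rewrite ?sz ?tz ?(ltW ys) ?(ltW yt).
Qed.

Variable al : R.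
Hypothesis al_gt1 : 1 < al.

Let al10 : 0 < al - 1. Proof. by rewrite subr_gt0. Qed.
Let al0 : 0 < al. Proof. by apply: lt_trans al_gt1; exact: ltr01. Qed.

Lemma norm_signed_pow (x : R) : `|signed_pow al x| = `|x| `^ (al - 1).
Proof.
rewrite /signed_pow normrM normr_sg (ger0_norm (powR_ge0 _ _)).
by have [->|x0] := eqVneq x 0; rewrite ?normr0 ?powR0 ?mul0r ?mulr1// gt_eqF.
Qed.

Lemma signed_pow0 : signed_pow al 0 = 0.
Proof. by rewrite /signed_pow sgr0 mulr0. Qed.

Lemma signed_powM (k x : R) : 0 < k -> signed_pow al (k * x) = k `^ (al - 1) * signed_pow al x.
Proof.
by move=> k0; rewrite /signed_pow normrM (gtr0_norm k0) powRM ?(ltW k0)// sgrM gtr0_sg// mul1r mulrA.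
Qed.

Lemma signed_pow_gt0 (x : R) : 0 < x -> signed_pow al x = x `^ (al - 1).
Proof. by move=> x0; rewrite /signed_pow gtr0_sg// mulr1 gtr0_norm. Qed.

Lemma signed_powN (x : R) : signed_pow al (- x) = - signed_pow al x.
Proof. by rewrite /signed_pow normrN sgrN mulrN. Qed.

Lemma signed_pow_mul (x : R) : x * signed_pow al x = `|x| `^ al.
Proof.
by rewrite /signed_pow mulrCA [x * _]mulrC -normrEsg mulrC mulr_powRB1.
Qed.

Lemma signed_pow_continuous : continuous (signed_pow al).
Proof.
move=> x; have [->|x0] := eqVneq x 0.
  apply/continuous_forP => e e0; have [d d0 H] := (continuous_forP _ _).1
    (@norm_powR_continuous R _ al10 0) e e0.
  exists d => // y /H; rewrite signed_pow0 subr0 norm_signed_pow normr0 powR0 ?gt_eqF//.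
  by rewrite subr0 ger0_norm ?powR_ge0.
apply: cvgM; first exact: norm_powR_continuous.
apply/continuous_forP => e e0; exists `|x|; first by rewrite normr_gt0.
move=> y yx; have -> : Num.sg y = Num.sg x.
  move: x0; rewrite neq_lt => /orP[xl|xg].
    have y0 : y < 0 by move: yx; rewrite (ltr0_norm xl) ltr_norml => /andP[_]; lra.
    by rewrite !ltr0_sg.
  have y0 : 0 < y by move: yx; rewrite (gtr0_norm xg) ltr_norml => /andP[]; lra.
  by rewrite !gtr0_sg.
by rewrite subrr normr0 ltW.
Qed.

(* [al * signed_pow al] is the derivative of the convex function [x |-> |x|^al]. *)
Lemma powR_tangent (x y : R) : `|y| `^ al - `|x| `^ al <= al * signed_pow al y * (y - x).
Proof.
have conj : al^-1 + (al / (al - 1))^-1 = 1 by field; rewrite !gt_eqF.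
(* Young's inequality for |x| and |y|^(al - 1) with exponents al and al / (al - 1). *)
have := @conjugate_powR R `|x| (`|y| `^ (al - 1)) al (al / (al - 1)) (normr_ge0 _) (powR_ge0 _ _) al0.
rewrite divr_gt0// => /(_ isT conj).
rewrite -powRrM (_ : (al - 1) * (al / (al - 1)) = al); last by field; rewrite gt_eqF.
have xy : signed_pow al y * x <= `|x| * `|y| `^ (al - 1).
  by rewrite (le_trans (ler_norm _))// normrM norm_signed_pow mulrC.
move=> Y; have yS := signed_pow_mul y.
move: Y xy yS; move: (`|x| * _) (signed_pow al y) (`|y| `^ al) (`|x| `^ al) => w S b a Y xy yS.
have h1 : al * (S * x) <= al * (a / al + b / (al / (al - 1))) by rewrite ler_pM2l//; exact: le_trans Y.
have h2 : al * (a / al + b / (al / (al - 1))) = a + (al - 1) * b by field; rewrite !gt_eqF.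
have -> : al * S * (y - x) = al * (y * S) - al * (S * x) by ring.
by rewrite yS; move: h1; rewrite h2; lra.
Qed.

End SignedPower.

(** * The conservation law in differential form *)

Section Flux.
Context {R : realType}.
Local Notation A := (`]0%R, 1%R]%classic : set R).
Variables (D v g h dh phi dphi : R -> R) (e c alpha : R).
Hypotheses (dp : damage_problem D v g h dh phi e c alpha)
  (cg : {within A, continuous g})
  (dv : forall x, 0 < x <= 1 -> derives_oc v x (g x)).

Let e_gt0 := dp_e_gt0 dp.
Let alpha_gt1 := dp_alpha_gt1 dp.
Let al0 : 0 < alpha. Proof. by apply: lt_trans alpha_gt1; exact: ltr01. Qed.
Let al10 : 0 < alpha - 1. Proof. by rewrite subr_gt0. Qed.

Let K x := e * `|g x| `^ alpha.
Let b x := - dh (D x - v x).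

Lemma v_derive (x : R) : 0 < x < 1 -> is_derive x 1 v (g x).
Proof. by move=> /[dup] x01 /andP[x0 /ltW x1]; apply: derives_oc_is_derive => //; apply: dv; rewrite x0. Qed.

Let cK : {within A, continuous K}.
Proof.
apply: withinM; first exact: within_cst.
by apply: (@within_comp _ _ (fun x => `|x| `^ alpha) g) => // x _; exact: norm_powR_continuous.
Qed.

Let c_excess (b0 : R) : {within A, continuous (excess v g phi e c alpha b0)}.
Proof.
apply: withinM; first by apply: withinX; exact: within_id.
apply: withinB; first by apply: withinM => //; exact: within_cst.
apply: withinD; first by apply: withinM; [exact: within_cst|exact: (dp_phi_v dp)].
by apply: withinM; [exact: within_cst|exact: (dp_v_cont dp)].
Qed.

Let c_source (b0 : R) : {within A, continuous (source v g phi e c alpha b0)}.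
Proof.
apply: withinM; first by apply: withinM; [exact: within_cst|exact: within_id].
apply: withinD => //.
apply: withinD; first by apply: withinM; [exact: within_cst|exact: (dp_phi_v dp)].
by apply: withinM; [exact: within_cst|exact: (dp_v_cont dp)].
Qed.

(** The slope is frozen at b(x), so near x the constant [M] of the conservation law may be taken
    arbitrarily small, and its error is small compared with the distance. As the gradient is
    continuous by now, the law holds between all points and not only almost all. *)
Lemma excess_derive (x : R) : 0 < x < 1 ->
  is_derive x 1 (excess v g phi e c alpha (b x)) (- source v g phi e c alpha (b x) x).
Proof.
move=> /[dup] x01 /andP[x0 x1]; have xA : 0 < x <= 1 by rewrite x0 ltW.
set b0 := b x; set Ex := excess _ _ _ _ _ _ _; set So := source _ _ _ _ _ _ _.
apply/is_deriveP => eps eps0.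
pose B := `|g x| + 1; have B0 : 0 < B by rewrite ltr_wpDl.
(* The error 2 M B (z - y) is then eps / 2 times the distance; the other half is left for the
   oscillation of the source. *)
pose M := eps / (4 * B); have M0 : 0 < M by rewrite divr_gt0 ?mulr_gt0.
have [|d1 d10 [eta eta0 Hgap]] := @gap_near_at _ D v g h dh phi e c alpha dp b0 M x xA.
  by rewrite /b0 /b subrr normr0.
have [d2 d20 H2] := (continuous_withinP _ _).1 cg x ((oc_itv x).2 xA) 1 ltr01.
have eps2 : 0 < eps / 2 by rewrite divr_gt0.
have cSo : {within A, continuous So} by exact: c_source.
have [d3 d30 H3] := (continuous_withinP _ _).1 cSo x ((oc_itv x).2 xA) _ eps2.
pose d := Num.min (Num.min (x / 2) ((1 - x) / 2)) (Num.min d1 (Num.min d2 d3)) / 2.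
have d0 : 0 < d by rewrite divr_gt0// !lt_min !divr_gt0 ?subr_gt0// d10 d20.
have : 2 * d <= Num.min (Num.min (x / 2) ((1 - x) / 2)) (Num.min d1 (Num.min d2 d3)).
  by rewrite mulrC divfK.
rewrite !le_min => /andP[/andP[m1 m2] /and3P[m3 m4 m5]].
pose p := x - d; pose n := x + d.
have p0 : 0 < p by rewrite /p; lra.
have n1 : n < 1 by rewrite /n; lra.
have near_x z : p <= z <= n -> `|z - x| < 2 * d.
  by rewrite /p /n => /andP[? ?]; rewrite ltr_norml; apply/andP; split; lra.
have pA z : p <= z <= n -> 0 < z <= 1.
  by move=> /andP[pz zn]; rewrite (lt_le_trans p0 pz) ltW// (le_lt_trans zn).
have pn : p < n by rewrite /p /n; lra.
have Hg2 z y : p <= z <= n -> `|y - (D z - v z)| < eta -> 0 < y /\ `|dh y + b0| <= M.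
  move=> zI; apply: Hgap; first exact: pA.
  exact: lt_le_trans (near_x z zI) m3.
have gB z : p <= z <= n -> `|g z| <= B.
  move=> zI; have := H2 z ((oc_itv z).2 (pA z zI)) (lt_le_trans (near_x z zI) m4).
  rewrite /B -{2}(subrK (g x) (g z)) => h1; rewrite (le_trans (ler_normD _ _))//; lra.
have iS : intg p n So by apply: intg_cont; apply: within_oc_itv => //; exact: ltW.
have ig : intg p n (fun z => `|g z|).
  by apply: intg_norm; apply: intg_cont; apply: within_oc_itv => //; exact: ltW.
pose Psi z := Ex z + itg p z So.
have pS : primitive_on p n (fun z => itg p z So) So by split => // z _; rewrite itg1 add0r.
have cPsi : {within `[p, n], continuous Psi}.
  have cEx : {within `[p, n], continuous Ex} by apply: (within_oc_itv p0 (ltW n1)); exact: c_excess.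
  exact: (withinD cEx (primitive_continuous (ltW pn) pS)).
have dPsi z : p < z < n -> is_derive z 1 (fun z => itg p z Psi) (Psi z).
  move=> zI; have [pz zn] := andP zI; apply: (@is_derive_itg _ p z Psi n) => //; first exact: intg_cont.
  exact: within_at_itv cPsi.
have cons y z : p < y -> y < z -> z < n -> `|Psi z - Psi y| <= eps / 2 * (z - y).
  move=> py yz zn; have py' : p < y < n by rewrite py (lt_trans yz).
  have pz' : p < z < n by rewrite zn (lt_trans py).
  have := @conservation _ D v g h dh phi e c alpha dp b0 p n M eta p0 pn (ltW n1) eta0 (ltW M0) Hg2 y z (ltW py) yz zn (dPsi y py') (dPsi z pz').
  move=> /le_trans; apply.
  have : itg y z (fun z => `|g z|) <= B * (z - y).
    rewrite -itg_cst ?(ltW yz)//; apply: le_itg; [exact: intgS (ltW py) (ltW zn) ig|exact: intg_cst|].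
    by move=> w /andP[yw wz]; apply: gB; rewrite (le_trans (ltW py) yw) (le_trans wz (ltW zn)).
  move=> h1; have M2 : 0 <= 2 * M by rewrite mulr_ge0// ltW.
  apply: (le_trans (ler_wpM2l M2 h1)); rewrite /M (_ : 2 * (eps / (4 * B)) * (B * (z - y)) = eps / 2 * (z - y))//.
  by field; rewrite gt_eqF.
have src y z : p < y -> y < z -> z < n -> `|itg y z So - So x * (z - y)| <= eps / 2 * (z - y).
  move=> py yz zn; have iyz : intg y z So := intgS (ltW py) (ltW zn) iS.
  rewrite -(itg_cst _ (ltW yz)) -itgB//; last exact: intg_cst.
  apply: itg_bound; [exact: ltW|by apply: intgB => //; exact: intg_cst|].
  move=> w /andP[yw wz]; have wI : p <= w <= n by rewrite (le_trans (ltW py) yw) (le_trans wz (ltW zn)).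
  by apply: H3; [exact/oc_itv/pA|exact: lt_le_trans (near_x w wI) m5].
have fin y z : p < y -> y < z -> z < n -> `|Ex z - Ex y - (- So x) * (z - y)| <= eps * (z - y).
  move=> py yz zn; have := cons y z py yz zn; have := src y z py yz zn.
  rewrite -(primitive_sub pS (ltW py) (ltW yz) (ltW zn)) => s1 s2.
  rewrite (_ : _ - _ = Psi z - Psi y - (itg p z So - itg p y So - So x * (z - y))); last by rewrite /Psi; ring.
  by rewrite (le_trans (ler_normB _ _))// (le_trans (lerD s2 s1))// -mulrDl -splitr.
exists d => // y; rewrite ltr_norml => /andP[y1 y2].
case: (ltgtP x y) => [xy|yx|<-]; last by rewrite !subrr mulr0 subrr normr0 mulr0.
  rewrite [`|y - x|]gtr0_norm ?subr_gt0//; apply: fin => //; [by rewrite gtrBl|by rewrite /n -ltrBlDl].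
rewrite -normrN (_ : - (Ex y - Ex x - - So x * (y - x)) = Ex x - Ex y - - So x * (x - y)); last by ring.
rewrite [`|y - x|]distrC [`|x - y|]gtr0_norm ?subr_gt0//; apply: fin => //; [by rewrite /p addrC -ltrBrDr|by rewrite ltrDl].
Qed.

(* The derivative of [(alpha - 1) K - c phi(v)]; it exists although [phi] is only differentiable. *)
Lemma energy_excess_derive (x : R) : 0 < x < 1 ->
  is_derive x 1 (fun y => (alpha - 1) * K y - c * phi (v y)) (- 2 * alpha * K x / x + b x * g x).
Proof.
move=> /[dup] x01 /andP[x0 _].
have xn0 : x != 0 by rewrite gt_eqF.
have x2n : x ^+ 2 != 0 by rewrite expf_neq0.
have d1 := @is_derive_div _ _ (fun y => y ^+ 2) x _ _ x2n (excess_derive x01) (is_derive_sqr x).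
have d2 := is_derive_add d1 (is_derive_scale (b x) (v_derive x01)).
apply/is_deriveP => eps eps0.
have dE : is_derive x 1 (fun y => excess v g phi e c alpha (b x) y / y ^+ 2 + b x * v y)
    (- 2 * alpha * K x / x + b x * g x).
  by apply: (is_derive_eq d2); rewrite /source /excess /K; field.
have [d d0 H] := (is_deriveP _ _ _).1 dE _ eps0.
exists (Num.min d x); first by rewrite lt_min d0.
move=> y; rewrite lt_min => /andP[yd yx]; have := H y yd.
have y0 : y != 0.
  by apply/eqP => E; move: yx; rewrite E sub0r normrN gtr0_norm// ltxx.
have EE z : z != 0 -> excess v g phi e c alpha (b x) z / z ^+ 2 + b x * v z = (alpha - 1) * K z - c * phi (v z).
  by move=> z0; rewrite /excess /K; field.
by rewrite !EE.
Qed.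

End Flux.

(** * Derivative of the flux at points with nonzero gradient *)

Section FluxNonzero.
Context {R : realType}.
Local Notation A := (`]0%R, 1%R]%classic : set R).

Lemma is_derive_near (F G : R -> R) (x l d : R) : 0 < d ->
  (forall y, `|y - x| < d -> F y = G y) -> is_derive x 1 G l -> is_derive x 1 F l.
Proof.
move=> d0 FG /is_deriveP H; apply/is_deriveP => e e0; have [d' d'0 Hd] := H e e0.
exists (Num.min d d'); first by rewrite lt_min d0.
move=> y; rewrite lt_min => /andP[yd yd']; rewrite FG// FG ?subrr ?normr0//; exact: Hd.
Qed.

Variables (D v g h dh phi dphi : R -> R) (e c alpha : R).
Hypotheses (dp : damage_problem D v g h dh phi e c alpha)
  (cg : {within A, continuous g})
  (dv : forall x, 0 < x <= 1 -> derives_oc v x (g x))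
  (phi_der : forall x : R, is_derive x 1 phi (dphi x)).

Let e_gt0 := dp_e_gt0 dp.
Let alpha_gt1 := dp_alpha_gt1 dp.
Let al0 : 0 < alpha. Proof. by apply: lt_trans alpha_gt1; exact: ltr01. Qed.
Let al10 : 0 < alpha - 1. Proof. by rewrite subr_gt0. Qed.

Let b x := - dh (D x - v x).

(** [phi] is differentiable at v(x) and [v] at x, so the damage potential can be moved to the other
    side. *)
Lemma power_derive (x : R) : 0 < x < 1 ->
  is_derive x 1 (fun y => `|g y| `^ alpha)
    ((- 2 * alpha * (e * `|g x| `^ alpha) / x + (b x + c * dphi (v x)) * g x) / (e * (alpha - 1))).
Proof.
move=> x01; have d1 := energy_excess_derive dp cg dv x01.
have d2 := is_derive_scale c (is_derive_compose (v_derive dv x01) (phi_der (v x))).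
have d3 := is_derive_scale (e * (alpha - 1))^-1 (is_derive_add d1 d2).
have xn : x != 0 by case/andP: x01 => x0 _; rewrite gt_eqF.
apply: (@is_derive_near _ _ x _ 1 ltr01 _ (is_derive_eq d3 _)).
  by move=> y _; field; rewrite !gt_eqF.
by rewrite /b; field; rewrite xn !gt_eqF.
Qed.

(** Near x the sign of [g] is constant and |g|^(alpha - 1) is the power (alpha - 1) / alpha of
    |g|^alpha, which is differentiable because its base is positive. This power is not
    differentiable at 0, whence the separate treatment of zeros. *)
Lemma flux_derive_nonzero (x : R) : 0 < x < 1 -> g x != 0 ->
  is_derive x 1 (fun y => y ^+ 2 * signed_pow alpha (g y))
    (x ^+ 2 * (b x + c * dphi (v x)) / (alpha * e)).
Proof.
move=> x01 gx0; have pw0 : 0 < `|g x| by rewrite normr_gt0.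
have P0 : 0 < `|g x| `^ alpha by rewrite powR_gt0.
have [d d0 H] := (continuous_forP _ _).1 (within_oc_at x01 cg) _ (divr_gt0 pw0 (ltr0n _ 2)).
have sgE y : `|y - x| < d -> Num.sg (g y) = Num.sg (g x).
  move=> /H; move: gx0; rewrite neq_lt => /orP[gl|gg].
    rewrite (ltr0_norm gl) ler_norml => /andP[_ h1].
    by rewrite !ltr0_sg//; lra.
  rewrite (gtr0_norm gg) ler_norml => /andP[h1 _].
  by rewrite !gtr0_sg//; lra.
pose s := (alpha - 1) / alpha.
have dP := is_derive_compose (power_derive x01) (is_derive1_powR s P0).
have dF := is_derive_mul (is_derive_sqr x) (is_derive_scale (Num.sg (g x)) dP).
have an : alpha != 0 by rewrite gt_eqF.
have pwE (z : R) : (`|z| `^ alpha) `^ s = `|z| `^ (alpha - 1).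
  by rewrite -powRrM /s mulrCA mulfV// mulr1.
apply: (is_derive_near d0 _ (is_derive_eq dF _)).
  by move=> y yd; rewrite pwE /signed_pow sgE// [_ * Num.sg _]mulrC.
have xn : x != 0 by case/andP: x01 => x0 _; rewrite gt_eqF.
have s1E : (`|g x| `^ alpha) `^ (s - 1) = `|g x|^-1.
  by rewrite -powRrM (_ : alpha * (s - 1) = -1) ?powR_inv1// /s; field.
have sE : (`|g x| `^ alpha) `^ s = `|g x| `^ alpha / `|g x|.
  by rewrite pwE -{1}(mulr_powRB1 (normr_ge0 (g x)) al0) mulrC mulKf// gt_eqF.
rewrite s1E sE /s; move: (`|g x| `^ alpha) => Pg.
have ss : Num.sg (g x) * Num.sg (g x) = 1 by rewrite -expr2 sqr_sg gx0.
have gE : g x = Num.sg (g x) * `|g x| by rewrite -numEsg.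
have nn : `|g x| != 0 by rewrite normr_eq0.
move: (b x + c * dphi (v x)) => k; rewrite (congr1 (fun z => k * z) gE).
move: (Num.sg (g x)) `|g x| ss nn => sg n ss nn.
rewrite [RHS](_ : _ = x ^+ 2 * (sg * sg * k) / (alpha * e)); last by rewrite ss mul1r.
field.
by rewrite an xn nn !gt_eqF.
Qed.

End FluxNonzero.

(** * The flux near a zero of the gradient *)

Section FluxZero.
Context {R : realType}.
Local Notation A := (`]0%R, 1%R]%classic : set R).

Lemma common_radius (a b c : R) : 0 < a -> 0 < b -> 0 < c ->
  exists2 d : R, 0 < d & [/\ d <= a, d <= b & d <= c].
Proof.
move=> a0 b0 c0; exists (Num.min a (Num.min b c)); first by rewrite !lt_min a0 b0.
by split; rewrite !ge_min lexx ?orbT.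
Qed.

Lemma between_dist (p u q x0 d l : R) : p <= u -> u <= q -> `|p - x0| <= d -> `|q - x0| <= d ->
  `|q - p| <= l -> [/\ `|u - x0| <= d, `|p - u| <= l & `|q - u| <= l].
Proof.
move=> pu uq; rewrite !ler_norml => /andP[? ?] /andP[? ?] /andP[? ?].
by split; apply/andP; split; lra.
Qed.

Lemma increment_closed (F : R -> R) (x0 d G x : R) :
  (forall y : R, `|y - x0| <= d -> exists2 l : R, is_derive y 1 F l & `|l| <= G) ->
  `|x - x0| <= d -> `|F x - F x0| <= G * `|x - x0|.
Proof.
move=> H xd.
have seg (a b : R) : a <= b -> (forall y, a <= y <= b -> `|y - x0| <= d) ->
    `|F b - F a| <= G * (b - a).
  move=> ab inb.
  have dF (s : R) : s \in `]a, b[ -> is_derive s 1 F ('D_1 F s).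
    rewrite in_itv/= => /andP[as_ sb].
    have [|l dl _] := H s; first by apply: inb; rewrite !ltW.
    by apply: DeriveDef => //; case: dl.
  have cF : {within `[a, b], continuous F}.
    apply/subspace_continuousP => s /=; rewrite in_itv/= => sI.
    have [|l dl _] := H s; first exact: inb.
    apply: cvg_within_filter; exact: (is_derive_cont dl).
  have [s sab ->] := MVT_segment ab dF cF.
  rewrite in_itv/= in sab; have [l [_ dl] lG] := H s (inb s sab).
  by rewrite normrM dl [X in _ * X]ger0_norm ?subr_ge0// ler_wpM2r// subr_ge0.
move: xd; rewrite ler_norml => /andP[x1 x2].
have [le|lt] := leP x0 x.
  rewrite [`|x - x0|]ger0_norm ?subr_ge0//; apply: seg => // y /andP[? ?].
  by rewrite ler_norml; apply/andP; split; lra.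
rewrite distrC [`|x - x0|]distrC [`|x0 - x|]gtr0_norm ?subr_gt0//.
apply: seg => [|y /andP[? ?]]; first exact: ltW.
by rewrite ler_norml; apply/andP; split; lra.
Qed.

(** |signed_pow s| is a uniformly continuous function of |s|^al. For arguments of the same sign the
    difference of signed powers is that of their moduli; for opposite signs both have to be
    small. *)
Lemma signed_pow_osc (al C kappa : R) : 1 < al -> 0 <= C -> 0 < kappa -> exists2 tau : R, 0 < tau &
  forall s t : R, `|s| <= C -> `|t| <= C -> `| `|s| `^ al - `|t| `^ al| <= tau ->
    0 <= s * t \/ (`|s| `^ al <= tau /\ `|t| `^ al <= tau) ->
    `|signed_pow al s - signed_pow al t| <= kappa.
Proof.
move=> al1 C0 k0; have al0 : 0 < al by apply: lt_trans al1; exact: ltr01.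
have al10 : 0 < al - 1 by rewrite subr_gt0.
pose p := (al - 1) / al; have p0 : 0 < p by rewrite divr_gt0.
have c0 : 0 <= C `^ al by exact: powR_ge0.
have k2 : 0 < kappa / 2 by rewrite divr_gt0.
have cp : {within `[0, C `^ al], continuous (fun u : R => `|u| `^ p)}.
  by apply: continuous_subspaceT => u; exact: norm_powR_continuous.
have [d d0 H] := within_unif c0 cp k2.
have pE (s : R) : `|signed_pow al s| = `| `|s| `^ al| `^ p.
  rewrite norm_signed_pow// (ger0_norm (powR_ge0 _ _)) -powRrM; congr (_ `^ _).
  by rewrite /p mulrCA mulfV ?mulr1// gt_eqF.
have pI (s : R) : `|s| <= C -> 0 <= `|s| `^ al <= C `^ al.
  by move=> sC; rewrite powR_ge0/=; apply: ge0_ler_powR; rewrite ?nnegrE ?(ltW al0).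
exists (d / 2); first by rewrite divr_gt0.
move=> s t sC tC st.
have near : `| `|signed_pow al s| - `|signed_pow al t| | <= kappa / 2.
  rewrite !pE; apply: H; [exact: pI|exact: pI|].
  by apply: le_lt_trans st _; lra.
have small (u : R) : `|u| <= C -> `|u| `^ al <= d / 2 -> `|signed_pow al u| <= kappa / 2.
  move=> uC ud; have := H 0 (`|u| `^ al).
  rewrite lexx c0 pI// subr0 => /(_ isT isT).
  rewrite normr0 powR0 ?gt_eqF// subr0 -pE normr_id; apply.
  by rewrite ger0_norm ?powR_ge0//; lra.
move=> [st0|[s1 t1]]; last first.
  have h1 := small s sC s1; have h2 := small t tC t1.
  by rewrite (le_trans (ler_normB _ _))//; lra.
suff -> : `|signed_pow al s - signed_pow al t| = `| `|signed_pow al s| - `|signed_pow al t| | by lra.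
rewrite !norm_signed_pow//.
have pos (u : R) : 0 <= u -> signed_pow al u = `|u| `^ (al - 1).
  rewrite le_eqVlt => /predU1P[<-|u0]; last by rewrite signed_pow_gt0// gtr0_norm.
  by rewrite signed_pow0 normr0 powR0// gt_eqF.
have neg (u : R) : u <= 0 -> signed_pow al u = - `|u| `^ (al - 1).
  by move=> u0; rewrite -[u]opprK signed_powN pos ?oppr_ge0// normrN opprK.
have [s0|s0] := leP 0 s; have [t0|t0] := leP 0 t.
- by rewrite !pos.
- have s00 : s = 0.
    apply/eqP; apply: contraTT st0 => sn; rewrite -ltNge nmulr_llt0//.
    by rewrite lt_neqAle eq_sym sn.
  by rewrite s00 signed_pow0 (neg t (ltW t0)) normr0 powR0 ?gt_eqF// !sub0r opprK normrN.
- have t00 : t = 0.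
    apply/eqP; apply: contraTT st0 => tn; rewrite -ltNge nmulr_rlt0//.
    by rewrite lt_neqAle eq_sym tn.
  by rewrite t00 signed_pow0 (neg s (ltW s0)) normr0 powR0 ?gt_eqF// !subr0 normrN.
- by rewrite (neg s (ltW s0)) (neg t (ltW t0)) -opprD normrN.
Qed.

Variables (D v g h dh phi dphi : R -> R) (e c alpha : R).
Hypotheses (dp : damage_problem D v g h dh phi e c alpha)
  (cg : {within A, continuous g})
  (dv : forall x, 0 < x <= 1 -> derives_oc v x (g x))
  (phi_der : forall x : R, is_derive x 1 phi (dphi x)).

Let e_gt0 := dp_e_gt0 dp.
Let alpha_gt1 := dp_alpha_gt1 dp.
Let al0 : 0 < alpha. Proof. by apply: lt_trans alpha_gt1; exact: ltr01. Qed.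
Let al10 : 0 < alpha - 1. Proof. by rewrite subr_gt0. Qed.
Let c_gt0 := dp_c_gt0 dp.

Variable x0 : R.
Hypotheses (x01 : 0 < x0 < 1) (gx0 : g x0 = 0) (v0_gt0 : 0 < v x0).

Let b x := - dh (D x - v x).
(** The coefficient in (alpha - 1) K = k (v - v(x0)) to leading order; k x0^2 is the expected
    derivative of alpha e times the flux. *)
Let k := b x0 + c * dphi (v x0).
Let r := (alpha - 1)^-1.
Let rho0 := Num.min (x0 / 2) ((1 - x0) / 2).

Let x0_gt0 : 0 < x0. Proof. by case/andP: x01. Qed.
Let x0A : 0 < x0 <= 1. Proof. by case/andP: x01 => -> /ltW. Qed.
Let rho00 : 0 < rho0. Proof. by rewrite lt_min !divr_gt0// subr_gt0; case/andP: x01. Qed.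

Let in01 z : `|z - x0| <= rho0 -> x0 / 2 <= z /\ z < 1.
Proof.
have /andP[h1 h2] := x01; rewrite le_min ler_norml => /andP[/andP[z1 _]].
by rewrite ler_norml => /andP[_ z2]; split; lra.
Qed.

Let in01' z : `|z - x0| <= rho0 -> 0 < z < 1.
Proof. by move=> /in01[z1 ->]; rewrite andbT (lt_le_trans _ z1)// divr_gt0. Qed.

Let v_incr (d G x y : R) : d <= rho0 -> (forall z, `|z - x0| <= d -> `|g z| <= G) ->
  `|x - x0| <= d -> `|y - x0| <= d -> `|v y - v x| <= G * `|y - x|.
Proof.
move=> dr HG; wlog : x y / x <= y.
  move=> W xd yd; have [xy|/ltW yx] := leP x y; first exact: W.
  by rewrite distrC [`|y - x|]distrC; exact: W.
(* The mean value bound is centred at a point, so the increment is split at the midpoint, both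
   halves of which stay in the ball. *)
move=> xy xd yd; pose m := (x + y) / 2; pose w := (y - x) / 2.
have ball z : `|z - m| <= w -> `|z - x0| <= d.
  move: xd yd; rewrite /m /w !ler_norml => /andP[? ?] /andP[? ?] /andP[? ?].
  by apply/andP; split; lra.
have dvz z : `|z - m| <= w -> exists2 l : R, is_derive z 1 v l & `|l| <= G.
  move=> /ball zd; exists (g z); last exact: HG.
  by apply: v_derive => //; apply: in01'; exact: le_trans dr.
have w0 : 0 <= w by rewrite /w; lra.
have xm : `|x - m| = w by rewrite /m /w (_ : _ - _ = - ((y - x) / 2)) ?normrN ?ger0_norm//; field.
have ym : `|y - m| = w by rewrite /m /w (_ : _ - _ = (y - x) / 2) ?ger0_norm//; field.
have h1 := increment_closed dvz (eq_ind_r (fun z => z <= w) (lexx w) xm).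
have h2 := increment_closed dvz (eq_ind_r (fun z => z <= w) (lexx w) ym).
rewrite xm in h1; rewrite ym in h2.
rewrite (_ : v y - v x = v y - v m - (v x - v m)); last by ring.
rewrite (le_trans (ler_normB _ _))// (le_trans (lerD h2 h1))// -mulrDr.
by rewrite [`|y - x|]ger0_norm ?subr_ge0// /w -splitr.
Qed.

(** The derivative of (alpha - 1) K - c phi(v) is integrated from [x0], where K = 0. With |v'| <= G,
    freezing [b] and linearising [phi] at v(x0) cost eps G d, and the term 2 alpha K / x costs a
    multiple of G^alpha d. *)
Lemma potential_balance (eps : R) : 0 < eps -> exists2 rho : R, 0 < rho <= rho0 &
  forall d G x : R, 0 < d <= rho -> (forall z, `|z - x0| <= d -> `|g z| <= G) -> `|x - x0| <= d ->
    `|(alpha - 1) * (e * `|g x| `^ alpha) - k * (v x - v x0)| <=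
    (eps * G + 4 * alpha * e / x0 * G `^ alpha) * d.
Proof.
move=> eps0; have eps2 : 0 < eps / 2 by rewrite divr_gt0.
have cb : {for x0, continuous b}.
  apply: continuousN; apply: (@continuous_comp _ _ _ (fun x => D x - v x) dh).
    by apply: within_oc_at x01 _; exact: (dp_gap_cont dp).
  exact: (dp_dh_cont dp (dp_gap_gt0 dp x0A)).
have [d1 d10 H1] := (continuous_forP _ _).1 cb _ eps2.
have epsc : 0 < eps / (2 * c) by rewrite divr_gt0 ?mulr_gt0.
have [d2 d20 H2] := (is_deriveP _ _ _).1 (phi_der (v x0)) _ epsc.
have cv := is_derive_cont (v_derive dv x01).
have [d3 d30 H3] := (continuous_forP _ _).1 cv _ (divr_gt0 d20 (ltr0n _ 2)).
have [rho rho_gt0 [r0 r1 r3]] := common_radius rho00 (divr_gt0 d10 (ltr0n _ 2)) (divr_gt0 d30 (ltr0n _ 2)).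
exists rho; first by rewrite rho_gt0.
move=> d G x /andP[d0 drho] HG xd.
have G0 : 0 <= G by apply: le_trans (HG x xd).
pose J y := (alpha - 1) * (e * `|g y| `^ alpha) - c * phi (v y) + - b x0 * v y.
have dJ y : `|y - x0| <= d -> exists2 l : R, is_derive y 1 J l &
    `|l| <= 4 * alpha * e / x0 * G `^ alpha + eps / 2 * G.
  move=> yd; have yr := le_trans yd (le_trans drho r0).
  have y01 := in01' yr; have [yx0 _] := in01 yr; have /andP[y0 _] := y01.
  exists (- 2 * alpha * (e * `|g y| `^ alpha) / y + b y * g y + - b x0 * g y).
    exact: is_derive_add (energy_excess_derive dp cg dv y01) (is_derive_scale _ (v_derive dv y01)).
  rewrite (_ : _ + _ = (b y - b x0) * g y - 2 * alpha * e * `|g y| `^ alpha / y); last by field; rewrite gt_eqF.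
  rewrite (le_trans (ler_normB _ _))// addrC; apply: lerD; last first.
    rewrite normrM; apply: ler_pM => //; last exact: HG.
    by apply: H1; lra.
  rewrite ger0_norm; last by rewrite divr_ge0 ?mulr_ge0 ?powR_ge0 ?(ltW e_gt0) ?(ltW al0) ?(ltW y0).
  have p1 : `|g y| `^ alpha <= G `^ alpha.
    by apply: ge0_ler_powR; rewrite ?nnegrE ?(ltW al0)//; exact: HG.
  have i1 : y^-1 <= 2 / x0.
    by rewrite -[2 / x0]invf_div lef_pV2 ?posrE ?divr_gt0.
  rewrite (_ : 4 * alpha * e / x0 * G `^ alpha = 2 * alpha * e * G `^ alpha * (2 / x0)); last by ring.
  apply: ler_pM => //; rewrite ?invr_ge0 ?(ltW y0) ?mulr_ge0 ?powR_ge0 ?(ltW e_gt0) ?(ltW al0)//.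
  by rewrite ler_pM2l ?mulr_gt0.
have Jx := increment_closed dJ xd.
have vx : `|v x - v x0| <= G * d.
  have n0 : `|x0 - x0| <= d by rewrite subrr normr0 ltW.
  apply: le_trans (v_incr (le_trans drho r0) HG n0 xd) _.
  by rewrite ler_wpM2l.
have vd2 : `|v x - v x0| < d2.
  have : `|v x - v x0| <= d2 / 2 by apply: H3; lra.
  by move=> /le_lt_trans; apply; lra.
have px := H2 _ vd2.
have K0 : `|g x0| `^ alpha = 0 by rewrite gx0 normr0 powR0// gt_eqF.
rewrite (_ : _ - _ = J x - J x0 + c * (phi (v x) - phi (v x0) - dphi (v x0) * (v x - v x0))); last first.
  by rewrite /J K0 /k; ring.
rewrite (le_trans (ler_normD _ _))//.
have t1 : `|J x - J x0| <= (4 * alpha * e / x0 * G `^ alpha + eps / 2 * G) * d.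
  apply: le_trans Jx _; apply: ler_wpM2l => //.
  by rewrite addr_ge0 ?mulr_ge0 ?invr_ge0 ?powR_ge0 ?(ltW e_gt0) ?(ltW al0) ?(ltW x0_gt0) ?(ltW eps0).
have t2 : `|c * (phi (v x) - phi (v x0) - dphi (v x0) * (v x - v x0))| <= eps / 2 * G * d.
  rewrite normrM (gtr0_norm c_gt0); apply: le_trans (ler_wpM2l (ltW c_gt0) px) _.
  rewrite (_ : c * (eps / (2 * c) * _) = eps / 2 * `|v x - v x0|); last by field; rewrite gt_eqF.
  by rewrite -[leRHS]mulrA ler_pM2l.
apply: le_trans (lerD t1 t2) _; rewrite -mulrDl ler_pM2r//.
by rewrite -addrA addrC -mulrDl -splitr.
Qed.

Let rr : r * (alpha - 1) = 1. Proof. by rewrite /r mulVf// gt_eqF. Qed.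

Let pow_r (d : R) : 0 < d -> [/\ 0 < d `^ r, (d `^ r) `^ (alpha - 1) = d & (d `^ r) `^ alpha = d * d `^ r].
Proof.
move=> d0; split; first exact: powR_gt0.
  by rewrite -powRrM rr powRr1// ltW.
rewrite -powRrM (_ : r * alpha = 1 + r); last by rewrite -rr; ring.
by rewrite powRD ?powRr1 ?(ltW d0)//; apply/implyP => _; rewrite gt_eqF.
Qed.

(** At a point where |v'| attains its maximum G over the ball, the balance reads G^alpha <= const G
    d after absorption, that is G^(alpha - 1) <= B d. *)
Lemma gradient_decay : exists2 C : R, 0 < C & exists2 rho : R, 0 < rho <= rho0 &
  forall d z : R, 0 < d <= rho -> `|z - x0| <= d -> `|g z| <= C * d `^ r.
Proof.
have [rho1 /andP[rho10 rho1r] H] := potential_balance ltr01.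
pose B := 2 * (`|k| + 1) / ((alpha - 1) * e).
have B0 : 0 < B by rewrite divr_gt0 ?mulr_gt0// ltr_wpDl.
(* Up to this radius the G^alpha term on the right is absorbed by half of the left-hand side. *)
pose m := (alpha - 1) * x0 / (8 * alpha); have m0 : 0 < m by rewrite divr_gt0 ?mulr_gt0.
have [rho rho_gt0 [r1 r2 _]] := common_radius rho10 m0 ltr01.
exists (B `^ r); first exact: powR_gt0.
exists rho; first by rewrite rho_gt0 (le_trans r1).
move=> d z /andP[d0 drho] zd.
have dr := le_trans drho (le_trans r1 rho1r).
have pn : x0 - d <= x0 + d by rewrite lerD2l ge0_cp// ltW.
have [p0 n1] : 0 < x0 - d /\ x0 + d <= 1.
  have h1 : `|x0 - d - x0| <= rho0 by rewrite addrAC subrr sub0r normrN gtr0_norm.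
  have h2 : `|x0 + d - x0| <= rho0 by rewrite addrAC subrr add0r gtr0_norm.
  by have /andP[? _] := in01' h1; have /andP[_ /ltW ?] := in01' h2.
have cgn : {within `[x0 - d, x0 + d], continuous (fun x => `|g x|)}.
  apply: (@within_comp _ _ (fun x : R => `|x|) g); first exact: within_oc_itv.
  by move=> x _; exact: norm_continuous.
have [y yI ymax] := EVT_max pn cgn.
have ball u : u \in `[x0 - d, x0 + d] -> `|u - x0| <= d.
  by rewrite in_itv/= ler_norml => /andP[? ?]; apply/andP; split; lra.
have ball' u : `|u - x0| <= d -> u \in `[x0 - d, x0 + d].
  by rewrite in_itv/= ler_norml => /andP[? ?]; apply/andP; split; lra.
set G := `|g y| in ymax.
have HG u : `|u - x0| <= d -> `|g u| <= G by move=> /ball'; exact: ymax.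
apply: le_trans (HG z zd) _.
have G0 : 0 <= G by exact: normr_ge0.
have dd : 0 < d <= rho1 by rewrite d0 (le_trans drho).
have := H d G y dd HG (ball y yI); rewrite -/G => HK.
have vy : `|v y - v x0| <= G * d.
  have n0 : `|x0 - x0| <= d by rewrite subrr normr0 ltW.
  apply: le_trans (v_incr dr HG n0 (ball y yI)) _.
  by rewrite ler_wpM2l// ball.
move: G0; rewrite le_eqVlt => /predU1P[<-|G0]; first by rewrite mulr_ge0// powR_ge0.
have kv : `|k * (v y - v x0)| <= `|k| * G * d.
  by rewrite normrM -mulrA ler_wpM2l.
have P0 : 0 < G `^ alpha by rewrite powR_gt0.
have small : 4 * alpha * e / x0 * G `^ alpha * d <= (alpha - 1) * e / 2 * G `^ alpha.
  have dm : d <= m by exact: le_trans drho r2.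
  rewrite (_ : (alpha - 1) * e / 2 * G `^ alpha = 4 * alpha * e / x0 * G `^ alpha * m); last first.
    by rewrite /m; field; rewrite !gt_eqF.
  by rewrite ler_pM2l// !mulr_gt0 ?invr_gt0.
have main : (alpha - 1) * e / 2 * G `^ alpha <= (`|k| + 1) * G * d.
  have h1 : (alpha - 1) * (e * G `^ alpha) <= (1 * G + 4 * alpha * e / x0 * G `^ alpha) * d + `|k| * G * d.
    rewrite -lerBlDr; apply: le_trans HK; apply: le_trans (ler_norm _).
    by rewrite lerD2l lerN2; apply: le_trans kv; exact: ler_norm.
  have -> : (alpha - 1) * e / 2 * G `^ alpha = (alpha - 1) * (e * G `^ alpha) - (alpha - 1) * e / 2 * G `^ alpha by field.
  apply: (@le_trans _ _ ((1 * G + 4 * alpha * e / x0 * G `^ alpha) * d + `|k| * G * d - 4 * alpha * e / x0 * G `^ alpha * d)).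
    by apply: lerB.
  by rewrite le_eqVlt; apply/orP; left; apply/eqP; ring.
have Gal : G `^ (alpha - 1) <= B * d.
  rewrite -(ler_pM2l G0) (mulr_powRB1 (ltW G0) al0).
  rewrite -(@ler_pM2l _ ((alpha - 1) * e / 2)) ?divr_gt0 ?mulr_gt0//; apply: le_trans main _.
  rewrite le_eqVlt; apply/orP; left; apply/eqP; rewrite /B; field.
  by rewrite !gt_eqF.
have -> : G = (G `^ (alpha - 1)) `^ r by rewrite -powRrM mulrC rr powRr1// ltW.
rewrite -powRM ?(ltW B0) ?(ltW d0)//; apply: ge0_ler_powR; rewrite ?nnegrE ?powR_ge0//.
  by rewrite /r invr_ge0 ltW.
by rewrite mulr_ge0// ltW.
Qed.

Section Decay.
Variables (C rho1 : R).
Hypotheses (C_gt0 : 0 < C) (rho1_bnd : 0 < rho1 <= rho0)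
  (decay : forall d z : R, 0 < d <= rho1 -> `|z - x0| <= d -> `|g z| <= C * d `^ r).

Let rho10 : 0 < rho1. Proof. by case/andP: rho1_bnd. Qed.

(** With G = C d^r both errors are small multiples of d^(1 + r), because (d^r)^alpha = d d^r. *)
Lemma balance_decay (eps : R) : 0 < eps -> exists2 rho : R, 0 < rho <= rho1 &
  forall d x : R, 0 < d <= rho -> `|x - x0| <= d ->
    `|(alpha - 1) * (e * `|g x| `^ alpha) - k * (v x - v x0)| <= eps * (d * d `^ r).
Proof.
move=> eps0; have e1 : 0 < eps / (2 * C) by rewrite divr_gt0 ?mulr_gt0.
have [rho2 /andP[rho20 _] H] := potential_balance e1.
have Ca : 0 < C `^ alpha by rewrite powR_gt0.
pose m := eps * x0 / (8 * alpha * e * C `^ alpha).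
have m0 : 0 < m by rewrite divr_gt0 ?mulr_gt0.
have [rho rho_gt0 [r1 r2 r3]] := common_radius rho10 rho20 m0.
exists rho; first by rewrite rho_gt0.
move=> d x /andP[d0 drho] xd; have [dr0 _ dra] := pow_r d0.
have d1 : 0 < d <= rho1 by rewrite d0 (le_trans drho).
have d2 : 0 < d <= rho2 by rewrite d0 (le_trans drho).
apply: le_trans (H d (C * d `^ r) x d2 (fun z => decay d1) xd) _.
rewrite powRM ?(ltW C_gt0) ?(ltW dr0)// dra.
have dm : 4 * alpha * e / x0 * C `^ alpha * d <= eps / 2.
  rewrite (_ : eps / 2 = 4 * alpha * e / x0 * C `^ alpha * m); last first.
    by rewrite /m; field; rewrite !gt_eqF.
  by rewrite ler_pM2l ?(le_trans drho)// !mulr_gt0 ?invr_gt0.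
rewrite (_ : _ * d = d * d `^ r * (eps / 2 + 4 * alpha * e / x0 * C `^ alpha * d)); last first.
  by field; rewrite !gt_eqF.
rewrite mulrC ler_pM2r ?mulr_gt0//.
by rewrite [leRHS]splitr lerD2l.
Qed.

(* Its derivative at [x0] should vanish: this is the equation for the flux at a zero of [g]. *)
Definition shifted_flux (z : R) : R :=
  alpha * e * (z ^+ 2 * signed_pow alpha (g z)) - k * x0 ^+ 2 * (z - x0).

(** After rescaling g = d^r gm the balance shows that |gm|^alpha varies little between points at
    distance l d, as k (v - v(x0)) does. If [g] changes sign between them, it has a zero there, so
    both powers are small; in either case the signed powers are close. *)
Lemma flux_osc (kappa : R) : 0 < kappa -> exists2 l : R, 0 < l <= 1 & exists2 rho : R, 0 < rho <= rho1 &
  forall d y z : R, 0 < d <= rho -> `|y - x0| <= d -> `|z - x0| <= d -> `|y - z| <= l * d ->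
    `|shifted_flux y - shifted_flux z| <= kappa * d.
Proof.
move=> kappa0; have ae0 : 0 < alpha * e by rewrite mulr_gt0.
pose kappa1 := kappa / (4 * (alpha * e)); have kappa10 : 0 < kappa1 by rewrite divr_gt0 ?mulr_gt0.
have [tau tau0 Htau] := signed_pow_osc alpha_gt1 (ltW C_gt0) kappa10.
pose B := (alpha - 1) * e; have B0 : 0 < B by rewrite mulr_gt0.
have eps0 : 0 < B * tau / 4 by rewrite divr_gt0 ?mulr_gt0.
have [rho2 /andP[rho20 rho2r] H] := balance_decay eps0.
have k1 : 0 < `|k| + 1 by rewrite ltr_wpDl.
have l10 : 0 < B * tau / 2 / ((`|k| + 1) * C) by rewrite divr_gt0 ?divr_gt0 ?mulr_gt0.
have l20 : 0 < kappa / 4 / (`|k| + 1) by rewrite !divr_gt0.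
have [l l0 [ll1 ll2 ll3]] := common_radius ltr01 l10 l20.
have Cp : 0 < C `^ (alpha - 1) by rewrite powR_gt0.
have m0 : 0 < kappa / (8 * (alpha * e) * C `^ (alpha - 1)) by rewrite divr_gt0 ?mulr_gt0.
have [rho rho_gt0 [rh1 rh2 _]] := common_radius rho20 m0 ltr01.
exists l; first by rewrite l0.
exists rho; first by rewrite rho_gt0 (le_trans rh1).
move=> d y z /andP[d0 drho].
have d2 : 0 < d <= rho2 by rewrite d0 (le_trans drho).
have d1 : 0 < d <= rho1 by rewrite d0 (le_trans (le_trans drho rh1)).
have dr : d <= rho0 by have /andP[_] := d1; move=> /le_trans; apply; case/andP: rho1_bnd.
have [dl0 dl1 dl2] := pow_r d0.
set dd := d `^ r in dl0 dl1 dl2.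
have ddd : 0 < d * dd by rewrite mulr_gt0.
pose gm u := g u / dd.
have gE u : g u = dd * gm u by rewrite /gm mulrCA mulfV ?mulr1// gt_eqF.
have gmC u : `|u - x0| <= d -> `|gm u| <= C.
  move=> ud; rewrite /gm normrM normfV (gtr0_norm dl0) ler_pdivrMr//; exact: decay d1 ud.
have gmP u : `|g u| `^ alpha = d * dd * `|gm u| `^ alpha.
  by rewrite {1}gE normrM (gtr0_norm dl0) powRM ?(ltW dl0)// dl2.
have Kosc u w : `|u - x0| <= d -> `|w - x0| <= d -> `|u - w| <= l * d ->
    `| `|gm u| `^ alpha - `|gm w| `^ alpha| <= tau.
  move=> ud wd uw; have hu := H d u d2 ud; have hw := H d w d2 wd; rewrite -/dd in hu hw.
  have vuw : `|v u - v w| <= C * dd * (l * d).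
    apply: le_trans (v_incr dr (fun z => decay d1) wd ud) _.
    by rewrite ler_wpM2l// mulr_ge0// ltW.
  have kvuw : `|k * (v u - v w)| <= B * tau / 2 * (d * dd).
    rewrite normrM; apply: (@le_trans _ _ ((`|k| + 1) * (C * dd * (l * d)))).
      by apply: ler_pM => //; rewrite lerDl.
    rewrite (_ : _ * _ = (`|k| + 1) * C * l * (d * dd)); last by ring.
    by rewrite ler_pM2r// mulrC -ler_pdivlMr ?mulr_gt0.
  rewrite -(ler_pM2l (mulr_gt0 B0 ddd)) -[X in X * _ <= _](gtr0_norm (mulr_gt0 B0 ddd)) -normrM.
  set Ku := (alpha - 1) * (e * `|g u| `^ alpha) - k * (v u - v x0) in hu.
  set Kw := (alpha - 1) * (e * `|g w| `^ alpha) - k * (v w - v x0) in hw.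
  rewrite (_ : B * (d * dd) * _ = Ku - Kw + k * (v u - v w)); last first.
    by rewrite /Ku /Kw !gmP /B; ring.
  rewrite (le_trans (ler_normD _ _))//.
  apply: le_trans (lerD (le_trans (ler_normB _ _) (lerD hu hw)) kvuw) _.
  by rewrite le_eqVlt; apply/orP; left; apply/eqP; field.
move=> yd zd yz.
have Fosc : `|signed_pow alpha (gm y) - signed_pow alpha (gm z)| <= kappa1.
  apply: Htau; [exact: gmC|exact: gmC|exact: Kosc|].
  have [pos|neg] := leP 0 (gm y * gm z); first by left.
  right; have gneg : g y * g z < 0.
    have -> : g y * g z = dd ^+ 2 * (gm y * gm z) by rewrite (gE y) (gE z); ring.
    by rewrite pmulr_rlt0// exprn_gt0.
  have zero : exists u, [/\ g u = 0, `|u - x0| <= d, `|y - u| <= l * d & `|z - u| <= l * d].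
    have ivt (p q : R) : p <= q -> `|p - x0| <= d -> `|q - x0| <= d -> `|q - p| <= l * d ->
        g p * g q < 0 -> exists u, [/\ g u = 0, `|u - x0| <= d, `|p - u| <= l * d & `|q - u| <= l * d].
      move=> pq pd qd qp gpq.
      have p01 := in01' (le_trans pd dr); have q01 := in01' (le_trans qd dr).
      have cpq : {within `[p, q], continuous g}.
        by apply: within_oc_itv => //; [case/andP: p01|case/andP: q01 => _ /ltW].
      have [|u uI gu] := @IVT _ g p q 0 pq cpq.
        move: gpq; rewrite ge_min le_max; have [gp|gp] := leP (g p) 0; have [gq|gq] := leP (g q) 0 => //=.
        - by rewrite ltNge mulr_le0.
        - by rewrite (ltW gq) orbT.
        - by rewrite (ltW gp).
        - by rewrite ltNge mulr_ge0// ltW.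
      exists u; move: uI; rewrite in_itv/= => /andP[pu uq].
      by have [] := between_dist pu uq pd qd qp.
    have [le|lt] := leP y z; first by apply: ivt => //; rewrite distrC.
    have gzy : g z * g y < 0 by rewrite mulrC.
    by have [u [gu ud zu yu]] := ivt z y (ltW lt) zd yd yz gzy; exists u.
  have [u [gu ud yu zu]] := zero.
  have gmu : `|gm u| `^ alpha = 0 by rewrite /gm gu mul0r normr0 powR0// gt_eqF.
  have h1 := Kosc y u yd ud yu; have h2 := Kosc z u zd ud zu.
  by rewrite gmu subr0 in h1; rewrite gmu subr0 in h2; split; [exact: le_trans (ler_norm _) h1|exact: le_trans (ler_norm _) h2].
have FE u : signed_pow alpha (g u) = d * signed_pow alpha (gm u).
  by rewrite {1}gE signed_powM// dl1.
have FC u : `|u - x0| <= d -> `|signed_pow alpha (gm u)| <= C `^ (alpha - 1).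
  by move=> ud; rewrite norm_signed_pow//; apply: ge0_ler_powR; rewrite ?nnegrE ?(ltW al10) ?(ltW C_gt0)//; exact: gmC.
have y01 := in01' (le_trans yd dr); have z01 := in01' (le_trans zd dr).
have y2 : y ^+ 2 <= 1 by case/andP: y01 => /ltW y0 /ltW y1; rewrite expr_le1.
have yz2 : `|y ^+ 2 - z ^+ 2| <= 2 * (l * d).
  rewrite subr_sqr normrM mulrC; apply: ler_pM => //.
  by case/andP: y01 => y0 y1; case/andP: z01 => z0 z1; rewrite gtr0_norm; lra.
have x02 : x0 ^+ 2 <= 1 by case/andP: x0A => /ltW h1 h2; rewrite expr_le1.
have t1 : `|y ^+ 2 * (d * (signed_pow alpha (gm y) - signed_pow alpha (gm z)))| <= d * kappa1.
  rewrite normrM ger0_norm ?sqr_ge0// normrM (gtr0_norm d0) -[leRHS]mul1r.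
  by apply: ler_pM; rewrite ?sqr_ge0 ?mulr_ge0 ?(ltW d0) ?ler_pM2l.
have t2 : `|(y ^+ 2 - z ^+ 2) * (d * signed_pow alpha (gm z))| <= 2 * d * (d * C `^ (alpha - 1)).
  rewrite normrM normrM (gtr0_norm d0); apply: ler_pM; rewrite ?mulr_ge0 ?(ltW d0)//.
    apply: le_trans yz2 _; rewrite ler_pM2l// -[leRHS]mul1r ler_pM2r//.
  by rewrite ler_pM2l//; exact: FC.
have t3 : `|k * x0 ^+ 2 * (y - z)| <= kappa / 4 * d.
  rewrite normrM normrM [`|x0 ^+ 2|]ger0_norm ?sqr_ge0//.
  apply: (@le_trans _ _ ((`|k| + 1) * 1 * (l * d))).
    apply: ler_pM; [by rewrite mulr_ge0// sqr_ge0|by []| |by []].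
    by apply: ler_pM; rewrite ?sqr_ge0// lerDl.
  by rewrite mulr1 mulrA ler_pM2r// mulrC -ler_pdivlMr.
have t4 : alpha * e * (2 * d * (d * C `^ (alpha - 1))) <= kappa / 4 * d.
  have dm : d <= kappa / (8 * (alpha * e) * C `^ (alpha - 1)) := le_trans drho rh2.
  rewrite ler_pdivlMr ?mulr_gt0// in dm.
  rewrite (_ : alpha * e * _ = d * (8 * (alpha * e) * C `^ (alpha - 1)) / 4 * d); last by field.
  by rewrite ler_pM2r// ler_pM2r.
have t5 : alpha * e * (d * kappa1) = kappa / 4 * d by rewrite /kappa1; field; rewrite !gt_eqF.
rewrite /shifted_flux !FE.
rewrite (_ : _ - _ = alpha * e * (y ^+ 2 * (d * (signed_pow alpha (gm y) - signed_pow alpha (gm z)))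
  + (y ^+ 2 - z ^+ 2) * (d * signed_pow alpha (gm z))) - k * x0 ^+ 2 * (y - z)); last by ring.
rewrite (le_trans (ler_normB _ _))// normrM (gtr0_norm ae0).
apply: (@le_trans _ _ (kappa / 4 * d + kappa / 4 * d + kappa / 4 * d)).
  apply: lerD => //; rewrite -t5; apply: le_trans (ler_wpM2l (ltW ae0) (le_trans (ler_normD _ _) (lerD t1 t2))) _.
  by rewrite mulrDr lerD2l t5.
have kd0 : 0 < kappa * d by rewrite mulr_gt0.
rewrite (_ : _ + _ = kappa * d * (3 / 4)); last by field.
by rewrite -[leRHS]mulr1 ler_pM2l//; lra.
Qed.

End Decay.

End FluxZero.

(** * Mean-square deviation of the shifted flux *)

Section FluxEnergy.
Context {R : realType}.
Local Notation A := (`]0%R, 1%R]%classic : set R).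
Variables (D v g h dh phi dphi : R -> R) (e c alpha : R).
Hypotheses (dp : damage_problem D v g h dh phi e c alpha)
  (cg : {within A, continuous g})
  (dv : forall x, 0 < x <= 1 -> derives_oc v x (g x))
  (phi_der : forall x : R, is_derive x 1 phi (dphi x)).

Let e_gt0 := dp_e_gt0 dp.
Let alpha_gt1 := dp_alpha_gt1 dp.
Let al0 : 0 < alpha. Proof. by apply: lt_trans alpha_gt1; exact: ltr01. Qed.
Let al10 : 0 < alpha - 1. Proof. by rewrite subr_gt0. Qed.
Let c_gt0 := dp_c_gt0 dp.

Variable x0 : R.
Hypotheses (x01 : 0 < x0 < 1) (gx0 : g x0 = 0) (v0_gt0 : 0 < v x0).

Let b x := - dh (D x - v x).
Let k := b x0 + c * dphi (v x0).
Let r := (alpha - 1)^-1.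
Let rho0 := Num.min (x0 / 2) ((1 - x0) / 2).
Let x0_gt0 : 0 < x0. Proof. by case/andP: x01. Qed.
Let x0A : 0 < x0 <= 1. Proof. by case/andP: x01 => -> /ltW. Qed.
Let F := signed_pow alpha.
Let H := shifted_flux D v g dh dphi e c alpha x0.

(** Upper first-order expansion of the density in the direction (q, s): the gradient term by
    convexity, with its slope at g + s replaced by the one at g, the terms in [h] and [phi] by
    linearisation at [x0]. Replacing z^2 by x0^2 in the linear term accounts for 2 d |k| |q|. *)
Lemma flux_pointwise (z q s d M eta E1 om : R) : 0 < z <= 1 -> `|z ^+ 2 - x0 ^+ 2| <= 2 * d ->
  0 <= M -> `|q| < eta ->
  (forall y : R, `|y - (D z - v z)| < eta -> 0 < y /\ `|dh y + b x0| <= M) ->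
  `|phi (v z + q) - phi (v z) - dphi (v x0) * q| <= E1 -> `|F (g z + s) - F (g z)| <= om ->
  z ^+ 2 * (h (D z - (v z + q)) + c * phi (v z + q) + e * `|g z + s| `^ alpha) <=
  z ^+ 2 * (h (D z - v z) + c * phi (v z) + e * `|g z| `^ alpha) +
  (k * x0 ^+ 2 * q + alpha * e * (z ^+ 2 * F (g z)) * s) +
  (2 * d * `|k| * `|q| + M * `|q| + c * E1 + e * alpha * om * `|s|).
Proof.
move=> /andP[z0 z1] zx M0 qe gap phiq Fs.
have z2 : z ^+ 2 <= 1 by rewrite expr_le1// ltW.
have z20 : 0 <= z ^+ 2 by exact: sqr_ge0.
have h1 : h (D z - (v z + q)) - h (D z - v z) - b x0 * q <= M * `|q|.
  have nq : `|- q| < eta by rewrite normrN.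
  have gap' y : `|y - (D z - v z)| < eta -> is_derive y 1 h (dh y) /\ `|dh y + b x0| <= M.
    by move=> /gap[y0 yM]; split => //; exact: (dp_h_der dp).
  have := increment_affine gap' nq; rewrite normrN.
  by rewrite (_ : D z - v z + - q = D z - (v z + q)); [lra|ring].
have h2 : c * phi (v z + q) - c * phi (v z) - c * dphi (v x0) * q <= c * E1.
  rewrite -mulrBr -mulrA -mulrBr ler_pM2l//; exact: le_trans (ler_norm _) phiq.
have h3 : e * `|g z + s| `^ alpha - e * `|g z| `^ alpha - alpha * e * F (g z) * s <= e * alpha * om * `|s|.
  have t := powR_tangent alpha_gt1 (g z) (g z + s); rewrite -/F addrAC subrr add0r in t.
  have t2 : (F (g z + s) - F (g z)) * s <= om * `|s|.
    apply: le_trans (ler_norm _) _; rewrite normrM; exact: ler_wpM2r.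
  have u1 := ler_wpM2l (ltW e_gt0) t; have u2 := ler_wpM2l (ltW (mulr_gt0 e_gt0 al0)) t2.
  rewrite -mulrBr; apply: le_trans (lerB u1 (lexx _)) _.
  rewrite (_ : _ - _ = e * alpha * ((F (g z + s) - F (g z)) * s)); last by ring.
  by apply: le_trans u2 _; rewrite !mulrA.
have h4 : (z ^+ 2 - x0 ^+ 2) * (k * q) <= 2 * d * `|k| * `|q|.
  apply: le_trans (ler_norm _) _; rewrite normrM [`|k * q|]normrM mulrA.
  by rewrite !ler_wpM2r.
rewrite -subr_ge0; have E0 : 0 <= c * E1 by rewrite mulr_ge0 ?(ltW c_gt0)// (le_trans _ phiq).
have O0 : 0 <= e * alpha * om * `|s|.
  by rewrite !mulr_ge0 ?(ltW e_gt0) ?(ltW al0)// (le_trans _ Fs).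
have Q0 : 0 <= M * `|q| by rewrite mulr_ge0.
set T1 := h (D z - (v z + q)) - _ - _ in h1; set T2 := c * phi (v z + q) - _ - _ in h2.
set T3 := e * `|g z + s| `^ alpha - _ - _ in h3.
rewrite (_ : _ - _ = (2 * d * `|k| * `|q| - (z ^+ 2 - x0 ^+ 2) * (k * q)) +
  (z ^+ 2 * (M * `|q| - T1) + (1 - z ^+ 2) * (M * `|q|)) +
  (z ^+ 2 * (c * E1 - T2) + (1 - z ^+ 2) * (c * E1)) +
  (z ^+ 2 * (e * alpha * om * `|s| - T3) + (1 - z ^+ 2) * (e * alpha * om * `|s|))); last first.
  by rewrite /T1 /T2 /T3 /k; ring.
have z2' : 0 <= 1 - z ^+ 2 by rewrite subr_ge0.
have mix (X Y : R) : Y <= X -> 0 <= X -> 0 <= z ^+ 2 * (X - Y) + (1 - z ^+ 2) * X.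
  by move=> YX X0; apply: addr_ge0; apply: mulr_ge0 => //; rewrite subr_ge0.
apply: addr_ge0; [apply: addr_ge0; [apply: addr_ge0|]|].
- by rewrite subr_ge0.
- exact: mix.
- exact: mix.
- exact: mix.
Qed.

Variables (C rho1 : R).
Hypotheses (C_gt0 : 0 < C) (rho1_bnd : 0 < rho1 <= rho0)
  (decay : forall d z : R, 0 < d <= rho1 -> `|z - x0| <= d -> `|g z| <= C * d `^ r).

(** Bounds the shifted flux in units of [d]: the first term comes from the flux, |k| from the
    subtracted tangent. *)
Let C3 := alpha * e * C `^ (alpha - 1) + `|k| + 1.
Let C3_gt0 : 0 < C3.
Proof. by rewrite ltr_wpDl// addr_ge0// !mulr_ge0 ?powR_ge0// ltW. Qed.

Let rr : r * (alpha - 1) = 1. Proof. by rewrite /r mulVf// gt_eqF. Qed.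

Section Ball.
Variable d : R.
Hypotheses (d_bnd : 0 < d <= rho1) (d_le1 : d <= 1).
Let p := x0 - d.
Let n := x0 + d.
Let dd := d `^ r.

Let d0 : 0 < d. Proof. by case/andP: d_bnd. Qed.
Let dd0 : 0 < dd. Proof. exact: powR_gt0. Qed.
Let dd1 : dd <= 1.
Proof.
have -> : 1 = 1 `^ r :> R by rewrite powR1.
by apply: ge0_ler_powR; rewrite ?nnegrE ?(ltW d0)// /r invr_ge0 ltW.
Qed.
Let dda : dd `^ (alpha - 1) = d. Proof. by rewrite /dd -powRrM rr powRr1// ltW. Qed.

Let d_le : d <= x0 / 2 /\ d <= (1 - x0) / 2.
Proof.
have /andP[_ dr] := d_bnd; have /andP[_ h1] := rho1_bnd.
by move: (le_trans dr h1); rewrite le_min => /andP[].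
Qed.

Let p_gt0 : 0 < p. Proof. by have [h1 _] := d_le; have h2 := x0_gt0; rewrite /p; lra. Qed.
Let n_lt1 : n < 1. Proof. by have [_ h1] := d_le; have /andP[_ h2] := x01; rewrite /n; lra. Qed.
Let pn : p < n. Proof. by have := d0; rewrite /p /n; lra. Qed.

Let ball z : p <= z <= n -> `|z - x0| <= d.
Proof. by rewrite ler_distl. Qed.

Let ball01 z : p <= z <= n -> 0 < z <= 1.
Proof. by move=> /andP[pz zn]; rewrite (lt_le_trans p_gt0 pz) ltW// (le_lt_trans zn). Qed.

Lemma F_decay z : p <= z <= n -> `|F (g z)| <= C `^ (alpha - 1) * d.
Proof.
move=> /ball zd; rewrite /F norm_signed_pow// -dda -powRM ?(ltW C_gt0) ?(ltW dd0)//.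
apply: ge0_ler_powR; rewrite ?nnegrE ?(ltW al10) ?mulr_ge0 ?(ltW C_gt0) ?(ltW dd0)//.
exact: decay.
Qed.

Lemma shifted_flux_bound z : p <= z <= n -> `|H z| <= C3 * d.
Proof.
move=> zI; have /andP[z0 z1] := ball01 zI; have := F_decay zI => Fz; have zd := ball zI.
have z2 : z ^+ 2 <= 1 by rewrite expr_le1// ltW.
have x2 : x0 ^+ 2 <= 1 by case/andP: x0A => /ltW h1 h2; rewrite expr_le1.
rewrite /H /shifted_flux -/F (le_trans (ler_normB _ _))//.
have t1 : `|alpha * e * (z ^+ 2 * F (g z))| <= alpha * e * C `^ (alpha - 1) * d.
  rewrite normrM gtr0_norm ?mulr_gt0// -[leRHS]mulrA ler_pM2l ?mulr_gt0//.
  rewrite normrM [`|z ^+ 2|]ger0_norm ?sqr_ge0// -[leRHS]mul1r.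
  by apply: ler_pM; rewrite ?sqr_ge0.
have t2 : `|k * x0 ^+ 2 * (z - x0)| <= `|k| * d.
  rewrite normrM normrM [`|x0 ^+ 2|]ger0_norm ?sqr_ge0//; apply: ler_pM; [by rewrite mulr_ge0// sqr_ge0|by []| |by []].
  by rewrite -[leRHS]mulr1; apply: ler_pM; rewrite ?sqr_ge0.
apply: le_trans (lerD t1 t2) _; rewrite -mulrDl ler_pM2r// /C3 lerDl.
exact: ler01.
Qed.

Let cF : {within A, continuous (fun z => F (g z))}.
Proof. by apply: (@within_comp _ _ F g) => // x _; exact: signed_pow_continuous. Qed.

Lemma shifted_flux_cont : {within A, continuous H}.
Proof.
apply: withinB.
  apply: withinM; first exact: within_cst.
  by apply: withinM => //; apply: withinX; exact: within_id.
apply: withinM; first exact: within_cst.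
by apply: withinB; [exact: within_id|exact: within_cst].
Qed.

Let cH : {within `[p, n], continuous H}.
Proof. by apply: within_oc_itv => //; [exact: ltW|exact: shifted_flux_cont]. Qed.

(** Subtracting the mean makes the primitive [eta] vanish at both ends of the ball, so that it can
    be used as a variation of [v]. *)
Let m := itg p n H / (n - p).
Let rho z := H z - m.
Let eta z := itg p z rho.

Let iH : intg p n H. Proof. exact: intg_cont. Qed.
Let c_rho : {within `[p, n], continuous rho}. Proof. by apply: withinB => //; exact: within_cst. Qed.
Let i_rho : intg p n rho. Proof. exact: intg_cont. Qed.
Let p_eta : primitive_on p n eta rho. Proof. by split => // z _; rewrite /eta itg1 add0r. Qed.

Let eta_p : eta p = 0. Proof. by rewrite /eta itg1. Qed.
Let eta_n : eta n = 0.
Proof.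
rewrite /eta itgB//; last exact: intg_cst.
by rewrite itg_cst ?(ltW pn)// /m divfK ?subrr// gt_eqF// subr_gt0.
Qed.

Let npE : n - p = 2 * d. Proof. by rewrite /n /p; ring. Qed.

Let m_bound : `|m| <= C3 * d.
Proof.
have np0 : 0 < n - p by rewrite subr_gt0.
rewrite /m normrM normfV (gtr0_norm np0) ler_pdivrMr//.
by apply: itg_bound => //; [exact: ltW|exact: shifted_flux_bound].
Qed.

Let rho_bound z : p <= z <= n -> `|rho z| <= 2 * C3 * d.
Proof.
move=> /shifted_flux_bound h1; rewrite /rho (le_trans (ler_normB _ _))//.
by rewrite -mulrA mulr_natl mulr2n; apply: lerD.
Qed.

Let eta_bound z : p <= z <= n -> `|eta z| <= 4 * C3 * d ^+ 2.
Proof.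
move=> /andP[pz zn]; have iz := intgS (lexx p) zn i_rho.
apply: (@le_trans _ _ (2 * C3 * d * (z - p))).
  by apply: itg_bound => // w /andP[pw wz]; apply: rho_bound; rewrite pw (le_trans wz).
have -> : 4 * C3 * d ^+ 2 = 2 * C3 * d * (2 * d) by ring.
by rewrite ler_pM2l ?mulr_gt0// -npE lerD2r.
Qed.

Section Test.
Variables (t M eta0 eps om : R).
Hypotheses (t_gt0 : 0 < t) (t_le1 : t <= 1) (M_ge0 : 0 <= M) (eps_ge0 : 0 <= eps) (om_ge0 : 0 <= om)
  (gap : forall z y : R, p <= z <= n -> `|y - (D z - v z)| < eta0 -> 0 < y /\ `|dh y + b x0| <= M)
  (small_eta : 4 * C3 * d < eta0) (small_v : (C + 4 * C3) * d < v x0)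
  (phi_near : forall w : R, `|w - v x0| <= (C + 4 * C3) * d ->
     `|phi w - phi (v x0) - dphi (v x0) * (w - v x0)| <= eps * `|w - v x0|)
  (F_near : forall s s' : R, `|s| <= C -> `|s' - s| <= 2 * C3 * t -> `|F s' - F s| <= om).

Let lam := t * dd / d.
Let lam0 : 0 < lam. Proof. by rewrite divr_gt0// mulr_gt0. Qed.
Let q z := - lam * eta z.
Let s z := - lam * rho z.

Let q_bound z : p <= z <= n -> `|q z| <= lam * (4 * C3 * d ^+ 2).
Proof. by move=> /eta_bound h1; rewrite /q normrM normrN (gtr0_norm lam0) ler_pM2l. Qed.
Let s_bound z : p <= z <= n -> `|s z| <= lam * (2 * C3 * d).
Proof. by move=> /rho_bound h1; rewrite /s normrM normrN (gtr0_norm lam0) ler_pM2l. Qed.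

Let lamE : lam * d = t * dd. Proof. by rewrite /lam divfK// gt_eqF. Qed.

Let q_small z : p <= z <= n -> `|q z| <= 4 * C3 * d.
Proof.
move=> /q_bound h1; apply: le_trans h1 _.
rewrite (_ : lam * _ = 4 * C3 * d * (lam * d)); last by ring.
rewrite lamE -[leRHS]mulr1 ler_pM2l; last by rewrite !mulr_gt0.
by rewrite -[leRHS]mulr1; apply: ler_pM; rewrite // ltW.
Qed.

Let v_near z : p <= z <= n -> `|v z - v x0| <= C * dd * d.
Proof.
move=> /ball zd; have [h1 h2] := d_le.
have dvz y : `|y - x0| <= d -> exists2 l : R, is_derive y 1 v l & `|l| <= C * dd.
  move=> yd; exists (g y); last exact: decay.
  apply: (v_derive dv); move: yd; rewrite ler_norml => /andP[? ?].
  by have x00 := x0_gt0; have /andP[_ x11] := x01; apply/andP; split; lra.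
apply: le_trans (increment_closed dvz zd) _.
by rewrite ler_wpM2l// mulr_ge0// ltW.
Qed.

Let w_near z : p <= z <= n -> `|v z - v x0| <= (C + 4 * C3) * d /\ `|v z + q z - v x0| <= (C + 4 * C3) * d.
Proof.
move=> zI; have h1 := q_small zI.
have h2 : `|v z - v x0| <= C * d.
  apply: le_trans (v_near zI) _; rewrite -mulrA ler_pM2l// -[leRHS]mul1r ler_pM2r//.
have c0 : 0 <= 4 * C3 * d by rewrite !mulr_ge0// ltW.
split; first by rewrite mulrDl (le_trans h2)// lerDl.
by rewrite addrAC mulrDl (le_trans (ler_normD _ _))// lerD.
Qed.

Let phi_q z : p <= z <= n ->
  `|phi (v z + q z) - phi (v z) - dphi (v x0) * q z| <= eps * (lam * d ^+ 2 * (4 * C3 + 2 * C / t)).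
Proof.
move=> zI; have [w1 w2] := w_near zI.
have h1 := phi_near w1; have h2 := phi_near w2.
rewrite (_ : _ - _ = (phi (v z + q z) - phi (v x0) - dphi (v x0) * (v z + q z - v x0)) -
  (phi (v z) - phi (v x0) - dphi (v x0) * (v z - v x0))); last by ring.
rewrite (le_trans (ler_normB _ _))// (le_trans (lerD h2 h1))// -mulrDr ler_wpM2l//.
have h3 := v_near zI; have h4 := q_bound zI.
have h5 : `|v z + q z - v x0| <= `|v z - v x0| + `|q z|.
  by rewrite addrAC; exact: ler_normD.
have E : lam * d ^+ 2 * (4 * C3 + 2 * C / t) = lam * (4 * C3 * d ^+ 2) + 2 * (C * dd * d).
  rewrite mulrDr (_ : lam * d ^+ 2 * (2 * C / t) = lam * d * d * (2 * C / t)); last by ring.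
  by rewrite lamE; field; rewrite gt_eqF.
by rewrite E; lra.
Qed.

(** [F] is homogeneous of degree alpha - 1, and d^r raised to this power is d: a modulus of
    continuity at scale 1 becomes one at scale d^r with an extra factor d. *)
Let F_q z : p <= z <= n -> `|F (g z + s z) - F (g z)| <= om * d.
Proof.
move=> zI; have gz := decay d_bnd (ball zI); rewrite -/dd in gz.
have FE u : F u = d * F (u / dd).
  have uE : u = dd * (u / dd) by rewrite mulrCA mulfV ?mulr1// gt_eqF.
  by rewrite {1}uE /F signed_powM// dda.
rewrite (FE (g z + s z)) (FE (g z)) -mulrBr normrM (gtr0_norm d0) mulrC ler_pM2r//; apply: F_near.
  by rewrite normrM normfV (gtr0_norm dd0) ler_pdivrMr.
rewrite mulrDl addrAC subrr add0r normrM normfV (gtr0_norm dd0) ler_pdivrMr//.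
apply: le_trans (s_bound zI) _.
by rewrite (_ : lam * (2 * C3 * d) = 2 * C3 * (lam * d)); [rewrite lamE mulrA|ring].
Qed.

(** The errors in units of lam d^2, in this order: variation of the weight z^2, remainder of [h],
    remainder of [phi], change of slope in the gradient term. *)
Let S := 8 * `|k| * C3 * d + 4 * C3 * M + c * eps * (4 * C3 + 2 * C / t) + 2 * e * alpha * C3 * om.

Let w z := v z + q z.
Let dw z := g z + s z.

Let pointwise z : p <= z <= n ->
  lagrangian D h phi e c alpha w dw z <= lagrangian D h phi e c alpha v g z +
    - lam * (k * x0 ^+ 2 * eta z + alpha * e * (z ^+ 2 * F (g z)) * rho z) + lam * d ^+ 2 * S.
Proof.
move=> zI; have zd := ball zI; have z01 := ball01 zI.
have zx : `|z ^+ 2 - x0 ^+ 2| <= 2 * d.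
  rewrite subr_sqr normrM mulrC; apply: ler_pM => //.
  case/andP: z01 => z0 z1; case/andP: x0A => x00 x11.
  by rewrite gtr0_norm; lra.
have qe : `|q z| < eta0 := le_lt_trans (q_small zI) small_eta.
have := flux_pointwise z01 zx M_ge0 qe (fun y => gap zI) (phi_q zI) (F_q zI).
rewrite -/(lagrangian D h phi e c alpha w dw z) -/(lagrangian D h phi e c alpha v g z).
move=> /le_trans; apply; apply: lerD.
  rewrite lerD2l le_eqVlt; apply/orP; left; apply/eqP; rewrite /q /s; ring.
have h1 := q_bound zI; have h2 := s_bound zI.
have d0' := ltW d0; have k0 := normr_ge0 k.
have t1 : 2 * d * `|k| * `|q z| <= 2 * d * `|k| * (lam * (4 * C3 * d ^+ 2)).
  by rewrite ler_wpM2l// !mulr_ge0.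
have t2 : M * `|q z| <= M * (lam * (4 * C3 * d ^+ 2)) by rewrite ler_wpM2l.
have t3 : e * alpha * (om * d) * `|s z| <= e * alpha * (om * d) * (lam * (2 * C3 * d)).
  by rewrite ler_wpM2l// !mulr_ge0 ?(ltW e_gt0) ?(ltW al0).
apply: le_trans (lerD (lerD (lerD t1 t2) (lexx _)) t3) _.
by rewrite le_eqVlt; apply/orP; left; apply/eqP; rewrite /S; ring.
Qed.

(* Compare [v] with [v - lam * eta], where [eta] is the primitive of [rho], at the scale [lam = t d^r / d] at which the bound on [g] is saturated. *)
Lemma flux_test : itg p n (fun z => rho z ^+ 2) <= 2 * d ^+ 3 * S.
Proof.
have n1 := ltW n_lt1.
have c_eta := primitive_continuous (ltW pn) p_eta.
have pv : primitive_on p n v g.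
  by apply: primitiveS (lexx p) n1 (dp_primitive dp _); rewrite p_gt0 (lt_trans pn).
have cgn : {within `[p, n], continuous g} by exact: within_oc_itv.
have cs : {within `[p, n], continuous s} by apply: withinM => //; exact: within_cst.
have pw : primitive_on p n w dw.
  by apply: primitiveD pv _; have := primitiveZ (- lam) p_eta.
have wp : w p = v p by rewrite /w /q eta_p mulr0 addr0.
have wn : w n = v n by rewrite /w /q eta_n mulr0 addr0.
have cpow (f : R -> R) : {within `[p, n], continuous f} -> intg p n (fun z => `|f z| `^ alpha).
  move=> cf; apply: intg_cont; apply: (@within_comp _ _ (fun x => `|x| `^ alpha) f) => // x _.
  exact: norm_powR_continuous.
have ipow : intg p n (fun z => `|dw z| `^ alpha) by apply: cpow; exact: withinD.
have wadm z : p <= z <= n -> 0 <= w z < D z.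
  move=> zI; have [_ h1] := w_near zI.
  have w0 : 0 <= w z.
    by move: (le_lt_trans h1 small_v); rewrite ltr_norml /w => /andP[? _]; lra.
  rewrite w0/= -subr_gt0; have [|//] := @gap z (D z - w z) zI.
  rewrite (_ : _ - _ = - q z); last by rewrite /w; ring.
  by rewrite normrN; exact: le_lt_trans (q_small zI) small_eta.
have vm := damage_min_on dp p_gt0 pn n1 pw wp wn ipow wadm.
have ilv : intg p n (lagrangian D h phi e c alpha v g).
  apply: (intg_lagrangian dp) => //; [exact: primitive_continuous (ltW pn) pv|exact: cpow|].
  by move=> z /ball01/(dp_adm dp)/andP[].
have ilw : intg p n (lagrangian D h phi e c alpha w dw).
  apply: (intg_lagrangian dp) => //; first exact: primitive_continuous (ltW pn) pw.
  by move=> z /wadm/andP[].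
pose Q z := k * x0 ^+ 2 * eta z + alpha * e * (z ^+ 2 * F (g z)) * rho z.
have cFn : {within `[p, n], continuous (fun z => F (g z))} by exact: within_oc_itv.
have i1 : intg p n (fun z => k * x0 ^+ 2 * eta z) by apply: intgZ; exact: intg_cont.
have i2 : intg p n (fun z => alpha * e * (z ^+ 2 * F (g z)) * rho z).
  apply: intg_cont; apply: withinM => //; apply: withinM; first exact: within_cst.
  by apply: withinM => //; apply: withinX; exact: within_id.
have iQ : intg p n Q by exact: intgD.
have i3 : intg p n (fun z => k * x0 ^+ 2 * (z - x0) * rho z).
  apply: intg_cont; apply: withinM => //; apply: withinM; first exact: within_cst.
  by apply: withinB; [exact: within_id|exact: within_cst].
(* Integration by parts moves the [k] term from [eta] to [rho] and completes the flux to H = rho +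
   m; the constant drops out because [rho] has mean zero. *)
have QE : itg p n Q = itg p n (fun z => rho z ^+ 2).
  have pl : primitive_on p n (fun z => k * x0 ^+ 2 * (z - x0)) (fun=> k * x0 ^+ 2).
    have := primitiveZ (k * x0 ^+ 2) (primitiveD (primitive_id p n) (primitive_cst p n (- x0))).
    by apply: eq_primitive => z _ //=; rewrite addr0 mulr1.
  have parts : itg p n (fun z => k * x0 ^+ 2 * eta z) = - itg p n (fun z => k * x0 ^+ 2 * (z - x0) * rho z).
    rewrite (itg_by_parts (ltW pn) pl p_eta) eta_p eta_n !mulr0 subrr sub0r opprK.
    by [].
  have ir2 : intg p n (fun z => rho z ^+ 2) by apply: intg_cont; exact: withinX.
  have r0 : itg p n rho = 0 by exact: eta_n.
  rewrite /Q itgD// parts.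
  rewrite addrC -itgB//.
  rewrite (@eq_itg _ _ _ _ (fun z => rho z ^+ 2 + m * rho z)); last first.
    by move=> z _; rewrite /rho /H /shifted_flux -/F -/k; ring.
  by rewrite itgD//; [rewrite itgZ// r0 mulr0 addr0|exact: intgZ].
have bound : itg p n (lagrangian D h phi e c alpha w dw) <=
    itg p n (lagrangian D h phi e c alpha v g) + - lam * itg p n Q + lam * d ^+ 2 * S * (n - p).
  rewrite -itg_cst ?(ltW pn)// -itgZ// -itgD//; last exact: intgZ.
  rewrite -itgD; [|by apply: intgD => //; exact: intgZ|exact: intg_cst].
  apply: le_itg; [by []| |by move=> z zI; exact: pointwise zI].
  by apply: intgD; [apply: intgD => //; exact: intgZ|exact: intg_cst].
rewrite QE npE in bound.
have arith (X Y I T l : R) : 0 < l -> X <= Y -> Y <= X + - l * I + l * d ^+ 2 * S * T -> I <= d ^+ 2 * S * T.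
  move=> l0 XY YX; rewrite -(ler_pM2l l0).
  by have := le_trans XY YX; rewrite -addrA lerDl mulNr addrC subr_ge0 !mulrA.
apply: le_trans (arith _ _ _ _ _ lam0 vm bound) _.
by rewrite le_eqVlt; apply/orP; left; apply/eqP; ring.
Qed.

End Test.
End Ball.

(** The order of choices matters: [om] determines the amplitude [t] through the continuity of the
    signed power, [eps] comes after [t] because the [phi] error contains 2 C / t, and the radius
    comes last. *)
Lemma flux_energy (kappa : R) : 0 < kappa -> exists2 rho : R, 0 < rho <= rho1 &
  forall d : R, 0 < d <= rho -> itg (x0 - d) (x0 + d)
    (fun z => (H z - itg (x0 - d) (x0 + d) H / (x0 + d - (x0 - d))) ^+ 2) <= kappa * d ^+ 3.
Proof.
have lt_half (y w d : R) : 0 < w -> d * (2 * y) <= w -> y * d < w by move=> *; lra.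
have in01 (d z : R) : d <= x0 / 2 -> d <= (1 - x0) / 2 -> 0 < d -> x0 - d <= z <= x0 + d ->
    0 < z /\ z <= 1.
  by move=> h1 h2 h3 /andP[h4 h5]; split; have := x0_gt0; have /andP[_ ?] := x01; lra.
have part (y w d kap : R) : 0 <= w * d -> d * (128 * ((y + 1) * w)) <= kap -> 8 * y * w * d <= kap / 16.
  by move=> *; lra.
have total (a kap : R) : 0 < kap -> a <= kap / 16 -> 2 * (a + kap / 16 + kap / 16 + kap / 8) <= kap.
  by move=> *; lra.
have half_lt (y w : R) : 0 < w -> y <= w / 2 -> y < w by move=> *; lra.
move=> kappa0; have k0 := normr_ge0 k; have rho10 : 0 < rho1 by case/andP: rho1_bnd.
pose om := kappa / (16 * (e * alpha * C3)).
have om0 : 0 < om by rewrite divr_gt0 ?mulr_gt0.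
pose L := C + 2 * C3; have L0 : 0 < L by rewrite addr_gt0 ?mulr_gt0.
have cF' : {within `[- L, L], continuous F}.
  by apply: continuous_subspaceT => z; exact: signed_pow_continuous.
have LL : - L <= L by have := L0; lra.
have [dF dF0 HF] := within_unif LL cF' om0.
have dF4 : 0 < dF / (4 * C3) by rewrite divr_gt0 ?mulr_gt0.
have [t t0 [t1 tF _]] := common_radius ltr01 dF4 ltr01.
have F_near (s s' : R) : `|s| <= C -> `|s' - s| <= 2 * C3 * t -> `|F s' - F s| <= om.
  move=> sC ss.
  have t2 : 2 * C3 * t <= 2 * C3 by rewrite -[leRHS]mulr1 ler_pM2l ?mulr_gt0.
  have tF2 : 2 * C3 * t < dF.
    have : 2 * C3 * t <= dF / 2.
      rewrite (_ : dF / 2 = 2 * C3 * (dF / (4 * C3))); last by field; rewrite gt_eqF.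
      by rewrite ler_pM2l ?mulr_gt0.
    by move=> /le_lt_trans; apply; have := dF0; lra.
  have s'L : `|s'| <= L.
    rewrite -(subrK s s') (le_trans (ler_normD _ _))// addrC /L.
    by apply: lerD => //; exact: le_trans ss t2.
  have sL : `|s| <= L by rewrite (le_trans sC)// lerDl mulr_ge0// ltW.
  by apply: HF; rewrite -?ler_norml//; exact: le_lt_trans ss tF2.
pose B := 4 * C3 + 2 * C / t; have B0 : 0 < B by rewrite addr_gt0 ?divr_gt0 ?mulr_gt0.
pose eps := kappa / (16 * (c * B)); have eps0 : 0 < eps by rewrite divr_gt0 ?mulr_gt0.
pose M := kappa / (64 * C3); have M0 : 0 < M by rewrite divr_gt0 ?mulr_gt0.
have bM : `|dh (D x0 - v x0) + b x0| < M by rewrite /b subrr normr0.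
have [dg dg0 [eta0 eta00 Hgap]] := gap_near_at dp x0A bM.
have /is_deriveP Hphi := phi_der (v x0).
have [dphi' dphi0 {}Hphi] := Hphi _ eps0.
have G0 : 0 < C + 4 * C3 by rewrite addr_gt0 ?mulr_gt0.
have C80 : 0 < 2 * (4 * C3) by rewrite !mulr_gt0.
have G20 : 0 < 2 * (C + 4 * C3) by rewrite mulr_gt0.
have K0 : 0 < 128 * ((`|k| + 1) * C3) by rewrite !mulr_gt0// ltr_wpDl.
have [a1 a10 [a11 a12 a13]] := common_radius ltr01 (divr_gt0 dg0 (ltr0n R 2)) (divr_gt0 eta00 C80).
have [a2 a20 [a21 a22 a23]] := common_radius (divr_gt0 v0_gt0 G20) (divr_gt0 dphi0 G20) (divr_gt0 kappa0 K0).
have [rho rho0' [r1 r2 r3]] := common_radius rho10 a10 a20.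
exists rho; first by rewrite rho0'.
move=> d /andP[d0 drho].
have d_bnd : 0 < d <= rho1 by rewrite d0 (le_trans drho).
have le1 := le_trans drho r2; have le2 := le_trans drho r3.
have dle1 := le_trans le1 a11; have dleg := le_trans le1 a12.
have dleta := le_trans le1 a13; have dlev := le_trans le2 a21.
have dlephi := le_trans le2 a22; have dlek := le_trans le2 a23.
rewrite ler_pdivlMr// in dleta; rewrite ler_pdivlMr// in dlev.
rewrite ler_pdivlMr// in dlephi; rewrite ler_pdivlMr// in dlek.
have small_eta : 4 * C3 * d < eta0 by exact: lt_half.
have small_v : (C + 4 * C3) * d < v x0 by exact: lt_half.
have [dx0 dx1] : d <= x0 / 2 /\ d <= (1 - x0) / 2.
  have /andP[_ h1] := rho1_bnd; have /andP[_ h2] := d_bnd.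
  by move: (le_trans h2 h1); rewrite le_min => /andP[].
have gap (z y : R) : x0 - d <= z <= x0 + d -> `|y - (D z - v z)| < eta0 -> 0 < y /\ `|dh y + b x0| <= M.
  move=> zI; have [z0 z1] := in01 d z dx0 dx1 d0 zI; apply: Hgap; first by rewrite z0.
  by apply: le_lt_trans (half_lt _ _ dg0 dleg); rewrite ler_distl.
have phi_near (w : R) : `|w - v x0| <= (C + 4 * C3) * d ->
    `|phi w - phi (v x0) - dphi (v x0) * (w - v x0)| <= eps * `|w - v x0|.
  move=> wd; apply: Hphi; exact: le_lt_trans wd (lt_half _ _ _ dphi0 dlephi).
have := flux_test d_bnd dle1 t0 t1 (ltW M0) (ltW eps0) (ltW om0) gap small_eta small_v phi_near F_near.
move=> /le_trans; apply.
have d30 : 0 < d ^+ 3 by rewrite exprn_gt0.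
rewrite -/B (_ : c * eps * B = kappa / 16); last by rewrite /eps; field; rewrite !gt_eqF.
rewrite (_ : 4 * C3 * M = kappa / 16); last by rewrite /M; field; rewrite gt_eqF.
rewrite (_ : 2 * e * alpha * C3 * om = kappa / 8); last by rewrite /om; field; rewrite !gt_eqF.
rewrite [leLHS]mulrAC ler_pM2r//.
by apply: total => //; apply: part dlek; rewrite mulr_ge0// ltW.
Qed.
End FluxEnergy.

(** * Derivative of the flux wherever the damage is positive *)

Section FluxDerivative.
Context {R : realType}.
Local Notation A := (`]0%R, 1%R]%classic : set R).

(** If |f(z)| exceeded 2a, then |f| >= a on a window of length L next to z, which already exceeds
    the energy. *)
Lemma small_of_energy (p n L a z : R) (f : R -> R) : {within `[p, n], continuous f} ->
  0 < a -> 0 < L -> 2 * L <= n - p ->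
  (forall y w : R, p <= y <= n -> p <= w <= n -> `|y - w| <= L -> `|f y - f w| <= a) ->
  itg p n (fun w => f w ^+ 2) < a ^+ 2 * L -> p <= z <= n -> `|f z| <= 2 * a.
Proof.
move=> cf a0 L0 Ln osc E zI; rewrite leNgt; apply/negP => fz.
have [pz zn] := andP zI.
(* The window lies to the right of [z] near the left end and to its left otherwise; 2 L <= n - p
   leaves room for it. *)
have [u [pu un uz]] : exists u : R, [/\ p <= u, u + L <= n & forall w : R, u <= w <= u + L -> `|z - w| <= L].
  have [zm|mz] := lerP z (p + L).
    exists z; split => //; first by lra.
    by move=> w /andP[w1 w2]; rewrite ler_norml; apply/andP; split; lra.
  exists (z - L); split; [by lra|by lra|].
  by move=> w /andP[w1 w2]; rewrite ler_norml; apply/andP; split; lra.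
have i2 : intg p n (fun w => f w ^+ 2) by apply: intg_cont; exact: withinX.
have uL : u <= u + L by rewrite lerDl ltW.
have low : a ^+ 2 * L <= itg u (u + L) (fun w => f w ^+ 2).
  have -> : a ^+ 2 * L = itg u (u + L) (fun=> a ^+ 2) by rewrite itg_cst// addrAC subrr add0r.
  apply: le_itg; [exact: intg_cst|exact: intgS i2|].
  move=> w wI; have wd := uz w wI; have [w1 w2] := andP wI.
  have wI' : p <= w <= n by rewrite (le_trans pu)// (le_trans w2).
  have fzw := osc z w zI wI' wd.
  have fw : a <= `|f w|.
    by have := ler_normD (f z - f w) (f w); rewrite subrK; lra.
  by rewrite -[f w ^+ 2]real_normK ?num_real// lerXn2r ?nnegrE// ltW.
have := ge0_le_itg pu uL un i2 (fun w _ => sqr_ge0 (f w)).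
by move=> /(le_trans low)/le_lt_trans/(_ E); rewrite ltxx.
Qed.

Variables (D v g h dh phi dphi : R -> R) (e c alpha : R).
Hypotheses (dp : damage_problem D v g h dh phi e c alpha)
  (cg : {within A, continuous g})
  (dv : forall x, 0 < x <= 1 -> derives_oc v x (g x))
  (phi_der : forall x : R, is_derive x 1 phi (dphi x)).

(** Small oscillation over distances l d and small mean-square deviation together give a small
    uniform deviation from the mean, so the shifted flux has derivative 0 and the flux that of the
    tangent subtracted. *)
Lemma flux_derive_zero (x : R) : 0 < x < 1 -> g x = 0 -> 0 < v x ->
  is_derive x 1 (fun y => y ^+ 2 * signed_pow alpha (g y))
    (x ^+ 2 * (- dh (D x - v x) + c * dphi (v x)) / (alpha * e)).
Proof.
move=> x01 gx vx; have e0 := dp_e_gt0 dp.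
have al0 : 0 < alpha by apply: lt_trans (dp_alpha_gt1 dp); exact: ltr01.
have [C C0 [rho1 rho1b decay]] := gradient_decay dp cg dv phi_der x01 gx.
pose k := - dh (D x - v x) + c * dphi (v x).
pose H := shifted_flux D v g dh dphi e c alpha x.
have HE y : H y = alpha * e * (y ^+ 2 * signed_pow alpha (g y)) - k * x ^+ 2 * (y - x) by [].
have [rho10 rho1r] := andP rho1b; have [x0 x1] := andP x01.
have dH : is_derive x 1 H 0.
  apply/is_deriveP => eps eps0.
  (* The deviation from the mean will be at most twice eps / 4 times d, at [y] and again at [x]. *)
  have kap0 : 0 < eps / 4 by rewrite divr_gt0.
  have [l /andP[l0 l1] [rho2 /andP[rho20 rho21] osc]] := flux_osc dp cg dv phi_der x01 gx C0 rho1b decay kap0.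
  have kap1 : 0 < (eps / 4) ^+ 2 * l / 2 by rewrite divr_gt0 ?mulr_gt0 ?exprn_gt0.
  have [rho3 /andP[rho30 rho31] en] := flux_energy dp cg dv phi_der x01 vx C0 rho1b decay kap1.
  have [rho rho0 [r1 r2 _]] := common_radius rho20 rho30 ltr01.
  exists rho => // y yx; rewrite mul0r subr0.
  have [->|yn] := eqVneq y x; first by rewrite !subrr normr0 mulr0.
  (* The radius is adapted to [y], which lies on the boundary of the ball. *)
  set d := `|y - x| in yx *; have d0 : 0 < d by rewrite normr_gt0 subr_eq0.
  have d2 : 0 < d <= rho2 by rewrite d0 (le_trans (ltW yx)).
  have d3 : 0 < d <= rho3 by rewrite d0 (le_trans (ltW yx)).
  have dr1 : d <= rho1 by case/andP: d2 => _ /le_trans; apply.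
  have [dx0 dx1] : d <= x / 2 /\ d <= (1 - x) / 2.
    by move: (le_trans dr1 rho1r); rewrite le_min => /andP[].
  set p := x - d; set n := x + d.
  have p0 : 0 < p by rewrite /p; lra.
  have pn : p < n by rewrite /p /n; lra.
  have n1 : n <= 1 by rewrite /n; lra.
  have ball w : p <= w <= n -> `|w - x| <= d.
    by rewrite ler_distl.
  pose m := itg p n H / (n - p).
  have cH : {within `[p, n], continuous H}.
    apply: within_oc_itv => //.
    by have := @shifted_flux_cont _ D v g h dh phi dphi e c alpha dp cg x.
  have crho : {within `[p, n], continuous (fun z => H z - m)} by apply: withinB => //; exact: within_cst.
  have a0 : 0 < eps / 4 * d by rewrite mulr_gt0.
  have L0 : 0 < l * d by rewrite mulr_gt0.
  have Ln : 2 * (l * d) <= n - p.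
    have -> : n - p = 2 * (1 * d) by rewrite /n /p; ring.
    by rewrite ler_pM2l// ler_pM2r.
  have osc' (z w : R) : p <= z <= n -> p <= w <= n -> `|z - w| <= l * d ->
      `|(H z - m) - (H w - m)| <= eps / 4 * d.
    move=> zI wI zw; rewrite (_ : _ - _ = H z - H w); last by ring.
    by apply: osc d2 (ball z zI) (ball w wI) zw.
  have E : itg p n (fun w => (H w - m) ^+ 2) < (eps / 4 * d) ^+ 2 * (l * d).
    apply: le_lt_trans (en d d3) _.
    rewrite (_ : (eps / 4 * d) ^+ 2 * (l * d) = (eps / 4) ^+ 2 * l * d ^+ 3); last by ring.
    rewrite ltr_pM2r ?exprn_gt0// ltr_pdivrMr// ltr_pMr ?ltr1n//.
    by rewrite mulr_gt0// exprn_gt0.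
  have yI : p <= y <= n by rewrite -ler_distl.
  have xI : p <= x <= n by rewrite gerBl lerDl ltW.
  have hy := small_of_energy crho a0 L0 Ln osc' E yI.
  have hx := small_of_energy crho a0 L0 Ln osc' E xI.
  have := ler_normB (H y - m) (H x - m).
  rewrite (_ : H y - m - (H x - m) = H y - H x); last by ring.
  by move=> hyx; apply: le_trans hyx _; apply: le_trans (lerD hy hx) _; rewrite le_eqVlt; apply/orP; left; apply/eqP; field.
have dl := is_derive_scale (alpha * e)^-1 (is_derive_add dH (is_derive_affine (- (k * x ^+ 2 * x)) (k * x ^+ 2) x)).
have an : alpha != 0 by rewrite gt_eqF.
have en : e != 0 by rewrite gt_eqF.
apply: (@is_derive_near _ _ _ x _ 1 ltr01 _ (is_derive_eq dl _)).
  by move=> y _; rewrite HE; field; rewrite an en.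
by rewrite -/k; field; rewrite an en.
Qed.

Lemma flux_derive (x : R) : 0 < x < 1 -> v x != 0 ->
  is_derive x 1 (fun y => y ^+ 2 * signed_pow alpha (g y))
    (x ^+ 2 * (- dh (D x - v x) + c * dphi (v x)) / (alpha * e)).
Proof.
move=> x01 vx; have x01' : 0 < x <= 1 by case/andP: x01 => -> /ltW.
have [gx|gx] := eqVneq (g x) 0; last first.
  exact: (is_derive_eq (flux_derive_nonzero dp cg dv phi_der x01 gx)).
apply: flux_derive_zero => //; rewrite lt0r vx.
by case/andP: (dp_adm dp x01').
Qed.

End FluxDerivative.

(** * The flux at the origin *)

Section Crossing.
Context {R : realType}.
Implicit Types (f : R -> R).

Lemma first_hit (a b s : R) f : a <= b -> {within `[a, b], continuous f} -> s <= f b ->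
  exists c : R, [/\ a <= c <= b, s <= f c & forall y : R, a <= y < c -> f y < s].
Proof.
move=> ab /continuous_withinP cf fb; pose S := [set y | a <= y <= b /\ s <= f y].
have Sb : S b by rewrite /S/= ab lexx.
have lbS : has_lbound S by exists a => y [/andP[]].
have infS : has_inf S by split; first by exists b.
pose c := inf S; have cb : c <= b by exact: (ge_inf lbS Sb).
have ac : a <= c by apply: lb_le_inf; [exists b|move=> y [/andP[]]].
have cI : `[a, b]%classic c by rewrite /= in_itv/= ac cb.
exists c; split; [by rewrite ac cb| |].
  rewrite leNgt; apply/negP => fc.
  have e0 : 0 < (s - f c) / 2 by rewrite divr_gt0 ?subr_gt0.
  have [d d0 Hd] := cf c cI _ e0.
  have [y [yI fy] yc] := inf_adherent d0 infS.
  have cy : c <= y by apply: (ge_inf lbS).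
  have yd : `|y - c| < d by rewrite ger0_norm ?subr_ge0// ltrBlDl.
  have yI' : `[a, b]%classic y by rewrite /= in_itv/=.
  have := Hd y yI' yd; rewrite ler_norml => /andP[_ h1]; lra.
move=> y /andP[ay yc]; rewrite ltNge; apply/negP => fy.
have Sy : S y by rewrite /S/= ay (le_trans (ltW yc)).
by have := ge_inf lbS Sy; rewrite leNgt yc.
Qed.

Lemma within_opp (a b : R) f : {within `[a, b], continuous f} ->
  {within `[- b, - a], continuous (fun x => f (- x))}.
Proof.
move=> /continuous_withinP cf; apply/continuous_withinP => x /=; rewrite in_itv/= => /andP[bx xa] e e0.
have xI : `[a, b]%classic (- x) by rewrite /= in_itv/= lerNr xa lerNl bx.
have [d d0 Hd] := cf _ xI e e0; exists d => // y /=; rewrite in_itv/= => /andP[by' ya] yx.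
apply: Hd; first by rewrite /= in_itv/= lerNr ya lerNl by'.
by rewrite -opprD normrN.
Qed.

(** [b'] is the first point at level t; [a'] is the last point before it that is not above s, found
    as a first hit of the reflected function. *)
Lemma up_crossing (a b s t : R) f : a <= b -> s < t -> {within `[a, b], continuous f} ->
  f a <= s -> t <= f b ->
  exists a' b' : R, [/\ a <= a', a' < b', b' <= b, f a' = s /\ t <= f b' &
    forall y : R, a' < y < b' -> s < f y < t].
Proof.
move=> ab st cf fa fb; have [b' [/andP[ab' b'b] fb' Hb]] := first_hit ab cf fb.
have ab'' : - b' <= - a by rewrite lerN2.
have cf' : {within `[a, b'], continuous f}.
  by apply: continuous_subspaceW cf; apply: subset_itv; rewrite bnd_simp.
have cg : {within `[- b', - a], continuous (fun x => - f (- x))}.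
  by apply: withinN; exact: within_opp.
have fa' : - s <= - f (- - a) by rewrite opprK lerN2.
have [u [/andP[bu ua] fu Hu]] := first_hit ab'' cg fa'.
rewrite lerN2 in fu.
have uB : - u < b'.
  rewrite lt_neqAle -[X in _ && X]lerN2 opprK bu andbT; apply/eqP => uE.
  by move: fu; rewrite uE leNgt (lt_le_trans st fb').
have au : a <= - u by rewrite lerNr.
have low (y : R) : - u < y < b' -> s < f y.
  move=> /andP[uy yb]; have := Hu (- y); rewrite opprK ltrN2; apply.
  by rewrite lerN2 (ltW yb) ltrNl.
exists (- u), b'; split => //.
  split=> //; apply/eqP; rewrite eq_le fu/= leNgt; apply/negP => fus.
  have e0 : 0 < (s - f (- u)) / 2 by rewrite divr_gt0 ?subr_gt0.
  have uI : `[a, b]%classic (- u) by rewrite /= in_itv/= au (le_trans (ltW uB)).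
  have [d d0 Hd] := (continuous_withinP _ _).1 cf _ uI _ e0.
  have du : 0 < (b' + u) / 2 by have := uB; lra.
  have [d' d'0 [dd db _]] := common_radius (divr_gt0 d0 (ltr0n R 2)) du ltr01.
  have yI : `[a, b]%classic (- u + d').
    by rewrite /= in_itv/=; apply/andP; split; lra.
  have yd : `|- u + d' - - u| < d by rewrite addrAC subrr add0r gtr0_norm//; lra.
  have yB : - u < - u + d' < b' by apply/andP; split; lra.
  have := low _ yB; have := Hd _ yI yd; rewrite ler_norml => /andP[_ h2]; lra.
move=> y yI; rewrite low//=; have /andP[uy yb] := yI.
by apply: Hb; rewrite yb andbT (le_trans au)// ltW.
Qed.

Lemma down_crossing (a b s t : R) f : a <= b -> s < t -> {within `[a, b], continuous f} ->
  t <= f a -> f b <= s ->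
  exists a' b' : R, [/\ a <= a', a' < b', b' <= b, t <= f a' /\ f b' = s &
    forall y : R, a' < y < b' -> s < f y < t].
Proof.
move=> ab st cf fa fb.
have [a' [b' [h1 h2 h3 [h4 h5] h6]]] : exists a' b' : R, [/\ - b <= a', a' < b', b' <= - a,
    f (- a') = s /\ t <= f (- b') & forall y : R, a' < y < b' -> s < f (- y) < t].
  apply: (@up_crossing (- b) (- a) s t (fun x => f (- x))); rewrite ?lerN2 ?opprK//.
  exact: within_opp.
exists (- b'), (- a'); split => //; [by rewrite lerNr|by rewrite ltrN2|by rewrite lerNl|].
by move=> y /andP[y1 y2]; rewrite -[y]opprK; apply: h6; rewrite ltrNr y2 ltrNl.
Qed.

End Crossing.

(** * One-sided growth estimates and decay of the flux *)

Section FluxAtZero.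
Context {R : realType}.
Local Notation A := (`]0%R, 1%R]%classic : set R).
Variables (D v g h dh phi : R -> R) (e c alpha B : R).
Hypotheses (dp : damage_problem D v g h dh phi e c alpha)
  (cg : {within A, continuous g})
  (dv : forall x, 0 < x <= 1 -> derives_oc v x (g x))
  (phi_bound : forall x : R, 0 < x <= 1 -> `|phi (v x)| <= B)
  (i_dh : intg 0 1 (fun x => x ^+ 2 * Num.max (dh (D x - v x)) 0))
  (i_pow : intg 0 1 (fun x => `|g x| `^ alpha)).

Let e_gt0 := dp_e_gt0 dp.
Let c_gt0 := dp_c_gt0 dp.
Let alpha_gt1 := dp_alpha_gt1 dp.
Let al0 : 0 < alpha. Proof. by apply: lt_trans alpha_gt1; exact: ltr01. Qed.
Let al10 : 0 < alpha - 1. Proof. by rewrite subr_gt0. Qed.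

Let q := alpha / (alpha - 1).
Let q_gt0 : 0 < q. Proof. by rewrite divr_gt0. Qed.
Let q_alpha : (alpha - 1) * q = alpha. Proof. by rewrite /q mulrC divfK// gt_eqF. Qed.
Let q1_alpha : (alpha - 1) * (q - 1) = 1. Proof. by rewrite mulrBr q_alpha; ring. Qed.
Let q1_gt0 : 0 < q - 1. Proof. by rewrite -(pmulr_rgt0 _ al10) q1_alpha. Qed.
Let B0 : 0 <= B.
Proof. by have := phi_bound (_ : 0 < 1 <= 1); rewrite ltr01 lexx => /(_ isT); exact: le_trans. Qed.

Let P x := x ^+ 2 * Num.max (dh (D x - v x)) 0.
Let f y := y ^+ 2 * signed_pow alpha (g y).
(** x^(2q) is the integrating factor for the term - 2 alpha K / x, since 2 q (alpha - 1) = 2 alpha;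
    what it leaves behind in [dY] is a bounded [phi] term and the elastic one. Moreover |flux|^q =
    x^(2q) |v'|^alpha. *)
Let Y y := y `^ (2 * q) * ((alpha - 1) * (e * `|g y| `^ alpha) - c * phi (v y)).
Let dY y := - 2 * q * c * y `^ (2 * q - 1) * phi (v y) + y `^ (2 * q) * (- dh (D y - v y) * g y).

Let P0 x : 0 <= P x.
Proof. by rewrite /P mulr_ge0 ?sqr_ge0// le_max lexx orbT. Qed.

Let norm_f y : `|f y| = y ^+ 2 * `|g y| `^ (alpha - 1).
Proof. by rewrite /f normrM norm_signed_pow// ger0_norm ?sqr_ge0. Qed.

Let sqr_powR (y s : R) : 0 < y -> (y ^+ 2) `^ s = y `^ (2 * s).
Proof. by move=> y0; rewrite -powR_mulrn ?(ltW y0)// -powRrM. Qed.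

Let norm_f_q y : 0 < y -> `|f y| `^ q = y `^ (2 * q) * `|g y| `^ alpha.
Proof.
by move=> y0; rewrite norm_f powRM ?sqr_ge0 ?powR_ge0// -powRrM q_alpha sqr_powR.
Qed.

Let YE y : 0 < y -> Y y = (alpha - 1) * e * `|f y| `^ q - y `^ (2 * q) * (c * phi (v y)).
Proof. by move=> y0; rewrite norm_f_q// /Y; ring. Qed.

Let powR_split (y s : R) : 0 < y -> y `^ s = y * y `^ (s - 1).
Proof.
move=> y0; rewrite -{2}[y](powRr1 (ltW y0)) -powRD ?(addrC 1) ?subrK//.
by apply/implyP => _; rewrite gt_eqF.
Qed.

Let Y_derive (y : R) : 0 < y < 1 -> is_derive y 1 Y (dY y).
Proof.
move=> /[dup] y01 /andP[y0 y1].
have d1 := is_derive_mul (is_derive1_powR (2 * q) y0) (energy_excess_derive dp cg dv y01).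
apply: (is_derive_eq d1 _).
rewrite /dY (powR_split (2 * q) y0); set Z := y `^ _; set G := `|g y| `^ alpha.
have an : alpha - 1 != 0 by rewrite gt_eqF.
by rewrite /q; field; rewrite an gt_eqF.
Qed.

Let powR_le1 (y s : R) : 0 < y <= 1 -> 0 <= s -> y `^ s <= 1.
Proof.
move=> /andP[y0 y1] s0; have -> : 1 = 1 `^ s :> R by rewrite powR1.
by apply: ge0_ler_powR; rewrite ?nnegrE// ltW.
Qed.

Let q2 : 0 <= 2 * q - 1. Proof. by have := q1_gt0; lra. Qed.

(** Multiplied by the sign of [g], the elastic term is - h' x^(2q) |g|, so only the positive part of
    h' can be harmful, and h' -> -oo at small determinants has the favourable sign. The identity
    x^(2q) |g| = x^2 |flux|^(q - 1) brings in the integrable weight. *)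
Let dY_bound (y del : R) : 0 < y <= 1 -> `|f y| <= del ->
  Num.sg (g y) * dY y >= - (2 * q * c * B + P y * del `^ (q - 1)).
Proof.
move=> /[dup] y01 /andP[y0 y1] fd.
have t1 : - 2 * q * c * y `^ (2 * q - 1) * phi (v y) * Num.sg (g y) >= - (2 * q * c * B).
  rewrite lerNl; apply: le_trans (ler_norm _) _.
  rewrite normrN 2!normrM; have -> : `|- 2 * q * c * y `^ (2 * q - 1)| = 2 * q * c * y `^ (2 * q - 1).
    rewrite (_ : - 2 * q * c * _ = - (2 * q * c * y `^ (2 * q - 1))); last by ring.
    by rewrite normrN gtr0_norm// (mulr_gt0 (mulr_gt0 (mulr_gt0 (ltr0n R 2) q_gt0) c_gt0))// powR_gt0.
  have h1 : y `^ (2 * q - 1) * `|phi (v y)| * `|Num.sg (g y)| <= B.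
    rewrite -[leRHS]mulr1; apply: ler_pM => //; [by rewrite mulr_ge0 ?powR_ge0| |].
      by rewrite -[leRHS]mul1r; apply: ler_pM; rewrite ?powR_ge0 ?powR_le1// phi_bound.
    by rewrite normr_sg lern1 leq_b1.
  have qc0 := mulr_gt0 (mulr_gt0 (ltr0n R 2) q_gt0) c_gt0.
  by apply: le_trans (_ : 2 * q * c * (y `^ (2 * q - 1) * `|phi (v y)| * `|Num.sg (g y)|) <= _); [rewrite !mulrA|rewrite ler_pM2l].
have fq : y ^+ 2 * `|f y| `^ (q - 1) = y `^ (2 * q) * `|g y|.
  rewrite norm_f powRM ?sqr_ge0 ?powR_ge0// -powRrM q1_alpha powRr1//.
  rewrite sqr_powR// mulrA -{1}powR_mulrn ?(ltW y0)// -powRD.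
    by congr (_ `^ _ * _); ring.
  by apply/implyP => _; rewrite gt_eqF.
have t2 : P y * del `^ (q - 1) >= dh (D y - v y) * (y `^ (2 * q) * `|g y|).
  rewrite -fq /P mulrCA -[leRHS]mulrA; apply: ler_wpM2l; first exact: sqr_ge0.
  apply: (@le_trans _ _ (Num.max (dh (D y - v y)) 0 * `|f y| `^ (q - 1))).
    by apply: ler_wpM2r; rewrite ?powR_ge0// le_max lexx.
  apply: ler_wpM2l; first by rewrite le_max lexx orbT.
  by apply: ge0_ler_powR; rewrite ?nnegrE ?(ltW q1_gt0)// (le_trans _ fd).
have gE : g y * Num.sg (g y) = `|g y| by rewrite normrEsg mulrC.
rewrite /dY mulrDr opprD; apply: lerD; first by rewrite [leRHS]mulrC.
rewrite (_ : Num.sg (g y) * _ = - (dh (D y - v y) * (y `^ (2 * q) * (g y * Num.sg (g y))))); last by ring.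
by rewrite gE lerN2.
Qed.

Let cY' : {within A, continuous dY}.
Proof.
have cpw (s : R) : {within A, continuous (fun y => y `^ s)}.
  apply/continuous_withinP => y /=; rewrite in_itv/= => /andP[y0 _] eps eps0.
  have [d d0 Hd] := (continuous_forP _ _).1 (is_derive_cont (is_derive1_powR s y0)) _ eps0.
  by exists d => // z _; exact: Hd.
apply: withinD; apply: withinM.
- by apply: withinM; [exact: within_cst|exact: cpw].
- exact: dp_phi_v dp.
- exact: cpw.
- apply: withinM => //; apply: withinN.
  apply: (@within_comp _ _ dh (fun y => D y - v y)); first exact: dp_gap_cont dp.
  by move=> x /oc_itv/(dp_gap_gt0 dp)/(dp_dh_cont dp).
Qed.

(** Integration of the one-sided bound over an interval on which the flux keeps its sign; [Y]
    differs from (alpha - 1) e |flux|^q by at most c B x. *)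
Let power_drop (a b del sg : R) : 0 < a -> a < b -> b < 1 ->
  (forall y : R, a < y < b -> Num.sg (g y) = sg /\ `|f y| <= del) -> `|sg| = 1 ->
  (alpha - 1) * e * (sg * (`|f a| `^ q - `|f b| `^ q)) <=
  c * B * (a + b) + (2 * q * c * B * (b - a) + del `^ (q - 1) * itg a b P).
Proof.
move=> a0 ab b1 H sg1; have b0 := lt_trans a0 ab.
have in01 y : a <= y <= b -> 0 < y < 1.
  by move=> /andP[ay yb]; rewrite (lt_le_trans a0 ay) (le_lt_trans yb).
have pY : primitive_on a b Y dY.
  apply: primitive_C1 (ltW ab) _ _ => y /in01 y01; first exact: Y_derive.
  exact: within_oc_at y01 cY'.
have idY : intg a b dY by case: pY.
have iP : intg a b P by apply: intgS i_dh; exact: ltW.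
have iB : intg a b (fun y => - (2 * q * c * B + del `^ (q - 1) * P y)).
  by apply: intgN; apply: intgD; [exact: intg_cst|exact: intgZ].
have drop : - (2 * q * c * B * (b - a) + del `^ (q - 1) * itg a b P) <= sg * (Y b - Y a).
  rewrite (primitive_sub pY (lexx a) (ltW ab) (lexx b)) -itgZ// -itgZ//.
  rewrite -itg_cst ?(ltW ab)// -itgD; [|exact: intg_cst|exact: intgZ].
  rewrite -itgN; last by apply: intgD; [exact: intg_cst|exact: intgZ].
  apply: le_itg_oo; [exact: iB|exact: intgZ|].
  move=> y yI; have [yg yd] := H y yI; have /andP[ay yb] := yI.
  have y01 : 0 < y <= 1 by rewrite (lt_trans a0 ay) ltW// (lt_trans yb).
  by have := dY_bound y01 yd; rewrite yg [P y * _]mulrC.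
have tail y : 0 < y < 1 -> `|y `^ (2 * q) * (c * phi (v y))| <= c * B * y.
  move=> /andP[y0 y1]; have y01 : 0 < y <= 1 by rewrite y0 ltW.
  rewrite normrM [`|c * _|]normrM (gtr0_norm c_gt0) gtr0_norm ?powR_gt0// mulrC.
  apply: ler_pM; [by rewrite mulr_ge0// ltW|exact: powR_ge0| |].
    by rewrite ler_pM2l// phi_bound.
  by rewrite (powR_split _ y0) -[leRHS]mulr1 ler_pM2l// powR_le1.
have ta : `|a `^ (2 * q) * (c * phi (v a))| <= c * B * a by apply: tail; rewrite a0 (lt_trans ab).
have tb : `|b `^ (2 * q) * (c * phi (v b))| <= c * B * b by apply: tail; rewrite b0.
rewrite !YE// in drop.
have sgle (x : R) : sg * x <= `|x| by rewrite -[leRHS]mul1r -sg1 -normrM ler_norm.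
have s1 := le_trans (sgle _) (le_trans (ler_normB (a `^ (2 * q) * (c * phi (v a))) (b `^ (2 * q) * (c * phi (v b)))) (lerD ta tb)).
have arith (k s FA FB TA TB X C1 : R) : - X <= s * (k * FB - TB - (k * FA - TA)) ->
    s * (TA - TB) <= C1 -> k * (s * (FA - FB)) <= C1 + X.
  move=> h1 h2; have -> : k * (s * (FA - FB)) = s * (TA - TB) - s * (k * FB - TB - (k * FA - TA)) by ring.
  by lra.
by rewrite [c * B * (a + b)]mulrDr; exact: arith drop s1.
Qed.

(* If [|flux|] exceeds [del] at [x], it crosses from [del / 2] to [del] within a factor 2 of [x], to the left
   if the flux is negative and to the right if it is positive; [power_drop] bounds the jump. *)
Lemma flux_small (del : R) : 0 < del -> exists2 rho : R, 0 < rho &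
  forall x : R, 0 < x < rho -> `|x ^+ 2 * signed_pow alpha (g x)| <= del.
Proof.
have quarter (y z : R) : y < 1 / 4 -> z <= 2 * y -> z < 1 by move=> *; lra.
have half_lt (y m d : R) : 0 < d -> y < m -> m <= d / 2 -> y < d by move=> *; lra.
have twice (a b m : R) : 0 < a -> b < 2 * m -> a < b -> a + b <= 4 * m /\ b - a <= 2 * m.
  by move=> *; split; lra.
have arith (X Z cB Q dq J k m : R) : X <= cB * (4 * m) -> Z <= 2 * Q * (2 * m) -> J * (2 * dq) < k ->
    0 < m -> m * (2 * (4 * cB + 4 * Q + 1)) <= k -> X + (Z + dq * J) < k.
  by move=> *; lra.
have gap_lt (a b m d : R) : 0 < a -> b < 2 * m -> m <= d / 2 -> b - a < d by move=> *; lra.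
move=> del0; have del20 : 0 < del / 2 by rewrite divr_gt0.
have del2 : del / 2 < del by lra.
pose kap := (alpha - 1) * e * (del `^ q - (del / 2) `^ q).
have pq : (del / 2) `^ q < del `^ q by apply: gt0_ltr_powR; rewrite ?nnegrE ?ltW.
have kap0 : 0 < kap by rewrite !mulr_gt0// subr_gt0.
have dq0 : 0 < del `^ (q - 1) by rewrite powR_gt0.
have [d1 d10 H1] := itg_norm_unif ler01 i_dh (divr_gt0 kap0 (mulr_gt0 (ltr0n R 2) dq0)).
have g0 : 0 < (del / 2) `^ q / 2 by rewrite divr_gt0 ?powR_gt0.
have [d2 d20 H2] := itg_norm_unif ler01 i_pow g0.
(* The boundary terms and the integrated [phi] term are at most 4 c B rho and 4 q c B rho; the 1
   makes the final inequality strict. *)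
pose K := 4 * (c * B) + 4 * (q * (c * B)) + 1.
have cB0 : 0 <= c * B by rewrite mulr_ge0// ltW.
have qcB0 : 0 <= q * (c * B) by rewrite mulr_ge0// ltW.
have K0 : 0 < K by rewrite ltr_wpDl// addr_ge0// mulr_ge0.
(* Otherwise z^(2q) |g|^alpha = |flux|^q > (del / 2)^q on [x, 2x], and z^(2q) <= z <= 2x would make
   the integral of |g|^alpha there at least (del / 2)^q / 2, against its absolute continuity. *)
have good x : 0 < x -> 2 * x < 1 -> x < d2 -> exists2 z : R, x <= z <= 2 * x & `|f z| <= del / 2.
  move=> x0 x1 xd; apply: contrapT => noz.
  have x2 : x <= 2 * x by lra.
  have ix : intg x (2 * x) (fun z => `|g z| `^ alpha) by apply: intgS i_pow; exact: ltW.
  have := H2 x (2 * x) (ltW x0) x2 (ltW x1).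
  have -> : 2 * x - x = x by ring.
  move=> /(_ xd); apply/negP; rewrite -leNgt.
  have -> : (del / 2) `^ q / 2 = itg x (2 * x) (fun=> (del / 2) `^ q / (2 * x)).
    by rewrite itg_cst//; field; rewrite gt_eqF.
  apply: le_itg; [exact: intg_cst|exact: intg_norm|].
  move=> z /andP[xz zx]; have z0 := lt_le_trans x0 xz.
  have fz : del / 2 <= `|f z|.
    by rewrite leNgt; apply/negP => fz; apply: noz; exists z; [rewrite xz|exact: ltW].
  rewrite ler_pdivrMr ?mulr_gt0// ger0_norm ?powR_ge0//.
  apply: (@le_trans _ _ (`|f z| `^ q)).
    by apply: ge0_ler_powR; rewrite ?nnegrE ?(ltW q_gt0) ?(ltW del20).
  rewrite norm_f_q// mulrC ler_wpM2l ?powR_ge0// (le_trans _ zx)//.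
  rewrite (powR_split _ z0) -[leRHS]mulr1 ler_pM2l// powR_le1//.
  by rewrite z0 (le_trans zx)// ltW.
have [rho rho0 [r1 r2 r3]] := common_radius (divr_gt0 d10 (ltr0n R 2)) (divr_gt0 d20 (ltr0n R 2))
  (divr_gt0 kap0 (mulr_gt0 (ltr0n R 2) K0)).
rewrite ler_pdivlMr ?mulr_gt0// in r3.
(* Close to the origin the q-th power cannot change, in the direction fixed by the sign, by as much
   as a crossing between del / 2 and del requires. *)
have no_drop (a b sg : R) : 0 < a -> a < b -> b < 1 -> b < 2 * rho ->
    (forall y : R, a < y < b -> Num.sg (g y) = sg /\ `|f y| <= del) -> `|sg| = 1 ->
    sg * (`|f a| `^ q - `|f b| `^ q) < del `^ q - (del / 2) `^ q.
  move=> a0 ab b1 br H sg1.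
  rewrite -(ltr_pM2l (mulr_gt0 al10 e_gt0)) -/kap; apply: le_lt_trans (power_drop a0 ab b1 H sg1) _.
  have [ab4 ab2] := twice a b rho a0 br ab; have bad := gap_lt a b rho d1 a0 br r1.
  have := H1 a b (ltW a0) (ltW ab) (ltW b1) bad.
  rewrite (@eq_itg _ _ _ _ P); last by move=> y _; rewrite ger0_norm// P0.
  rewrite ltr_pdivlMr ?mulr_gt0//; set I := itg a b P => hI.
  have h1 : c * B * (a + b) <= c * B * (4 * rho) by rewrite ler_wpM2l.
  have qcBE : 2 * q * c * B = 2 * (q * (c * B)) by rewrite !mulrA.
  have qcB2 : 0 <= 2 * q * c * B by rewrite qcBE; apply: mulr_ge0.
  have h2 : 2 * q * c * B * (b - a) <= 2 * q * c * B * (2 * rho) by rewrite ler_wpM2l.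
  apply: (arith _ _ (c * B) (q * (c * B)) _ _ _ rho) => //.
  by apply: le_trans h2 _; rewrite !mulrA.
have [rh rh0 [rr1 rr2 rr3]] := common_radius rho0 (divr_gt0 (@ltr01 R) (ltr0n R 4)) ltr01.
exists rh => // x /andP[x0 xr]; rewrite -/(f x) leNgt; apply/negP => fx.
have cf (a b : R) : 0 < a -> b <= 1 -> {within `[a, b], continuous f}.
  move=> a0 b1; apply: within_oc_itv => //; apply: withinM; first by apply: withinX; exact: within_id.
  by apply: (@within_comp _ _ (signed_pow alpha) g) => // z _; exact: signed_pow_continuous.
have pos_sg y : 0 < f y -> Num.sg (g y) = 1.
  move=> fy; apply: gtr0_sg; rewrite ltNge; apply/negP => gy; move: fy; apply/negP; rewrite -leNgt /f.
  by rewrite mulr_ge0_le0 ?sqr_ge0// /signed_pow mulr_ge0_le0 ?powR_ge0// sgr_le0.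
have neg_sg y : f y < 0 -> Num.sg (g y) = -1.
  move=> fy; apply: ltr0_sg; rewrite ltNge; apply/negP => gy; move: fy; apply/negP; rewrite -leNgt /f.
  by rewrite mulr_ge0 ?sqr_ge0// /signed_pow mulr_ge0 ?powR_ge0// sgr_ge0.
have xr2 : x < rho by exact: lt_le_trans xr rr1.
have x4 : x < 1 / 4 by exact: lt_le_trans xr rr2.
have contra (s t : R) : `|s| = del / 2 -> del <= `|t| -> ~ (`|t| `^ q - `|s| `^ q < del `^ q - (del / 2) `^ q).
  move=> -> tdel; apply/negP; rewrite -leNgt lerD2r.
  by apply: ge0_ler_powR; rewrite ?nnegrE ?(ltW q_gt0) ?(ltW del0).
have [fx0|fx0] := lerP 0 (f x).
  rewrite ger0_norm// in fx.
  have [||z /andP[xz zx] fz] := good x x0; [exact: quarter x4 (lexx _)|exact: half_lt r2|].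
  have zb : z <= 1 by exact/ltW/(quarter x).
  have fz' : f z <= del / 2 by apply: le_trans (ler_norm _) fz.
  have [a [b [xa ab bz [fa fb] I]]] := down_crossing xz del2 (cf x z x0 zb) (ltW fx) fz'.
  have a0 := lt_le_trans x0 xa; have b1 := le_lt_trans bz (quarter x z x4 zx).
  have br : b < 2 * rho by rewrite (le_lt_trans bz)// (le_lt_trans zx)// ltr_pM2l.
  have sg y : a < y < b -> Num.sg (g y) = 1 /\ `|f y| <= del.
    move=> /I/andP[y1 y2]; have y0 := lt_trans del20 y1.
    by rewrite pos_sg// gtr0_norm// ltW.
  have := no_drop a b 1 a0 ab b1 br sg (normr1 _); rewrite mul1r; apply: contra.
    by rewrite fb gtr0_norm.
  by rewrite (le_trans fa)// ler_norm.
rewrite ltr0_norm// in fx.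
have xh0 : 0 < x / 2 by rewrite divr_gt0.
have xE : 2 * (x / 2) = x by rewrite mulrC divfK.
have x1 : x < 1 by apply: quarter x4 _; rewrite ler_peMl ?ler1n// ltW.
have xd2 : x / 2 < d2 by apply: half_lt r2 => //; apply: le_lt_trans xr2; rewrite ler_pdivrMr// ler_peMr ?ler1n// ltW.
have [||z /andP[xz zx'] fz] := good (x / 2) xh0; [by rewrite xE|exact: xd2|].
rewrite xE in zx'.
have z0 : 0 < z by exact: lt_le_trans xh0 xz.
have fz' : - f z <= del / 2 by rewrite (le_trans _ fz)// -normrN ler_norm.
have cf' : {within `[z, x], continuous (fun y => - f y)} by apply: withinN; apply: cf => //; exact: ltW.
have [a [b [za ab bx [fa fb] I]]] := up_crossing zx' del2 cf' fz' (ltW fx).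
have a0 := lt_le_trans z0 za; have b1 := le_lt_trans bx x1.
have br : b < 2 * rho by rewrite (le_lt_trans bx)// (lt_trans xr2)// ltr_pMl// ltr1n.
have sg y : a < y < b -> Num.sg (g y) = -1 /\ `|f y| <= del.
  move=> /I/andP[y1 y2]; have y0 : f y < 0 by rewrite -oppr_gt0 (lt_trans del20).
  by rewrite neg_sg// ltr0_norm// ltW.
have sgn1 : `|-1 : R| = 1 by rewrite normrN normr1.
have := no_drop a b (-1) a0 ab b1 br sg sgn1; rewrite mulN1r opprB; apply: contra.
  by rewrite -normrN fa gtr0_norm.
by rewrite (le_trans fb)// -normrN ler_norm.
Qed.

End FluxAtZero.

(** * Minimizers *)

Section Minimizer.
Context {R : realType}.
Local Notation mu := (@lebesgue_measure R).
Local Notation A := (`]0%R, 1%R]%classic : set R).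

Lemma intg_ae_oo (a b : R) (f g : R -> R) : intg a b f -> measurable_fun `]a, b[ g ->
  {ae mu, forall x : R, a < x < b -> f x = g x} -> intg a b g.
Proof. by move=> iff mg fg; have [] := primitive_ae (primitive_of_itg 0 iff) mg fg. Qed.

Lemma within_oc_measurable (f : R -> R) : {within A, continuous f} -> measurable_fun (`]0, 1[%classic : set R) f.
Proof.
move=> cf; apply: (@measurable_funS _ _ _ _ A) => //.
  by apply: subset_itv; rewrite bnd_simp.
by apply: subspace_continuous_measurable_fun => //; exact: measurable_itv.
Qed.

Section Partial.
Variables (psi dpsi h dh : R -> R).
Hypotheses (psi_der : forall x : R, 0 < x -> is_derive x 1 psi (dpsi x))
  (h_der : forall x : R, 0 < x -> is_derive x 1 h (dh x)).

Lemma partial1_Phi_hat (v1 v2 v3 v4 : R) : 0 < v1 -> 0 < v1 * v2 * v3 - v4 ->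
  partial1 (Phi_hat psi h) v1 v2 v3 v4 = dpsi v1 + dh (v1 * v2 * v3 - v4) * (v2 * v3).
Proof.
move=> v10 d0; rewrite /partial1 derive1E; apply: derive_val.
have E : - v4 + v2 * v3 * v1 = v1 * v2 * v3 - v4 by ring.
have dh' : is_derive (- v4 + v2 * v3 * v1) 1 h (dh (v1 * v2 * v3 - v4)) by rewrite E; exact: h_der.
have d1 := is_derive_compose (is_derive_affine (- v4) (v2 * v3) v1) dh'.
have d2 := is_derive_add (is_derive_add (psi_der v10) (is_derive_affine (psi v2 + psi v3) 0 v1)) d1.
apply: (@is_derive_near _ _ _ v1 _ 1 ltr01 _ (is_derive_eq d2 _)); last by rewrite addr0.
move=> y _; rewrite /Phi_hat mul0r addr0 -!addrA; congr (_ + (_ + (_ + h _))); ring.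
Qed.

Lemma partial2_Phi_hat (v1 v2 v3 v4 : R) : 0 < v2 -> 0 < v1 * v2 * v3 - v4 ->
  partial2 (Phi_hat psi h) v1 v2 v3 v4 = dpsi v2 + dh (v1 * v2 * v3 - v4) * (v1 * v3).
Proof.
move=> v20 d0; rewrite /partial2 derive1E; apply: derive_val.
have E : - v4 + v1 * v3 * v2 = v1 * v2 * v3 - v4 by ring.
have dh' : is_derive (- v4 + v1 * v3 * v2) 1 h (dh (v1 * v2 * v3 - v4)) by rewrite E; exact: h_der.
have d1 := is_derive_compose (is_derive_affine (- v4) (v1 * v3) v2) dh'.
have d2 := is_derive_add (is_derive_add (psi_der v20) (is_derive_affine (psi v1 + psi v3) 0 v2)) d1.
apply: (@is_derive_near _ _ _ v2 _ 1 ltr01 _ (is_derive_eq d2 _)); last by rewrite addr0.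
move=> y _; rewrite /Phi_hat mul0r addr0 (addrC (psi v1)) -!addrA; congr (_ + (_ + (_ + h _))); ring.
Qed.

Lemma partial4_Phi_hat (v1 v2 v3 v4 : R) : 0 < v1 * v2 * v3 - v4 ->
  partial4 (Phi_hat psi h) v1 v2 v3 v4 = - dh (v1 * v2 * v3 - v4).
Proof.
move=> d0; rewrite /partial4 derive1E; apply: derive_val.
have E : v1 * v2 * v3 + - 1 * v4 = v1 * v2 * v3 - v4 by rewrite mulN1r.
have dh' : is_derive (v1 * v2 * v3 + - 1 * v4) 1 h (dh (v1 * v2 * v3 - v4)) by rewrite E; exact: h_der.
have d1 := is_derive_compose (is_derive_affine (v1 * v2 * v3) (- 1) v4) dh'.
have d2 := is_derive_add (is_derive_affine (psi v1 + psi v2 + psi v3) 0 v4) d1.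
apply: (@is_derive_near _ _ _ v4 _ 1 ltr01 _ (is_derive_eq d2 _)); last by rewrite add0r mulrN1.
by move=> y _; rewrite /Phi_hat mul0r addr0 mulN1r.
Qed.

End Partial.

Variables (psi dpsi h dh phi : R -> R) (lambda eps alpha q d0 gamma C K gamma0 : R) (r v : R -> R).
Hypotheses (lambda_gt0 : 0 < lambda) (eps_gt0 : 0 < eps) (alpha_gt1 : 1 < alpha) (q_gt0 : 0 < q)
  (phi_cont : continuous phi)
  (psi_der : forall x : R, 0 < x -> is_derive x 1 psi (dpsi x))
  (dpsi_cont : forall x : R, 0 < x -> {for x, continuous dpsi})
  (psi_convex : convex_pos psi)
  (psi_ge0 : forall x : R, 0 < x -> 0 <= psi x)
  (h_der : forall x : R, 0 < x -> is_derive x 1 h (dh x))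
  (dh_cont : forall x : R, 0 < x -> {for x, continuous dh})
  (h_strict : strictly_convex_on `]0, +oo[ h)
  (h_0 : h d @[d --> 0^'+] --> +oo) (h_oo : h d / d @[d --> +oo] --> +oo)
  (h_min : forall x : R, 0 < x -> h d0 <= h x)
  (C_gt0 : 0 < C) (gamma_ge0 : 0 <= gamma)
  (h_growth : h d / (C * d `^ gamma) @[d --> +oo] --> (1 : R))
  (K_gt0 : 0 < K) (gamma0_gt0 : 0 < gamma0)
  (psi_bound : forall s k : R, 0 < s -> `|k - 1| <= gamma0 -> `|s * dpsi (k * s)| <= K * psi s)
  (rv_min : minimizer psi h phi lambda eps alpha q r v).

Let e := eps `^ alpha / alpha.
Let c := (q * eps `^ q)^-1.
Let D (sg : R -> R) x := sg x * (r x / x) ^+ 2.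

Lemma minimizer_boundary : [/\ r 0 = 0, r 1 = lambda & v 1 = 0].
Proof. by have [dr [dv [[_ _ [r0 r1] _ v1] _]]] := rv_min. Qed.

(** The two variations are decoupled: with [v] fixed the radius minimises the elastic part, which
    provides [sg]; with the radius fixed, now with the continuous stretch [sg], the damage solves a
    [damage_problem]. The last three facts are what the analysis at the origin consumes. *)
Lemma minimizer_regularity : exists sg g : R -> R, exists m : R,
  [/\ {within A, continuous sg}, forall x : R, 0 < x <= 1 -> 0 < r x,
      forall x : R, 0 < x <= 1 -> admissible r sg v x,
      forall a : R, 0 < a < 1 -> primitive_on a 1 r sg &
      forall x : R, 0 < x <= 1 ->
        x ^+ 2 * dpsi (sg x) / r x ^+ 2 + dh (sg x * (r x / x) ^+ 2 - v x) =
        m - itg x 1 (fun x => - 2 * x ^+ 2 * sg x * dpsi (sg x) / r x ^+ 3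
                              + 2 * x * dpsi (r x / x) / r x ^+ 2)] /\
  [/\ {within A, continuous g}, forall x : R, 0 < x <= 1 -> derives_oc v x (g x) &
      damage_problem (D sg) v g h dh phi e c alpha] /\
  [/\ {within `[0, 1], continuous v},
      intg 0 1 (fun x => x ^+ 2 * Num.max (dh (D sg x - v x)) 0) &
      intg 0 1 (fun x => `|g x| `^ alpha)].
Proof.
have [r0 r1 v1] := minimizer_boundary.
have h_cont x : 0 < x -> {for x, continuous h} by move=> /h_der/is_derive_cont.
have psi_cont x : 0 < x -> {for x, continuous psi} by move=> /psi_der/is_derive_cont.
have h_convex := strictly_convex_onW h_strict.
have [dr [dv [[pr pv r_gt0] [adm ipow iA vmin]]]] :=
  local_minimality lambda_gt0 alpha_gt1 phi_cont h_cont psi_cont psi_ge0 h_min rv_min.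
have [e_gt0 c_gt0] := coef_gt0 eps_gt0 alpha_gt1 q_gt0.
rewrite -/e -/c in vmin e_gt0 c_gt0.
have r_min (a : R) (s ds : R -> R) : 0 < a < 1 -> primitive_on a 1 s ds -> s a = r a -> s 1 = r 1 ->
    intg a 1 (elastic psi h s ds v) -> (forall x : R, a <= x <= 1 -> admissible s ds v x) ->
    itg a 1 (elastic psi h r dr v) <= itg a 1 (elastic psi h s ds v).
  move=> /[dup] a01 /andP[/ltW a0 a1] ps sa s1 ie sadm; rewrite r1 in s1.
  have := vmin a s ds v dv a01 ps (primitiveS a0 (lexx 1) pv) sa s1 erefl v1
    (intgS a0 (lexx 1) ipow) ie sadm.
  by rewrite lerD2r.
have [sg [m [csg asg psg drsg eqn]]] := stretch_regularity psi_der dpsi_cont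
  (convex_derive_le psi_convex psi_der) psi_ge0 h_der dh_cont (strictly_convex_derive_lt h_strict h_der)
  (derive_to_Ny h_convex h_der h_0) (derive_to_y h_convex h_der h_oo) h_min K_gt0 gamma0_gt0
  psi_bound pr pv r_gt0 adm iA r_min.
have cv := primitive_continuous ler01 pv.
have cvA : {within A, continuous v}.
  by apply: oc_within => a /andP[/ltW a0 _]; apply: continuous_subspaceW cv; apply: subset_itvr; rewrite bnd_simp.
have crA : {within A, continuous r} := within_radius psg.
have cq : {within A, continuous (fun x => r x / x)}.
  apply: withinM => //; apply: withinV; first exact: within_id.
  by move=> x /oc_itv/andP[x0 _]; rewrite gt_eqF.
have q0 x : 0 < x <= 1 -> 0 < r x / x.
  by move=> /[dup] x01 /andP[x0 _]; rewrite divr_gt0// r_gt0.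
have cD : {within A, continuous (D sg)} by apply: withinM => //; exact: withinX.
have sg0 x : 0 < x <= 1 -> 0 < sg x.
  by move=> /[dup] x01 /andP[x0 _]; exact: admissible_stretch x0 (asg x x01).
have gap0 x : 0 < x <= 1 -> 0 < D sg x - v x.
  by move=> /asg/andP[_]; rewrite subr_gt0.
have cx2 : {within A, continuous (fun x : R => x ^+ 2)} by apply: withinX; exact: within_id.
pose pp x := x ^+ 2 * (psi (sg x) + 2 * psi (r x / x)).
have cpp : {within A, continuous pp}.
  apply: withinM => //; apply: withinD.
    by apply: (@within_comp _ _ psi sg) => // x /oc_itv/sg0/psi_cont.
  apply: withinM; first exact: within_cst.
  by apply: (@within_comp _ _ psi (fun x => r x / x)) => // x /oc_itv/q0/psi_cont.
have cE : {within A, continuous (elastic psi h r sg v)}.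
  apply: (@eq_within _ _ (fun x => pp x + x ^+ 2 * h (D sg x - v x))).
    by move=> x _; rewrite /pp /elastic /D; ring.
  apply: withinD => //; apply: withinM => //.
  apply: (@within_comp _ _ h (fun x => D sg x - v x)); first exact: withinB.
  by move=> x /oc_itv/gap0/h_cont.
have Eae : {ae mu, forall x : R, 0 < x < 1 -> elastic psi h r dr v x = elastic psi h r sg v x}.
  by apply: ae_imp drsg => x Hx x01; rewrite /elastic Hx.
have iE : intg 0 1 (elastic psi h r sg v) := intg_ae_oo iA (within_oc_measurable cE) Eae.
have dp : damage_problem (D sg) v dv h dh phi e c alpha.
  split; [exact: e_gt0|exact: c_gt0|exact: alpha_gt1|exact: phi_cont|exact: h_der|exact: dh_cont|exact: cD| |exact: asg| |].
  - by move=> a /andP[/ltW a0 _]; exact: primitiveS pv.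
  - by move=> a /andP[/ltW a0 _]; exact: intgS ipow.
  move=> a w dw a01 pw wa w1 iw wadm; have [a0 a1] := andP a01.
  have cw := primitive_continuous (ltW a1) pw.
  have inA x : a <= x <= 1 -> 0 < x <= 1 by move=> /andP[ax ->]; rewrite (lt_le_trans a0).
  have onI (f : R -> R) : {within A, continuous f} -> {within `[a, 1], continuous f}.
    by move=> cf; exact: within_oc_itv.
  (* The Lagrangian of the damage problem is the full density minus the [psi] terms [pp], which are
     common to both sides of the comparison. *)
  have part (u du : R -> R) : {within `[a, 1], continuous u} -> intg a 1 (fun x => `|du x| `^ alpha) ->
      (forall x : R, a <= x <= 1 -> 0 <= u x < D sg x) ->
      intg a 1 (elastic psi h r sg u) /\ itg a 1 (lagrangian (D sg) h phi e c alpha u du) =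
      itg a 1 (elastic psi h r sg u) + itg a 1 (damage phi e c alpha u du) - itg a 1 pp.
    move=> cu iu uD.
    have ie : intg a 1 (elastic psi h r sg u).
      apply: intg_cont; apply: (@eq_within _ _ (fun x => pp x + x ^+ 2 * h (D sg x - u x))).
        by move=> x _; rewrite /pp /elastic /D; ring.
      apply: withinD; first exact: onI.
      apply: withinM; first exact: onI.
      apply: (@within_comp _ _ h (fun x => D sg x - u x)); first by apply: withinB => //; exact: onI.
      by move=> x /=; rewrite in_itv/= => /uD/andP[_ ux]; apply: h_cont; rewrite subr_gt0.
    have id' : intg a 1 (damage phi e c alpha u du).
      apply: (@eq_intg _ _ _ (fun x => (e * `|du x| `^ alpha + c * phi (u x)) * x ^+ 2)).
        by move=> x _; rewrite /damage mulrC.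
      apply: intg_mul_cont; [exact: ltW| |exact: onI].
      apply: intgD; apply: intgZ => //; apply: intg_cont.
      by apply: (@within_comp _ _ phi u) => // x _; exact: phi_cont.
    split => //; rewrite -itgD// -itgB//; last by apply: intg_cont; exact: onI.
      by apply: eq_itg => x _; rewrite /lagrangian /elastic /damage /pp /D; ring.
    exact: intgD.
  have [_ ->] := part v dv (onI v cvA) (intgS (ltW a0) (lexx 1) ipow)
    (fun x xI => asg x (inA x xI)).
  have [iw' ->] := part w dw cw iw wadm.
  rewrite lerD2r.
  have <- : itg a 1 (elastic psi h r dr v) = itg a 1 (elastic psi h r sg v).
    have iEa := intgS (ltW a0) (lexx 1) iA.
    have mE : measurable_fun `]a, 1[ (elastic psi h r sg v).
      by apply: within_measurable_oo; exact: onI.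
    have Eae' : {ae mu, forall x : R, a < x < 1 -> elastic psi h r dr v x = elastic psi h r sg v x}.
      by apply: ae_imp Eae => x Hx /andP[ax x1]; rewrite Hx// (lt_trans a0).
    have p1 := primitive_ae (primitive_of_itg 0 iEa) mE Eae'.
    have p2 := primitive_sub p1 (lexx a) (ltW a1) (lexx 1).
    by rewrite -p2 itg1; ring.
  by apply: vmin => //; [exact: psg|rewrite w1].
have [g [[cg dvg dpg] vg]] := damage_C1 dp.
exists sg, g, m; split => //; split => //; split => //.
(* h'(d)^+ <= B (1 + h(d) - h(d0)), so x^2 h'(d)^+ is dominated by the elastic density plus a
   constant. *)
- have [B B0 HB] := growth_derive_bound h_convex h_der C_gt0 gamma_ge0 h_min h_growth.
  apply: (@intg_bound_oo _ _ _ B _ (fun x => elastic psi h r sg v x + (1 + `|h d0|))).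
  + apply: within_oc_measurable; apply: withinM => //.
    apply: (@within_comp _ _ (fun y => Num.max (dh y) 0) (fun x => D sg x - v x)); first exact: withinB.
    move=> x /oc_itv/gap0/dh_cont cdh; apply: continuous_max => //.
    exact: cvg_cst.
  + by apply: intgD => //; exact: intg_cst.
  + move=> x /andP[x0 x1]; have x01 : 0 < x <= 1 by rewrite x0 ltW.
    have x2 : x ^+ 2 <= 1 by rewrite expr_le1// ltW.
    have x20 : 0 <= x ^+ 2 by exact: sqr_ge0.
    have gx := gap0 x x01; have hm := h_min gx.
    rewrite ger0_norm; last by rewrite mulr_ge0// le_max lexx orbT.
    have mx : Num.max (dh (D sg x - v x)) 0 <= B * (1 + (h (D sg x - v x) - h d0)).
      by rewrite ge_max HB//= mulr_ge0// addr_ge0// subr_ge0.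
    apply: le_trans (ler_wpM2l x20 mx) _; rewrite mulrCA ler_wpM2l//.
    have p1 := psi_ge0 (sg0 x x01); have p2 := psi_ge0 (q0 x x01).
    rewrite /elastic -/(D sg x) !mulrDr mulrN.
    have P1 : 0 <= x ^+ 2 * psi (sg x) by rewrite mulr_ge0.
    have P2 : 0 <= x ^+ 2 * (2 * psi (r x / x)) by apply: mulr_ge0 => //; exact: mulr_ge0.
    have P3 : - (x ^+ 2 * h d0) <= `|h d0|.
      apply: le_trans (ler_norm _) _; rewrite normrN normrM ger0_norm//.
      by rewrite -[leRHS]mul1r ler_wpM2r.
    by move: P1 P2 P3 x2; rewrite mulr1; lra.
- apply: (intg_ae_oo ipow).
    apply: within_oc_measurable; apply: (@within_comp _ _ (fun y => `|y| `^ alpha) g) => // x _.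
    by apply: norm_powR_continuous; exact: lt_trans alpha_gt1.
  by apply: ae_imp vg => x Hx /Hx ->.
Qed.

End Minimizer.

(** * Equilibrium equations and boundary conditions for the given minimizer *)

Theorem theorem5p4 (R : realType)
  (lambda eps tau alpha q : R)
  (lambda_gt0 : 0 < lambda) (eps_gt0 : 0 < eps) (tau_gt0 : 0 < tau)
  (alpha_gt1 : 1 < alpha) (alpha_q : alpha^-1 + q^-1 = 1)
  (phi : R -> R)
  (phi_ge0 : forall x : R, 0 <= phi x)
  (phi_cont : continuous phi)
  (phi_derivable : forall x : R, derivable phi x 1)
  (phi_supp : supp phi `<=` `]0, tau[)
  (h : R -> R)
  (h_C2 : Ck_on_open 2 `]0, +oo[ h)
  (h_convex : convex_function (`]0, +oo[%classic : set R) h)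
  (h_0 : h d @[d --> 0^'+] --> +oo)
  (h_oo : h d / d @[d --> +oo] --> +oo)
  (h_strict : strictly_convex_on `]0, +oo[ h)
  (d0 : R) (d0_gt0 : 0 < d0)
  (h_min : forall d : R, 0 < d -> d != d0 -> h d0 < h d)
  (gamma C : R) (gamma_gt1 : 1 < gamma) (C_gt0 : 0 < C)
  (h_growth : h d / (C * d `^ gamma) @[d --> +oo] --> (1 : R))
  (psi : R -> R)
  (psi_ge0 : forall x : R, 0 < x -> 0 <= psi x)
  (psi_convex : convex_function (`]0, +oo[%classic : set R) psi)
  (psi_C3 : Ck_on_open 3 `]0, +oo[ psi)
  (K gamma0 : R) (K_gt0 : 0 < K) (gamma0_gt0 : 0 < gamma0)
  (psi_bound : forall v c : R, 0 < v -> `|c - 1| <= gamma0 ->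
     `|v * derive1 psi (c * v)| <= K * psi v)
  (r v : R -> R)
  (rv_min : minimizer psi h phi lambda eps alpha q r v) :
  let Phi := Phi_hat psi h in
  let dr := deriv_on `]0, 1] r in
  let dv := deriv_on `]0, 1] v in
  let stress := fun x => x ^+ 2 * radial (partial1 Phi) r dr v x in
  let flux := fun x => x ^+ 2 * signed_pow alpha (dv x) in
  (C1_on `]0, 1] r /\ C1_on `]0, 1] v) /\
  (forall x : R, 0 < x <= 1 -> 0 < dr x) /\
  C1_on `]0, 1] stress /\
  (forall x : R, 0 < x < 1 ->
     is_derive x 1 stress (2 * x * radial (partial2 Phi) r dr v x)) /\
  (* flux is only claimed to be differentiable where the prefactor v^(1/2)
     does not vanish; elsewhere the product is read as 0 *)
  (forall x : R, 0 < x < 1 -> v x != 0 -> derivable flux x 1) /\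
  (forall x : R, 0 < x < 1 ->
     v x `^ 2^-1 *
       (eps `^ alpha * derive1 flux x -
        x ^+ 2 * (radial (partial4 Phi) r dr v x +
                  (q * eps `^ q)^-1 * derive1 phi (v x))) = 0) /\
  [/\ r 0 = 0, r 1 = lambda,
      flux x * v x `^ 2^-1 @[x --> 0^'+] --> (0 : R) &
      v 1 = 0].
Proof.
move=> Phi dr dv stress flux.
have q_gt0 : 0 < q.
  rewrite -invr_gt0 -(addKr alpha^-1 q^-1) alpha_q addrC subr_gt0.
  by rewrite invf_lt1// (lt_trans ltr01).
pose dpsi := derive1 psi; pose dh := derive1 h.
have psi_der (x : R) : 0 < x -> is_derive x 1 psi (dpsi x) by move=> /(Ck_derive (isT : 0 < 3)%N psi_C3)[].
have dpsi_cont (x : R) : 0 < x -> {for x, continuous dpsi} by move=> /(Ck_derive (isT : 0 < 3)%N psi_C3)[].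
have h_der (x : R) : 0 < x -> is_derive x 1 h (dh x) by move=> /(Ck_derive (isT : 0 < 2)%N h_C2)[].
have dh_cont (x : R) : 0 < x -> {for x, continuous dh} by move=> /(Ck_derive (isT : 0 < 2)%N h_C2)[].
have h_le (x : R) : 0 < x -> h d0 <= h x.
  by move=> x0; have [->//|xd] := eqVneq x d0; exact/ltW/h_min.
have phi_der (x : R) : is_derive x 1 phi (derive1 phi x).
  by rewrite derive1E; exact: DeriveDef.
have [sg [g [m [[csg r_gt0 asg psg eqn] [[cg dvg dp] [cv i_dh i_pow]]]]]] :=
  minimizer_regularity lambda_gt0 eps_gt0 alpha_gt1 q_gt0 phi_cont psi_der dpsi_cont
    (convex_functionW psi_convex) psi_ge0 h_der dh_cont h_strict h_0 h_oo h_le C_gt0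
    (ltW (lt_trans ltr01 gamma_gt1)) h_growth K_gt0 gamma0_gt0 psi_bound rv_min.
have [r0 r1 v1] := minimizer_boundary rv_min.
have [C1r drE] := C1_oc csg (derives_oc_radius csg psg).
have [C1v dvE] := C1_oc cg dvg.
have cvA : {within `]0, 1]%classic : set R, continuous v} := dp_v_cont dp.
have q0 (x : R) : 0 < x <= 1 -> 0 < r x / x.
  by move=> /[dup] x01 /andP[x0 _]; rewrite divr_gt0// r_gt0.
have sg0 (x : R) : 0 < x <= 1 -> 0 < sg x.
  by move=> /[dup] x01 /andP[x0 _]; exact: admissible_stretch x0 (asg x x01).
have detE (x : R) : sg x * (r x / x) * (r x / x) - v x = sg x * (r x / x) ^+ 2 - v x by ring.
have det0 (x : R) : 0 < x <= 1 -> 0 < sg x * (r x / x) * (r x / x) - v x.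
  by rewrite detE => /asg/andP[_]; rewrite subr_gt0.
have oo01 (x : R) : 0 < x < 1 -> 0 < x <= 1 by move=> /andP[-> /ltW].
have stressE (x : R) : 0 < x <= 1 -> stress x =
    x ^+ 2 * (dpsi (sg x) + dh (sg x * (r x / x) ^+ 2 - v x) * (r x / x) ^+ 2).
  move=> x01; rewrite /stress /radial /dr drE//.
  by rewrite (partial1_Phi_hat psi_der h_der (sg0 x x01) (det0 x x01)) detE expr2.
have [cN dstress] := stress_regularity dpsi_cont dh_cont cvA csg r_gt0 asg psg eqn stressE.
have [C1s _] := C1_oc cN dstress.
have flux_der (x : R) : 0 < x < 1 -> v x != 0 -> is_derive x 1 flux
    (x ^+ 2 * (- dh (sg x * (r x / x) ^+ 2 - v x) + (q * eps `^ q)^-1 * derive1 phi (v x)) / eps `^ alpha).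
  move=> x01 vx; have [x0 x1] := andP x01.
  (* The neighbourhood has to stay inside (0, 1), where the derivative relative to (0, 1] is known
     to be [g]. *)
  have d_gt0 : 0 < Num.min x (1 - x) by rewrite lt_min x0 subr_gt0.
  have df := flux_derive dp cg dvg phi_der x01 vx.
  apply: (is_derive_near d_gt0 _ (is_derive_eq df _)).
    move=> y; rewrite lt_min !ltr_norml => /andP[/andP[y1 y2] /andP[y3 y4]].
    by rewrite /flux /dv dvE//; apply/andP; split; lra.
  by congr (_ / _); rewrite [alpha * _]mulrC divfK// gt_eqF// (lt_trans ltr01).
split=> //; split=> [x x01|]; first by rewrite /dr drE// sg0.
split=> //; split=> [x x01|].
  have := derives_oc_is_derive x01 (dstress x (oo01 x x01)).
  rewrite /radial /dr drE ?oo01//.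
  by rewrite (partial2_Phi_hat psi_der h_der (q0 x (oo01 x x01)) (det0 x (oo01 x x01))) detE.
split=> [x x01 vx|]; first by have [] := flux_der x x01 vx.
split=> [x x01|].
  (* Where v = 0 the prefactor is 0, whatever value [derive1 flux x] has. *)
  have [->|vx] := eqVneq (v x) 0; first by rewrite powR0 ?mul0r// gt_eqF// invr_gt0.
  rewrite derive1E (@derive_val _ _ _ _ _ _ _ (flux_der x x01 vx)) /radial /dr drE ?oo01//.
  rewrite (partial4_Phi_hat psi h_der (det0 x (oo01 x x01))) detE mulrCA mulrA mulfK ?subrr ?mulr0//.
  by rewrite gt_eqF// powR_gt0.
split => //.
have [M HM] := within_bounded ler01 cv.
have cphi : {within `[0, 1]%classic : set R, continuous (fun x => phi (v x))}.
  by apply: (@within_comp _ _ phi v) => // x _; exact: phi_cont.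
have [B HB] := within_bounded ler01 cphi.
have phi_bnd (x : R) : 0 < x <= 1 -> `|phi (v x)| <= B.
  by move=> /andP[x0 x1]; rewrite HB// x1 ltW.
(* A positive bound for v^(1/2); the 1 allows division by it. *)
pose M' := `|M| `^ 2^-1 + 1.
have M'0 : 0 < M' by rewrite ltr_wpDl// powR_ge0.
apply/cvgrPdist_le => /= del del0.
have [rho rho0 Hrho] := flux_small dp cg dvg phi_bnd i_dh i_pow (divr_gt0 del0 M'0).
near=> x.
have x0 : 0 < x by near: x; exact: nbhs_right_gt.
have x1 : x < 1 by near: x; exact: nbhs_right_lt.
have xr : x < rho by near: x; exact: nbhs_right_lt.
have x01 : 0 < x <= 1 by rewrite x0 ltW.
rewrite sub0r normrN normrM -[leRHS](divfK (lt0r_neq0 M'0)).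
apply: ler_pM => //; first by rewrite /flux /dv dvE// Hrho// x0.
rewrite ger0_norm ?powR_ge0// /M' ler_wpDr//.
have /andP[vx0 _] := asg x x01.
apply: ge0_ler_powR; rewrite ?nnegrE ?invr_ge0//.
have : `|v x| <= M by rewrite HM// (ltW x0) ltW.
by rewrite ger0_norm// => /le_trans; apply; exact: ler_norm.
Unshelve. all: by end_near.
Qed.
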